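(* Let $\delta>0$ be fixed. Let $\sigma_0$, $\sigma_1$ and their reciprocals be bounded. Assume that $|\arg N_j|\le\frac{\pi}{2}-\delta$ $(<\frac{\pi}{2})$ for $j=0,1$ and $\left|\arg\left(\mathrm{e}^{-\frac{\pi}{2}\mathrm{i}}\sigma_2z\right)\right|\le\pi-\delta$ $(<\pi)$, where $\sigma_2=\sigma_0+\sigma_1$. Then, when $\mathrm{e}^{-\pi\mathrm{i}}z=\frac{N_0}{\sigma_0}=\frac{N_1}{\sigma_1}$, we have $$\frac{\mathrm{e}^{-(\sigma_0+\sigma_1)z}}{z^{N_0+N_1}}F^{(2)}\left(z;\begin{smallmatrix}N_0+1,&N_1+1\\ \sigma_0,&\sigma_1\end{smallmatrix}\right)=2\pi\arctan\sqrt{\frac{N_0}{N_1}}-\frac{\pi\mathrm{i}}{3}\sqrt{\frac{2\pi}{N_1}}\left(1-\frac1{\sqrt{1+\frac{N_0}{N_1}}}\right)+\mathcal{O}\left(N_1^{-1}\right),$$ as $\Re(N_1)\to+\infty$.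
   Context: Here $z,\sigma_0,\sigma_1,N_0,N_1$ are complex; $z,\sigma_0,\sigma_1$ are nonzero and carry chosen arguments. For $\Re(N_0)>-1$, $\Re(N_1)>-1$, the second hyperterminant is $$F^{(2)}\left(z;\begin{smallmatrix}N_0+1,&N_1+1\\ \sigma_0,&\sigma_1\end{smallmatrix}\right)=\int_0^{\infty\mathrm{e}^{\mathrm{i}(\pi-\arg\sigma_0)}}\int_0^{\infty\mathrm{e}^{\mathrm{i}(\pi-\arg\sigma_1)}}\frac{\mathrm{e}^{\sigma_0\tau_0+\sigma_1\tau_1}\tau_0^{N_0}\tau_1^{N_1}}{(z-\tau_0)(\tau_0-\tau_1)}\,\mathrm{d}\tau_1\,\mathrm{d}\tau_0$$ for $|\arg(\sigma_0z)|<\pi$ and $\arg\sigma_1-\arg\sigma_0\in(0,2\pi)$ (with the value at $\arg\sigma_1=\arg\sigma_0$ being the limit $\arg\sigma_1-\arg\sigma_0\to0^+$), extended elsewhere by analytic continuation. *)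

(* Defs.v *)
From Stdlib Require Import Reals.
From Coquelicot Require Import Coquelicot.
Open Scope R_scope.

(** ** Elementary complex functions (principal branches) *)

Definition Cexp (w : C) : C := (exp (Re w) * cos (Im w), exp (Re w) * sin (Im w)).

(** Values in (-PI, PI]; a junk value at [0]. *)
Definition Carg (w : C) : R :=
  if Rlt_dec (Im w) 0 then - acos (Re w / Cmod w) else acos (Re w / Cmod w).

Definition Clog (w : C) : C := (ln (Cmod w), Carg w).

(** Only meant for [w <> 0]. *)
Definition Csqrt (w : C) : C := Cexp (Clog w / 2)%C.

Definition Carctan (w : C) : C :=
  ((Clog (1 + Ci * w) - Clog (1 - Ci * w)) / (2 * Ci))%C.

(** ** Nonzero complex numbers with a chosen argument

    Such a number is encoded by its logarithm [w : C]: the number is [Cexp w], its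
    modulus is [exp (Re w)], its chosen argument is [Im w], and its power with
    exponent [N] is [Cexp (N * w)].  Multiplication is addition of logarithms; in
    particular multiplying by e^(i a), argument included, is adding [Ci * a]. *)

(** The sum of two such numbers, with argument between those of the summands when
    these differ by less than [PI]. *)
Definition log_add (s0 s1 : C) : C := (s0 + Clog (1 + Cexp (s1 - s0)))%C.

(** Contour integral over the ray from 0 to infinity of argument [theta]; the
    integrand is a function of the logarithm [ln t + i theta] of tau = t e^(i theta). *)
Definition ray_integral (theta : R) (f : C -> C) : C :=
  (Cexp (Ci * theta) *
   RInt_gen (V := C_R_CompleteNormedModule) (fun t : R => f (ln t, theta))
     (at_right 0) (Rbar_locally p_infty))%C.

(** ** The second hyperterminant *)

Definition hyperterminant2_integrand (N0 N1 lz s0 s1 u0 u1 : C) : C :=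
  let z := Cexp lz in
  let tau0 := Cexp u0 in
  let tau1 := Cexp u1 in
  (Cexp (Cexp s0 * tau0 + Cexp s1 * tau1) * Cexp (N0 * u0) * Cexp (N1 * u1)
   / ((z - tau0) * (tau0 - tau1)))%C.

Definition hyperterminant2_integral (N0 N1 lz s0 s1 : C) : C :=
  ray_integral (PI - Im s0) (fun u0 =>
    ray_integral (PI - Im s1) (fun u1 =>
      hyperterminant2_integrand N0 N1 lz s0 s1 u0 u1)).

(** C^3 as a normed module over C: triples of logarithms of (z, sigma_0, sigma_1). *)
Definition C3 : NormedModule C_AbsRing :=
  prod_NormedModule C_AbsRing
    (prod_NormedModule C_AbsRing C_NormedModule C_NormedModule) C_NormedModule.

Definition base_domain (p : C3) : Prop :=
  let '(lz, s0, s1) := p in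
  Rabs (Im (s0 + lz)%C) < PI /\ 0 < Im (s1 - s0)%C < 2 * PI.

Definition convex3 (W : C3 -> Prop) : Prop :=
  forall (p q : C3) (t : R), W p -> W q -> 0 <= t <= 1 ->
    W (plus (scal (RtoC (1 - t)) p) (scal (RtoC t) q)).

(** Differentiability over C in the sense of Fréchet. *)
Definition holomorphic_on (W : C3 -> Prop) (f : C3 -> C) : Prop :=
  forall p : C3, W p ->
    ex_filterdiff (K := C_AbsRing) (U := C3) (V := C_NormedModule) f (locally p).

(** [v] is the value at [p] of the analytic continuation of the integral from
    [base_domain].  The intersection of two convex open sets containing [base_domain]
    is connected, so there is at most one such [v].  Asking for convexity fixes the
    branch: the continuation is singular where sigma_0 + sigma_1 = 0 with
    arg sigma_1 - arg sigma_0 = -PI or 3 PI, and this excludes paths that wind around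
    these points.  By continuity the value at arg sigma_1 = arg sigma_0 is the limit
    arg sigma_1 - arg sigma_0 -> 0+. *)
Definition is_hyperterminant2 (N0 N1 : C) (p : C3) (v : C) : Prop :=
  exists (W : C3 -> Prop) (F : C3 -> C),
    open W /\ convex3 W /\ (forall q, base_domain q -> W q) /\ W p /\
    holomorphic_on W F /\
    (forall lz s0 s1 : C, base_domain (lz, s0, s1) ->
       F (lz, s0, s1) = hyperterminant2_integral N0 N1 lz s0 s1) /\
    v = F p.

(** F^(2)(z; N0+1, N1+1; sigma_0, sigma_1), as a function of the logarithms of z,
    sigma_0, sigma_1. *)
Definition hyperterminant2 (N0 N1 lz s0 s1 : C) : C :=
  iota (T := C_CompleteNormedModule) (is_hyperterminant2 N0 N1 (lz, s0, s1)).

(* Main.v *)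
Require Import Defs.
From Stdlib Require Import Reals Lra Lia Psatz ClassicalEpsilon.
From Coquelicot Require Import Coquelicot.
Open Scope R_scope.

(** Put [w_j = sigma_j z].  In the logarithmic coordinates [tau_j = z e^(v_j)] the
    hyperterminant is [z^(N_0 + N_1)] times the double integral [Phi] of
    [e^(w_0 e^(v_0) + N_0 v_0) e^(w_1 e^(v_1) + N_1 v_1) b (- v_0) b (v_0 - v_1)],
    [b v = 1 / (e^v - 1)], along two horizontal lines.  The heights of the lines may be moved
    as long as both exponential factors decay and no pole of [b] is crossed.  The parameters
    for which some pair of heights is admissible form a convex open set containing the base
    domain, so [Phi] is the analytic continuation ([is_hyperterminant2_continuation]); there is
    no other by the identity theorem on complex lines ([is_hyperterminant2_unique]).  Hence the
    hyperterminant is [Phi] along any admissible pair of lines ([hyperterminant2_value]).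

    The hypotheses say that [w_j = - N_j].  Both exponents are then [- N_j (e^v - v)], with a
    saddle point at 0, exactly where the kernels have their poles.  Take the heights [h] and 0
    with [h = |N_1|^(-1/2)] and rescale [v_0 = h Y_0], [v_1 = h Y_1], where [Y_0] runs over the
    line of height 1 and [Y_1] over the real line.  With [nu_j = h^2 N_j], the integrand becomes
    [- E_0 E_1 / (Y_0 (Y_0 - Y_1))], [E_j] being the Gaussian [e^(- nu_j Y_j^2 / 2)], plus [h]
    times an explicit correction, plus a remainder of order [h^2] that is integrable uniformly
    in [nu_0], [nu_1] ([scaled_expand]).  The bounds on [sigma_j] and on the arguments of [N_j]
    confine [nu_j] to a compact part of the right half plane, so the remainder contributes
    [O (1 / N_1)].

    The two Gaussian integrals are computed by deforming [Y_0 - Y_1] to [Y_0 - s Y_1].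
    Integration by parts gives [- G_0 G_1 nu_0 nu_1 / (nu_1 + s^2 nu_0)] for the integral of
    [E_0 E_1 / (Y_0 - s Y_1)^2], where [G_j = sqrt (2 pi / nu_j)] is the mass of [E_j]; this is
    minus the derivative in [s] of an arctangent, and yields the leading term ([lead_value]).
    The integral of [E_0 E_1 / (Y_0 - s Y_1)] times [sqrt (nu_1 + s^2 nu_0)] is independent of
    [s]; at [s = 0] it involves only the Gaussian against a simple pole, which is [- pi i] by
    Cauchy's formula ([pole_value]).  By further integrations by parts the correction reduces
    to this integral ([corr_value]), and gives the term of order [N_1^(-1/2)]. *)

(** * Complex numbers and their exponential *)

Lemma pos_prod3 : forall a b c, 0 <= a -> 0 <= b -> 0 <= c -> 0 <= a * b * c.
Proof. intros. apply Rmult_le_pos; auto. apply Rmult_le_pos; auto. Qed.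

Lemma C_ext : forall a b : C, Re a = Re b -> Im a = Im b -> a = b.
Proof. intros [a1 a2] [b1 b2]; simpl; intros; subst; reflexivity. Qed.

Lemma Re_plus : forall a b : C, Re (a + b)%C = Re a + Re b.
Proof. reflexivity. Qed.
Lemma Im_plus : forall a b : C, Im (a + b)%C = Im a + Im b.
Proof. reflexivity. Qed.
Lemma Re_opp : forall a : C, Re (- a)%C = - Re a.
Proof. reflexivity. Qed.
Lemma Im_opp : forall a : C, Im (- a)%C = - Im a.
Proof. reflexivity. Qed.
Lemma Re_minus : forall a b : C, Re (a - b)%C = Re a - Re b.
Proof. reflexivity. Qed.
Lemma Im_minus : forall a b : C, Im (a - b)%C = Im a - Im b.
Proof. reflexivity. Qed.
Lemma Re_mult : forall a b : C, Re (a * b)%C = Re a * Re b - Im a * Im b.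
Proof. reflexivity. Qed.
Lemma Im_mult : forall a b : C, Im (a * b)%C = Re a * Im b + Im a * Re b.
Proof. reflexivity. Qed.
Lemma Re_RtoC : forall x : R, Re (RtoC x) = x.
Proof. reflexivity. Qed.
Lemma Im_RtoC : forall x : R, Im (RtoC x) = 0.
Proof. reflexivity. Qed.
Lemma Re_Ci : Re Ci = 0.
Proof. reflexivity. Qed.
Lemma Im_Ci : Im Ci = 1.
Proof. reflexivity. Qed.

Ltac reim := rewrite ?Re_plus, ?Im_plus, ?Re_minus, ?Im_minus, ?Re_opp, ?Im_opp,
  ?Re_mult, ?Im_mult, ?Re_RtoC, ?Im_RtoC, ?Re_Ci, ?Im_Ci.
Ltac creim := repeat (progress reim).
Ltac ceq := apply C_ext; creim.

Lemma im_le_Cmod : forall c : C, Rabs (Im c) <= Cmod c.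
Proof.
  intros c. eapply Rle_trans; [apply Rmax_r | apply (Rmax_Cmod c)].
Qed.

Lemma Cmod_le_reim : forall c : C, Cmod c <= Rabs (Re c) + Rabs (Im c).
Proof.
  intros c.
  replace c with (RtoC (Re c) + Ci * RtoC (Im c))%C at 1 by (ceq; ring).
  eapply Rle_trans; [apply Cmod_triangle|].
  rewrite Cmod_mult, Cmod_Ci, !Cmod_R. lra.
Qed.

Lemma Cmod_triangle_minus : forall x y : C, Cmod (x - y) <= Cmod x + Cmod y.
Proof. intros. unfold Cminus. rewrite <- (Cmod_opp y). apply Cmod_triangle. Qed.

Lemma Cmod_minus_sym : forall x y : C, Cmod (x - y) = Cmod (y - x).
Proof. intros. rewrite <- Cmod_opp. f_equal. ring. Qed.

Lemma Cmod_triangle_rev : forall x y : C, Cmod x - Cmod y <= Cmod (x + y).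
Proof.
  intros. replace x with ((x + y) - y)%C at 1 by ring.
  pose proof (Cmod_triangle_minus (x + y) y). lra.
Qed.

Lemma Cmod_sqr : forall c : C, Cmod c * Cmod c = Re c * Re c + Im c * Im c.
Proof. intros. pose proof (Cmod2_alt c). nra. Qed.

Lemma Cmod_le_sqr : forall (c : C) M, 0 <= M -> Re c * Re c + Im c * Im c <= M * M -> Cmod c <= M.
Proof. intros c M HM H. rewrite <- Cmod_sqr in H. pose proof (Cmod_ge_0 c). nra. Qed.

Lemma Cmod_ge_sqr : forall (c : C) M, 0 <= M -> M * M <= Re c * Re c + Im c * Im c -> M <= Cmod c.
Proof. intros c M HM H. rewrite <- Cmod_sqr in H. pose proof (Cmod_ge_0 c). nra. Qed.

Lemma Cneq_0_Im : forall c : C, Im c <> 0 -> c <> 0%C.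
Proof. intros c H E. apply H. rewrite E. reflexivity. Qed.

Lemma Cneq_0_Re : forall c : C, Re c <> 0 -> c <> 0%C.
Proof. intros c H E. apply H. rewrite E. reflexivity. Qed.

(** * The exponential *)

Lemma Re_Cexp : forall w, Re (Cexp w) = exp (Re w) * cos (Im w).
Proof. reflexivity. Qed.
Lemma Im_Cexp : forall w, Im (Cexp w) = exp (Re w) * sin (Im w).
Proof. reflexivity. Qed.

Lemma Cexp_plus : forall a b, Cexp (a + b) = (Cexp a * Cexp b)%C.
Proof.
  intros. ceq; rewrite ?Re_Cexp, ?Im_Cexp, ?Re_plus, ?Im_plus, exp_plus, ?cos_plus, ?sin_plus; ring.
Qed.

Lemma Cexp_0 : Cexp 0 = 1%C.
Proof. ceq; rewrite ?Re_Cexp, ?Im_Cexp; simpl; rewrite exp_0, ?cos_0, ?sin_0; ring. Qed.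

Lemma Cmod_Cexp : forall w, Cmod (Cexp w) = exp (Re w).
Proof.
  intros. assert (H := Cmod_sqr (Cexp w)). rewrite Re_Cexp, Im_Cexp in H.
  pose proof (Cmod_ge_0 (Cexp w)). pose proof (exp_pos (Re w)).
  assert (Hs := sin2_cos2 (Im w)). unfold Rsqr in Hs.
  assert (Cmod (Cexp w) * Cmod (Cexp w) = exp (Re w) * exp (Re w)) by (rewrite H; nra).
  nra.
Qed.

Lemma Cexp_neq_0 : forall w, Cexp w <> 0%C.
Proof. intros w. apply Cmod_gt_0. rewrite Cmod_Cexp. apply exp_pos. Qed.

Lemma Cexp_opp : forall w, Cexp (- w) = (/ Cexp w)%C.
Proof.
  intros w. assert (H : (Cexp (- w) * Cexp w = 1)%C).
  { rewrite <- Cexp_plus. replace (- w + w)%C with (RtoC 0) by ring. apply Cexp_0. }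
  rewrite <- (Cmult_1_r (/ Cexp w)), <- H. field. apply Cexp_neq_0.
Qed.

Lemma Cexp_minus : forall a b, Cexp (a - b) = (Cexp a / Cexp b)%C.
Proof. intros. unfold Cminus. rewrite Cexp_plus, Cexp_opp. reflexivity. Qed.

Lemma Cexp_RtoC : forall x : R, Cexp (RtoC x) = RtoC (exp x).
Proof. intros. ceq; rewrite ?Re_Cexp, ?Im_Cexp; simpl; rewrite ?cos_0, ?sin_0; ring. Qed.

Lemma Cexp_iPI : Cexp (Ci * PI) = (- (1))%C.
Proof.
  ceq; rewrite ?Re_Cexp, ?Im_Cexp; creim; simpl;
  replace (0 * PI - 1 * 0) with 0 by ring; replace (0 * 0 + 1 * PI) with PI by ring;
  rewrite exp_0, ?cos_PI, ?sin_PI; ring.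
Qed.

(** * Derivatives along a set of directions *)

(** Differentiability at [c] with increments restricted to [A]: all increments give complex
    differentiability, real ones differentiability along the real axis, and one set of rules
    serves both. *)
Definition deriv (A : C -> Prop) (f : C -> C) (c l : C) : Prop :=
  forall eps : R, 0 < eps -> exists d : R, 0 < d /\
    forall h : C, A h -> Cmod h < d -> Cmod (f (c + h) - f c - l * h)%C <= eps * Cmod h.

Definition isreal (h : C) : Prop := Im h = 0.
Definition anyC (h : C) : Prop := True.
Notation CD := (deriv anyC).
Notation RD := (deriv isreal).

Lemma deriv_eq : forall A f c l l', l = l' -> deriv A f c l -> deriv A f c l'.
Proof. intros; subst; auto. Qed.

Lemma deriv_of_CD : forall A f c l, CD f c l -> deriv A f c l.
Proof.
  intros A f c l H eps He. destruct (H eps He) as [d [Hd K]].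
  exists d. split; auto. intros. apply K; auto. exact I.
Qed.

Lemma deriv_const : forall A k c, deriv A (fun _ => k) c 0%C.
Proof.
  intros A k c eps He. exists 1. split; [lra|]. intros h _ _.
  replace (k - k - 0 * h)%C with (RtoC 0) by ring. rewrite Cmod_0.
  pose proof (Cmod_ge_0 h). nra.
Qed.

Lemma deriv_id : forall A c, deriv A (fun z => z) c 1%C.
Proof.
  intros A c eps He. exists 1. split; [lra|]. intros h _ _.
  replace (c + h - c - 1 * h)%C with (RtoC 0) by ring. rewrite Cmod_0.
  pose proof (Cmod_ge_0 h). nra.
Qed.

Lemma deriv_plus : forall A f g c l m, deriv A f c l -> deriv A g c m ->
  deriv A (fun z => f z + g z)%C c (l + m)%C.
Proof.
  intros A f g c l m Hf Hg eps He.
  destruct (Hf (eps/2)) as [d1 [Hd1 K1]]; [lra|].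
  destruct (Hg (eps/2)) as [d2 [Hd2 K2]]; [lra|].
  exists (Rmin d1 d2). split; [apply Rmin_pos; auto|]. intros h Ah Hh.
  specialize (K1 h Ah (Rlt_le_trans _ _ _ Hh (Rmin_l _ _))).
  specialize (K2 h Ah (Rlt_le_trans _ _ _ Hh (Rmin_r _ _))).
  replace (f (c + h) + g (c + h) - (f c + g c) - (l + m) * h)%C with
    ((f (c + h) - f c - l * h) + (g (c + h) - g c - m * h))%C by ring.
  eapply Rle_trans; [apply Cmod_triangle|]. lra.
Qed.

Lemma deriv_lip : forall A f c l, deriv A f c l -> exists d, 0 < d /\
  forall h, A h -> Cmod h < d -> Cmod (f (c + h) - f c)%C <= (Cmod l + 1) * Cmod h.
Proof.
  intros A f c l H. destruct (H 1) as [d [Hd K]]; [lra|].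
  exists d. split; auto. intros h Ah Hh. specialize (K h Ah Hh).
  replace (f (c + h) - f c)%C with ((f (c + h) - f c - l * h) + l * h)%C by ring.
  eapply Rle_trans; [apply Cmod_triangle|]. rewrite Cmod_mult. lra.
Qed.

Lemma deriv_mult : forall A f g c l m, deriv A f c l -> deriv A g c m ->
  deriv A (fun z => f z * g z)%C c (l * g c + f c * m)%C.
Proof.
  intros A f g c l m Hf Hg eps He.
  destruct (deriv_lip _ _ _ _ Hf) as [d0 [Hd0 K0]].
  destruct (deriv_lip _ _ _ _ Hg) as [d3 [Hd3 K3]].
  pose proof (Cmod_ge_0 l) as L0. pose proof (Cmod_ge_0 m) as M0.
  pose proof (Cmod_ge_0 (f c)) as F0. pose proof (Cmod_ge_0 (g c)) as G0.
  set (e1 := eps / (3 * (Cmod (g c) + 1))).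
  set (e2 := eps / (3 * (Cmod (f c) + 1))).
  set (e3 := eps / (3 * ((Cmod l + 1) * (Cmod m + 1)))).
  assert (He1 : 0 < e1) by (apply Rdiv_lt_0_compat; nra).
  assert (He2 : 0 < e2) by (apply Rdiv_lt_0_compat; nra).
  assert (He3 : 0 < e3) by (apply Rdiv_lt_0_compat; nra).
  destruct (Hf e1 He1) as [d1 [Hd1 K1]].
  destruct (Hg e2 He2) as [d2 [Hd2 K2]].
  exists (Rmin (Rmin d0 d3) (Rmin e3 (Rmin d1 d2))).
  split; [repeat apply Rmin_pos; auto|]. intros h Ah Hh.
  apply Rmin_Rgt in Hh as [Ha Hb]. apply Rmin_Rgt in Ha as [Ha1 Ha2].
  apply Rmin_Rgt in Hb as [Hb1 Hb]. apply Rmin_Rgt in Hb as [Hb2 Hb3].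
  specialize (K0 h Ah Ha1). specialize (K3 h Ah Ha2). specialize (K1 h Ah Hb2). specialize (K2 h Ah Hb3).
  replace (f (c + h) * g (c + h) - f c * g c - (l * g c + f c * m) * h)%C with
    ((f (c + h) - f c - l * h) * g c + f c * (g (c + h) - g c - m * h)
     + (f (c + h) - f c) * (g (c + h) - g c))%C by ring.
  eapply Rle_trans; [apply Cmod_triangle|].
  eapply Rle_trans; [apply Rplus_le_compat_r, Cmod_triangle|].
  rewrite !Cmod_mult.
  pose proof (Cmod_ge_0 h) as Hh0.
  assert (A1 : Cmod (f (c + h)%C - f c - l * h) * Cmod (g c) <= eps / 3 * Cmod h).
  { apply Rle_trans with (e1 * Cmod h * (Cmod (g c) + 1)).
    - pose proof (Cmod_ge_0 (f (c + h)%C - f c - l * h)). apply Rmult_le_compat; lra.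
    - apply Req_le. unfold e1. field. lra. }
  assert (A2 : Cmod (f c) * Cmod (g (c + h)%C - g c - m * h) <= eps / 3 * Cmod h).
  { apply Rle_trans with ((Cmod (f c) + 1) * (e2 * Cmod h)).
    - pose proof (Cmod_ge_0 (g (c + h)%C - g c - m * h)). apply Rmult_le_compat; lra.
    - apply Req_le. unfold e2. field. lra. }
  assert (A3 : Cmod (f (c + h)%C - f c) * Cmod (g (c + h)%C - g c) <= eps / 3 * Cmod h).
  { apply Rle_trans with (((Cmod l + 1) * Cmod h) * ((Cmod m + 1) * e3)).
    - pose proof (Cmod_ge_0 (g (c + h)%C - g c)). pose proof (Cmod_ge_0 (f (c + h)%C - f c)).
      apply Rmult_le_compat; try lra. eapply Rle_trans; [exact K3|].
      apply Rmult_le_compat_l; lra.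
    - apply Req_le. unfold e3. field. lra. }
  lra.
Qed.

(** The outer function needs all directions: the increment of [f] need not lie in [A]. *)
Lemma deriv_comp : forall A (g f : C -> C) c l m, CD g (f c) m -> deriv A f c l ->
  deriv A (fun z => g (f z)) c (m * l)%C.
Proof.
  intros A g f c l m Hg Hf eps He.
  pose proof (Cmod_ge_0 l) as L0. pose proof (Cmod_ge_0 m) as M0.
  destruct (deriv_lip _ _ _ _ Hf) as [d0 [Hd0 K0]].
  set (e1 := eps / (2 * (Cmod l + 1))). set (e2 := eps / (2 * (Cmod m + 1))).
  assert (He1 : 0 < e1) by (apply Rdiv_lt_0_compat; nra).
  assert (He2 : 0 < e2) by (apply Rdiv_lt_0_compat; nra).
  destruct (Hg e1 He1) as [d1 [Hd1 K1]]. destruct (Hf e2 He2) as [d2 [Hd2 K2]].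
  assert (Hd3 : 0 < d1 / (Cmod l + 1)) by (apply Rdiv_lt_0_compat; lra).
  exists (Rmin d0 (Rmin (d1 / (Cmod l + 1)) d2)).
  split; [repeat apply Rmin_pos; auto|]. intros h Ah Hh.
  apply Rmin_Rgt in Hh as [Ha Hb]. apply Rmin_Rgt in Hb as [Hb Hc].
  specialize (K0 h Ah Ha). specialize (K2 h Ah Hc).
  set (k := (f (c + h) - f c)%C) in *.
  assert (Hk : Cmod k < d1).
  { eapply Rle_lt_trans; [exact K0|]. apply Rmult_lt_reg_r with (/ (Cmod l + 1)).
    - apply Rinv_0_lt_compat; lra.
    - replace ((Cmod l + 1) * Cmod h * / (Cmod l + 1)) with (Cmod h) by (field; lra). exact Hb. }
  specialize (K1 k I Hk). replace (f c + k)%C with (f (c + h)%C) in K1 by (unfold k; ring).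
  replace (g (f (c + h)) - g (f c) - m * l * h)%C with
    ((g (f (c + h)) - g (f c) - m * k) + m * (k - l * h))%C by ring.
  eapply Rle_trans; [apply Cmod_triangle|]. rewrite Cmod_mult.
  pose proof (Cmod_ge_0 h) as Hh0.
  assert (A1 : e1 * Cmod k <= eps / 2 * Cmod h).
  { apply Rle_trans with (e1 * ((Cmod l + 1) * Cmod h)).
    - apply Rmult_le_compat_l; lra.
    - apply Req_le. unfold e1. field. lra. }
  assert (A2 : Cmod m * Cmod (k - l * h) <= eps / 2 * Cmod h).
  { apply Rle_trans with ((Cmod m + 1) * (e2 * Cmod h)).
    - pose proof (Cmod_ge_0 (k - l * h)). apply Rmult_le_compat; lra.
    - apply Req_le. unfold e2. field. lra. }
  lra.
Qed.

Lemma deriv_ext : forall A f g c l, (forall z, f z = g z) -> deriv A f c l -> deriv A g c l.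
Proof.
  intros A f g c l E H eps He. destruct (H eps He) as [d [Hd K]].
  exists d. split; auto. intros h. rewrite <- !E. apply K.
Qed.

Lemma deriv_ext_loc : forall A f g c l r, 0 < r -> (forall h, Cmod h < r -> f (c + h)%C = g (c + h)%C) ->
  deriv A f c l -> deriv A g c l.
Proof.
  intros A f g c l r Hr E H eps He. destruct (H eps He) as [d [Hd K]].
  assert (E0 : f c = g c).
  { specialize (E 0%C). rewrite Cmod_0, Cplus_0_r in E. auto. }
  exists (Rmin d r). split; [apply Rmin_pos; auto|]. intros h Ah Hh. apply Rmin_Rgt in Hh as [H1 H2].
  rewrite <- E, <- E0; auto.
Qed.

Lemma deriv_scal : forall A f c l k, deriv A f c l -> deriv A (fun z => k * f z)%C c (k * l)%C.
Proof.
  intros. eapply deriv_eq; [|apply deriv_mult; [apply deriv_const | eassumption]]. simpl. ring.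
Qed.

Lemma deriv_opp : forall A f c l, deriv A f c l -> deriv A (fun z => - f z)%C c (- l)%C.
Proof.
  intros A f c l H. apply deriv_ext with (fun z => (- (1)) * f z)%C; [intros; ring|].
  eapply deriv_eq; [|apply deriv_scal; eassumption]. ring.
Qed.

Lemma deriv_minus : forall A f g c l m, deriv A f c l -> deriv A g c m ->
  deriv A (fun z => f z - g z)%C c (l - m)%C.
Proof. intros. apply deriv_plus; auto. apply deriv_opp; auto. Qed.

Lemma CD_inv : forall c : C, c <> 0%C -> CD (fun z => / z)%C c (- / (c * c))%C.
Proof.
  intros c Hc eps He. pose proof (proj1 (Cmod_gt_0 c) Hc) as Hm.
  set (m := Cmod c) in *.
  exists (Rmin (m / 2) (eps * m * m * m / 2)). split.
  { apply Rmin_pos; [lra|]. apply Rdiv_lt_0_compat; [|lra]. repeat apply Rmult_lt_0_compat; lra. }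
  intros h _ Hh. apply Rmin_Rgt in Hh as [H1 H2].
  assert (B : m / 2 <= Cmod (c + h)).
  { pose proof (Cmod_triangle_rev c h). unfold m in *. lra. }
  assert (Hch : (c + h)%C <> 0%C) by (apply Cmod_gt_0; lra).
  replace (/ (c + h) - / c - - / (c * c) * h)%C with (h * h * / ((c + h) * c * c))%C
    by (field; auto).
  rewrite !Cmod_mult, Cmod_inv by (repeat apply Cmult_neq_0; auto). rewrite !Cmod_mult. fold m.
  pose proof (Cmod_ge_0 h).
  apply Rmult_le_reg_r with (Cmod (c + h) * m * m).
  { repeat apply Rmult_lt_0_compat; lra. }
  replace (Cmod h * Cmod h * / (Cmod (c + h) * m * m) * (Cmod (c + h) * m * m)) with (Cmod h * Cmod h)
    by (field; lra).
  apply Rle_trans with (eps * Cmod h * (m / 2 * m * m)).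
  - replace (eps * Cmod h * (m / 2 * m * m)) with (Cmod h * (eps * m * m * m / 2)) by field.
    apply Rmult_le_compat_l; lra.
  - apply Rmult_le_compat_l; [nra|]. apply Rmult_le_compat_r; [lra|]. apply Rmult_le_compat_r; lra.
Qed.

(** * Continuity of functions of a real variable *)

Definition cts (f : R -> C) (x : R) : Prop :=
  forall eps, 0 < eps -> exists d, 0 < d /\ forall y, Rabs (y - x) < d -> Cmod (f y - f x) < eps.

Lemma cts_continuous : forall f x, cts f x ->
  continuous (T := R_UniformSpace) (U := C_R_CompleteNormedModule) f x.
Proof.
  intros f x H. apply filterlim_locally. intros eps.
  destruct (H eps (cond_pos eps)) as [d [Hd K]]. exists (mkposreal d Hd). intros y Hy.
  assert (B : Rabs (y - x) < d) by exact Hy. specialize (K y B).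
  split.
  - change (Rabs (Re (f y) - Re (f x)) < eps). eapply Rle_lt_trans; [|exact K].
    rewrite <- Re_minus. apply re_le_Cmod.
  - change (Rabs (Im (f y) - Im (f x)) < eps). eapply Rle_lt_trans; [|exact K].
    rewrite <- Im_minus. apply im_le_Cmod.
Qed.

Lemma RD_cts : forall (f : C -> C) (x : R) l, RD f x l -> cts (fun t => f (RtoC t)) x.
Proof.
  intros f x l H eps He. destruct (deriv_lip _ _ _ _ H) as [d [Hd K]].
  pose proof (Cmod_ge_0 l).
  assert (P : 0 < eps / (Cmod l + 1)) by (apply Rdiv_lt_0_compat; lra).
  exists (Rmin d (eps / (Cmod l + 1))). split; [apply Rmin_pos; auto|].
  intros y Hy. apply Rmin_Rgt in Hy as [H1 H2].
  specialize (K (RtoC (y - x))). rewrite Cmod_R in K.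
  replace (x + RtoC (y - x))%C with (RtoC y) in K by (rewrite RtoC_minus; ring).
  specialize (K eq_refl H1). eapply Rle_lt_trans; [exact K|].
  apply Rmult_lt_reg_r with (/ (Cmod l + 1)).
  - apply Rinv_0_lt_compat; lra.
  - replace ((Cmod l + 1) * Rabs (y - x) * / (Cmod l + 1)) with (Rabs (y - x)) by (field; lra). exact H2.
Qed.

Lemma cts_const : forall k x, cts (fun _ => k) x.
Proof.
  intros k x eps He. exists 1. split; [lra|]. intros. unfold Cminus. rewrite Cplus_opp_r, Cmod_0. auto.
Qed.

Lemma cts_plus : forall f g x, cts f x -> cts g x -> cts (fun t => f t + g t)%C x.
Proof.
  intros f g x Hf Hg eps He.
  destruct (Hf (eps/2)) as [d1 [Hd1 K1]]; [lra|].
  destruct (Hg (eps/2)) as [d2 [Hd2 K2]]; [lra|].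
  exists (Rmin d1 d2). split; [apply Rmin_pos; auto|]. intros y Hy. apply Rmin_Rgt in Hy as [H1 H2].
  specialize (K1 y H1). specialize (K2 y H2).
  replace (f y + g y - (f x + g x))%C with ((f y - f x) + (g y - g x))%C by ring.
  eapply Rle_lt_trans; [apply Cmod_triangle|]. lra.
Qed.

Lemma cts_mult : forall f g x, cts f x -> cts g x -> cts (fun t => f t * g t)%C x.
Proof.
  intros f g x Hf Hg eps He.
  pose proof (Cmod_ge_0 (f x)) as F0. pose proof (Cmod_ge_0 (g x)) as G0.
  set (e1 := Rmin 1 (eps / (3 * (Cmod (g x) + 1)))).
  set (e2 := Rmin 1 (eps / (3 * (Cmod (f x) + 1)))).
  assert (P1 : 0 < eps / (3 * (Cmod (g x) + 1))) by (apply Rdiv_lt_0_compat; nra).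
  assert (P2 : 0 < eps / (3 * (Cmod (f x) + 1))) by (apply Rdiv_lt_0_compat; nra).
  assert (He1 : 0 < e1) by (apply Rmin_pos; lra).
  assert (He2 : 0 < e2) by (apply Rmin_pos; lra).
  destruct (Hf e1 He1) as [d1 [Hd1 K1]].
  destruct (Hg e2 He2) as [d2 [Hd2 K2]].
  exists (Rmin d1 d2). split; [apply Rmin_pos; auto|]. intros y Hy. apply Rmin_Rgt in Hy as [H1 H2].
  specialize (K1 y H1). specialize (K2 y H2).
  replace (f y * g y - f x * g x)%C with ((f y - f x) * g x + (f x + (f y - f x)) * (g y - g x))%C by ring.
  eapply Rle_lt_trans; [apply Cmod_triangle|]. rewrite !Cmod_mult.
  assert (A1 : Cmod (f y - f x) * Cmod (g x) <= eps / 3).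
  { apply Rle_trans with (eps / (3 * (Cmod (g x) + 1)) * (Cmod (g x) + 1)).
    - apply Rmult_le_compat; try apply Cmod_ge_0; try lra.
      apply Rlt_le, Rlt_le_trans with e1; auto. apply Rmin_r.
    - apply Req_le. field. lra. }
  assert (A2 : Cmod (f x + (f y - f x)) * Cmod (g y - g x) <= eps / 3).
  { apply Rle_trans with ((Cmod (f x) + 1) * (eps / (3 * (Cmod (f x) + 1)))).
    - apply Rmult_le_compat; try apply Cmod_ge_0.
      + eapply Rle_trans; [apply Cmod_triangle|]. apply Rplus_le_compat_l.
        apply Rlt_le, Rlt_le_trans with e1; auto. apply Rmin_l.
      + apply Rlt_le, Rlt_le_trans with e2; auto. apply Rmin_r.
    - apply Req_le. field. lra. }
  lra.
Qed.

Lemma cts_opp : forall f x, cts f x -> cts (fun t => - f t)%C x.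
Proof.
  intros f x H eps He. destruct (H eps He) as [d [Hd K]]. exists d. split; auto.
  intros y Hy. replace (- f y - - f x)%C with (- (f y - f x))%C by ring. rewrite Cmod_opp. auto.
Qed.

Lemma cts_minus : forall f g x, cts f x -> cts g x -> cts (fun t => f t - g t)%C x.
Proof. intros. apply cts_plus; auto. apply cts_opp; auto. Qed.

Lemma cts_ext : forall f g x, (forall t, f t = g t) -> cts f x -> cts g x.
Proof.
  intros f g x E H eps He. destruct (H eps He) as [d [Hd K]].
  exists d. split; auto. intros y. rewrite <- !E. auto.
Qed.

(** * Segment integrals of complex functions *)

Notation CRI := (RInt (V := C_R_CompleteNormedModule)).
Notation is_CRI := (is_RInt (V := C_R_CompleteNormedModule)).
Notation ex_CRI := (ex_RInt (V := C_R_CompleteNormedModule)).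

Lemma ex_CRI_cts : forall f a b, a <= b -> (forall x, a <= x <= b -> cts f x) -> ex_CRI f a b.
Proof.
  intros f a b Hab H. apply ex_RInt_continuous. intros z Hz.
  rewrite Rmin_left, Rmax_right in Hz by lra. apply cts_continuous; auto.
Qed.

Lemma ex_CRI_cts' : forall f a b, (forall x, cts f x) -> ex_CRI f a b.
Proof. intros f a b H. apply ex_RInt_continuous. intros z Hz. apply cts_continuous; auto. Qed.

Lemma is_CRI_scal : forall (k : C) f a b l, is_CRI f a b l -> is_CRI (fun t => k * f t)%C a b (k * l)%C.
Proof.
  intros k f a b l H.
  pose proof (is_RInt_fct_extend_fst (U := R_NormedModule) (V := R_NormedModule) f a b l H) as H1.
  pose proof (is_RInt_fct_extend_snd (U := R_NormedModule) (V := R_NormedModule) f a b l H) as H2.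
  apply (is_RInt_fct_extend_pair (U := R_NormedModule) (V := R_NormedModule)).
  - exact (is_RInt_minus _ _ _ _ _ _ (is_RInt_scal _ _ _ (fst k) _ H1) (is_RInt_scal _ _ _ (snd k) _ H2)).
  - exact (is_RInt_plus _ _ _ _ _ _ (is_RInt_scal _ _ _ (fst k) _ H2) (is_RInt_scal _ _ _ (snd k) _ H1)).
Qed.

Lemma CRI_scal : forall k f a b, ex_CRI f a b -> CRI (fun t => k * f t)%C a b = (k * CRI f a b)%C.
Proof. intros. apply is_RInt_unique, is_CRI_scal, RInt_correct. auto. Qed.

Lemma CRI_minus : forall f g a b, ex_CRI f a b -> ex_CRI g a b ->
  CRI (fun t => f t - g t)%C a b = (CRI f a b - CRI g a b)%C.
Proof. intros. apply (RInt_minus (V := C_R_CompleteNormedModule) f g); auto. Qed.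

Lemma CRI_chasles : forall f a b c, ex_CRI f a b -> ex_CRI f b c ->
  (CRI f a b + CRI f b c)%C = CRI f a c.
Proof. intros. apply (RInt_Chasles (V := C_R_CompleteNormedModule) f); auto. Qed.

Lemma CRI_ext : forall f g a b, a <= b -> (forall x, a <= x <= b -> f x = g x) -> CRI f a b = CRI g a b.
Proof.
  intros f g a b Hab H. apply RInt_ext. intros x Hx. rewrite Rmin_left, Rmax_right in Hx by lra.
  apply H; lra.
Qed.

Lemma Cmod_norm_R : forall x : C, Cmod x = norm (V := C_R_NormedModule) x.
Proof. exact Cmod_norm. Qed.

Lemma CRI_bound : forall (f : R -> C) a b M, a <= b -> ex_CRI f a b ->
  (forall x, a <= x <= b -> Cmod (f x) <= M) -> Cmod (CRI f a b) <= (b - a) * M.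
Proof.
  intros f a b M Hab Hex H. rewrite Cmod_norm_R.
  apply (norm_RInt_le_const (V := C_R_NormedModule) f a b _ M Hab).
  - intros x Hx. specialize (H x Hx). rewrite Cmod_norm_R in H. exact H.
  - apply (RInt_correct (V := C_R_CompleteNormedModule)). auto.
Qed.

Lemma CRI_bound_fun : forall (f : R -> C) (g : R -> R) a b, a <= b -> ex_CRI f a b -> ex_RInt g a b ->
  (forall x, a <= x <= b -> Cmod (f x) <= g x) -> Cmod (CRI f a b) <= RInt g a b.
Proof.
  intros f g a b Hab Hex Hg H. rewrite Cmod_norm_R.
  apply (norm_RInt_le (V := C_R_NormedModule) f g a b _ (RInt g a b) Hab).
  - intros x Hx. specialize (H x Hx). rewrite Cmod_norm_R in H. exact H.
  - apply (RInt_correct (V := C_R_CompleteNormedModule)). auto.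
  - apply (RInt_correct (V := R_CompleteNormedModule)). auto.
Qed.

Lemma RD_is_derive : forall (f : C -> C) (x : R) l, RD f x l ->
  is_derive (K := R_AbsRing) (V := C_R_NormedModule) (fun t => f (RtoC t)) x l.
Proof.
  intros f x l H. split.
  - apply is_linear_scal_l.
  - intros y Hy. pose proof (@is_filter_lim_locally_unique R_AbsRing R_NormedModule x y Hy) as E. subst y; clear Hy.
    intros eps. destruct (H eps (cond_pos eps)) as [d [Hd K]].
    exists (mkposreal d Hd). intros y Hy.
    assert (B : Rabs (y - x) < d) by exact Hy.
    specialize (K (RtoC (y - x)) eq_refl). rewrite Cmod_R in K. specialize (K B).
    replace (x + RtoC (y - x))%C with (RtoC y) in K by (rewrite RtoC_minus; ring).
    change (norm (minus y x)) with (Rabs (y - x)).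
    rewrite Cmod_norm_R in K. eapply Rle_trans; [|exact K]. apply Req_le.
    f_equal. apply C_ext; simpl; unfold minus, plus, opp, scal; simpl; unfold mult; simpl; ring.
Qed.

Lemma CRI_FTC : forall (F f : C -> C) a b, a <= b ->
  (forall x : R, a <= x <= b -> RD F x (f x)) ->
  (forall x : R, a <= x <= b -> cts (fun t => f (RtoC t)) x) ->
  CRI (fun t => f (RtoC t)) a b = (F b - F a)%C.
Proof.
  intros F f a b Hab H1 H2. apply is_RInt_unique.
  apply (is_RInt_derive (V := C_R_CompleteNormedModule) (fun t => F (RtoC t)) (fun t => f (RtoC t))).
  - intros x Hx. rewrite Rmin_left, Rmax_right in Hx by lra. apply RD_is_derive; auto.
  - intros x Hx. rewrite Rmin_left, Rmax_right in Hx by lra. apply cts_continuous; auto.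
Qed.

(** The fundamental theorem on the segment; differentiability of [f] serves only to make it
    integrable. *)
Lemma mean_value_le : forall (F f : C -> C) (a d : C) M,
  (forall t : R, 0 <= t <= 1 -> CD F (a + t * d) (f (a + t * d)))%C ->
  (forall t : R, 0 <= t <= 1 -> exists l, CD f (a + t * d) l)%C ->
  (forall t : R, 0 <= t <= 1 -> Cmod (f (a + t * d)%C) <= M) ->
  Cmod (F (a + d) - F a)%C <= M * Cmod d.
Proof.
  intros F f a d M H1 H2 H3.
  assert (L : forall A c, deriv A (fun z => a + z * d)%C c d).
  { intros. eapply deriv_eq; [|apply deriv_plus; [apply deriv_const|apply deriv_mult; [apply deriv_id|apply deriv_const]]].
    simpl. ring. }
  assert (E : CRI (fun t => (f (a + RtoC t * d) * d)%C) 0 1 = (F (a + d) - F a)%C).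
  { rewrite (CRI_FTC (fun z => F (a + z * d)%C) (fun z => f (a + z * d) * d)%C); try lra.
    - f_equal; [f_equal; ring|]. f_equal. f_equal. ring.
    - intros x Hx. eapply (deriv_comp _ F (fun z => (a + z * d)%C)); [|apply L]. apply H1; auto.
    - intros x Hx. destruct (H2 x Hx) as [l Hl].
      eapply (RD_cts (fun z => (f (a + z * d) * d)%C)). apply deriv_mult; [|apply deriv_const].
      eapply (deriv_comp _ f (fun z => (a + z * d)%C)); [|apply L]. exact Hl. }
  rewrite <- E. replace (M * Cmod d) with ((1 - 0) * (M * Cmod d)) by ring.
  apply CRI_bound; [lra| |].
  - apply ex_CRI_cts; [lra|]. intros x Hx. destruct (H2 x Hx) as [l Hl].
    eapply (RD_cts (fun z => (f (a + z * d) * d)%C)). apply deriv_mult; [|apply deriv_const].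
    eapply (deriv_comp _ f (fun z => (a + z * d)%C)); [|apply L]. exact Hl.
  - intros x Hx. rewrite Cmod_mult. apply Rmult_le_compat_r; [apply Cmod_ge_0|]. auto.
Qed.

(** * Integrals over the real line *)

Definition RI (f : R -> C) : C :=
  RInt_gen (V := C_R_CompleteNormedModule) f (Rbar_locally m_infty) (Rbar_locally p_infty).
Notation is_RI f l := (is_RInt_gen (V := C_R_CompleteNormedModule) f (Rbar_locally m_infty) (Rbar_locally p_infty) l).

(** The majorant of all one-dimensional integrands: its primitive is [atan], so an integrand
    dominated by [K * wt] has an absolutely convergent integral of modulus at most [PI * K]. *)
Definition wt (x : R) : R := / (1 + x * x).

Definition dom (f : R -> C) (K : R) : Prop :=
  (forall x, cts f x) /\ (forall x, Cmod (f x) <= K * wt x).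

Lemma wt_pos : forall x, 0 < wt x.
Proof. intros. apply Rinv_0_lt_compat. nra. Qed.

Lemma wt_le_1 : forall x, wt x <= 1.
Proof. intros. unfold wt. rewrite <- Rinv_1. apply Rinv_le_contravar; nra. Qed.

Lemma dom_K_nonneg : forall f K, dom f K -> 0 <= K.
Proof.
  intros f K [_ H]. specialize (H 0). pose proof (Cmod_ge_0 (f 0)). pose proof (wt_pos 0). nra.
Qed.

Lemma is_derive_atan_K : forall K x, is_derive (fun x => K * atan x) x (K * wt x).
Proof.
  intros. unfold wt. auto_derive; auto. unfold Rsqr. field. nra.
Qed.

Lemma continuous_wt : forall x, continuous wt x.
Proof.
  intros. apply (ex_derive_continuous (V := R_NormedModule)). unfold wt. auto_derive. nra.
Qed.

Lemma is_RInt_wt : forall K a b, is_RInt (fun x => K * wt x) a b (K * atan b - K * atan a).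
Proof.
  intros. apply (is_RInt_derive (fun x => K * atan x)).
  - intros. apply is_derive_atan_K.
  - intros. apply (continuous_scal_r K (V := R_NormedModule)). apply continuous_wt.
Qed.

Lemma ex_CRI_dom : forall f K a b, dom f K -> ex_CRI f a b.
Proof. intros f K a b [H _]. apply ex_CRI_cts'; auto. Qed.

Lemma CRI_dom_le : forall f K a b, dom f K -> a <= b ->
  Cmod (CRI f a b) <= K * atan b - K * atan a.
Proof.
  intros f K a b D Hab. rewrite <- (is_RInt_unique _ _ _ _ (is_RInt_wt K a b)).
  apply CRI_bound_fun; auto.
  - eapply ex_CRI_dom; eauto.
  - eexists. apply is_RInt_wt.
  - intros. apply D.
Qed.

Lemma CRI_dom_abs : forall f K a b, dom f K ->
  Cmod (CRI f a b) <= K * Rabs (atan b - atan a).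
Proof.
  intros f K a b D. pose proof (dom_K_nonneg _ _ D).
  destruct (Rle_dec a b) as [Hab|Hab].
  - eapply Rle_trans; [apply CRI_dom_le; eauto|]. pose proof (Rle_abs (atan b - atan a)). nra.
  - assert (E : CRI f a b = (- CRI f b a)%C).
    { symmetry. apply (opp_RInt_swap (V := C_R_CompleteNormedModule)). eapply ex_CRI_dom; eauto. }
    rewrite E, Cmod_opp. eapply Rle_trans; [apply CRI_dom_le; eauto; lra|].
    rewrite Rabs_minus_sym. pose proof (Rle_abs (atan a - atan b)). nra.
Qed.

Lemma CRI_reflect : forall f a b, (forall u v, ex_CRI f u v) -> CRI (fun x => f (- x)) a b = CRI f (- b) (- a).
Proof.
  intros f a b H. apply (is_RInt_unique (V := C_R_CompleteNormedModule)).
  pose proof (RInt_correct (V := C_R_CompleteNormedModule) f (- b) (- a) (H _ _)) as K.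
  apply (is_RInt_swap (V := C_R_CompleteNormedModule)) in K.
  apply (is_RInt_comp_opp (V := C_R_CompleteNormedModule)) in K.
  apply (is_RInt_opp (V := C_R_CompleteNormedModule)) in K.
  rewrite opp_opp in K. revert K. apply (is_RInt_ext (V := C_R_CompleteNormedModule)).
  intros x _. apply opp_opp.
Qed.

Lemma ball_of_Cmod : forall (x y : C) e, Cmod (y - x) < e ->
  ball (M := C_R_CompleteNormedModule) x e y.
Proof.
  intros x y e H. split.
  - change (Rabs (Re y - Re x) < e). eapply Rle_lt_trans; [|exact H].
    rewrite <- Re_minus. apply re_le_Cmod.
  - change (Rabs (Im y - Im x) < e). eapply Rle_lt_trans; [|exact H].
    rewrite <- Im_minus. apply im_le_Cmod.
Qed.

Lemma Cmod_of_ball : forall (x y : C) e,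
  ball (M := C_R_CompleteNormedModule) x e y -> Cmod (y - x) < 2 * e.
Proof.
  intros x y e [H1 H2].
  change (Rabs (Re y - Re x) < e) in H1. change (Rabs (Im y - Im x) < e) in H2.
  eapply Rle_lt_trans; [apply Cmod_le_reim|]. rewrite Re_minus, Im_minus. lra.
Qed.

Lemma atan_near : forall e, 0 < e -> exists A, 0 < A /\ forall x y, A < x -> A < y ->
  Rabs (atan x - atan y) < e /\ Rabs (atan (-x) - atan (-y)) < e.
Proof.
  intros e He. set (e' := Rmin e 1).
  assert (He' : 0 < e' <= 1) by (unfold e'; split; [apply Rmin_pos; lra | apply Rmin_r]).
  pose proof PI2_1.
  exists (Rmax 1 (tan (PI / 2 - e'))). split.
  - eapply Rlt_le_trans; [|apply Rmax_l]. lra.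
  - assert (K : forall x, Rmax 1 (tan (PI / 2 - e')) < x -> PI / 2 - e' < atan x < PI / 2).
    { intros x Hx. split; [|apply atan_bound].
      rewrite <- (atan_tan (PI / 2 - e')) by lra. apply atan_increasing.
      eapply Rle_lt_trans; [apply Rmax_r|exact Hx]. }
    intros x y Hx Hy. rewrite !atan_opp. apply K in Hx. apply K in Hy.
    assert (e' <= e) by apply Rmin_l.
    split; apply Rabs_def1; lra.
Qed.

Lemma CRI_swap4 : forall f K a b c d, dom f K ->
  (CRI f c d - CRI f a b)%C = (CRI f c a + CRI f b d)%C.
Proof.
  intros f K a b c d D.
  assert (E : forall u v, ex_CRI f u v) by (intros; eapply ex_CRI_dom; eauto).
  rewrite <- (CRI_chasles f c a d), <- (CRI_chasles f a b d) by auto. ring.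
Qed.

(** Cauchy's criterion: the tails are bounded by [K] times increments of [atan]. *)
Lemma is_RI_dom : forall f K, dom f K -> is_RI f (RI f).
Proof.
  intros f K D. apply (RInt_gen_correct (V := C_R_CompleteNormedModule)).
  pose proof (dom_K_nonneg _ _ D) as HK.
  destruct (proj1 (filterlim_locally_cauchy (U := C_R_CompleteNormedModule)
     (F := filter_prod (Rbar_locally m_infty) (Rbar_locally p_infty)) (fun ab => CRI f (fst ab) (snd ab)))) as [l Hl].
  - intros eps.
    destruct (atan_near (eps / (4 * (K + 1)))) as [A [HA B]].
    { apply Rdiv_lt_0_compat; [apply cond_pos|lra]. }
    exists (fun ab => fst ab < - A /\ A < snd ab). split.
    + apply Filter_prod with (fun a => a < - A) (fun b => A < b).
      * exists (- A). auto.
      * exists A. auto.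
      * auto.
    + intros [a b] [c d] [H1 H2] [H3 H4]. simpl in *. apply ball_of_Cmod.
      rewrite (CRI_swap4 f K) by auto.
      eapply Rle_lt_trans; [apply Cmod_triangle|].
      pose proof (CRI_dom_abs f K c a D) as P1. pose proof (CRI_dom_abs f K b d D) as P2.
      destruct (B d b) as [Q1 _]; try lra. destruct (B (-a) (-c)) as [_ Q2]; try lra.
      rewrite !Ropp_involutive in Q2.
      assert (R1 : K * Rabs (atan a - atan c) <= eps / 4).
      { apply Rle_trans with ((K + 1) * (eps / (4 * (K + 1)))).
        - apply Rmult_le_compat; try lra. apply Rabs_pos.
        - apply Req_le. field. lra. }
      assert (R2 : K * Rabs (atan d - atan b) <= eps / 4).
      { apply Rle_trans with ((K + 1) * (eps / (4 * (K + 1)))).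
        - apply Rmult_le_compat; try lra. apply Rabs_pos.
        - apply Req_le. field. lra. }
      pose proof (cond_pos eps). lra.
  - exists l. intros P HP. specialize (Hl P HP). unfold filtermap in Hl.
    unfold filtermapi. eapply filter_imp; [|exact Hl].
    intros [a b] Hab. simpl in *. exists (CRI f a b). split; auto.
    apply (RInt_correct (V := C_R_CompleteNormedModule)). eapply ex_CRI_dom; eauto.
Qed.

Lemma is_RI_unique : forall f l, is_RI f l -> RI f = l.
Proof.
  intros f l H. unfold RI.
  exact (is_RInt_gen_unique (V := C_R_CompleteNormedModule) f l H).
Qed.

Lemma RI_trunc : forall f l, is_RI f l -> forall eps, 0 < eps -> exists A, 0 < A /\
  forall a b, A < a -> A < b -> exists y, is_CRI f (- a) b y /\ Cmod (y - l) < eps.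
Proof.
  intros f l H eps He.
  assert (He2 : 0 < eps / 2) by lra.
  specialize (H (ball (M := C_R_CompleteNormedModule) l (eps/2)) (locally_ball l (mkposreal _ He2))).
  destruct H as [P Q [A HA] [B HB] HPQ].
  exists (Rmax 1 (Rmax (- A) B)). split.
  - eapply Rlt_le_trans; [|apply Rmax_l]; lra.
  - intros a b Ha Hb.
    pose proof (Rmax_r 1 (Rmax (- A) B)). pose proof (Rmax_l (- A) B). pose proof (Rmax_r (- A) B).
    destruct (HPQ (- a) b) as [y [Hy1 Hy2]].
    + apply HA. lra.
    + apply HB. lra.
    + exists y. split; auto. apply Cmod_of_ball in Hy2. lra.
Qed.

Lemma RI_trunc_dom : forall f K, dom f K -> forall eps, 0 < eps -> exists A, 0 < A /\
  forall a b, A < a -> A < b -> Cmod (CRI f (- a) b - RI f) < eps.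
Proof.
  intros f K D eps He. destruct (RI_trunc f _ (is_RI_dom f K D) eps He) as [A [HA H]].
  exists A. split; auto. intros a b Ha Hb. destruct (H a b Ha Hb) as [y [H1 H2]].
  apply (is_RInt_unique (V := C_R_CompleteNormedModule)) in H1. rewrite H1. auto.
Qed.

Lemma Cmod_le_eps : forall (c : C) M, (forall eps, 0 < eps -> Cmod c <= M + eps) -> Cmod c <= M.
Proof. intros. apply le_epsilon. auto. Qed.

Lemma C_eq_eps : forall a b : C, (forall eps, 0 < eps -> Cmod (a - b) <= eps) -> a = b.
Proof.
  intros a b H. assert (E : Cmod (a - b) = 0).
  { apply Rle_antisym; [|apply Cmod_ge_0]. apply Cmod_le_eps. intros. rewrite Rplus_0_l. auto. }
  apply Cmod_eq_0 in E. replace a with ((a - b) + b)%C by ring. rewrite E. ring.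
Qed.

Lemma RI_bound : forall f K, dom f K -> Cmod (RI f) <= PI * K.
Proof.
  intros f K D. apply Cmod_le_eps. intros eps He. pose proof (dom_K_nonneg _ _ D).
  destruct (RI_trunc_dom f K D eps He) as [A [HA H1]].
  specialize (H1 (A + 1) (A + 1)).
  pose proof (CRI_dom_le f K (- (A+1)) (A+1) D ltac:(lra)).
  pose proof (atan_bound (A+1)). pose proof (atan_bound (- (A+1))).
  replace (RI f) with (CRI f (- (A + 1)) (A + 1) - (CRI f (- (A + 1)) (A + 1) - RI f))%C by ring.
  eapply Rle_trans; [apply Cmod_triangle_minus|].
  apply Rplus_le_compat; [|left; apply H1; lra].
  eapply Rle_trans; [eassumption|]. nra.
Qed.

Lemma RI_ext : forall f g, (forall x, f x = g x) -> RI f = RI g.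
Proof.
  intros f g H. assert (E : f = g) by (apply FunctionalExtensionality.functional_extensionality; auto).
  rewrite E. reflexivity.
Qed.

Lemma dom_plus : forall f g K L, dom f K -> dom g L -> dom (fun x => f x + g x)%C (K + L).
Proof.
  intros f g K L [H1 H2] [H3 H4]. split.
  - intros. apply cts_plus; auto.
  - intros x. eapply Rle_trans; [apply Cmod_triangle|]. specialize (H2 x). specialize (H4 x). lra.
Qed.

Lemma dom_scal : forall f K k, dom f K -> dom (fun x => k * f x)%C (Cmod k * K).
Proof.
  intros f K k [H1 H2]. split.
  - intros. apply cts_mult; auto. apply cts_const.
  - intros x. rewrite Cmod_mult, Rmult_assoc. apply Rmult_le_compat_l; auto. apply Cmod_ge_0.
Qed.

Lemma dom_opp : forall f K, dom f K -> dom (fun x => - f x)%C K.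
Proof.
  intros f K [H1 H2]. split.
  - intros. apply cts_opp; auto.
  - intros x. rewrite Cmod_opp. auto.
Qed.

Lemma dom_minus : forall f g K L, dom f K -> dom g L -> dom (fun x => f x - g x)%C (K + L).
Proof. intros. apply dom_plus; auto. apply dom_opp; auto. Qed.

Lemma dom_ext : forall f g K, (forall x, f x = g x) -> dom f K -> dom g K.
Proof.
  intros f g K H D. assert (E : f = g) by (apply FunctionalExtensionality.functional_extensionality; auto).
  rewrite <- E. auto.
Qed.

Lemma RI_plus : forall f g K L, dom f K -> dom g L -> RI (fun x => f x + g x)%C = (RI f + RI g)%C.
Proof.
  intros f g K L Df Dg. apply is_RI_unique.
  exact (is_RInt_gen_plus (V := C_R_CompleteNormedModule) f g _ _ (is_RI_dom _ _ Df) (is_RI_dom _ _ Dg)).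
Qed.

Lemma RI_opp : forall f K, dom f K -> RI (fun x => - f x)%C = (- RI f)%C.
Proof.
  intros f K Df. apply is_RI_unique.
  exact (is_RInt_gen_opp (V := C_R_CompleteNormedModule) f _ (is_RI_dom _ _ Df)).
Qed.

Lemma RI_minus : forall f g K L, dom f K -> dom g L -> RI (fun x => f x - g x)%C = (RI f - RI g)%C.
Proof.
  intros f g K L Df Dg. apply is_RI_unique.
  exact (is_RInt_gen_minus (V := C_R_CompleteNormedModule) f g _ _ (is_RI_dom _ _ Df) (is_RI_dom _ _ Dg)).
Qed.

(** The integral is taken in a real normed module, so a complex scalar is first moved across
    the truncated integrals. *)
Lemma RI_scal : forall f K k, dom f K -> RI (fun x => k * f x)%C = (k * RI f)%C.
Proof.
  intros f K k D. apply C_eq_eps. intros eps He. pose proof (Cmod_ge_0 k) as Hk.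
  assert (P : 0 < eps / (2 * (Cmod k + 1))) by (apply Rdiv_lt_0_compat; lra).
  destruct (RI_trunc_dom f K D _ P) as [A [HA H1]].
  destruct (RI_trunc_dom _ _ (dom_scal f K k D) (eps/2)) as [B [HB H2]]; [lra|].
  specialize (H1 (A + B) (A + B) ltac:(lra) ltac:(lra)). specialize (H2 (A + B) (A + B) ltac:(lra) ltac:(lra)).
  rewrite CRI_scal in H2 by (eapply ex_CRI_dom; eauto).
  replace (RI (fun x : R => k * f x) - k * RI f)%C with
    (k * (CRI f (- (A + B)) (A + B) - RI f) - (k * CRI f (- (A + B)) (A + B) - RI (fun x : R => k * f x)))%C by ring.
  eapply Rle_trans; [apply Cmod_triangle_minus|]. rewrite Cmod_mult.
  assert (Cmod k * Cmod (CRI f (- (A + B)) (A + B) - RI f) <= eps / 2).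
  { apply Rle_trans with ((Cmod k + 1) * (eps / (2 * (Cmod k + 1)))).
    - apply Rmult_le_compat; try lra; apply Cmod_ge_0.
    - apply Req_le. field. lra. }
  lra.
Qed.

Lemma RI_scal_r : forall f K k, dom f K -> RI (fun x => f x * k)%C = (RI f * k)%C.
Proof.
  intros. rewrite (RI_ext _ (fun x => k * f x)%C) by (intros; ring).
  erewrite RI_scal; eauto. ring.
Qed.

Lemma scal_R_Cmult : forall (r : R) (c : C),
  scal (V := C_R_CompleteNormedModule) r c = (RtoC r * c)%C.
Proof.
  intros r [a b]. apply C_ext; simpl; unfold scal; simpl; unfold mult; simpl; ring.
Qed.

(** The constant comes from [1 + y^2 <= 3 (1 + c^2) (1 + (y + c)^2)]. *)
Lemma dom_shift : forall f K c, dom f K -> dom (fun x => f (x + c)) (3 * (1 + c * c) * K).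
Proof.
  intros f K c D. pose proof (dom_K_nonneg _ _ D) as HK. destruct D as [Dc Db]. split.
  - intros y eps He. destruct (Dc (y + c) eps He) as [d [Hd Hdd]]. exists d. split; auto.
    intros y' Hy'. apply Hdd. replace (y' + c - (y + c)) with (y' - y) by ring. auto.
  - intros y. eapply Rle_trans; [apply Db|].
    replace (3 * (1 + c * c) * K * wt y) with (K * (3 * (1 + c * c) * wt y)) by ring.
    apply Rmult_le_compat_l; auto. unfold wt.
    assert (Q1 : 0 < 1 + (y + c) * (y + c)) by (pose proof (Rle_0_sqr (y + c)); unfold Rsqr in *; lra).
    assert (Q2 : 0 < 1 + y * y) by (pose proof (Rle_0_sqr y); unfold Rsqr in *; lra).
    apply Rmult_le_reg_r with (1 + (y + c) * (y + c)); auto. rewrite Rinv_l by lra.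
    apply Rmult_le_reg_r with (1 + y * y); auto.
    replace (3 * (1 + c * c) * / (1 + y * y) * (1 + (y + c) * (y + c)) * (1 + y * y))
     with (3 * (1 + c * c) * (1 + (y + c) * (y + c))) by (field; lra).
    pose proof (Rle_0_sqr (c * (y + c))). unfold Rsqr in *.
    assert (y * y <= 2 * ((y + c) * (y + c)) + 2 * (c * c)).
    { pose proof (Rle_0_sqr (y + 2 * c)). unfold Rsqr in *. nra. }
    nra.
Qed.

Lemma RI_affine : forall f l c r, 0 < r -> is_RI f l ->
  is_RI (fun x => RtoC r * f (r * x + c)%R)%C l.
Proof.
  intros f l c r Hr H P HP. specialize (H P HP).
  destruct H as [Q S [A HA] [B HB] HQ].
  apply Filter_prod with (fun a => a < (A - c) / r) (fun b => (B - c) / r < b).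
  - eexists. intros x Hx. exact Hx.
  - eexists. intros x Hx. exact Hx.
  - intros a b Ha Hb.
    destruct (HQ (r * a + c) (r * b + c)) as [y [Hy1 Hy2]].
    + apply HA. apply Rmult_lt_compat_l with (r := r) in Ha; auto.
      replace (r * ((A - c) / r)) with (A - c) in Ha by (field; lra). lra.
    + apply HB. apply Rmult_lt_compat_l with (r := r) in Hb; auto.
      replace (r * ((B - c) / r)) with (B - c) in Hb by (field; lra). lra.
    + exists y. split; auto.
      simpl in *.
      apply (is_RInt_ext (V := C_R_CompleteNormedModule) (fun x => scal r (f (r * x + c)))).
      * intros x Hx. apply scal_R_Cmult.
      * apply (is_RInt_comp_lin (V := C_R_CompleteNormedModule) f r c a b). exact Hy1.
Qed.

Lemma RI_shift : forall f K c, dom f K -> RI (fun x => f (x + c)) = RI f.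
Proof.
  intros f K c D. apply is_RI_unique.
  pose proof (RI_affine f _ c 1 Rlt_0_1 (is_RI_dom f K D)) as H.
  assert (E : (fun x : R => (RtoC 1 * f (1 * x + c)%R)%C) = (fun x => f (x + c))).
  { apply FunctionalExtensionality.functional_extensionality. intros. rewrite Rmult_1_l, Cmult_1_l. auto. }
  rewrite E in H. exact H.
Qed.

Lemma RI_scale : forall f K r, 0 < r -> dom f K -> RI (fun x => RtoC r * f (r * x)%R)%C = RI f.
Proof.
  intros f K r Hr D. apply is_RI_unique.
  pose proof (RI_affine f _ 0 r Hr (is_RI_dom f K D)) as H.
  assert (E : (fun x : R => (RtoC r * f (r * x + 0)%R)%C) = (fun x => RtoC r * f (r * x)%R)%C).
  { apply FunctionalExtensionality.functional_extensionality. intros. rewrite Rplus_0_r. auto. }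
  rewrite E in H. exact H.
Qed.

Lemma wt_small : forall eps, 0 < eps -> exists A, 0 < A /\ forall x, A < Rabs x -> wt x < eps.
Proof.
  intros eps He. exists (Rmax 1 (/ eps)). split; [eapply Rlt_le_trans; [|apply Rmax_l]; lra|].
  intros x Hx. pose proof (Rmax_l 1 (/ eps)). pose proof (Rmax_r 1 (/ eps)).
  unfold wt. rewrite <- (Rinv_inv eps). apply Rinv_lt_contravar.
  - apply Rmult_lt_0_compat; [apply Rinv_0_lt_compat; auto | nra].
  - assert (x * x = Rabs x * Rabs x) by (rewrite <- Rabs_mult, Rabs_pos_eq; auto; nra). nra.
Qed.

Lemma RI_reflect : forall f K, dom f K -> RI (fun x => f (- x)) = RI f.
Proof.
  intros f K D.
  assert (D' : dom (fun x => f (- x)) K).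
  { destruct D as [D1 D2]. split.
    - intros x eps He. destruct (D1 (- x) eps He) as [d [Hd H]]. exists d. split; auto.
      intros y Hy. apply H. replace (- y - - x) with (- (y - x)) by ring. rewrite Rabs_Ropp. auto.
    - intros x. eapply Rle_trans; [apply D2|]. unfold wt. replace (- x * - x) with (x * x) by ring. lra. }
  apply C_eq_eps. intros eps He.
  destruct (RI_trunc_dom _ _ D (eps / 2)) as [A [HA H1]]; [lra|].
  destruct (RI_trunc_dom _ _ D' (eps / 2)) as [B [HB H2]]; [lra|].
  specialize (H1 (A + B) (A + B) ltac:(lra) ltac:(lra)). specialize (H2 (A + B) (A + B) ltac:(lra) ltac:(lra)).
  rewrite CRI_reflect in H2 by (intros; eapply ex_CRI_dom; eauto). rewrite Ropp_involutive in H2.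
  match type of H1 with Cmod (?c - _) < _ =>
  replace (RI (fun x => f (- x)%R) - RI f)%C with ((c - RI f) - (c - RI (fun x => f (- x)%R)))%C by ring end.
  eapply Rle_trans; [apply Cmod_triangle_minus|]. lra.
Qed.

(** By the fundamental theorem only boundary terms are left on a large interval, and these
    tend to zero.  All integrations by parts are instances of this. *)
Lemma RI_deriv_zero : forall (F f : C -> C) K L,
  (forall x : R, RD F x (f x)) ->
  dom (fun x => f (RtoC x)) K -> (forall x : R, Cmod (F x) <= L * wt x) ->
  RI (fun x => f (RtoC x)) = 0%C.
Proof.
  intros F f K L HF D HL. apply C_eq_eps. intros eps He.
  assert (HL0 : 0 <= L).
  { pose proof (HL 0). pose proof (Cmod_ge_0 (F 0)). pose proof (wt_pos 0). nra. }
  destruct (RI_trunc_dom _ K D (eps/2)) as [A [HA H1]]; [lra|].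
  destruct (wt_small (eps / (4 * (L + 1)))) as [B [HB H2]]; [apply Rdiv_lt_0_compat; lra|].
  specialize (H1 (A + B) (A + B) ltac:(lra) ltac:(lra)).
  rewrite (CRI_FTC F f) in H1; [|lra|auto|intros; apply D].
  set (I0 := RI _) in *. set (Fp := F (RtoC (A + B))) in *. set (Fm := F (RtoC (- (A + B)))) in *.
  replace (I0 - 0)%C with ((Fp - Fm) - ((Fp - Fm) - I0))%C by ring.
  eapply Rle_trans; [apply Cmod_triangle_minus|].
  assert (Q : forall x : R, B < Rabs x -> Cmod (F x) <= eps / 4).
  { intros x Hx. eapply Rle_trans; [apply HL|]. apply Rle_trans with ((L + 1) * (eps / (4 * (L + 1)))).
    - apply Rmult_le_compat; try lra; [left; apply wt_pos| left; auto].
    - apply Req_le. field. lra. }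
  pose proof (Cmod_triangle_minus Fp Fm).
  assert (Cmod Fp <= eps / 4) by (apply Q; rewrite Rabs_pos_eq; lra).
  assert (Cmod Fm <= eps / 4) by (apply Q; rewrite Rabs_Ropp, Rabs_pos_eq; lra).
  lra.
Qed.

(** The remainder of the integrand, quadratic in the increment with the integrable factor
    [wt], integrates to a quadratic remainder. *)
Lemma RI_deriv : forall A (f : C -> R -> C) (f' : R -> C) (c : C) K0 K1 K d, 0 < d ->
  dom (f c) K0 -> dom f' K1 ->
  (forall h, A h -> Cmod h < d -> exists K2, dom (f (c + h)%C) K2) ->
  (forall h x, A h -> Cmod h < d -> Cmod (f (c + h)%C x - f c x - h * f' x)%C <= K * (Cmod h * Cmod h) * wt x) ->
  deriv A (fun z => RI (f z)) c (RI f').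
Proof.
  intros A f f' c K0 K1 K d Hd D0 D1 D2 HB eps He.
  assert (P : 0 < eps / (PI * (Rabs K + 1))).
  { pose proof PI_RGT_0. pose proof (Rabs_pos K). apply Rdiv_lt_0_compat; nra. }
  exists (Rmin d (eps / (PI * (Rabs K + 1)))). split; [apply Rmin_pos; auto|].
  intros h Ah Hh. apply Rmin_Rgt in Hh as [H1 H2].
  destruct (D2 h Ah H1) as [K2 Dh].
  assert (E : (RI (f (c + h)%C) - RI (f c) - RI f' * h)%C = RI (fun x => f (c + h)%C x - f c x - h * f' x)%C).
  { erewrite RI_minus; [|eapply dom_minus; eassumption | apply dom_scal; eassumption].
    erewrite RI_minus; eauto. erewrite (RI_scal f'); eauto. ring. }
  rewrite E.
  assert (DD : dom (fun x => f (c + h)%C x - f c x - h * f' x)%C (K * (Cmod h * Cmod h))).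
  { split; [|intros; apply HB; auto]. intros. apply cts_minus; [apply cts_minus|apply cts_mult].
    - apply Dh. - apply D0. - apply cts_const. - apply D1. }
  eapply Rle_trans; [apply RI_bound; exact DD|].
  pose proof (Cmod_ge_0 h). pose proof (Rle_abs K). pose proof (Rabs_pos K). pose proof PI_RGT_0.
  replace (PI * (K * (Cmod h * Cmod h))) with ((PI * K * Cmod h) * Cmod h) by ring.
  apply Rmult_le_compat_r; auto.
  apply Rle_trans with (PI * (Rabs K + 1) * (eps / (PI * (Rabs K + 1)))).
  - apply Rle_trans with (PI * (Rabs K + 1) * Cmod h).
    + apply Rmult_le_compat_r; auto. nra.
    + apply Rmult_le_compat_l; [nra|lra].
  - apply Req_le. field. split; nra.
Qed.

(** * Cauchy's theorem on rectangles *)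

Definition boxint (f : C -> C) (x1 x2 y1 y2 : R) : C :=
  (CRI (fun x => f (x, y1)) x1 x2 + Ci * CRI (fun y => f (x2, y)) y1 y2
   - CRI (fun x => f (x, y2)) x1 x2 - Ci * CRI (fun y => f (x1, y)) y1 y2)%C.

Definition hol_box (f : C -> C) (x1 x2 y1 y2 : R) : Prop :=
  forall x y, x1 <= x <= x2 -> y1 <= y <= y2 -> exists l, CD f (x, y) l.

Lemma pair_reim : forall x y : R, ((x, y) : C) = (RtoC x + Ci * RtoC y)%C.
Proof. intros. ceq; simpl; ring. Qed.

Lemma RD_hline : forall f (x y : R) l, CD f (x, y) l -> RD (fun t => f (t + Ci * RtoC y)%C) (RtoC x) l.
Proof.
  intros f x y l H. eapply deriv_eq; [|eapply (deriv_comp _ f (fun t => t + Ci * RtoC y)%C)].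
  2:{ rewrite <- pair_reim. exact H. }
  2:{ eapply deriv_plus; [apply deriv_id|apply deriv_const]. }
  ring.
Qed.

Lemma RD_vline : forall f (x y : R) l, CD f (x, y) l -> RD (fun t => f (RtoC x + Ci * t)%C) (RtoC y) (l * Ci)%C.
Proof.
  intros f x y l H. eapply deriv_eq; [|eapply (deriv_comp _ f (fun t => RtoC x + Ci * t)%C)].
  2:{ rewrite <- pair_reim. exact H. }
  2:{ eapply deriv_plus; [apply deriv_const|apply deriv_scal, deriv_id]. }
  ring.
Qed.

Lemma cts_hline : forall f x y l, CD f (x, y) l -> cts (fun t => f (t, y)) x.
Proof.
  intros f x y l H. eapply cts_ext; [|eapply RD_cts, RD_hline; exact H].
  intros. simpl. rewrite <- pair_reim. reflexivity.
Qed.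

Lemma cts_vline : forall f x y l, CD f (x, y) l -> cts (fun t => f (x, t)) y.
Proof.
  intros f x y l H. eapply cts_ext; [|eapply RD_cts, RD_vline; exact H].
  intros. simpl. rewrite <- pair_reim. reflexivity.
Qed.

Lemma hol_box_sub : forall f x1 x2 y1 y2 a b c d, hol_box f x1 x2 y1 y2 ->
  x1 <= a -> b <= x2 -> y1 <= c -> d <= y2 -> hol_box f a b c d.
Proof. intros f x1 x2 y1 y2 a b c d H ? ? ? ? x y Hx Hy. apply H; lra. Qed.

Lemma ex_h : forall f x1 x2 y1 y2 a b y, hol_box f x1 x2 y1 y2 -> x1 <= a -> a <= b -> b <= x2 ->
  y1 <= y <= y2 -> ex_CRI (fun x => f (x, y)) a b.
Proof.
  intros f x1 x2 y1 y2 a b y H Ha Hab Hb Hy. apply ex_CRI_cts; auto.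
  intros x Hx. destruct (H x y) as [l Hl]; try lra. eapply cts_hline; eauto.
Qed.

Lemma ex_v : forall f x1 x2 y1 y2 a b x, hol_box f x1 x2 y1 y2 -> y1 <= a -> a <= b -> b <= y2 ->
  x1 <= x <= x2 -> ex_CRI (fun y => f (x, y)) a b.
Proof.
  intros f x1 x2 y1 y2 a b x H Ha Hab Hb Hx. apply ex_CRI_cts; auto.
  intros y Hy. destruct (H x y) as [l Hl]; try lra. eapply cts_vline; eauto.
Qed.

Lemma boxint_split_x : forall f x1 m x2 y1 y2, hol_box f x1 x2 y1 y2 -> x1 <= m <= x2 -> y1 <= y2 ->
  boxint f x1 x2 y1 y2 = (boxint f x1 m y1 y2 + boxint f m x2 y1 y2)%C.
Proof.
  intros f x1 m x2 y1 y2 H Hm Hy. unfold boxint.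
  rewrite <- (CRI_chasles (fun x => f (x, y1)) x1 m x2), <- (CRI_chasles (fun x => f (x, y2)) x1 m x2).
  { ring. }
  all: eapply ex_h; eauto; lra.
Qed.

Lemma boxint_split_y : forall f x1 x2 y1 m y2, hol_box f x1 x2 y1 y2 -> y1 <= m <= y2 -> x1 <= x2 ->
  boxint f x1 x2 y1 y2 = (boxint f x1 x2 y1 m + boxint f x1 x2 m y2)%C.
Proof.
  intros f x1 x2 y1 m y2 H Hm Hy. unfold boxint.
  rewrite <- (CRI_chasles (fun x => f (x1, x)) y1 m y2), <- (CRI_chasles (fun x => f (x2, x)) y1 m y2).
  { ring. }
  all: eapply ex_v; eauto; lra.
Qed.

(** Bounds and linearity of the contour integral use the integrand only on the four sides,
    so that they apply to functions with a pole inside. *)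
Definition on_bd (x1 x2 y1 y2 x y : R) : Prop :=
  x1 <= x <= x2 /\ y1 <= y <= y2 /\ (x = x1 \/ x = x2 \/ y = y1 \/ y = y2).

Definition hol_bd (f : C -> C) (x1 x2 y1 y2 : R) : Prop :=
  forall x y, on_bd x1 x2 y1 y2 x y -> exists l, CD f (x, y) l.

Lemma hol_bd_box : forall f x1 x2 y1 y2, hol_box f x1 x2 y1 y2 -> hol_bd f x1 x2 y1 y2.
Proof. intros f x1 x2 y1 y2 H x y [H1 [H2 _]]. apply H; auto. Qed.

Lemma ex_bd : forall f x1 x2 y1 y2, hol_bd f x1 x2 y1 y2 -> x1 <= x2 -> y1 <= y2 ->
  ex_CRI (fun x => f (x, y1)) x1 x2 /\ ex_CRI (fun x => f (x, y2)) x1 x2 /\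
  ex_CRI (fun y => f (x1, y)) y1 y2 /\ ex_CRI (fun y => f (x2, y)) y1 y2.
Proof.
  intros f x1 x2 y1 y2 H Hx Hy.
  repeat split; apply ex_CRI_cts; auto; intros t Ht.
  - destruct (H t y1) as [l Hl]; [unfold on_bd; lra|]. eapply cts_hline; eauto.
  - destruct (H t y2) as [l Hl]; [unfold on_bd; lra|]. eapply cts_hline; eauto.
  - destruct (H x1 t) as [l Hl]; [unfold on_bd; lra|]. eapply cts_vline; eauto.
  - destruct (H x2 t) as [l Hl]; [unfold on_bd; lra|]. eapply cts_vline; eauto.
Qed.

Lemma boxint_bound : forall f x1 x2 y1 y2 M, hol_bd f x1 x2 y1 y2 -> x1 <= x2 -> y1 <= y2 ->
  (forall x y, on_bd x1 x2 y1 y2 x y -> Cmod (f (x, y)) <= M) ->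
  Cmod (boxint f x1 x2 y1 y2) <= 2 * ((x2 - x1) + (y2 - y1)) * M.
Proof.
  intros f x1 x2 y1 y2 M H Hx Hy HM. unfold boxint.
  destruct (ex_bd _ _ _ _ _ H Hx Hy) as [E1 [E2 [E3 E4]]].
  assert (B1 : Cmod (CRI (fun x => f (x, y1)) x1 x2) <= (x2 - x1) * M)
    by (apply CRI_bound; auto; intros; apply HM; unfold on_bd; lra).
  assert (B2 : Cmod (CRI (fun x => f (x, y2)) x1 x2) <= (x2 - x1) * M)
    by (apply CRI_bound; auto; intros; apply HM; unfold on_bd; lra).
  assert (B3 : Cmod (CRI (fun x => f (x1, x)) y1 y2) <= (y2 - y1) * M)
    by (apply CRI_bound; auto; intros; apply HM; unfold on_bd; lra).
  assert (B4 : Cmod (CRI (fun x => f (x2, x)) y1 y2) <= (y2 - y1) * M)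
    by (apply CRI_bound; auto; intros; apply HM; unfold on_bd; lra).
  eapply Rle_trans; [apply Cmod_triangle_minus|].
  eapply Rle_trans; [apply Rplus_le_compat_r, Cmod_triangle_minus|].
  eapply Rle_trans; [apply Rplus_le_compat_r, Rplus_le_compat_r, Cmod_triangle|].
  rewrite !Cmod_mult, Cmod_Ci. lra.
Qed.

Lemma boxint_minus : forall f g x1 x2 y1 y2, hol_bd f x1 x2 y1 y2 -> hol_bd g x1 x2 y1 y2 ->
  x1 <= x2 -> y1 <= y2 ->
  boxint (fun z => f z - g z)%C x1 x2 y1 y2 = (boxint f x1 x2 y1 y2 - boxint g x1 x2 y1 y2)%C.
Proof.
  intros f g x1 x2 y1 y2 Hf Hg Hx Hy. unfold boxint.
  destruct (ex_bd _ _ _ _ _ Hf Hx Hy) as [E1 [E2 [E3 E4]]].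
  destruct (ex_bd _ _ _ _ _ Hg Hx Hy) as [G1 [G2 [G3 G4]]].
  rewrite !CRI_minus by auto. ring.
Qed.

Lemma boxint_scal : forall f k x1 x2 y1 y2, hol_bd f x1 x2 y1 y2 -> x1 <= x2 -> y1 <= y2 ->
  boxint (fun z => k * f z)%C x1 x2 y1 y2 = (k * boxint f x1 x2 y1 y2)%C.
Proof.
  intros f k x1 x2 y1 y2 Hf Hx Hy. unfold boxint.
  destruct (ex_bd _ _ _ _ _ Hf Hx Hy) as [E1 [E2 [E3 E4]]].
  rewrite !CRI_scal by auto. ring.
Qed.

Lemma boxint_primitive : forall F f x1 x2 y1 y2, x1 <= x2 -> y1 <= y2 ->
  (forall x y, on_bd x1 x2 y1 y2 x y -> CD F (x, y) (f (x, y))) -> hol_bd f x1 x2 y1 y2 ->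
  boxint f x1 x2 y1 y2 = 0%C.
Proof.
  intros F f x1 x2 y1 y2 Hx Hy HF Hf. unfold boxint.
  destruct (ex_bd _ _ _ _ _ Hf Hx Hy) as [E1 [E2 [E3 E4]]].
  assert (Hh : forall y, y = y1 \/ y = y2 -> CRI (fun x => f (x, y)) x1 x2 = (F (x2, y) - F (x1, y))%C).
  { intros y Hyy.
    assert (E : (fun x => f (x, y)) = (fun x => f (RtoC x + Ci * RtoC y)%C))
      by (apply FunctionalExtensionality.functional_extensionality; intros; rewrite pair_reim; auto).
    rewrite E, (CRI_FTC (fun z => F (z + Ci * RtoC y)%C) (fun z => f (z + Ci * RtoC y)%C)); auto.
    - rewrite <- !pair_reim. reflexivity.
    - intros x Hxx. rewrite <- pair_reim. apply RD_hline. apply HF. unfold on_bd. lra.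
    - intros x Hxx. destruct (Hf x y) as [l Hl]; [unfold on_bd; lra|].
      eapply (RD_cts (fun z => f (z + Ci * RtoC y)%C)). apply RD_hline; eauto. }
  assert (Hv : forall x, x = x1 \/ x = x2 -> (Ci * CRI (fun y => f (x, y)) y1 y2 = F (x, y2) - F (x, y1))%C).
  { intros x Hxx. rewrite <- CRI_scal by (destruct Hxx; subst; auto).
    assert (E : (fun y => Ci * f (x, y))%C = (fun y => Ci * f (RtoC x + Ci * RtoC y))%C)
      by (apply FunctionalExtensionality.functional_extensionality; intros; rewrite pair_reim; auto).
    rewrite E, (CRI_FTC (fun z => F (RtoC x + Ci * z)%C) (fun z => Ci * f (RtoC x + Ci * z))%C); auto.
    - rewrite <- !pair_reim. reflexivity.
    - intros y Hyy. rewrite <- pair_reim. rewrite Cmult_comm. apply RD_vline. apply HF. unfold on_bd. lra.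
    - intros y Hyy. destruct (Hf x y) as [l Hl]; [unfold on_bd; lra|].
      eapply (RD_cts (fun z => Ci * f (RtoC x + Ci * z))%C). apply deriv_scal. apply RD_vline; eauto. }
  rewrite !Hh, !Hv by auto. ring.
Qed.

Lemma CD_affine : forall a b c, CD (fun z => a + b * z)%C c b.
Proof.
  intros. eapply deriv_eq; [|apply deriv_plus; [apply deriv_const|apply deriv_scal, deriv_id]]. ring.
Qed.

Lemma boxint_affine : forall a b x1 x2 y1 y2, x1 <= x2 -> y1 <= y2 ->
  boxint (fun z => a + b * z)%C x1 x2 y1 y2 = 0%C.
Proof.
  intros a b x1 x2 y1 y2 Hx Hy.
  set (k := (RtoC (/ 2) * b)%C).
  assert (E : (b = k + k)%C).
  { unfold k. rewrite <- Cmult_plus_distr_r, <- RtoC_plus. replace (/ 2 + / 2) with 1 by lra. ring. }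
  apply (boxint_primitive (fun z => z * (a + k * z))%C); auto.
  - intros x y _. eapply deriv_eq; [|apply deriv_mult; [apply deriv_id|apply CD_affine]].
    rewrite E. ring.
  - intros x y _. eexists. apply CD_affine.
Qed.

Section Bisection.
Variables (f : C -> C) (eta x0 y0 L H : R).

Definition badbox (x y : R) (n : nat) : Prop :=
  eta / 4 ^ n <= Cmod (boxint f x (x + L / 2 ^ n) y (y + H / 2 ^ n)).

(** Of the four quarters of a rectangle, one carries at least a quarter of the integral; only
    lower left corners need to be recorded. *)
Fixpoint bisect (n : nat) : R * R :=
  match n with
  | O => (x0, y0)
  | S m =>
    let (x, y) := bisect m in
    let l := L / 2 ^ n in
    let h := H / 2 ^ n in
    let b u v := Cmod (boxint f u (u + l) v (v + h)) in
    if Rle_dec (eta / 4 ^ n) (b x y) then (x, y)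
    else if Rle_dec (eta / 4 ^ n) (b (x + l) y) then (x + l, y)
    else if Rle_dec (eta / 4 ^ n) (b x (y + h)) then (x, y + h)
    else (x + l, y + h)
  end.

Hypotheses (HL : 0 <= L) (HH : 0 <= H).
Hypothesis Hol : hol_box f x0 (x0 + L) y0 (y0 + H).
Hypothesis Bad : eta <= Cmod (boxint f x0 (x0 + L) y0 (y0 + H)).

Lemma half_nonneg : forall K n, 0 <= K -> 0 <= K / 2 ^ n.
Proof.
  intros. apply Rmult_le_pos; auto. left. apply Rinv_0_lt_compat, pow_lt. lra.
Qed.

Lemma half_S : forall K n, K / 2 ^ n = K / 2 ^ (S n) + K / 2 ^ (S n).
Proof. intros. simpl. field. apply pow_nonzero. lra. Qed.

Lemma bisect_step : forall n, let (x, y) := bisect n in let (x', y') := bisect (S n) in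
  x <= x' /\ x' + L / 2 ^ (S n) <= x + L / 2 ^ n /\ y <= y' /\ y' + H / 2 ^ (S n) <= y + H / 2 ^ n.
Proof.
  intros n. cbn [bisect]. destruct (bisect n) as [x y].
  pose proof (half_nonneg L (S n) HL). pose proof (half_nonneg H (S n) HH).
  pose proof (half_S L n). pose proof (half_S H n).
  set (l := L / 2 ^ (S n)) in *. set (h := H / 2 ^ (S n)) in *.
  set (e := eta / 4 ^ (S n)) in *.
  destruct (Rle_dec e (Cmod (boxint f x (x + l) y (y + h)))); [repeat split; lra|].
  destruct (Rle_dec e (Cmod (boxint f (x + l) (x + l + l) y (y + h)))); [repeat split; lra|].
  destruct (Rle_dec e (Cmod (boxint f x (x + l) (y + h) (y + h + h)))); repeat split; lra.
Qed.

Lemma bisect_in : forall n k,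
  fst (bisect n) <= fst (bisect (n + k)) /\ fst (bisect (n + k)) + L / 2 ^ (n + k) <= fst (bisect n) + L / 2 ^ n /\
  snd (bisect n) <= snd (bisect (n + k)) /\ snd (bisect (n + k)) + H / 2 ^ (n + k) <= snd (bisect n) + H / 2 ^ n.
Proof.
  intros n k. induction k.
  - rewrite Nat.add_0_r. repeat split; lra.
  - rewrite Nat.add_succ_r. pose proof (bisect_step (n + k)) as B.
    destruct IHk as [I1 [I2 [I3 I4]]].
    destruct (bisect (n + k)) as [x y]. destruct (bisect (S (n + k))) as [x' y'].
    destruct B as [B1 [B2 [B3 B4]]].
    cbn [fst snd] in *. repeat split; lra.
Qed.

Lemma bisect_bad : forall n, badbox (fst (bisect n)) (snd (bisect n)) n.
Proof.
  induction n.
  - unfold badbox. simpl. rewrite !Rdiv_1_r. exact Bad.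
  - pose proof (bisect_in 0 n) as [I1 [I2 [I3 I4]]]. simpl in I1, I2, I3, I4.
    rewrite !Rdiv_1_r in I2, I4.
    unfold badbox in *. cbn [bisect]. destruct (bisect n) as [x y].
    cbn [fst snd] in *.
    pose proof (half_nonneg L (S n) HL) as P1. pose proof (half_nonneg H (S n) HH) as P2.
    pose proof (half_S L n) as Q1. pose proof (half_S H n) as Q2.
    assert (Hb : hol_box f x (x + L / 2 ^ n) y (y + H / 2 ^ n)) by (eapply hol_box_sub; eauto).
    set (l := L / 2 ^ (S n)) in *. set (h := H / 2 ^ (S n)) in *.
    set (e := eta / 4 ^ (S n)) in *.
    destruct (Rle_dec e (Cmod (boxint f x (x + l) y (y + h)))) as [|n0]; [assumption|].
    destruct (Rle_dec e (Cmod (boxint f (x + l) (x + l + l) y (y + h)))) as [|n1]; [assumption|].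
    destruct (Rle_dec e (Cmod (boxint f x (x + l) (y + h) (y + h + h)))) as [|n2]; [assumption|].
    apply Rnot_le_lt in n0, n1, n2. cbn [fst snd].
    rewrite (boxint_split_x f x (x + l)) in IHn by (auto; lra).
    rewrite (boxint_split_y f x (x + l) y (y + h)) in IHn by (try (eapply hol_box_sub; eauto); lra).
    rewrite (boxint_split_y f (x + l) _ y (y + h)) in IHn by (try (eapply hol_box_sub; eauto); lra).
    replace (x + L / 2 ^ n) with (x + l + l) in IHn by lra.
    replace (y + H / 2 ^ n) with (y + h + h) in IHn by lra.
    assert (E4 : eta / 4 ^ n = 4 * e) by (unfold e; simpl; field; apply pow_nonzero; lra).
    rewrite E4 in IHn.
    match type of IHn with _ <= Cmod ((?a + ?b) + (?c + ?d))%C =>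
      pose proof (Cmod_triangle (a + b) (c + d)); pose proof (Cmod_triangle a b); pose proof (Cmod_triangle c d) end.
    lra.
Qed.

Lemma bisect_limit : exists a b, forall n,
  fst (bisect n) <= a <= fst (bisect n) + L / 2 ^ n /\ snd (bisect n) <= b <= snd (bisect n) + H / 2 ^ n.
Proof.
  assert (X : forall n m, fst (bisect n) <= fst (bisect m) + L / 2 ^ m /\ snd (bisect n) <= snd (bisect m) + H / 2 ^ m).
  { intros n m. pose proof (half_nonneg L (m + n) HL). pose proof (half_nonneg H (m + n) HH).
    destruct (bisect_in n m) as [? [? [? ?]]]. destruct (bisect_in m n) as [? [? [? ?]]].
    rewrite (Nat.add_comm n m) in *. split; lra. }
  destruct (completeness (fun x => exists n, x = fst (bisect n))) as [a [Ha1 Ha2]].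
  { exists (fst (bisect 0) + L / 2 ^ 0). intros x [n ->]. apply X. }
  { exists (fst (bisect 0)). exists O. auto. }
  destruct (completeness (fun x => exists n, x = snd (bisect n))) as [b [Hb1 Hb2]].
  { exists (snd (bisect 0) + H / 2 ^ 0). intros x [n ->]. apply X. }
  { exists (snd (bisect 0)). exists O. auto. }
  exists a, b. intros n. repeat split.
  - apply Ha1. exists n; auto.
  - apply Ha2. intros x [m ->]. apply X.
  - apply Hb1. exists n; auto.
  - apply Hb2. intros x [m ->]. apply X.
Qed.

(** Close to the common point of the rectangles [f] is affine up to a small multiple of the
    distance.  The affine part integrates to zero, and the rest is too small for the lower
    bound carried by every rectangle unless [eta <= 0]. *)
Lemma bisect_eta : eta <= 0.
Proof.
  destruct bisect_limit as [a [b Hab]].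
  destruct (Hab O) as [Ha0 Hb0]. simpl in Ha0, Hb0. rewrite !Rdiv_1_r in *.
  destruct (Hol a b) as [l Hl]; auto.
  apply Rnot_lt_le. intros He.
  set (D := L + H + 1).
  assert (HD : 1 <= D) by (unfold D; lra).
  assert (P : 0 < eta / (4 * D * D)) by (apply Rdiv_lt_0_compat; nra).
  destruct (Hl _ P) as [d [Hd K]].
  assert (exists n, D / 2 ^ n < d) as [n Hn].
  { destruct (pow_lt_1_zero (/ 2)) with (y := d / D) as [N HN].
    - rewrite Rabs_pos_eq; lra.
    - apply Rdiv_lt_0_compat; lra.
    - exists N. specialize (HN N (Nat.le_refl _)).
      assert (0 < (/ 2) ^ N) by (apply pow_lt; lra).
      rewrite Rabs_pos_eq in HN by lra. rewrite pow_inv in HN.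
      unfold Rdiv. apply Rmult_lt_compat_r with (r := D) in HN; [|lra].
      replace (d / D * D) with d in HN by (field; lra). lra. }
  specialize (Hab n) as [Ha Hb].
  pose proof (bisect_bad n) as Hbad. unfold badbox in Hbad.
  pose proof (bisect_in 0 n) as [I1 [I2 [I3 I4]]]. simpl in I1, I2, I3, I4.
  rewrite !Rdiv_1_r in I2, I4.
  destruct (bisect n) as [x y]. simpl fst in *. simpl snd in *.
  pose proof (half_nonneg L n HL) as P1. pose proof (half_nonneg H n HH) as P2.
  assert (P3 : 0 < / 2 ^ n) by (apply Rinv_0_lt_compat, pow_lt; lra).
  assert (ED : D / 2 ^ n = L / 2 ^ n + H / 2 ^ n + / 2 ^ n) by (unfold D; field; apply pow_nonzero; lra).
  set (g := fun z => ((f (a, b) - l * (a, b)) + l * z)%C).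
  assert (Hb' : hol_box f x (x + L / 2 ^ n) y (y + H / 2 ^ n)) by (eapply hol_box_sub; eauto).
  assert (Hg : hol_bd g x (x + L / 2 ^ n) y (y + H / 2 ^ n))
    by (intros u v _; eexists; apply CD_affine).
  assert (E : boxint f x (x + L / 2 ^ n) y (y + H / 2 ^ n)
     = boxint (fun z => f z - g z)%C x (x + L / 2 ^ n) y (y + H / 2 ^ n)).
  { rewrite boxint_minus; auto; try lra; [|apply hol_bd_box; auto].
    unfold g. rewrite boxint_affine by lra. ring. }
  rewrite E in Hbad.
  assert (B : Cmod (boxint (fun z => f z - g z)%C x (x + L / 2 ^ n) y (y + H / 2 ^ n))
    <= 2 * ((x + L / 2 ^ n - x) + (y + H / 2 ^ n - y)) * (eta / (4 * D * D) * (D / 2 ^ n))).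
  { apply boxint_bound; try lra.
    - intros u v Huv. destruct (hol_bd_box _ _ _ _ _ Hb' u v Huv) as [m Hm].
      eexists. apply deriv_minus; [exact Hm|apply CD_affine].
    - intros u v [Hu [Hv _]].
      assert (Hz : Cmod ((u, v) - (a, b))%C <= L / 2 ^ n + H / 2 ^ n).
      { eapply Rle_trans; [apply Cmod_le_reim|]. simpl.
        assert (Rabs (u + - a) <= L / 2 ^ n) by (apply Rabs_le; lra).
        assert (Rabs (v + - b) <= H / 2 ^ n) by (apply Rabs_le; lra). lra. }
      specialize (K ((u, v) - (a, b))%C I ltac:(lra)).
      unfold g. revert K Hz. generalize ((u, v) : C) ((a, b) : C). intros z c K Hz.
      replace (c + (z - c))%C with z in K by ring.
      replace (f z - (f c - l * c + l * z))%C with (f z - f c - l * (z - c))%C by ring.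
      eapply Rle_trans; [exact K|]. apply Rmult_le_compat_l; lra. }
  assert (B2 : eta / 4 ^ n <= 2 * (D / 2 ^ n) * (eta / (4 * D * D) * (D / 2 ^ n))).
  { eapply Rle_trans; [exact Hbad|]. eapply Rle_trans; [exact B|].
    apply Rmult_le_compat_r; [|lra]. apply Rmult_le_pos; lra. }
  assert (P4 : 0 < 4 ^ n) by (apply pow_lt; lra).
  replace (2 * (D / 2 ^ n) * (eta / (4 * D * D) * (D / 2 ^ n))) with (eta / 4 ^ n / 2) in B2.
  { assert (0 < eta / 4 ^ n) by (apply Rdiv_lt_0_compat; lra). lra. }
  replace (4 ^ n) with (2 ^ n * 2 ^ n) by (rewrite <- Rpow_mult_distr; f_equal; lra).
  field. split; [|lra]. apply pow_nonzero; lra.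
Qed.
End Bisection.

(** Continuity of the derivative is not assumed: the competing continuations in the uniqueness
    argument are only known to be differentiable. *)
Theorem goursat : forall f x1 x2 y1 y2, x1 <= x2 -> y1 <= y2 -> hol_box f x1 x2 y1 y2 ->
  boxint f x1 x2 y1 y2 = 0%C.
Proof.
  intros f x1 x2 y1 y2 Hx Hy Hf. apply Cmod_eq_0. apply Rle_antisym; [|apply Cmod_ge_0].
  apply (bisect_eta f _ x1 y1 (x2 - x1) (y2 - y1)); try lra;
  replace (x1 + (x2 - x1)) with x2 by ring; replace (y1 + (y2 - y1)) with y2 by ring; auto. lra.
Qed.

(** * The integral formula of Cauchy and shifts of lines *)

Definition hol_punct (f : C -> C) (x1 x2 y1 y2 a b : R) : Prop :=
  forall x y, x1 <= x <= x2 -> y1 <= y <= y2 -> (x, y) <> (a, b) -> exists l, CD f (x, y) l.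

Lemma punct_box : forall f x1 x2 y1 y2 a b u1 u2 v1 v2, hol_punct f x1 x2 y1 y2 a b ->
  x1 <= u1 -> u2 <= x2 -> y1 <= v1 -> v2 <= y2 -> (u2 < a \/ a < u1 \/ v2 < b \/ b < v1) ->
  hol_box f u1 u2 v1 v2.
Proof.
  intros f x1 x2 y1 y2 a b u1 u2 v1 v2 H H1 H2 H3 H4 H5 x y Hx Hy.
  apply H; try lra. intros E. injection E as -> ->. lra.
Qed.

(** The rectangle minus the small square is cut into four rectangles avoiding [(a, b)]. *)
Lemma boxint_shrink : forall f x1 x2 y1 y2 a b e, hol_punct f x1 x2 y1 y2 a b -> 0 < e ->
  x1 <= a - e -> a + e <= x2 -> y1 <= b - e -> b + e <= y2 ->
  boxint f x1 x2 y1 y2 = boxint f (a - e) (a + e) (b - e) (b + e).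
Proof.
  intros f x1 x2 y1 y2 a b e H He H1 H2 H3 H4.
  assert (X : forall y u v, y1 <= y <= y2 -> y < b \/ b < y -> x1 <= u -> u <= v -> v <= x2 ->
    ex_CRI (fun x => f (x, y)) u v).
  { intros y u v Hy Hb Hu Huv Hv. apply (ex_h f x1 x2 y y); try lra.
    eapply punct_box; eauto; lra. }
  assert (Y : forall x u v, x1 <= x <= x2 -> x < a \/ a < x -> y1 <= u -> u <= v -> v <= y2 ->
    ex_CRI (fun y => f (x, y)) u v).
  { intros x u v Hx Ha Hu Huv Hv. apply (ex_v f x x y1 y2); try lra.
    eapply punct_box; eauto; lra. }
  assert (Z : forall u1 u2 v1 v2, x1 <= u1 -> u1 <= u2 -> u2 <= x2 -> y1 <= v1 -> v1 <= v2 -> v2 <= y2 ->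
     (u2 < a \/ a < u1 \/ v2 < b \/ b < v1) -> boxint f u1 u2 v1 v2 = 0%C).
  { intros. apply goursat; auto. eapply punct_box; eauto. }
  pose proof (Z x1 (a - e) y1 y2 ltac:(lra) ltac:(lra) ltac:(lra) ltac:(lra) ltac:(lra) ltac:(lra) ltac:(lra)) as Z1.
  pose proof (Z (a + e) x2 y1 y2 ltac:(lra) ltac:(lra) ltac:(lra) ltac:(lra) ltac:(lra) ltac:(lra) ltac:(lra)) as Z2.
  pose proof (Z (a - e) (a + e) y1 (b - e) ltac:(lra) ltac:(lra) ltac:(lra) ltac:(lra) ltac:(lra) ltac:(lra) ltac:(lra)) as Z3.
  pose proof (Z (a - e) (a + e) (b + e) y2 ltac:(lra) ltac:(lra) ltac:(lra) ltac:(lra) ltac:(lra) ltac:(lra) ltac:(lra)) as Z4.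
  unfold boxint in *.
  rewrite <- (CRI_chasles (fun x => f (x, y1)) x1 (a - e) x2) by (apply X; lra).
  rewrite <- (CRI_chasles (fun x => f (x, y1)) (a - e) (a + e) x2) by (apply X; lra).
  rewrite <- (CRI_chasles (fun x => f (x, y2)) x1 (a - e) x2) by (apply X; lra).
  rewrite <- (CRI_chasles (fun x => f (x, y2)) (a - e) (a + e) x2) by (apply X; lra).
  rewrite <- (CRI_chasles (fun y => f (a - e, y)) y1 (b - e) y2) in Z1 by (apply Y; lra).
  rewrite <- (CRI_chasles (fun y => f (a - e, y)) (b - e) (b + e) y2) in Z1 by (apply Y; lra).
  rewrite <- (CRI_chasles (fun y => f (a + e, y)) y1 (b - e) y2) in Z2 by (apply Y; lra).
  rewrite <- (CRI_chasles (fun y => f (a + e, y)) (b - e) (b + e) y2) in Z2 by (apply Y; lra).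
  match type of Z1 with ?z1 = _ => match type of Z2 with ?z2 = _ => match type of Z3 with ?z3 = _ =>
  match type of Z4 with ?z4 = _ =>
  match goal with |- ?l = ?r => change (@eq C l r); transitivity (r + z1 + z2 + z3 + z4)%C;
    [ring | rewrite Z1, Z2, Z3, Z4; ring] end end end end end.
Qed.

Lemma is_CRI_RtoC : forall (g : R -> R) a b l, is_RInt g a b l -> is_CRI (fun t => RtoC (g t)) a b (RtoC l).
Proof.
  intros g a b l H. apply (is_RInt_fct_extend_pair (U := R_NormedModule) (V := R_NormedModule)); simpl; auto.
  pose proof (is_RInt_const (V := R_NormedModule) a b 0) as K.
  change (scal (b - a) 0) with ((b - a) * 0) in K. rewrite Rmult_0_r in K. exact K.
Qed.

Lemma is_RInt_poisson : forall a e, 0 < e ->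
  is_RInt (fun x => 2 * e / ((x - a) * (x - a) + e * e)) (a - e) (a + e) PI.
Proof.
  intros a e He.
  assert (P : forall x, 0 < (x - a) * (x - a) + e * e) by (intros x; pose proof (Rle_0_sqr (x - a)); unfold Rsqr in *; nra).
  replace PI with (2 * atan ((a + e - a) / e) - 2 * atan ((a - e - a) / e)).
  - apply (is_RInt_derive (V := R_CompleteNormedModule) (fun x => 2 * atan ((x - a) / e))).
    + intros x _. auto_derive; [lra|]. unfold Rsqr. specialize (P x). field. repeat split; try lra; nra.
    + intros x _. apply (ex_derive_continuous (V := R_NormedModule)). auto_derive. specialize (P x).
      unfold Rminus in P. lra.
  - replace ((a + e - a) / e) with 1 by (field; lra). replace ((a - e - a) / e) with (- (1)) by (field; lra).
    rewrite atan_opp, atan_1. field.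
Qed.

Lemma pair_minus : forall x y a b : R, ((x, y) - (a, b))%C = (x - a, y - b).
Proof. reflexivity. Qed.

Lemma sub_neq_0 : forall z w : C, z <> w -> (z - w)%C <> 0%C.
Proof. intros z w H E. apply H. replace z with (z - w + w)%C by ring. rewrite E. ring. Qed.

Lemma CD_inv_sub : forall z w : C, z <> w -> exists l, CD (fun z => / (z - w))%C z l.
Proof.
  intros z w H. eexists. eapply (deriv_comp _ (fun u => / u)%C (fun z => z - w)%C).
  - apply CD_inv. apply sub_neq_0; auto.
  - apply deriv_minus; [apply deriv_id|apply deriv_const].
Qed.

Lemma sq_sum_pos : forall t e : R, 0 < e -> 0 < t * t + e * e.
Proof. intros t e He. pose proof (Rle_0_sqr t). unfold Rsqr in *. nra. Qed.

(** At opposite points of the square the values of [1 / z] differ by a multiple of the Poisson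
    kernel, whose primitive is an arctangent. *)
Lemma poisson_h : forall t e : R, 0 < e ->
  (/ (t, (- e)%R) - / (t, e) = Ci * RtoC (2 * e / (t * t + e * e)))%C.
Proof.
  intros t e He. pose proof (sq_sum_pos t e He).
  apply C_ext; simpl; field; repeat split; apply Rgt_not_eq; lra.
Qed.

Lemma poisson_v : forall t e : R, 0 < e ->
  (/ (e, t) - / ((- e)%R, t) = RtoC (2 * e / (t * t + e * e)))%C.
Proof.
  intros t e He. pose proof (sq_sum_pos t e He).
  apply C_ext; simpl; field; repeat split; apply Rgt_not_eq; lra.
Qed.

Lemma boxint_inv_square : forall a b e, 0 < e ->
  boxint (fun z => / (z - (a, b)))%C (a - e) (a + e) (b - e) (b + e) = (2 * PI * Ci)%C.
Proof.
  intros a b e He.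
  assert (Hbd : hol_bd (fun z => / (z - (a, b)))%C (a - e) (a + e) (b - e) (b + e)).
  { intros x y Hxy. apply CD_inv_sub. intros E. injection E as -> ->. unfold on_bd in Hxy. lra. }
  destruct (ex_bd _ _ _ _ _ Hbd ltac:(lra) ltac:(lra)) as [E1 [E2 [E3 E4]]].
  unfold boxint.
  assert (H1 : (CRI (fun x => / ((x, (b - e)%R) - (a, b)))%C (a - e) (a + e)
     - CRI (fun x => / ((x, (b + e)%R) - (a, b)))%C (a - e) (a + e) = Ci * PI)%C).
  { rewrite <- CRI_minus by auto.
    rewrite (CRI_ext _ (fun x => Ci * RtoC (2 * e / ((x - a) * (x - a) + e * e)))%C) by
     (try lra; intros x _; rewrite !pair_minus;
       replace (b - e - b) with (- e) by ring; replace (b + e - b) with e by ring; apply poisson_h; auto).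
    apply (is_RInt_unique (V := C_R_CompleteNormedModule)). apply is_CRI_scal, is_CRI_RtoC, is_RInt_poisson. auto. }
  assert (H2 : (CRI (fun y => / (((a + e)%R, y) - (a, b)))%C (b - e) (b + e)
     - CRI (fun y => / (((a - e)%R, y) - (a, b)))%C (b - e) (b + e) = PI)%C).
  { rewrite <- CRI_minus by auto.
    rewrite (CRI_ext _ (fun x => RtoC (2 * e / ((x - b) * (x - b) + e * e)))%C) by
     (try lra; intros x _; rewrite !pair_minus;
       replace (a - e - a) with (- e) by ring; replace (a + e - a) with e by ring; apply poisson_v; auto).
    apply (is_RInt_unique (V := C_R_CompleteNormedModule)). apply is_CRI_RtoC, is_RInt_poisson. auto. }
  match goal with |- (?a1 + Ci * ?a2 - ?a3 - Ci * ?a4 = _)%C =>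
    replace (a1 + Ci * a2 - a3 - Ci * a4)%C with ((a1 - a3) + Ci * (a2 - a4))%C by ring end.
  rewrite H1, H2. ring.
Qed.

(** The difference quotient is bounded near [(a, b)], so its integral over a shrinking square
    vanishes; what remains is the integral of [1 / (z - (a, b))]. *)
Theorem cauchy_formula : forall f x1 x2 y1 y2 a b, hol_box f x1 x2 y1 y2 -> x1 < a < x2 -> y1 < b < y2 ->
  boxint (fun z => f z * / (z - (a, b)))%C x1 x2 y1 y2 = (2 * PI * Ci * f (a, b))%C.
Proof.
  intros f x1 x2 y1 y2 a b H Ha Hb.
  set (w0 := (a, b) : C).
  set (q := fun z => ((f z - f w0) * / (z - w0))%C).
  assert (Hq : hol_punct q x1 x2 y1 y2 a b).
  { intros x y Hx Hy Hne. destruct (H x y Hx Hy) as [l Hl]. destruct (CD_inv_sub (x, y) w0 Hne) as [m Hm].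
    eexists. apply deriv_mult; [|exact Hm]. apply deriv_minus; [exact Hl|apply deriv_const]. }
  assert (Hi : hol_punct (fun z => / (z - w0))%C x1 x2 y1 y2 a b).
  { intros x y Hx Hy Hne. apply CD_inv_sub. auto. }
  assert (N : forall x y, on_bd x1 x2 y1 y2 x y -> (x, y) <> w0).
  { intros x y Hxy E. injection E as -> ->. unfold on_bd in Hxy. lra. }
  assert (Eq : boxint q x1 x2 y1 y2 = 0%C).
  { destruct (H a b) as [l Hl]; try lra. destruct (deriv_lip _ _ _ _ Hl) as [d [Hd K]].
    apply C_eq_eps. intros eps Heps. pose proof (Cmod_ge_0 l).
    set (r := Rmin (Rmin (a - x1) (x2 - a)) (Rmin (b - y1) (y2 - b))).
    assert (Hr : 0 < r) by (unfold r; repeat apply Rmin_pos; lra).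
    assert (Hr1 : r <= a - x1 /\ r <= x2 - a /\ r <= b - y1 /\ r <= y2 - b).
    { unfold r. repeat split.
      - eapply Rle_trans; [apply Rmin_l|apply Rmin_l].
      - eapply Rle_trans; [apply Rmin_l|apply Rmin_r].
      - eapply Rle_trans; [apply Rmin_r|apply Rmin_l].
      - eapply Rle_trans; [apply Rmin_r|apply Rmin_r]. }
    assert (P : 0 < eps / (8 * (Cmod l + 1))) by (apply Rdiv_lt_0_compat; lra).
    set (e := Rmin r (Rmin (d / 3) (eps / (8 * (Cmod l + 1))))).
    assert (He : 0 < e) by (unfold e; repeat apply Rmin_pos; lra).
    assert (He1 : e <= r) by apply Rmin_l.
    assert (He2 : e <= d / 3) by (unfold e; eapply Rle_trans; [apply Rmin_r|apply Rmin_l]).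
    assert (He3 : e <= eps / (8 * (Cmod l + 1))) by (unfold e; eapply Rle_trans; [apply Rmin_r|apply Rmin_r]).
    rewrite (boxint_shrink q x1 x2 y1 y2 a b e) by (auto; lra).
    replace (boxint q (a - e) (a + e) (b - e) (b + e) - 0)%C with (boxint q (a - e) (a + e) (b - e) (b + e)) by ring.
    eapply Rle_trans.
    - apply boxint_bound with (M := Cmod l + 1); try lra.
      + intros x y [Hx [Hy Hxy]]. apply Hq; try lra. intros E. injection E as -> ->. lra.
      + intros x y [Hx [Hy Hxy]].
        assert (Hne : ((x, y) : C) <> w0) by (intros E; injection E as -> ->; lra).
        pose proof (sub_neq_0 _ _ Hne) as Hne'.
        assert (Hlt : Cmod ((x, y) - w0)%C < d).
        { eapply Rle_lt_trans; [apply Cmod_le_reim|]. unfold w0. simpl.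
          assert (Rabs (x + - a) <= e) by (apply Rabs_le; lra).
          assert (Rabs (y + - b) <= e) by (apply Rabs_le; lra). lra. }
        specialize (K _ I Hlt). unfold q. fold w0 in K. revert K Hne'. generalize ((x, y) : C). intros z K Hne'.
        replace (w0 + (z - w0))%C with z in K by ring.
        rewrite Cmod_mult, Cmod_inv by auto. apply Cmod_gt_0 in Hne'.
        apply Rmult_le_reg_r with (Cmod (z - w0)); auto. rewrite Rmult_assoc, Rinv_l by lra. lra.
    - apply Rle_trans with (8 * e * (Cmod l + 1)); [nra|].
      apply Rle_trans with (8 * (eps / (8 * (Cmod l + 1))) * (Cmod l + 1)).
      + apply Rmult_le_compat_r; lra.
      + apply Req_le. field. lra. }
  set (r := Rmin (Rmin (a - x1) (x2 - a)) (Rmin (b - y1) (y2 - b))).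
  assert (Hr : 0 < r) by (unfold r; repeat apply Rmin_pos; lra).
  assert (Hr1 : r <= a - x1 /\ r <= x2 - a /\ r <= b - y1 /\ r <= y2 - b).
  { unfold r. repeat split.
      - eapply Rle_trans; [apply Rmin_l|apply Rmin_l].
      - eapply Rle_trans; [apply Rmin_l|apply Rmin_r].
      - eapply Rle_trans; [apply Rmin_r|apply Rmin_l].
      - eapply Rle_trans; [apply Rmin_r|apply Rmin_r]. }
  assert (Ei : boxint (fun z => / (z - w0))%C x1 x2 y1 y2 = (2 * PI * Ci)%C).
  { rewrite (boxint_shrink _ x1 x2 y1 y2 a b r) by (auto; lra). apply boxint_inv_square; auto. }
  assert (Hfi : hol_bd (fun z => f z * / (z - w0))%C x1 x2 y1 y2).
  { intros x y Hxy. destruct (H x y (proj1 Hxy) (proj1 (proj2 Hxy))) as [l Hl].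
    destruct (CD_inv_sub (x, y) w0 (N x y Hxy)) as [m Hm].
    eexists. apply deriv_mult; [exact Hl|exact Hm]. }
  assert (Hii : hol_bd (fun z => / (z - w0))%C x1 x2 y1 y2).
  { intros x y Hxy. apply CD_inv_sub. auto. }
  assert (Hii2 : hol_bd (fun z => f w0 * / (z - w0))%C x1 x2 y1 y2).
  { intros x y Hxy. destruct (Hii x y Hxy) as [m Hm]. eexists. apply deriv_scal. exact Hm. }
  assert (E : boxint q x1 x2 y1 y2 = (boxint (fun z => f z * / (z - w0)) x1 x2 y1 y2
     - f w0 * boxint (fun z => / (z - w0)) x1 x2 y1 y2)%C).
  { rewrite <- boxint_scal by (auto; lra). rewrite <- boxint_minus by (auto; lra).
    f_equal. apply FunctionalExtensionality.functional_extensionality. intros z. unfold q. ring. }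
  rewrite Eq, Ei in E.
  match goal with |- ?l = _ => replace l with (l - f w0 * (2 * PI * Ci) + f w0 * (2 * PI * Ci))%C by ring end.
  rewrite <- E. unfold w0. ring.
Qed.

(** The vertical sides of long rectangles contribute nothing in the limit. *)
Lemma RI_box_limit : forall g t1 t2 K v, t1 <= t2 -> dom (fun x => g (x, t1)) K -> dom (fun x => g (x, t2)) K ->
  (forall x t, 1 <= Rabs x -> t1 <= t <= t2 -> exists l, CD g (x, t) l) ->
  (forall x t, 1 <= Rabs x -> t1 <= t <= t2 -> Cmod (g (x, t)) <= K * wt x) ->
  (forall n, 1 <= n -> boxint g (- n) n t1 t2 = v) ->
  (RI (fun x => g (x, t1)) - RI (fun x => g (x, t2)) = v)%C.
Proof.
  intros g t1 t2 K v Ht D1 D2 Hg HK Hbox.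
  pose proof (dom_K_nonneg _ _ D1) as HK0.
  apply C_eq_eps. intros eps He.
  destruct (RI_trunc_dom _ _ D1 (eps / 4)) as [A1 [HA1 K1]]; [lra|].
  destruct (RI_trunc_dom _ _ D2 (eps / 4)) as [A2 [HA2 K2]]; [lra|].
  set (T := t2 - t1 + 1).
  destruct (wt_small (eps / (4 * T * (K + 1)))) as [B [HB HW]].
  { apply Rdiv_lt_0_compat; [lra|]. unfold T. nra. }
  set (n := A1 + A2 + B + 1).
  specialize (K1 n n ltac:(unfold n; lra) ltac:(unfold n; lra)).
  specialize (K2 n n ltac:(unfold n; lra) ltac:(unfold n; lra)).
  pose proof (Hbox n ltac:(unfold n; lra)) as G. unfold boxint in G.
  assert (S : forall x, B < Rabs x -> 1 <= Rabs x -> Cmod (CRI (fun y => g (x, y)) t1 t2) <= eps / 4).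
  { intros x Hx Hx1. apply Rle_trans with ((t2 - t1) * (K * wt x)).
    - apply CRI_bound; auto. apply ex_CRI_cts; auto. intros y Hy. destruct (Hg x y Hx1 Hy) as [l Hl].
      eapply cts_vline; eauto.
    - specialize (HW x Hx). pose proof (wt_pos x).
      apply Rle_trans with (T * ((K + 1) * (eps / (4 * T * (K + 1))))).
      + apply Rmult_le_compat; unfold T in *; try lra; [nra|]. apply Rmult_le_compat; lra.
      + apply Req_le. field. unfold T. lra. }
  pose proof (S n ltac:(rewrite Rabs_pos_eq; unfold n; lra) ltac:(rewrite Rabs_pos_eq; unfold n; lra)) as S1.
  pose proof (S (- n) ltac:(rewrite Rabs_Ropp, Rabs_pos_eq; unfold n; lra) ltac:(rewrite Rabs_Ropp, Rabs_pos_eq; unfold n; lra)) as S2.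
  revert G K1 K2 S1 S2.
  generalize (CRI (fun x => g (x, t1)) (- n) n) (CRI (fun x => g (x, t2)) (- n) n)
   (CRI (fun y => g (n, y)) t1 t2) (CRI (fun y => g (- n, y)) t1 t2)
   (RI (fun x => g (x, t1))) (RI (fun x => g (x, t2))).
  intros a b c d I1 I2 G K1 K2 S1 S2.
  replace (I1 - I2 - v)%C with ((b - I2) - (a - I1) - Ci * c + Ci * d)%C by (rewrite <- G; ring).
  eapply Rle_trans; [apply Cmod_triangle|].
  eapply Rle_trans; [apply Rplus_le_compat_r, Cmod_triangle_minus|].
  eapply Rle_trans; [apply Rplus_le_compat_r, Rplus_le_compat_r, Cmod_triangle_minus|].
  rewrite !Cmod_mult, Cmod_Ci. lra.
Qed.

Lemma RI_strip_shift : forall g t1 t2 K, t1 <= t2 ->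
  (forall x t, t1 <= t <= t2 -> exists l, CD g (x, t) l) ->
  (forall x t, t1 <= t <= t2 -> Cmod (g (x, t)) <= K * wt x) ->
  RI (fun x => g (x, t1)) = RI (fun x => g (x, t2)).
Proof.
  intros g t1 t2 K Ht Hg HK.
  assert (D : forall t, t1 <= t <= t2 -> dom (fun x => g (x, t)) K).
  { intros t Htt. split; [|intros; apply HK; auto]. intros x. destruct (Hg x t Htt) as [l Hl].
    eapply cts_hline; eauto. }
  assert (E : (RI (fun x => g (x, t1)) - RI (fun x => g (x, t2)) = 0)%C).
  { apply (RI_box_limit g t1 t2 K); auto; try (apply D; lra).
    intros n Hn. apply goursat; auto; [lra|]. intros x y _ Hy. apply Hg; auto. }
  replace (RI (fun x => g (x, t1))) with ((RI (fun x => g (x, t1)) - RI (fun x => g (x, t2))) + RI (fun x => g (x, t2)))%C by ring.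
  rewrite E. ring.
Qed.

(** * The identity theorem along a segment *)

Lemma cts_bounded : forall f a b, a <= b -> (forall x, a <= x <= b -> cts f x) ->
  exists M, 0 <= M /\ forall x, a <= x <= b -> Cmod (f x) <= M.
Proof.
  intros f a b Hab H.
  destruct (continuity_ab_maj (fun x => Cmod (f x)) a b Hab) as [m [Hm _]].
  - intros x Hx eps He. destruct (H x Hx eps He) as [d [Hd K]]. exists d. split; auto.
    intros y [_ Hy]. simpl in *. unfold R_dist in *. specialize (K y Hy).
    eapply Rle_lt_trans; [|exact K]. apply Rabs_le.
    pose proof (Cmod_triangle_rev (f y) (f x - f y)). pose proof (Cmod_triangle_rev (f x) (f y - f x)).
    rewrite (Cmod_minus_sym (f x) (f y)) in H0.
    replace (f y + (f x - f y))%C with (f x) in H0 by ring.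
    replace (f x + (f y - f x))%C with (f y) in H1 by ring.
    pose proof (Cmod_triangle (f x) (f y - f x)). pose proof (Cmod_triangle (f y) (f x - f y)).
    rewrite (Cmod_minus_sym (f x) (f y)) in H3.
    replace (f y + (f x - f y))%C with (f x) in H3 by ring.
    replace (f x + (f y - f x))%C with (f y) in H2 by ring. lra.
  - exists (Cmod (f m)). split; [apply Cmod_ge_0|]. auto.
Qed.

Lemma bd_bounded : forall f x1 x2 y1 y2, x1 <= x2 -> y1 <= y2 -> hol_bd f x1 x2 y1 y2 ->
  exists M, 0 <= M /\ forall x y, on_bd x1 x2 y1 y2 x y -> Cmod (f (x, y)) <= M.
Proof.
  intros f x1 x2 y1 y2 Hx Hy H.
  destruct (cts_bounded (fun x => f (x, y1)) x1 x2 Hx) as [M1 [P1 Q1]].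
  { intros t Ht. destruct (H t y1) as [l Hl]; [unfold on_bd; lra|]. eapply cts_hline; eauto. }
  destruct (cts_bounded (fun x => f (x, y2)) x1 x2 Hx) as [M2 [P2 Q2]].
  { intros t Ht. destruct (H t y2) as [l Hl]; [unfold on_bd; lra|]. eapply cts_hline; eauto. }
  destruct (cts_bounded (fun x => f (x1, x)) y1 y2 Hy) as [M3 [P3 Q3]].
  { intros t Ht. destruct (H x1 t) as [l Hl]; [unfold on_bd; lra|]. eapply cts_vline; eauto. }
  destruct (cts_bounded (fun x => f (x2, x)) y1 y2 Hy) as [M4 [P4 Q4]].
  { intros t Ht. destruct (H x2 t) as [l Hl]; [unfold on_bd; lra|]. eapply cts_vline; eauto. }
  exists (M1 + M2 + M3 + M4). split; [lra|].
  intros x y [Hxx [Hyy [E|[E|[E|E]]]]]; subst.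
  - specialize (Q3 y Hyy). lra.
  - specialize (Q4 y Hyy). lra.
  - specialize (Q1 x Hxx). lra.
  - specialize (Q2 x Hxx). lra.
Qed.

Lemma CD_pow_inv : forall (a z : C) n, z <> a -> exists l, CD (fun z => / (z - a) ^ n)%C z l.
Proof.
  intros a z n H. induction n.
  - exists 0%C. apply (deriv_ext _ (fun _ => / 1)%C); [reflexivity|apply deriv_const].
  - destruct IHn as [l Hl]. destruct (CD_inv_sub z a H) as [m Hm].
    pose proof (sub_neq_0 _ _ H) as Hn. eexists.
    eapply (deriv_ext_loc _ (fun z => / (z - a) * / (z - a) ^ n)%C _ _ _ (Cmod (z - a))).
    + apply Cmod_gt_0; auto.
    + intros h Hh. simpl.
      assert ((z + h - a)%C <> 0%C).
      { apply Cmod_gt_0. pose proof (Cmod_triangle_rev (z - a) h).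
        replace (z - a + h)%C with (z + h - a)%C in H0 by ring. lra. }
      field. split; auto. apply Cpow_nz. auto.
    + apply deriv_mult; eauto.
Qed.

(** Divided by any power of [z - a], a function vanishing near [a] stays holomorphic.  On a
    contour around [w] with [|z - a| >= 3 r / 8], Cauchy's formula bounds the quotient; as
    [|w - a| < r / 8], this makes [g w] at most a constant times [(1 / 3)^n] for every [n]. *)
Lemma vanish_spread : forall (g : C -> C) (a : C) r rho, 0 < r -> 0 < rho ->
  (forall z, Cmod (z - a) < r -> exists l, CD g z l) ->
  (forall z, Cmod (z - a) < rho -> g z = 0%C) ->
  forall w, Cmod (w - a) < r / 8 -> g w = 0%C.
Proof.
  intros g a r rho Hr Hrho Hg H0 [u v] Hw.
  set (w := (u, v) : C) in *.
  set (s := r / 2).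
  assert (Hin : forall x y, u - s <= x <= u + s -> v - s <= y <= v + s -> Cmod ((x, y) - w)%C <= 3 / 4 * r).
  { intros x y Hx Hy. apply Cmod_le_sqr; [lra|]. simpl. unfold s in *. nra. }
  assert (Hdist : forall x y, on_bd (u - s) (u + s) (v - s) (v + s) x y -> s <= Cmod ((x, y) - w)%C).
  { intros x y [Hx [Hy [E|[E|[E|E]]]]]; subst.
    - eapply Rle_trans; [|apply re_le_Cmod]. simpl. rewrite Rabs_left1; unfold s in *; lra.
    - eapply Rle_trans; [|apply re_le_Cmod]. simpl. rewrite Rabs_right; unfold s in *; lra.
    - eapply Rle_trans; [|apply im_le_Cmod]. simpl. rewrite Rabs_left1; unfold s in *; lra.
    - eapply Rle_trans; [|apply im_le_Cmod]. simpl. rewrite Rabs_right; unfold s in *; lra. }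
  assert (Hgb : hol_box g (u - s) (u + s) (v - s) (v + s)).
  { intros x y Hx Hy. apply Hg. replace ((x, y) - a)%C with (((x, y) - w) + (w - a))%C.
    - eapply Rle_lt_trans; [apply Cmod_triangle|]. specialize (Hin x y Hx Hy). lra.
    - generalize ((x, y) : C). intros. ring. }
  assert (Hs : 0 < s) by (unfold s; lra).
  destruct (bd_bounded g (u - s) (u + s) (v - s) (v + s)) as [M [HM HMb]]; try lra.
  { apply hol_bd_box; auto. }
  set (c := 3 / 8 * r).
  assert (Hc : 0 < c) by (unfold c; lra).
  assert (Hdist2 : forall x y, on_bd (u - s) (u + s) (v - s) (v + s) x y -> c <= Cmod ((x, y) - a)%C).
  { intros x y Hxy. specialize (Hdist x y Hxy).
    pose proof (Cmod_triangle_rev ((x, y) - w) (w - a)) as T.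
    replace (((x, y) - w) + (w - a))%C with ((x, y) - a)%C in T.
    - unfold c, s in *. lra.
    - generalize ((x, y) : C). intros. ring. }
  set (K := 2 * ((u + s - (u - s)) + (v + s - (v - s))) * M * / s).
  assert (HK : 0 <= K).
  { unfold K. apply Rmult_le_pos; [nra|]. left. apply Rinv_0_lt_compat; auto. }
  assert (Main : forall n, Cmod (g w) <= K * (1 / 3) ^ n).
  { intros n. set (h := fun z => (g z * / (z - a) ^ n)%C).
    assert (Hh : forall z, Cmod (z - a) < r -> exists l, CD h z l).
    { intros z Hz. destruct (Rlt_dec (Cmod (z - a)) rho) as [Hlt|Hge].
      - exists 0%C. apply (deriv_ext_loc _ (fun _ => 0%C) _ _ _ (rho - Cmod (z - a))); [lra| |apply deriv_const].
        intros k Hk. unfold h. rewrite H0; [ring|].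
        replace (z + k - a)%C with ((z - a) + k)%C by ring.
        eapply Rle_lt_trans; [apply Cmod_triangle|]. lra.
      - destruct (Hg z Hz) as [l Hl]. destruct (CD_pow_inv a z n) as [m Hm].
        + intros E. subst. apply Hge. unfold Cminus. rewrite Cplus_opp_r, Cmod_0. auto.
        + eexists. apply deriv_mult; eauto. }
    assert (Hhb : hol_box h (u - s) (u + s) (v - s) (v + s)).
    { intros x y Hx Hy. apply Hh. replace ((x, y) - a)%C with (((x, y) - w) + (w - a))%C.
      - eapply Rle_lt_trans; [apply Cmod_triangle|]. specialize (Hin x y Hx Hy). lra.
      - generalize ((x, y) : C). intros. ring. }
    pose proof (cauchy_formula h (u - s) (u + s) (v - s) (v + s) u v Hhb ltac:(lra) ltac:(lra)) as CF.
    fold w in CF.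
    assert (Bd : Cmod (boxint (fun z => h z * / (z - w))%C (u - s) (u + s) (v - s) (v + s)) <= K * (/ c) ^ n).
    { eapply Rle_trans; [apply boxint_bound with (M := M * (/ c) ^ n * / s); try lra|].
      - intros x y Hxy. destruct (hol_bd_box _ _ _ _ _ Hhb x y Hxy) as [l Hl].
        destruct (CD_inv_sub (x, y) w) as [m Hm].
        + intros E. specialize (Hdist x y Hxy). rewrite E in Hdist. unfold Cminus in Hdist.
          rewrite Cplus_opp_r, Cmod_0 in Hdist. lra.
        + eexists. apply deriv_mult; eauto.
      - intros x y Hxy. specialize (Hdist x y Hxy). specialize (Hdist2 x y Hxy). specialize (HMb x y Hxy).
        unfold h. revert Hdist Hdist2 HMb. generalize ((x, y) : C). intros z D1 D2 D3.
        rewrite !Cmod_mult. rewrite !Cmod_inv, Cmod_pow.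
        2:{ apply Cmod_gt_0. lra. }
        2:{ apply Cpow_nz. apply Cmod_gt_0. lra. }
        rewrite <- pow_inv.
        assert (0 <= / Cmod (z - a)) by (left; apply Rinv_0_lt_compat; lra).
        assert (/ Cmod (z - a) <= / c) by (apply Rinv_le_contravar; lra).
        assert (0 <= / Cmod (z - w)) by (left; apply Rinv_0_lt_compat; lra).
        assert (/ Cmod (z - w) <= / s) by (apply Rinv_le_contravar; lra).
        assert (0 <= (/ Cmod (z - a)) ^ n) by (apply pow_le; auto).
        assert ((/ Cmod (z - a)) ^ n <= (/ c) ^ n) by (apply pow_incr; auto).
        pose proof (Cmod_ge_0 (g z)).
        apply Rmult_le_compat; auto; [apply Rmult_le_pos; auto|]. apply Rmult_le_compat; auto.
      - apply Req_le. unfold K. field. lra. }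
    rewrite CF in Bd.
    assert (Bh : Cmod (h w) <= K * (/ c) ^ n).
    { eapply Rle_trans; [|exact Bd]. rewrite !Cmod_mult, Cmod_Ci, !Cmod_R.
      pose proof PI2_1. rewrite !Rabs_pos_eq by lra. pose proof (Cmod_ge_0 (h w)). nra. }
    destruct (Ceq_dec w a) as [E|E].
    { rewrite H0. - rewrite Cmod_0. apply Rmult_le_pos; auto. apply pow_le; lra.
      - rewrite E. unfold Cminus. rewrite Cplus_opp_r, Cmod_0. auto. }
    pose proof (sub_neq_0 _ _ E) as Hn.
    assert (Eg : g w = (h w * (w - a) ^ n)%C) by (unfold h; field; apply Cpow_nz; auto).
    rewrite Eg, Cmod_mult, Cmod_pow.
    apply Rle_trans with (K * (/ c) ^ n * (r / 8) ^ n).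
    - apply Rmult_le_compat; try apply Cmod_ge_0; auto.
      + apply pow_le, Cmod_ge_0.
      + apply pow_incr. split; [apply Cmod_ge_0|lra].
    - rewrite Rmult_assoc, <- Rpow_mult_distr. apply Req_le. f_equal. f_equal. unfold c. field. lra. }
  apply Cmod_eq_0. apply Rle_antisym; [|apply Cmod_ge_0]. apply Cmod_le_eps. intros eps He. rewrite Rplus_0_l.
  destruct (pow_lt_1_zero (1 / 3)) with (y := eps / (K + 1)) as [N HN].
  - rewrite Rabs_pos_eq; lra.
  - apply Rdiv_lt_0_compat; lra.
  - specialize (HN N (Nat.le_refl _)). specialize (Main N).
    assert (0 < (1 / 3) ^ N) by (apply pow_lt; lra). rewrite Rabs_pos_eq in HN by lra.
    eapply Rle_trans; [exact Main|]. apply Rle_trans with ((K + 1) * (eps / (K + 1))).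
    + apply Rmult_le_compat; lra.
    + apply Req_le. field. lra.
Qed.

(** Discs of radius [r / 16] along the segment are reached one after the other by
    [vanish_spread], starting from the disc where [g] is known to vanish. *)
Theorem identity_segment : forall (g : C -> C) r, 0 < r ->
  (forall (t : R) (z : C), 0 <= t <= 1 -> Cmod (z - t) < r -> exists l, CD g z l) ->
  (forall z, Cmod z < r -> g z = 0%C) -> g 1%C = 0%C.
Proof.
  intros g r Hr Hg H0.
  destruct (INR_unbounded (16 / r)) as [N HN].
  assert (HN0 : 0 < INR N).
  { eapply Rlt_trans; [|exact HN]. apply Rdiv_lt_0_compat; lra. }
  assert (Hstep : / INR N < r / 16).
  { apply Rmult_lt_reg_r with (INR N); auto. rewrite Rinv_l by lra.
    apply Rmult_lt_compat_r with (r := r / 16) in HN; [|lra].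
    replace (16 / r * (r / 16)) with 1 in HN by (field; lra). lra. }
  assert (Main : forall k, (k <= N)%nat -> forall z, Cmod (z - RtoC (INR k * / INR N))%C < r / 16 -> g z = 0%C).
  { induction k.
    - intros _ z Hz. apply H0. simpl INR in Hz. rewrite Rmult_0_l in Hz.
      replace z with (z - 0)%C by ring. lra.
    - intros Hk z Hz.
      assert (Hk2 : INR (S k) <= INR N) by (apply le_INR; auto).
      rewrite S_INR in *. pose proof (pos_INR k).
      assert (Hp : 0 < / INR N) by (apply Rinv_0_lt_compat; auto).
      assert (Hkk : 0 <= INR k * / INR N <= 1).
      { split; [nra|]. apply Rmult_le_reg_r with (INR N); auto. rewrite Rmult_assoc, Rinv_l by lra. lra. }
      apply (vanish_spread g (RtoC (INR k * / INR N)) r (r / 16)); try lra.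
      + intros u Hu. eapply Hg; eauto.
      + apply IHk. lia.
      + replace (z - RtoC (INR k * / INR N))%C with ((z - RtoC ((INR k + 1) * / INR N)) + RtoC (/ INR N))%C.
        * eapply Rle_lt_trans; [apply Cmod_triangle|]. rewrite Cmod_R, Rabs_pos_eq; lra.
        * replace ((INR k + 1) * / INR N) with (INR k * / INR N + / INR N) by ring. rewrite RtoC_plus. ring. }
  apply (Main N (Nat.le_refl _)). rewrite Rinv_r by lra.
  unfold Cminus. rewrite Cplus_opp_r, Cmod_0. lra.
Qed.

(** * Taylor bounds for the exponential *)

Lemma derivable_lim_lin : forall f l, derivable_pt_lim f 0 l -> forall eps, 0 < eps -> exists d, 0 < d /\
  forall x, Rabs x < d -> Rabs (f x - f 0 - l * x) <= eps * Rabs x.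
Proof.
  intros f l H eps He. destruct (H eps He) as [d Hd]. exists d. split; [apply cond_pos|].
  intros x Hx. destruct (Req_dec x 0) as [->|Hx0].
  - rewrite Rmult_0_r. unfold Rminus. rewrite Rplus_opp_r, Ropp_0, Rplus_0_r, Rabs_R0. lra.
  - specialize (Hd x Hx0 Hx). rewrite Rplus_0_l in Hd.
    replace (f x - f 0 - l * x) with (((f x - f 0) / x - l) * x) by (field; auto).
    rewrite Rabs_mult. apply Rmult_le_compat_r; [apply Rabs_pos|lra].
Qed.

Lemma CD_Cexp_0 : CD Cexp 0%C 1%C.
Proof.
  unfold deriv. intros eps He.
  set (e := Rmin 1 (eps / 9)).
  assert (He' : 0 < e) by (apply Rmin_pos; lra).
  assert (e <= 1) by apply Rmin_l. assert (e <= eps / 9) by apply Rmin_r.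
  destruct (derivable_lim_lin exp 1 derivable_pt_lim_exp_0 e He') as [d1 [Hd1 K1]].
  destruct (derivable_lim_lin cos (- sin 0) (derivable_pt_lim_cos 0) e He') as [d2 [Hd2 K2]].
  destruct (derivable_lim_lin sin (cos 0) (derivable_pt_lim_sin 0) e He') as [d3 [Hd3 K3]].
  rewrite exp_0 in K1. rewrite cos_0 in K2, K3. rewrite sin_0 in K2, K3.
  exists (Rmin (Rmin d1 e) (Rmin d2 d3)). split; [repeat apply Rmin_pos; lra|].
  intros [x y] _ Hh. apply Rmin_Rgt in Hh as [Ha Hb]. apply Rmin_Rgt in Ha as [Ha1 Ha2].
  apply Rmin_Rgt in Hb as [Hb1 Hb2].
  pose proof (re_le_Cmod (x, y)) as Bx. pose proof (im_le_Cmod (x, y)) as By. simpl in Bx, By.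
  set (m := Cmod (x, y)) in *.
  specialize (K1 x ltac:(lra)). specialize (K2 y ltac:(lra)). specialize (K3 y ltac:(lra)).
  rewrite Cexp_0, Cplus_0_l, Cmult_1_l.
  assert (Ex : exp x <= 3).
  { destruct (Rle_dec x 1).
    - apply Rle_trans with (exp 1). + destruct (Req_dec x 1); [subst; lra|]. left; apply exp_increasing; lra.
      + apply exp_le_3.
    - pose proof (Rle_abs x). lra. }
  pose proof (exp_pos x).
  assert (Q1 : Rabs (exp x - 1) <= 2 * m).
  { replace (exp x - 1) with ((exp x - 1 - 1 * x) + x) by ring. eapply Rle_trans; [apply Rabs_triang|].
    pose proof (Rabs_pos x). nra. }
  assert (Q2 : Rabs (cos y - 1) <= e * m).
  { replace (cos y - 1) with (cos y - 1 - - 0 * y) by ring. pose proof (Rabs_pos y). nra. }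
  assert (Q3 : Rabs (sin y - y) <= e * m).
  { replace (sin y - y) with (sin y - 0 - 1 * y) by ring. pose proof (Rabs_pos y). nra. }
  assert (Q4 : Rabs (exp x - 1 - x) <= e * m).
  { replace (exp x - 1 - x) with (exp x - 1 - 1 * x) by ring. pose proof (Rabs_pos x). nra. }
  pose proof (Cmod_ge_0 (x, y)) as Hm0. fold m in Hm0.
  eapply Rle_trans; [apply Cmod_le_reim|]. rewrite !Re_minus, !Im_minus, Re_Cexp, Im_Cexp. simpl.
  replace (exp x * cos y - 1 - x) with ((exp x - 1 - x) + exp x * (cos y - 1)) by ring.
  replace (exp x * sin y - 0 - y) with (exp x * (sin y - y) + (exp x - 1) * y) by ring.
  pose proof (Rabs_triang (exp x - 1 - x) (exp x * (cos y - 1))) as exp_rem1.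
  pose proof (Rabs_triang (exp x * (sin y - y)) ((exp x - 1) * y)) as exp_rem2.
  rewrite Rabs_mult, (Rabs_pos_eq (exp x)) in exp_rem1 by lra.
  rewrite !Rabs_mult, (Rabs_pos_eq (exp x)) in exp_rem2 by lra.
  assert (U1 : exp x * Rabs (cos y - 1) <= 3 * (e * m)) by (apply Rmult_le_compat; try lra; apply Rabs_pos).
  assert (U2 : exp x * Rabs (sin y - y) <= 3 * (e * m)) by (apply Rmult_le_compat; try lra; apply Rabs_pos).
  assert (U3 : Rabs (exp x - 1) * Rabs y <= 2 * (e * m)).
  { pose proof (Rabs_pos y). pose proof (Rabs_pos (exp x - 1)).
    apply Rle_trans with (2 * m * m); [|nra]. apply Rmult_le_compat; lra. }
  assert (U4 : e * m <= eps / 9 * m) by (apply Rmult_le_compat_r; lra).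
  lra.
Qed.

Lemma CD_Cexp : forall c, CD Cexp c (Cexp c).
Proof.
  intros c eps He. pose proof (exp_pos (Re c)) as P. rewrite <- Cmod_Cexp in P.
  destruct (CD_Cexp_0 (eps / Cmod (Cexp c))) as [d [Hd K]]; [apply Rdiv_lt_0_compat; auto|].
  exists d. split; auto. intros h _ Hh. specialize (K h I Hh).
  rewrite Cexp_0, Cplus_0_l in K. rewrite Cexp_plus.
  replace (Cexp c * Cexp h - Cexp c - Cexp c * h)%C with (Cexp c * (Cexp h - 1 - 1 * h))%C by ring.
  rewrite Cmod_mult. apply Rmult_le_compat_l with (r := Cmod (Cexp c)) in K; [|lra].
  eapply Rle_trans; [exact K|]. apply Req_le. field. lra.
Qed.

Lemma deriv_Cexp : forall A f c l, deriv A f c l -> deriv A (fun z => Cexp (f z)) c (Cexp (f c) * l)%C.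
Proof. intros. apply (deriv_comp A Cexp); auto. apply CD_Cexp. Qed.

(** Each remainder is a primitive of the preceding one and vanishes at 0, which gives the
    bounds by successive integration. *)
Definition exp_rem1 (v : C) : C := (Cexp v - 1)%C.
Definition exp_rem2 (v : C) : C := (Cexp v - 1 - v)%C.
Definition exp_rem3 (v : C) : C := (Cexp v - 1 - v - v * v * RtoC (/ 2))%C.
Definition exp_rem4 (v : C) : C := (Cexp v - 1 - v - v * v * RtoC (/ 2) - v * v * v * RtoC (/ 6))%C.

Lemma CD_exp_rem1 : forall v, CD exp_rem1 v (Cexp v).
Proof.
  intros. eapply deriv_eq; [|apply deriv_minus; [apply CD_Cexp|apply deriv_const]]. ring.
Qed.
Lemma CD_exp_rem2 : forall v, CD exp_rem2 v (exp_rem1 v).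
Proof. intros. apply deriv_minus; [apply CD_exp_rem1|apply deriv_id]. Qed.
Lemma CD_exp_rem3 : forall v, CD exp_rem3 v (exp_rem2 v).
Proof.
  intros. eapply deriv_eq; [|apply deriv_minus; [apply CD_exp_rem2|apply deriv_mult; [apply deriv_mult; apply deriv_id|apply deriv_const]]].
  unfold exp_rem2. transitivity (Cexp v - 1 - v * RtoC (/ 2 + / 2))%C; [rewrite RtoC_plus; unfold exp_rem1; ring|].
  replace (/ 2 + / 2) with 1 by lra. ring.
Qed.
Lemma CD_exp_rem4 : forall v, CD exp_rem4 v (exp_rem3 v).
Proof.
  intros. eapply deriv_eq; [|apply deriv_minus; [apply CD_exp_rem3|apply deriv_mult; [apply deriv_mult; [apply deriv_mult; apply deriv_id|apply deriv_id]|apply deriv_const]]].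
  unfold exp_rem3, exp_rem2. transitivity (Cexp v - 1 - v - v * v * RtoC (/ 6 + / 6 + / 6))%C; [rewrite !RtoC_plus; ring|].
  replace (/ 6 + / 6 + / 6) with (/ 2) by lra. ring.
Qed.

Lemma taylor_step : forall (F f : C -> C) d M k, (forall v, CD F v (f v)) -> (forall v, exists l, CD f v l) ->
  F 0%C = 0%C -> 0 <= M -> (forall t : R, 0 <= t <= 1 -> Cmod (f (t * d)%C) <= M * Cmod d ^ k) ->
  forall t : R, 0 <= t <= 1 -> Cmod (F (t * d)%C) <= M * Cmod d ^ (S k).
Proof.
  intros F f d M k H1 H2 H0 HM HB t Ht.
  pose proof (mean_value_le F f 0 (t * d) (M * Cmod d ^ k)) as K.
  rewrite H0 in K. replace (F (0 + t * d) - 0)%C with (F (t * d)%C) in K by (rewrite Cplus_0_l; ring).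
  eapply Rle_trans; [apply K|].
  - intros; apply H1.
  - intros; apply H2.
  - intros u Hu. replace (0 + u * (t * d))%C with (RtoC (u * t) * d)%C by (rewrite RtoC_mult; ring).
    apply HB. nra.
  - rewrite Cmod_mult, Cmod_R, Rabs_pos_eq by lra. simpl.
    pose proof (Cmod_ge_0 d). assert (0 <= M * Cmod d ^ k) by (apply Rmult_le_pos; auto; apply pow_le; auto).
    replace (M * (Cmod d * Cmod d ^ k)) with (M * Cmod d ^ k * Cmod d) by ring.
    apply Rmult_le_compat_l; auto. nra.
Qed.

Lemma taylor_all : forall d M, (forall t : R, 0 <= t <= 1 -> Cmod (Cexp (t * d)%C) <= M) ->
  Cmod (exp_rem1 d) <= M * Cmod d /\ Cmod (exp_rem2 d) <= M * Cmod d ^ 2 /\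
  Cmod (exp_rem3 d) <= M * Cmod d ^ 3 /\ Cmod (exp_rem4 d) <= M * Cmod d ^ 4.
Proof.
  intros d M H.
  assert (HM : 0 <= M) by (eapply Rle_trans; [apply Cmod_ge_0|apply (H 0); lra]).
  assert (Z : forall (a b : C), (a = b)%C -> (a - b = 0)%C) by (intros; subst; ring).
  assert (A0 : forall t : R, 0 <= t <= 1 -> Cmod (Cexp (t * d)%C) <= M * Cmod d ^ 0) by (intros; rewrite Rmult_1_r; auto).
  assert (A1 : forall t : R, 0 <= t <= 1 -> Cmod (exp_rem1 (t * d)%C) <= M * Cmod d ^ 1).
  { apply (taylor_step exp_rem1 Cexp); auto; [apply CD_exp_rem1|intros v; eexists; apply CD_Cexp|].
    unfold exp_rem1; rewrite Cexp_0; ring. }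
  assert (A2 : forall t : R, 0 <= t <= 1 -> Cmod (exp_rem2 (t * d)%C) <= M * Cmod d ^ 2).
  { apply (taylor_step exp_rem2 exp_rem1); auto; [apply CD_exp_rem2|intros v; eexists; apply CD_exp_rem1|].
    unfold exp_rem2; rewrite Cexp_0; ring. }
  assert (A3 : forall t : R, 0 <= t <= 1 -> Cmod (exp_rem3 (t * d)%C) <= M * Cmod d ^ 3).
  { apply (taylor_step exp_rem3 exp_rem2); auto; [apply CD_exp_rem3|intros v; eexists; apply CD_exp_rem2|].
    unfold exp_rem3; rewrite Cexp_0; ring. }
  assert (A4 : forall t : R, 0 <= t <= 1 -> Cmod (exp_rem4 (t * d)%C) <= M * Cmod d ^ 4).
  { apply (taylor_step exp_rem4 exp_rem3); auto; [apply CD_exp_rem4|intros v; eexists; apply CD_exp_rem3|].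
    unfold exp_rem4; rewrite Cexp_0; ring. }
  specialize (A1 1 ltac:(lra)). specialize (A2 1 ltac:(lra)). specialize (A3 1 ltac:(lra)). specialize (A4 1 ltac:(lra)).
  rewrite Cmult_1_l in *. simpl in *. lra.
Qed.

Lemma exp_le_compat : forall x y, x <= y -> exp x <= exp y.
Proof. intros x y [H|H]; [left; apply exp_increasing; auto|subst; lra]. Qed.

Lemma Cmod_Cexp_seg : forall (d : C) (t : R), 0 <= t <= 1 -> Cmod (Cexp (t * d)%C) <= exp (Cmod d).
Proof.
  intros d t Ht. rewrite Cmod_Cexp. apply exp_le_compat. rewrite Re_mult. simpl.
  pose proof (re_le_Cmod d). pose proof (Rle_abs (Re d)). pose proof (Cmod_ge_0 d). nra.
Qed.

Lemma Cmod_Cexp_seg' : forall (d : C) (t : R), 0 <= t <= 1 -> Cmod (Cexp (t * d)%C) <= Rmax 1 (exp (Re d)).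
Proof.
  intros d t Ht. rewrite Cmod_Cexp, Re_mult. simpl.
  destruct (Rle_dec 0 (Re d)).
  - eapply Rle_trans; [|apply Rmax_r]. apply exp_le_compat. nra.
  - eapply Rle_trans; [|apply Rmax_l]. rewrite <- exp_0. apply exp_le_compat. nra.
Qed.

Lemma taylor_le1 : forall d, Cmod d <= 1 ->
  Cmod (exp_rem1 d) <= 3 * Cmod d /\ Cmod (exp_rem2 d) <= 3 * Cmod d ^ 2 /\
  Cmod (exp_rem3 d) <= 3 * Cmod d ^ 3 /\ Cmod (exp_rem4 d) <= 3 * Cmod d ^ 4.
Proof.
  intros d Hd. apply taylor_all. intros t Ht. eapply Rle_trans; [apply Cmod_Cexp_seg; auto|].
  eapply Rle_trans; [|apply exp_le_3]. apply exp_le_compat. auto.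
Qed.

(** The modulus of the exponential is monotone along the segment from [b] to [a], so the
    larger of its values at the ends suffices. *)
Lemma Cexp_sub_taylor : forall a b : C, Cmod (Cexp a - Cexp b * (1 + (a - b)))%C
  <= Rmax (Cmod (Cexp a)) (Cmod (Cexp b)) * Cmod (a - b)%C ^ 2.
Proof.
  intros a b.
  replace (Cexp a - Cexp b * (1 + (a - b)))%C with (Cexp b * exp_rem2 (a - b))%C.
  - rewrite Cmod_mult. destruct (taylor_all (a - b) _ (Cmod_Cexp_seg' (a - b))) as [_ [H _]].
    apply Rle_trans with (Cmod (Cexp b) * (Rmax 1 (exp (Re (a - b))) * Cmod (a - b) ^ 2)).
    + apply Rmult_le_compat_l; auto. apply Cmod_ge_0.
    + rewrite <- Rmult_assoc. apply Rmult_le_compat_r; [apply pow_le, Cmod_ge_0|].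
      rewrite !Cmod_Cexp, Re_minus. rewrite <- RmaxRmult by (left; apply exp_pos).
      unfold Rminus. rewrite <- exp_plus. replace (Re b + (Re a + - Re b)) with (Re a) by ring.
      rewrite Rmult_1_r, Rmax_comm. lra.
  - unfold exp_rem2. rewrite Cexp_minus. field. apply Cexp_neq_0.
Qed.

(** * The kernel 1/(e^v - 1) *)

(** In logarithmic coordinates [1 / (z - tau_0)] and [1 / (tau_0 - tau_1)], together with
    the differentials, become the values of this function at [- v_0] and [v_0 - v_1]. *)
Definition expm1_inv (v : C) : C := (/ (Cexp v - 1))%C.

Lemma cos_max_interval : forall p1 p p2, 0 <= p1 -> p1 <= p <= p2 -> p2 <= 2 * PI ->
  cos p <= Rmax (cos p1) (cos p2).
Proof.
  intros p1 p p2 H1 H H2. destruct (Rle_dec p PI).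
  - eapply Rle_trans; [|apply Rmax_l]. apply cos_decr_1; lra.
  - eapply Rle_trans; [|apply Rmax_r]. apply cos_incr_1; lra.
Qed.

Lemma cos_lt_1 : forall t, 0 < t < 2 * PI -> cos t < 1.
Proof.
  intros t Ht. rewrite <- cos_0. destruct (Rle_dec t PI).
  - apply cos_decreasing_1; lra.
  - rewrite cos_0, <- cos_2PI. apply cos_increasing_1; lra.
Qed.

Lemma expm1_lower : forall v, (1 - cos (Im v)) / 2 <= Cmod (Cexp v - 1)%C.
Proof.
  intros v. pose proof (COS_bound (Im v)). apply Cmod_ge_sqr; [lra|].
  rewrite Re_minus, Im_minus, Re_Cexp, Im_Cexp. simpl.
  pose proof (exp_pos (Re v)). set (r := exp (Re v)) in *. set (c := cos (Im v)) in *.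
  assert (S : sin (Im v) * sin (Im v) = 1 - c * c).
  { pose proof (sin2_cos2 (Im v)). unfold Rsqr in *. fold c in H1. lra. }
  replace ((r * c - 1) * (r * c - 1) + (r * sin (Im v) - 0) * (r * sin (Im v) - 0))
    with (r * r - 2 * r * c + 1) by nra.
  assert ((1 - c) / 2 <= 1) by lra.
  destruct (Rle_dec c 0).
  - assert (0 <= r * - c) by (apply Rmult_le_pos; lra). nra.
  - pose proof (Rle_0_sqr (r - c)). unfold Rsqr in *. nra.
Qed.

Lemma expm1_neq_0 : forall v, cos (Im v) < 1 -> (Cexp v - 1)%C <> 0%C.
Proof. intros v H. apply Cmod_gt_0. pose proof (expm1_lower v). lra. Qed.

Lemma expm1_inv_bound : forall v c, cos (Im v) <= c -> c < 1 -> Cmod (expm1_inv v) <= 2 / (1 - c).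
Proof.
  intros v c H Hc. unfold expm1_inv. rewrite Cmod_inv by (apply expm1_neq_0; lra).
  pose proof (expm1_lower v).
  replace (2 / (1 - c)) with (/ ((1 - c) / 2)) by (field; lra).
  apply Rinv_le_contravar; lra.
Qed.

(** The Lipschitz and Taylor bounds for the kernel all come from this identity. *)
Lemma expm1_inv_diff : forall u h, (Cexp u - 1)%C <> 0%C -> (Cexp (u + h) - 1)%C <> 0%C ->
  (expm1_inv (u + h) - expm1_inv u = - (exp_rem1 h * ((1 + expm1_inv u) * expm1_inv (u + h))))%C.
Proof.
  intros u h H1 H2. unfold expm1_inv, exp_rem1. rewrite Cexp_plus in *. field. auto.
Qed.

Definition expm1_inv' (u : C) : C := (- ((1 + expm1_inv u) * expm1_inv u))%C.

Lemma CD_expm1_inv : forall u, (Cexp u - 1)%C <> 0%C -> CD expm1_inv u (expm1_inv' u).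
Proof.
  intros u Hu. eapply deriv_eq; [|eapply (deriv_comp _ (fun z => / z)%C (fun z => Cexp z - 1)%C)].
  2:{ apply CD_inv; auto. }
  2:{ apply (CD_exp_rem1 u). }
  unfold expm1_inv', expm1_inv. field. auto.
Qed.

Lemma expm1_inv_lip : forall u h B, (Cexp u - 1)%C <> 0%C -> (Cexp (u + h) - 1)%C <> 0%C ->
  Cmod (expm1_inv u) <= B -> Cmod (expm1_inv (u + h)%C) <= B -> Cmod h <= 1 ->
  Cmod (expm1_inv (u + h) - expm1_inv u)%C <= 3 * (1 + B) * B * Cmod h.
Proof.
  intros u h B H1 H2 B1 B2 Hh. rewrite expm1_inv_diff by auto. rewrite Cmod_opp, !Cmod_mult.
  destruct (taylor_le1 h Hh) as [TT _].
  pose proof (Cmod_triangle 1 (expm1_inv u)) as Q. rewrite Cmod_1 in Q.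
  pose proof (Cmod_ge_0 (1 + expm1_inv u)). pose proof (Cmod_ge_0 (expm1_inv (u + h)%C)).
  replace (3 * (1 + B) * B * Cmod h) with (3 * Cmod h * ((1 + B) * B)) by ring.
  apply Rmult_le_compat; auto; try apply Cmod_ge_0; [apply Rmult_le_pos; auto|].
  apply Rmult_le_compat; auto. lra.
Qed.

Lemma expm1_inv_taylor : forall u h B, (Cexp u - 1)%C <> 0%C -> (Cexp (u + h) - 1)%C <> 0%C ->
  Cmod (expm1_inv u) <= B -> Cmod (expm1_inv (u + h)%C) <= B -> Cmod h <= 1 ->
  Cmod (expm1_inv (u + h) - expm1_inv u - h * expm1_inv' u)%C <= 6 * (1 + B) * (1 + B) * B * (Cmod h * Cmod h).
Proof.
  intros u h B H1 H2 B1 B2 Hh.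
  pose proof (expm1_inv_lip u h B H1 H2 B1 B2 Hh) as L.
  assert (E : (expm1_inv (u + h) - expm1_inv u - h * expm1_inv' u =
     - (exp_rem2 h * ((1 + expm1_inv u) * expm1_inv (u + h))) - h * ((1 + expm1_inv u) * (expm1_inv (u + h) - expm1_inv u)))%C).
  { rewrite (expm1_inv_diff u h) at 1 by auto. unfold expm1_inv', exp_rem1, exp_rem2. ring. }
  rewrite E. clear E.
  destruct (taylor_le1 h Hh) as [_ [TT _]].
  pose proof (Cmod_triangle 1 (expm1_inv u)) as Q. rewrite Cmod_1 in Q.
  pose proof (Cmod_ge_0 (1 + expm1_inv u)). pose proof (Cmod_ge_0 (expm1_inv (u + h)%C)). pose proof (Cmod_ge_0 (expm1_inv u)).
  pose proof (Cmod_ge_0 h).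
  eapply Rle_trans; [apply Cmod_triangle_minus|]. rewrite Cmod_opp, !Cmod_mult.
  assert (A1 : Cmod (exp_rem2 h) * (Cmod (1 + expm1_inv u) * Cmod (expm1_inv (u + h)%C)) <= 3 * Cmod h ^ 2 * ((1 + B) * B)).
  { apply Rmult_le_compat; auto; try apply Cmod_ge_0; [apply Rmult_le_pos; auto|].
    apply Rmult_le_compat; auto. lra. }
  assert (A2 : Cmod h * (Cmod (1 + expm1_inv u) * Cmod (expm1_inv (u + h) - expm1_inv u)%C)
     <= Cmod h * ((1 + B) * (3 * (1 + B) * B * Cmod h))).
  { apply Rmult_le_compat_l; auto. apply Rmult_le_compat; auto; [apply Cmod_ge_0|lra]. }
  assert (A3 : 3 * Cmod h ^ 2 * ((1 + B) * B) <= 3 * (1 + B) * (1 + B) * B * (Cmod h * Cmod h)).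
  { replace (3 * Cmod h ^ 2 * ((1 + B) * B)) with (3 * ((1 + B) * B * (Cmod h * Cmod h)) * 1) by ring.
    replace (3 * (1 + B) * (1 + B) * B * (Cmod h * Cmod h)) with (3 * ((1 + B) * B * (Cmod h * Cmod h)) * (1 + B)) by ring.
    apply Rmult_le_compat_l; [|lra]. assert (0 <= B) by lra.
    repeat apply Rmult_le_pos; lra. }
  lra.
Qed.

(** * Iterated integrals over the plane *)

Definition RI2 (F : R -> R -> C) : C := RI (fun x => RI (F x)).

(** Continuity in [x] is uniform in [y] relative to the weight, so that the inner integral is
    a continuous function of [x]. *)
Record dom2 (F : R -> R -> C) (K : R) : Prop := {
  dom2_cts : forall x y, cts (F x) y;
  dom2_ucts : forall x eps, 0 < eps -> exists d, 0 < d /\ forall x' y, Rabs (x' - x) < d ->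
     Cmod (F x' y - F x y) <= eps * wt y;
  dom2_le : forall x y, Cmod (F x y) <= K * (wt x * wt y) }.

Lemma dom2_inner : forall F K x, dom2 F K -> dom (F x) (K * wt x).
Proof.
  intros F K x H. split; [apply (dom2_cts _ _ H)|]. intros y. rewrite Rmult_assoc. apply (dom2_le _ _ H).
Qed.

Lemma dom2_outer : forall F K, dom2 F K -> dom (fun x => RI (F x)) (PI * K).
Proof.
  intros F K H. split.
  - intros x eps He. pose proof PI_RGT_0.
    destruct (dom2_ucts _ _ H x (eps / (2 * PI))) as [d [Hd K1]]; [apply Rdiv_lt_0_compat; lra|].
    exists d. split; auto. intros y Hy.
    rewrite <- (RI_minus _ _ _ _ (dom2_inner _ _ y H) (dom2_inner _ _ x H)).
    eapply Rle_lt_trans; [apply (RI_bound _ (eps / (2 * PI)))|].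
    + split; [|intros; apply K1; auto]. intros. apply cts_minus; apply (dom2_cts _ _ H).
    + replace (PI * (eps / (2 * PI))) with (eps / 2) by (field; lra). lra.
  - intros x. rewrite Rmult_assoc. apply RI_bound. apply dom2_inner; auto.
Qed.

Lemma RI2_bound : forall F K, dom2 F K -> Cmod (RI2 F) <= PI * (PI * K).
Proof. intros F K H. apply RI_bound. apply dom2_outer. auto. Qed.

Lemma dom2_weaken : forall F K K', K <= K' -> dom2 F K -> dom2 F K'.
Proof.
  intros F K K' HK [H1 H2 H3]. split; auto. intros. eapply Rle_trans; [apply H3|].
  apply Rmult_le_compat_r; auto. pose proof (wt_pos x). pose proof (wt_pos y). nra.
Qed.

Lemma dom2_rebound : forall F K K', dom2 F K -> (forall x y, Cmod (F x y) <= K' * (wt x * wt y)) -> dom2 F K'.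
Proof. intros F K K' [H1 H2 H3] H. split; auto. Qed.

Lemma dom2_plus : forall F G K L, dom2 F K -> dom2 G L -> dom2 (fun x y => F x y + G x y)%C (K + L).
Proof.
  intros F G K L [H1 H2 H3] [G1 G2 G3]. split.
  - intros. apply cts_plus; auto.
  - intros x eps He. destruct (H2 x (eps / 2)) as [d [Hd Kd]]; [lra|].
    destruct (G2 x (eps / 2)) as [d' [Hd' Kd']]; [lra|].
    exists (Rmin d d'). split; [apply Rmin_pos; auto|]. intros x' y Hx. apply Rmin_Rgt in Hx as [Hx Hx'].
    specialize (Kd x' y Hx). specialize (Kd' x' y Hx').
    replace (F x' y + G x' y - (F x y + G x y))%C with ((F x' y - F x y) + (G x' y - G x y))%C by ring.
    eapply Rle_trans; [apply Cmod_triangle|]. lra.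
  - intros x y. eapply Rle_trans; [apply Cmod_triangle|]. specialize (H3 x y). specialize (G3 x y). lra.
Qed.

Lemma dom2_scal : forall F K k, dom2 F K -> dom2 (fun x y => k * F x y)%C (Cmod k * K).
Proof.
  intros F K k [H1 H2 H3]. pose proof (Cmod_ge_0 k). split.
  - intros. apply cts_mult; auto. apply cts_const.
  - intros x eps He. destruct (H2 x (eps / (Cmod k + 1))) as [d [Hd Kd]]; [apply Rdiv_lt_0_compat; lra|].
    exists d. split; auto. intros x' y Hx. specialize (Kd x' y Hx).
    replace (k * F x' y - k * F x y)%C with (k * (F x' y - F x y))%C by ring. rewrite Cmod_mult.
    apply Rle_trans with ((Cmod k + 1) * (eps / (Cmod k + 1) * wt y)).
    + apply Rmult_le_compat; try lra. apply Cmod_ge_0.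
    + apply Req_le. field. lra.
  - intros x y. rewrite Cmod_mult, Rmult_assoc. apply Rmult_le_compat_l; auto.
Qed.

Lemma dom2_ext : forall F G K, (forall x y, F x y = G x y) -> dom2 F K -> dom2 G K.
Proof.
  intros F G K E H. assert (EE : F = G).
  { do 2 (apply FunctionalExtensionality.functional_extensionality; intros). apply E. }
  rewrite <- EE. auto.
Qed.

Lemma RI2_ext : forall F G, (forall x y, F x y = G x y) -> RI2 F = RI2 G.
Proof. intros F G E. apply RI_ext. intros x. apply RI_ext. auto. Qed.

Lemma dom2_opp : forall F K, dom2 F K -> dom2 (fun x y => - F x y)%C K.
Proof.
  intros F K H. eapply dom2_ext; [|eapply dom2_weaken; [|apply (dom2_scal F K (- (1))%C H)]].
  - intros. simpl. ring.
  - rewrite Cmod_opp, Cmod_1. lra.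
Qed.

Lemma dom2_minus : forall F G K L, dom2 F K -> dom2 G L -> dom2 (fun x y => F x y - G x y)%C (K + L).
Proof. intros. apply dom2_plus; auto. apply dom2_opp; auto. Qed.

Lemma RI2_plus : forall F G K L, dom2 F K -> dom2 G L ->
  RI2 (fun x y => F x y + G x y)%C = (RI2 F + RI2 G)%C.
Proof.
  intros F G K L HF HG. unfold RI2.
  rewrite <- (RI_plus _ _ _ _ (dom2_outer _ _ HF) (dom2_outer _ _ HG)).
  apply RI_ext. intros x. eapply RI_plus; apply dom2_inner; eauto.
Qed.

Lemma RI2_scal : forall F K k, dom2 F K -> RI2 (fun x y => k * F x y)%C = (k * RI2 F)%C.
Proof.
  intros F K k HF. unfold RI2.
  rewrite <- (RI_scal _ _ k (dom2_outer _ _ HF)).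
  apply RI_ext. intros x. eapply RI_scal; apply dom2_inner; eauto.
Qed.

Lemma RI2_minus : forall F G K L, dom2 F K -> dom2 G L ->
  RI2 (fun x y => F x y - G x y)%C = (RI2 F - RI2 G)%C.
Proof.
  intros F G K L HF HG. unfold RI2.
  rewrite <- (RI_minus _ _ _ _ (dom2_outer _ _ HF) (dom2_outer _ _ HG)).
  apply RI_ext. intros x. eapply RI_minus; apply dom2_inner; eauto.
Qed.

(** One of the two powers of the weight is spent on the growth of the kernel. *)
Definition decay2 (f : R -> C) (K : R) : Prop :=
  (forall x, cts f x) /\ forall x, Cmod (f x) <= K * (wt x * wt x).

Record ker (k : R -> R -> C) (K L : R) : Prop := {
  ker_cts : forall x y, cts (k x) y;
  ker_le : forall x y, Cmod (k x y) * (wt x * wt y) <= K;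
  ker_lip : forall x x' y, Cmod (k x' y - k x y) * wt y <= L * Rabs (x' - x) }.

Lemma decay2_nonneg : forall f K, decay2 f K -> 0 <= K.
Proof.
  intros f K [_ H]. specialize (H 0). pose proof (Cmod_ge_0 (f 0)). pose proof (wt_pos 0).
  destruct (Rle_dec 0 K); auto. assert (0 < wt 0 * wt 0) by nra. nra.
Qed.

Lemma decay2_dom : forall f K, decay2 f K -> dom f K.
Proof.
  intros f K H. pose proof (decay2_nonneg _ _ H). destruct H as [H1 H2]. split; auto.
  intros x. eapply Rle_trans; [apply H2|]. apply Rmult_le_compat_l; auto.
  pose proof (wt_pos x). pose proof (wt_le_1 x). nra.
Qed.

Lemma wt_local : forall x x', Rabs (x' - x) <= 1 -> wt x <= 3 * wt x'.
Proof.
  intros x x' H. apply Rabs_le_between in H. unfold wt.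
  assert (0 < 1 + x * x) by nra. assert (0 < 1 + x' * x') by nra.
  apply Rmult_le_reg_r with (1 + x * x); auto. rewrite Rinv_l by lra.
  apply Rmult_le_reg_r with (1 + x' * x'); auto.
  replace (3 * / (1 + x' * x') * (1 + x * x) * (1 + x' * x')) with (3 * (1 + x * x)) by (field; lra).
  assert ((x' - x) * (x' - x) <= 1) by nra. pose proof (Rle_0_sqr (x' - 2 * x)). unfold Rsqr in *. nra.
Qed.

Lemma dom2_prod : forall f0 f1 k K0 K1 K L, decay2 f0 K0 -> decay2 f1 K1 -> ker k K L ->
  dom2 (fun x y => f0 x * (f1 y * k x y))%C (K0 * K1 * K).
Proof.
  intros f0 f1 k K0 K1 K L D0 D1 Hk.
  pose proof (decay2_nonneg _ _ D0) as P0. pose proof (decay2_nonneg _ _ D1) as P1.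
  destruct D0 as [C0 B0]. destruct D1 as [C1 B1]. destruct Hk as [Ck Bk Lk].
  assert (PK : 0 <= K).
  { eapply Rle_trans; [|apply (Bk 0 0)]. pose proof (wt_pos 0). apply Rmult_le_pos; [apply Cmod_ge_0|nra]. }
  assert (PL : 0 <= L).
  { specialize (Lk 0 1 0). replace (1 - 0) with 1 in Lk by ring. rewrite Rabs_R1, Rmult_1_r in Lk.
    eapply Rle_trans; [|exact Lk]. apply Rmult_le_pos; [apply Cmod_ge_0|left; apply wt_pos]. }
  split.
  - intros. apply cts_mult; [apply cts_const|]. apply cts_mult; auto.
  - intros x eps He.
    pose proof (wt_pos x) as Wx.
    set (A := 3 * K1 * K * / wt x + 1).
    assert (HA : 1 <= A).
    { unfold A. assert (0 <= 3 * K1 * K * / wt x) by (repeat apply Rmult_le_pos; try lra; left; apply Rinv_0_lt_compat; auto). lra. }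
    set (B := Cmod (f0 x) * K1 * L + 1).
    assert (HB : 1 <= B).
    { unfold B. pose proof (Cmod_ge_0 (f0 x)). assert (0 <= Cmod (f0 x) * K1 * L) by (repeat apply Rmult_le_pos; lra). lra. }
    destruct (C0 x (eps / (2 * A))) as [d [Hd Kd]]; [apply Rdiv_lt_0_compat; lra|].
    assert (HB' : 0 < eps / (2 * B)) by (apply Rdiv_lt_0_compat; lra).
    exists (Rmin (Rmin d 1) (eps / (2 * B))). split; [repeat apply Rmin_pos; lra|].
    intros x' y Hx. apply Rmin_Rgt in Hx as [Hx Hx2]. apply Rmin_Rgt in Hx as [Hx Hx1].
    specialize (Kd x' Hx). specialize (Bk x' y). specialize (Lk x x' y). specialize (B1 y).
    pose proof (wt_pos y) as Wy. pose proof (wt_pos x') as Wx'.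
    pose proof (wt_local x x' ltac:(lra)) as Wl.
    replace (f0 x' * (f1 y * k x' y) - f0 x * (f1 y * k x y))%C
      with ((f0 x' - f0 x) * (f1 y * k x' y) + f0 x * (f1 y * (k x' y - k x y)))%C by ring.
    eapply Rle_trans; [apply Cmod_triangle|]. rewrite !Cmod_mult.
    pose proof (Cmod_ge_0 (k x' y)). pose proof (Cmod_ge_0 (k x' y - k x y)).
    pose proof (Cmod_ge_0 (f1 y)). pose proof (Cmod_ge_0 (f0 x)). pose proof (Cmod_ge_0 (f0 x' - f0 x)).
    assert (Q1 : Cmod (f1 y) * Cmod (k x' y) <= A * wt y).
    { apply Rle_trans with (K1 * (wt y * wt y) * Cmod (k x' y)); [apply Rmult_le_compat_r; auto|].
      apply Rle_trans with (K1 * wt y * (K * / wt x')).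
      - replace (K1 * (wt y * wt y) * Cmod (k x' y)) with (K1 * wt y * (wt y * Cmod (k x' y))) by ring.
        apply Rmult_le_compat_l; [nra|].
        apply Rmult_le_reg_r with (wt x'); auto. rewrite Rmult_assoc, (Rmult_assoc K), Rinv_l by lra. lra.
      - assert (/ wt x' <= 3 * / wt x).
        { apply Rmult_le_reg_r with (wt x'); auto. rewrite Rinv_l by lra.
          apply Rmult_le_reg_r with (wt x); auto. rewrite Rmult_1_l.
          replace (3 * / wt x * wt x' * wt x) with (3 * wt x') by (field; lra). auto. }
        apply Rle_trans with (K1 * wt y * (K * (3 * / wt x))).
        + apply Rmult_le_compat_l; [nra|]. apply Rmult_le_compat_l; auto.
        + unfold A. nra. }
    assert (Q2 : Cmod (f1 y) * Cmod (k x' y - k x y) <= K1 * L * Rabs (x' - x) * wt y).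
    { apply Rle_trans with (K1 * (wt y * wt y) * Cmod (k x' y - k x y)); [apply Rmult_le_compat_r; auto|].
      replace (K1 * (wt y * wt y) * Cmod (k x' y - k x y)) with (K1 * wt y * (Cmod (k x' y - k x y) * wt y)) by ring.
      replace (K1 * L * Rabs (x' - x) * wt y) with (K1 * wt y * (L * Rabs (x' - x))) by ring.
      apply Rmult_le_compat_l; [nra|]. auto. }
    assert (R1 : Cmod (f0 x' - f0 x) * (Cmod (f1 y) * Cmod (k x' y)) <= eps / 2 * wt y).
    { apply Rle_trans with (eps / (2 * A) * (A * wt y)).
      - apply Rmult_le_compat; auto; [apply Rmult_le_pos; auto|lra].
      - apply Req_le. field. lra. }
    assert (R2 : Cmod (f0 x) * (Cmod (f1 y) * Cmod (k x' y - k x y)) <= eps / 2 * wt y).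
    { apply Rle_trans with (Cmod (f0 x) * (K1 * L * Rabs (x' - x) * wt y)); [apply Rmult_le_compat_l; auto|].
      apply Rle_trans with (B * (eps / (2 * B)) * wt y).
      - replace (Cmod (f0 x) * (K1 * L * Rabs (x' - x) * wt y)) with ((Cmod (f0 x) * K1 * L) * Rabs (x' - x) * wt y) by ring.
        apply Rmult_le_compat_r; [lra|]. apply Rmult_le_compat; try apply Rabs_pos; try lra.
        + repeat apply Rmult_le_pos; auto.
        + unfold B. lra.
      - apply Req_le. field. lra. }
    lra.
  - intros x y. rewrite !Cmod_mult. specialize (B0 x). specialize (B1 y). specialize (Bk x y).
    pose proof (wt_pos x). pose proof (wt_pos y).
    pose proof (Cmod_ge_0 (f0 x)). pose proof (Cmod_ge_0 (f1 y)). pose proof (Cmod_ge_0 (k x y)).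
    apply Rle_trans with ((K0 * (wt x * wt x)) * (K1 * (wt y * wt y) * Cmod (k x y))).
    + apply Rmult_le_compat; auto; [apply Rmult_le_pos; auto|]. apply Rmult_le_compat_r; auto.
    + replace (K0 * (wt x * wt x) * (K1 * (wt y * wt y) * Cmod (k x y))) with
       (K0 * K1 * (wt x * wt y) * (Cmod (k x y) * (wt x * wt y))) by ring.
      replace (K0 * K1 * K * (wt x * wt y)) with (K0 * K1 * (wt x * wt y) * K) by ring.
      apply Rmult_le_compat_l; auto. repeat apply Rmult_le_pos; lra.
Qed.

Lemma ker_bounded : forall k K L, 0 <= L -> (forall x y, cts (k x) y) -> (forall x y, Cmod (k x y) <= K) ->
  (forall x x' y, Rabs (x' - x) <= 1 -> Cmod (k x' y - k x y) <= L * Rabs (x' - x)) ->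
  ker k K (L + 2 * K).
Proof.
  intros k K L HL H1 H2 H3.
  assert (HK : 0 <= K) by (eapply Rle_trans; [apply Cmod_ge_0|apply (H2 0 0)]).
  split; auto.
  - intros x y. pose proof (wt_pos x). pose proof (wt_le_1 x). pose proof (wt_pos y). pose proof (wt_le_1 y).
    pose proof (Cmod_ge_0 (k x y)). specialize (H2 x y).
    apply Rle_trans with (Cmod (k x y) * 1); [|lra]. apply Rmult_le_compat_l; auto. nra.
  - intros x x' y. pose proof (wt_pos y). pose proof (wt_le_1 y). pose proof (Cmod_ge_0 (k x' y - k x y)).
    pose proof (Rabs_pos (x' - x)).
    apply Rle_trans with (Cmod (k x' y - k x y)); [nra|].
    destruct (Rle_dec (Rabs (x' - x)) 1) as [Hd|Hd].
    + eapply Rle_trans; [apply H3; auto|]. nra.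
    + eapply Rle_trans; [apply Cmod_triangle_minus|]. pose proof (H2 x' y). pose proof (H2 x y). nra.
Qed.

Lemma exp_decay : forall c m, 0 < c -> exists K, 0 < K /\ forall x, exp (- (c * Rabs x)) <= K * wt x ^ m.
Proof.
  intros c m Hc. destruct m as [|m].
  { exists 1. split; [lra|]. intros x. simpl. rewrite Rmult_1_r, <- exp_0.
    apply exp_le_compat. pose proof (Rabs_pos x). nra. }
  set (c1 := c / INR (S m)).
  assert (Hm : 0 < INR (S m)) by (apply lt_0_INR; lia).
  assert (Hc1 : 0 < c1) by (apply Rdiv_lt_0_compat; auto).
  set (q := Rmin 1 (c1 * c1 / 4)).
  assert (Hq : 0 < q) by (unfold q; apply Rmin_pos; [lra|nra]).
  exists ((/ q) ^ (S m)). split; [apply pow_lt, Rinv_0_lt_compat; auto|].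
  intros x. rewrite <- Rpow_mult_distr.
  assert (E : exp (- (c * Rabs x)) = exp (- (c1 * Rabs x)) ^ (S m)).
  { rewrite <- Rpower_pow by apply exp_pos. unfold Rpower. rewrite ln_exp. f_equal. unfold c1. field. lra. }
  rewrite E. apply pow_incr. split; [left; apply exp_pos|].
  rewrite exp_Ropp. unfold wt. rewrite <- Rinv_mult.
  assert (H1 : q * (1 + x * x) <= exp (c1 * Rabs x)).
  { assert (H2 : 1 + c1 * Rabs x / 2 <= exp (c1 * Rabs x / 2)) by apply exp_ineq1_le.
    replace (c1 * Rabs x) with (c1 * Rabs x / 2 + c1 * Rabs x / 2) by field. rewrite exp_plus.
    pose proof (Rabs_pos x). assert (E2 : x * x = Rabs x * Rabs x) by (rewrite <- Rabs_mult, Rabs_pos_eq; auto; nra).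
    rewrite E2. assert (q <= 1) by apply Rmin_l. assert (q <= c1 * c1 / 4) by apply Rmin_r.
    apply Rle_trans with ((1 + c1 * Rabs x / 2) * (1 + c1 * Rabs x / 2)).
    - assert (0 <= c1 * Rabs x) by nra. assert (0 <= Rabs x * Rabs x) by nra.
      assert (q * (Rabs x * Rabs x) <= c1 * c1 / 4 * (Rabs x * Rabs x)) by (apply Rmult_le_compat_r; auto). nra.
    - assert (0 <= c1 * Rabs x) by nra. apply Rmult_le_compat; lra. }
  apply Rinv_le_contravar; auto. apply Rmult_lt_0_compat; auto. nra.
Qed.

(** The double exponential wins at [+oo]; at [-oo] the factor [e^(n x)] decays. *)
Lemma gamma_decay : forall kappa n, 0 < kappa -> 1 <= n -> exists K, 0 < K /\
  forall k x, kappa <= k -> exp (- k * exp x + n * x) <= K * (wt x * wt x).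
Proof.
  intros kappa n Hk Hn. destruct (exp_decay 1 2) as [K [HK H]]; [lra|].
  set (M := exp ((n + 1) * (n + 1) / kappa)).
  exists (M * K). assert (HM : 0 < M) by apply exp_pos. split; [nra|].
  intros k x Hkk. specialize (H x). rewrite Rmult_1_l in H.
  replace (wt x ^ 2) with (wt x * wt x) in H by ring.
  apply Rle_trans with (M * exp (- Rabs x)); [|nra].
  unfold M. rewrite <- exp_plus. apply exp_le_compat.
  assert (0 <= (n + 1) * (n + 1) / kappa) by (apply Rlt_le, Rdiv_lt_0_compat; nra).
  destruct (Rle_dec 0 x) as [Hx|Hx].
  - rewrite Rabs_pos_eq by auto.
    assert (E : x * x / 4 <= exp x).
    { assert (H2 : 1 + x / 2 <= exp (x / 2)) by apply exp_ineq1_le.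
      replace x with (x / 2 + x / 2) at 3 by field. rewrite exp_plus. nra. }
    assert (Q : (n + 1) * x <= kappa * (x * x / 4) + (n + 1) * (n + 1) / kappa).
    { apply Rmult_le_reg_r with kappa; [lra|].
      replace ((kappa * (x * x / 4) + (n + 1) * (n + 1) / kappa) * kappa)
        with (kappa * kappa * (x * x) / 4 + (n + 1) * (n + 1)) by (field; lra).
      pose proof (Rle_0_sqr (kappa * x / 2 - (n + 1))). unfold Rsqr in *. nra. }
    assert (kappa * (x * x / 4) <= k * exp x) by (apply Rmult_le_compat; nra).
    lra.
  - rewrite Rabs_left by lra. pose proof (exp_pos x). nra.
Qed.

(** * The integral in logarithmic coordinates *)

(** This is [e^(sigma tau) tau^N / z^N] for [tau = z e^v] and [w = sigma z]. *)
Definition gamma_factor (N w v : C) : C := Cexp (w * Cexp v + N * v)%C.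

Definition phi_integrand (N0 N1 w0 w1 : C) (t0 t1 x0 x1 : R) : C :=
  ((gamma_factor N0 w0 (x0, t0) * expm1_inv (- (x0, t0)))
   * (gamma_factor N1 w1 (x1, t1) * expm1_inv ((x0, t0) - (x1, t1))))%C.

(** The hyperterminant divided by [z^(N0 + N1)]: [w_j] stands for [sigma_j z], and the contours
    are the lines of heights [t0] and [t1]. *)
Definition Phi (N0 N1 w0 w1 : C) (t0 t1 : R) : C := RI2 (phi_integrand N0 N1 w0 w1 t0 t1).

(** This is [- Re (w e^(i t))]: on the line of height [t], the modulus of [e^(w e^v)] is
    [e^(- rate w t * e^x)]. *)
Definition rate (w : C) (t : R) : R := - (Re w * cos t - Im w * sin t).

Lemma rate_Cexp : forall a t, rate (Cexp a) t = - (exp (Re a) * cos (Im a + t)).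
Proof. intros. unfold rate. rewrite Re_Cexp, Im_Cexp, cos_plus. ring. Qed.

Lemma Cmod_gamma_factor : forall N w x t,
  Cmod (gamma_factor N w (x, t)) = exp (- rate w t * exp x + Re N * x) * exp (- Im N * t).
Proof.
  intros. unfold gamma_factor. rewrite Cmod_Cexp, <- exp_plus. f_equal. unfold rate.
  rewrite Re_plus, !Re_mult, Re_Cexp, Im_Cexp. simpl. ring.
Qed.

Lemma gamma_factor_le : forall N kappa T, 0 < kappa -> 1 <= Re N -> exists K, 0 < K /\
  forall w t x, kappa <= rate w t -> Rabs t <= T -> Cmod (gamma_factor N w (x, t)) <= K * (wt x * wt x).
Proof.
  intros N kappa T Hk HN. destruct (gamma_decay kappa (Re N) Hk HN) as [K [HK H]].
  exists (K * exp (Rabs (Im N) * T)). split; [apply Rmult_lt_0_compat; auto; apply exp_pos|].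
  intros w t x Hw Ht. rewrite Cmod_gamma_factor. specialize (H (rate w t) x Hw).
  assert (E : exp (- Im N * t) <= exp (Rabs (Im N) * T)).
  { apply exp_le_compat. eapply Rle_trans; [apply Rle_abs|]. rewrite Rabs_mult, Rabs_Ropp.
    apply Rmult_le_compat_l; auto. apply Rabs_pos. }
  replace (K * exp (Rabs (Im N) * T) * (wt x * wt x)) with (K * (wt x * wt x) * exp (Rabs (Im N) * T)) by ring.
  apply Rmult_le_compat; auto; left; apply exp_pos.
Qed.

Lemma CD_gamma_factor : forall N w v, exists l, CD (gamma_factor N w) v l.
Proof.
  intros. eexists. unfold gamma_factor. apply deriv_Cexp. apply deriv_plus.
  - apply deriv_scal. apply CD_Cexp.
  - apply deriv_scal. apply deriv_id.
Qed.

Lemma gamma_factor_succ : forall N w v, gamma_factor (N + 1) w v = (Cexp v * gamma_factor N w v)%C.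
Proof. intros. unfold gamma_factor. rewrite <- Cexp_plus. f_equal. ring. Qed.

Lemma gamma_factor_shift : forall N w h v, gamma_factor N (w + h) v = (gamma_factor N w v * Cexp (h * Cexp v))%C.
Proof. intros. unfold gamma_factor. rewrite <- Cexp_plus. f_equal. ring. Qed.

Lemma rate_shift : forall w h t, rate w t - Cmod h <= rate (w + h) t.
Proof.
  intros w h t. unfold rate. rewrite Re_plus, Im_plus.
  assert (B : Re h * cos t - Im h * sin t <= Cmod h).
  { replace (Re h * cos t - Im h * sin t) with (Re (h * Cexp (0, t))%C).
    - eapply Rle_trans; [apply Rle_abs|]. eapply Rle_trans; [apply re_le_Cmod|].
      rewrite Cmod_mult, Cmod_Cexp. simpl. rewrite exp_0. lra.
    - rewrite Re_mult, Re_Cexp, Im_Cexp. simpl. rewrite exp_0. ring. }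
  lra.
Qed.

Lemma gamma_factor_taylor : forall N w t, 0 < rate w t -> 1 <= Re N -> exists K d, 0 < K /\ 0 < d /\
  forall h, Cmod h < d ->
   0 < rate (w + h) t /\
   forall x, Cmod (gamma_factor N (w + h) (x, t)) <= K * (wt x * wt x) /\
    Cmod (gamma_factor (N + 1) w (x, t)) <= K * (wt x * wt x) /\
    Cmod (gamma_factor N (w + h) (x, t) - gamma_factor N w (x, t) - h * gamma_factor (N + 1) w (x, t))%C
      <= K * Cmod h ^ 2 * (wt x * wt x).
Proof.
  intros N w t Hr HN. set (kp := rate w t) in *.
  destruct (gamma_factor_le N (kp / 2) (Rabs t)) as [K1 [HK1 H1]]; try lra.
  destruct (gamma_factor_le (N + 1) (kp / 2) (Rabs t)) as [K2 [HK2 H2]]; [lra| |].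
  { rewrite Re_plus. simpl. lra. }
  destruct (gamma_decay (kp / 2) (Re N + 2)) as [K3 [HK3 H3]]; try lra.
  set (E := exp (- Im N * t)). assert (HE : 0 < E) by apply exp_pos.
  exists (K1 + K2 + K3 * E), (kp / 2).
  assert (HK3E : 0 < K3 * E) by (apply Rmult_lt_0_compat; auto).
  split; [lra|]. split; [lra|]. intros h Hh.
  pose proof (rate_shift w h t) as RS. fold kp in RS.
  split; [lra|]. intros x.
  assert (Wx : 0 < wt x * wt x) by (pose proof (wt_pos x); nra).
  specialize (H1 (w + h)%C t x ltac:(lra) ltac:(lra)). specialize (H2 w t x ltac:(fold kp; lra) ltac:(lra)).
  split; [nra|]. split; [nra|].
  replace (gamma_factor N (w + h) (x, t) - gamma_factor N w (x, t) - h * gamma_factor (N + 1) w (x, t))%C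
    with (gamma_factor N w (x, t) * exp_rem2 (h * Cexp (x, t)))%C by (rewrite gamma_factor_shift, gamma_factor_succ; unfold exp_rem2; ring).
  rewrite Cmod_mult, Cmod_gamma_factor. fold kp. fold E.
  destruct (taylor_all (h * Cexp (x, t)) _ (Cmod_Cexp_seg (h * Cexp (x, t)))) as [_ [TT _]].
  rewrite Cmod_mult, Cmod_Cexp in TT. change (Re (x, t)) with x in TT.
  apply Rle_trans with (exp (- kp * exp x + Re N * x) * E * (exp (Cmod h * exp x) * (Cmod h * exp x) ^ 2)).
  { apply Rmult_le_compat_l; auto. apply Rmult_le_pos; left; auto; apply exp_pos. }
  specialize (H3 (kp - Cmod h) x ltac:(lra)).
  replace (- (kp - Cmod h) * exp x + (Re N + 2) * x) with ((- kp * exp x + Re N * x) + (Cmod h * exp x) + x + x) in H3 by ring.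
  rewrite !exp_plus in H3.
  pose proof (Cmod_ge_0 h). assert (0 <= Cmod h ^ 2) by (apply pow_le; auto).
  assert (HH : 0 <= Cmod h ^ 2 * E) by nra.
  apply Rmult_le_compat_l with (r := Cmod h ^ 2 * E) in H3; auto.
  rewrite !exp_plus.
  match goal with |- ?l <= _ => replace l with
   (Cmod h ^ 2 * E * (exp (- kp * exp x) * exp (Re N * x) * exp (Cmod h * exp x) * exp x * exp x)) by ring end.
  eapply Rle_trans; [exact H3|].
  replace (Cmod h ^ 2 * E * (K3 * (wt x * wt x))) with (K3 * E * (Cmod h ^ 2 * (wt x * wt x))) by ring.
  apply Rle_trans with ((K1 + K2 + K3 * E) * (Cmod h ^ 2 * (wt x * wt x))); [|right; ring].
  apply Rmult_le_compat_r; [apply Rmult_le_pos; lra|lra].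
Qed.

Lemma cts_line : forall (f : C -> C) t, (forall x, exists l, CD f (x, t) l) -> forall x, cts (fun x => f (x, t)) x.
Proof. intros f t H x. destruct (H x) as [l Hl]. eapply cts_hline; eauto. Qed.

Lemma gamma_factor_decay2 : forall N w t, 0 < rate w t -> 1 <= Re N -> exists K, decay2 (fun x => gamma_factor N w (x, t)) K.
Proof.
  intros N w t Hr HN. destruct (gamma_factor_le N (rate w t) (Rabs t) Hr HN) as [K [HK H]].
  exists K. split.
  - apply cts_line. intros. apply CD_gamma_factor.
  - intros. apply H; lra.
Qed.

Lemma decay2_bounded : forall f g K B, decay2 f K -> (forall x, cts g x) -> (forall x, Cmod (g x) <= B) ->
  decay2 (fun x => f x * g x)%C (K * B).
Proof.
  intros f g K B D H1 H2. pose proof (decay2_nonneg _ _ D). destruct D as [D1 D2]. split.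
  - intros. apply cts_mult; auto.
  - intros x. rewrite Cmod_mult. replace (K * B * (wt x * wt x)) with (K * (wt x * wt x) * B) by ring.
    apply Rmult_le_compat; auto; apply Cmod_ge_0.
Qed.

Definition bsup (t : R) : R := 2 / (1 - cos t).

Lemma expm1_inv_line_bound : forall v, cos (Im v) < 1 -> Cmod (expm1_inv v) <= bsup (Im v).
Proof. intros v H. apply expm1_inv_bound; lra. Qed.

Lemma expm1_inv_neg_cts : forall t, 0 < t < 2 * PI -> forall x, cts (fun x => expm1_inv (- (x, t))%C) x.
Proof.
  intros t Ht. apply (cts_line (fun v => expm1_inv (- v)%C)). intros x. eexists.
  apply (deriv_comp _ expm1_inv); [|apply deriv_opp, deriv_id]. apply CD_expm1_inv. apply expm1_neq_0.
  rewrite Im_opp, cos_neg. apply cos_lt_1. auto.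
Qed.

Lemma expm1_inv_neg_bound : forall t, 0 < t < 2 * PI -> forall x, Cmod (expm1_inv (- (x, t))%C) <= bsup t.
Proof.
  intros t Ht x. pose proof (expm1_inv_line_bound (- (x, t))%C) as H. rewrite Im_opp in H. unfold bsup in *.
  rewrite cos_neg in H. apply H. apply cos_lt_1. auto.
Qed.

Lemma CD_expm1_inv_sub : forall v0 v1, cos (Im v0 - Im v1) < 1 -> exists l, CD (fun v => expm1_inv (v0 - v)%C) v1 l.
Proof.
  intros v0 v1 H. eexists. apply (deriv_comp _ expm1_inv).
  - apply CD_expm1_inv. apply expm1_neq_0. rewrite Im_minus. auto.
  - apply deriv_minus; [apply deriv_const|apply deriv_id].
Qed.

Lemma expm1_inv_ker : forall t0 t1, 0 < t0 - t1 < 2 * PI ->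
  exists L, ker (fun x y => expm1_inv ((x, t0) - (y, t1))%C) (bsup (t0 - t1)) L.
Proof.
  intros t0 t1 Ht. pose proof (cos_lt_1 _ Ht) as Hc.
  assert (B : forall x y, Cmod (expm1_inv ((x, t0) - (y, t1))%C) <= bsup (t0 - t1)).
  { intros x y. apply (expm1_inv_line_bound ((x, t0) - (y, t1))%C). exact Hc. }
  set (B0 := bsup (t0 - t1)) in *.
  assert (HB0 : 0 <= B0) by (eapply Rle_trans; [apply Cmod_ge_0|apply (B 0 0)]).
  eexists. apply ker_bounded with (L := 3 * (1 + B0) * B0).
  - nra.
  - intros x. apply (cts_line (fun v => expm1_inv ((x, t0) - v)%C)). intros y. apply CD_expm1_inv_sub. exact Hc.
  - apply B.
  - intros x x' y Hx.
    assert (E : ((x', t0) - (y, t1))%C = ((x, t0) - (y, t1) + RtoC (x' - x))%C) by (apply C_ext; simpl; ring).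
    rewrite E, <- Cmod_R. apply expm1_inv_lip.
    + apply expm1_neq_0. exact Hc.
    + rewrite <- E. apply expm1_neq_0. exact Hc.
    + apply B.
    + rewrite <- E. apply B.
    + rewrite Cmod_R. auto.
Qed.

Lemma phi_dom2 : forall N0 N1 w0 w1 t0 t1, 1 <= Re N0 -> 1 <= Re N1 -> 0 < rate w0 t0 -> 0 < rate w1 t1 ->
  0 < t0 < 2 * PI -> 0 < t0 - t1 < 2 * PI -> exists K, dom2 (phi_integrand N0 N1 w0 w1 t0 t1) K.
Proof.
  intros N0 N1 w0 w1 t0 t1 HN0 HN1 H0 H1 Ht0 Ht.
  destruct (gamma_factor_decay2 N0 w0 t0 H0 HN0) as [K0 D0]. destruct (gamma_factor_decay2 N1 w1 t1 H1 HN1) as [K1 D1].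
  destruct (expm1_inv_ker t0 t1 Ht) as [L Hk].
  pose proof (decay2_bounded _ _ _ _ D0 (expm1_inv_neg_cts t0 Ht0) (expm1_inv_neg_bound t0 Ht0)) as D0'.
  eexists. apply (dom2_prod _ _ _ _ _ _ _ D0' D1 Hk).
Qed.

Lemma wt2_le : forall x, wt x * wt x <= wt x.
Proof. intros. pose proof (wt_pos x). pose proof (wt_le_1 x). nra. Qed.

(** The derivative in [w_j] raises [N_j] by one, which keeps the integrand in the same class. *)
Lemma Phi_diff : forall N0 N1 w0 w1 t0 t1, 1 <= Re N0 -> 1 <= Re N1 -> 0 < rate w0 t0 -> 0 < rate w1 t1 ->
  0 < t0 < 2 * PI -> 0 < t0 - t1 < 2 * PI -> exists l0 l1 K d, 0 < d /\ 0 <= K /\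
  forall h0 h1, Cmod h0 < d -> Cmod h1 < d ->
   Cmod (Phi N0 N1 (w0 + h0) (w1 + h1) t0 t1 - Phi N0 N1 w0 w1 t0 t1 - l0 * h0 - l1 * h1)%C
    <= K * (Cmod h0 + Cmod h1) ^ 2.
Proof.
  intros N0 N1 w0 w1 t0 t1 HN0 HN1 H0 H1 Ht0 Ht.
  destruct (gamma_factor_taylor N0 w0 t0 H0 HN0) as [K0 [d0 [HK0 [Hd0 E0]]]].
  destruct (gamma_factor_taylor N1 w1 t1 H1 HN1) as [K1 [d1 [HK1 [Hd1 E1]]]].
  assert (HN0' : 1 <= Re (N0 + 1)) by (rewrite Re_plus; simpl; lra).
  assert (HN1' : 1 <= Re (N1 + 1)) by (rewrite Re_plus; simpl; lra).
  exists (Phi (N0 + 1) N1 w0 w1 t0 t1), (Phi N0 (N1 + 1) w0 w1 t0 t1).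
  destruct (ex_intro (fun B => B = bsup t0) _ eq_refl) as [B0 EB0].
  destruct (ex_intro (fun B => B = bsup (t0 - t1)) _ eq_refl) as [B1 EB1].
  assert (HB0 : 0 <= B0) by (rewrite EB0; eapply Rle_trans; [apply Cmod_ge_0|apply (expm1_inv_neg_bound t0 Ht0 0)]).
  assert (HB1 : 0 <= B1).
  { rewrite EB1. eapply Rle_trans; [apply Cmod_ge_0|apply (expm1_inv_line_bound (0, t0 - t1))]. apply cos_lt_1. auto. }
  destruct (ex_intro (fun K => K = K0 * K1 * B0 * B1) _ eq_refl) as [KK EKK].
  assert (HKK : 0 <= KK) by (rewrite EKK; repeat apply Rmult_le_pos; lra).
  exists (PI * (PI * (2 * KK))), (Rmin (Rmin d0 d1) 1).
  pose proof PI_RGT_0.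
  split; [repeat apply Rmin_pos; lra|].
  split; [apply Rmult_le_pos; [lra|]; apply Rmult_le_pos; lra|].
  intros h0 h1 Hh0 Hh1. apply Rmin_Rgt in Hh0 as [Hh0 Hh0']. apply Rmin_Rgt in Hh1 as [Hh1 Hh1'].
  apply Rmin_Rgt in Hh0 as [Hh0 _]. apply Rmin_Rgt in Hh1 as [_ Hh1].
  destruct (E0 h0 Hh0) as [R0 F0]. destruct (E1 h1 Hh1) as [R1 F1].
  destruct (E0 0%C) as [_ G0]; [rewrite Cmod_0; auto|]. destruct (E1 0%C) as [_ G1]; [rewrite Cmod_0; auto|].
  rewrite Cplus_0_r in G0, G1.
  destruct (phi_dom2 N0 N1 (w0 + h0) (w1 + h1) t0 t1) as [C1 D1]; auto.
  destruct (phi_dom2 N0 N1 w0 w1 t0 t1) as [C2 D2]; auto.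
  destruct (phi_dom2 (N0 + 1) N1 w0 w1 t0 t1) as [C3 D3]; auto.
  destruct (phi_dom2 N0 (N1 + 1) w0 w1 t0 t1) as [C4 D4]; auto.
  unfold Phi. rewrite (Cmult_comm (RI2 (phi_integrand (N0 + 1) _ _ _ _ _))).
  rewrite (Cmult_comm (RI2 (phi_integrand N0 (N1 + 1) _ _ _ _))).
  rewrite <- (RI2_scal _ _ h0 D3), <- (RI2_scal _ _ h1 D4).
  rewrite <- (RI2_minus _ _ _ _ D1 D2).
  rewrite <- (RI2_minus _ _ _ _ (dom2_minus _ _ _ _ D1 D2) (dom2_scal _ _ h0 D3)).
  rewrite <- (RI2_minus _ _ _ _ (dom2_minus _ _ _ _ (dom2_minus _ _ _ _ D1 D2) (dom2_scal _ _ h0 D3)) (dom2_scal _ _ h1 D4)).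
  replace (PI * (PI * (2 * KK)) * (Cmod h0 + Cmod h1) ^ 2) with (PI * (PI * (2 * KK * (Cmod h0 + Cmod h1) ^ 2))) by ring.
  apply RI2_bound.
  eapply dom2_rebound.
  { apply (dom2_minus _ _ _ _ (dom2_minus _ _ _ _ (dom2_minus _ _ _ _ D1 D2) (dom2_scal _ _ h0 D3)) (dom2_scal _ _ h1 D4)). }
  intros x y. unfold phi_integrand.
  pose proof (expm1_inv_neg_bound t0 Ht0 x) as Bx.
  assert (By : Cmod (expm1_inv ((x, t0) - (y, t1))%C) <= B1).
  { rewrite EB1. apply (expm1_inv_line_bound ((x, t0) - (y, t1))%C). apply cos_lt_1. auto. }
  rewrite <- EB0 in Bx.
  destruct (F0 x) as [P1 [P2 P3]]. destruct (F1 y) as [Q1 [Q2 Q3]].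
  destruct (G0 x) as [P4 _]. destruct (G1 y) as [Q4 _].
  revert P1 P2 P3 P4 Q1 Q2 Q3 Q4 Bx By.
  generalize (gamma_factor N0 (w0 + h0) (x, t0)) (gamma_factor N0 w0 (x, t0)) (gamma_factor (N0 + 1) w0 (x, t0)).
  intros f0h f0 f0'.
  generalize (gamma_factor N1 (w1 + h1) (y, t1)) (gamma_factor N1 w1 (y, t1)) (gamma_factor (N1 + 1) w1 (y, t1)).
  intros f1h f1 f1'.
  generalize (expm1_inv (- (x, t0))) (expm1_inv ((x, t0) - (y, t1))). intros b0 b1.
  intros P1 P2 P3 P4 Q1 Q2 Q3 Q4 Bx By.
  remember (wt x * wt x) as u eqn:Eu. remember (wt y * wt y) as v eqn:Ev.
  assert (Hu : 0 <= u) by (rewrite Eu; pose proof (wt_pos x); nra).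
  assert (Hv : 0 <= v) by (rewrite Ev; pose proof (wt_pos y); nra).
  match goal with |- Cmod ?e <= _ => replace e with
    ((b0 * b1) * ((f0h * (f1h - f1 - h1 * f1') + (f0h - f0 - h0 * f0') * f1)
     + (h1 * h0 * (f0' * f1') + h1 * (f0h - f0 - h0 * f0') * f1')))%C by ring end.
  rewrite Cmod_mult, Cmod_mult.
  set (a0 := Cmod h0) in *. set (a1 := Cmod h1) in *.
  assert (Ha0 : 0 <= a0) by apply Cmod_ge_0. assert (Ha1 : 0 <= a1) by apply Cmod_ge_0.
  assert (M1 : Cmod (f0h * (f1h - f1 - h1 * f1')) <= (K0 * u) * (K1 * a1 ^ 2 * v))
    by (rewrite Cmod_mult; apply Rmult_le_compat; auto; apply Cmod_ge_0).
  assert (M2 : Cmod ((f0h - f0 - h0 * f0') * f1) <= (K0 * a0 ^ 2 * u) * (K1 * v))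
    by (rewrite Cmod_mult; apply Rmult_le_compat; auto; apply Cmod_ge_0).
  assert (M3 : Cmod (h1 * h0 * (f0' * f1')) <= a1 * a0 * ((K0 * u) * (K1 * v))).
  { rewrite !Cmod_mult. apply Rmult_le_compat_l; [apply Rmult_le_pos; auto|].
    apply Rmult_le_compat; auto; apply Cmod_ge_0. }
  assert (M4 : Cmod (h1 * (f0h - f0 - h0 * f0') * f1') <= a1 * (K0 * a0 ^ 2 * u) * (K1 * v)).
  { rewrite !Cmod_mult. apply Rmult_le_compat; auto; try apply Cmod_ge_0.
    - apply Rmult_le_pos; [auto|apply Cmod_ge_0].
    - apply Rmult_le_compat_l; auto. }
  assert (MM : Cmod ((f0h * (f1h - f1 - h1 * f1') + (f0h - f0 - h0 * f0') * f1)
     + (h1 * h0 * (f0' * f1') + h1 * (f0h - f0 - h0 * f0') * f1')) <= K0 * K1 * (u * v) * (2 * (a0 + a1) ^ 2)).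
  { eapply Rle_trans; [apply Cmod_triangle|].
    eapply Rle_trans; [apply Rplus_le_compat; apply Cmod_triangle|].
    assert (HH : 0 <= K0 * K1 * (u * v)) by (repeat apply Rmult_le_pos; lra).
    eapply Rle_trans; [apply Rplus_le_compat; [apply Rplus_le_compat; [exact M1|exact M2]|apply Rplus_le_compat; [exact M3|exact M4]]|].
    match goal with |- ?l <= _ => replace l with (K0 * K1 * (u * v) * (a1 ^ 2 + a0 ^ 2 + a1 * a0 + a1 * a0 ^ 2)) by ring end.
    apply Rmult_le_compat_l; auto. assert (a1 * a0 ^ 2 <= a0 ^ 2) by (assert (0 <= a0 ^ 2) by (apply pow_le; auto); nra).
    nra. }
  apply Rle_trans with (B0 * B1 * (K0 * K1 * (u * v) * (2 * (a0 + a1) ^ 2))).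
  - apply Rmult_le_compat; auto; try apply Cmod_ge_0.
    + apply Rmult_le_pos; apply Cmod_ge_0.
    + apply Rmult_le_compat; auto; apply Cmod_ge_0.
  - replace (B0 * B1 * (K0 * K1 * (u * v) * (2 * (a0 + a1) ^ 2))) with (2 * KK * (a0 + a1) ^ 2 * (u * v)) by (rewrite EKK; ring).
    apply Rmult_le_compat_l.
    + apply Rmult_le_pos; [lra|]. apply pow_le. lra.
    + pose proof (wt2_le x). pose proof (wt2_le y). subst u v. apply Rmult_le_compat; auto.
Qed.

(** * Rotation of the contours *)

Lemma rate_strip : forall a t1 t2, t1 <= t2 -> PI / 2 < Im a + t1 -> Im a + t2 < 3 * (PI / 2) ->
  exists kappa, 0 < kappa /\ forall t, t1 <= t <= t2 -> kappa <= rate (Cexp a) t.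
Proof.
  intros a t1 t2 Ht H1 H2. pose proof PI_RGT_0.
  set (c := Rmax (cos (Im a + t1)) (cos (Im a + t2))).
  assert (Hc : c < 0).
  { unfold c. apply Rmax_lub_lt; apply cos_lt_0; lra. }
  pose proof (exp_pos (Re a)).
  exists (- (exp (Re a) * c)). split; [nra|]. intros t Htt. rewrite rate_Cexp.
  assert (cos (Im a + t) <= c) by (apply cos_max_interval; lra). nra.
Qed.

Lemma cos_strip : forall t1 t2, t1 <= t2 -> 0 < t1 -> t2 < 2 * PI ->
  exists c, c < 1 /\ forall t, t1 <= t <= t2 -> cos t <= c.
Proof.
  intros t1 t2 Ht H1 H2. exists (Rmax (cos t1) (cos t2)). split.
  - apply Rmax_lub_lt; apply cos_lt_1; lra.
  - intros. apply cos_max_interval; lra.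
Qed.

Lemma abs_le_max : forall t t1 t2, t1 <= t <= t2 -> Rabs t <= Rabs t1 + Rabs t2.
Proof.
  intros. apply Rabs_le. pose proof (Rle_abs t1). pose proof (Rle_abs (- t1)). pose proof (Rle_abs t2).
  pose proof (Rle_abs (- t2)). rewrite Rabs_Ropp in *. pose proof (Rabs_pos t1). pose proof (Rabs_pos t2). lra.
Qed.

Lemma Phi_shift1 : forall N0 N1 w0 a1 t0 t1 t1', t1 <= t1' -> 1 <= Re N1 ->
  PI / 2 < Im a1 + t1 -> Im a1 + t1' < 3 * (PI / 2) -> 0 < t0 - t1' -> t0 - t1 < 2 * PI ->
  Phi N0 N1 w0 (Cexp a1) t0 t1 = Phi N0 N1 w0 (Cexp a1) t0 t1'.
Proof.
  intros N0 N1 w0 a1 t0 t1 t1' Ht HN H1 H2 H3 H4.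
  destruct (rate_strip a1 t1 t1' Ht H1 H2) as [kp [Hkp Hr]].
  destruct (cos_strip (t0 - t1') (t0 - t1)) as [c [Hc Hcc]]; try lra.
  destruct (gamma_factor_le N1 kp (Rabs t1 + Rabs t1') Hkp HN) as [K [HK HB]].
  apply RI_ext. intros x. unfold phi_integrand.
  set (f := (gamma_factor N0 w0 (x, t0) * expm1_inv (- (x, t0)))%C).
  apply (RI_strip_shift (fun v => f * (gamma_factor N1 (Cexp a1) v * expm1_inv ((x, t0) - v)))%C t1 t1'
     (Cmod f * (K * (2 / (1 - c))))); auto.
  - intros y t Htt. destruct (CD_gamma_factor N1 (Cexp a1) (y, t)) as [l Hl].
    destruct (CD_expm1_inv_sub (x, t0) (y, t)) as [m Hm].
    { simpl. eapply Rle_lt_trans; [apply Hcc|auto]. lra. }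
    eexists. apply deriv_scal. apply deriv_mult; eauto.
  - intros y t Htt. rewrite !Cmod_mult.
    assert (B1 : Cmod (expm1_inv ((x, t0) - (y, t))%C) <= 2 / (1 - c)).
    { apply expm1_inv_bound; auto. simpl. apply Hcc. lra. }
    specialize (HB (Cexp a1) t y (Hr t Htt) (abs_le_max _ _ _ Htt)).
    rewrite Rmult_assoc. apply Rmult_le_compat_l; [apply Cmod_ge_0|].
    apply Rle_trans with (K * (wt y * wt y) * (2 / (1 - c))).
    + apply Rmult_le_compat; auto; apply Cmod_ge_0.
    + replace (K * (wt y * wt y) * (2 / (1 - c))) with (K * (2 / (1 - c)) * (wt y * wt y)) by ring.
      apply Rmult_le_compat_l; [|apply wt2_le].
      apply Rmult_le_pos; [lra|]. eapply Rle_trans; [apply Cmod_ge_0|exact B1].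
Qed.

(** Moving the outer line requires the inner integral to be holomorphic; the outer variable
    enters it through the kernel only. *)
Lemma CD_inner : forall N1 w1 t1 v0, 1 <= Re N1 -> 0 < rate w1 t1 -> 0 < Im v0 - t1 < 2 * PI ->
  exists l, CD (fun v => RI (fun y => gamma_factor N1 w1 (y, t1) * expm1_inv (v - (y, t1)))%C) v0 l.
Proof.
  intros N1 w1 t1 v0 HN Hr Ht. set (s := Im v0 - t1) in *.
  destruct (gamma_factor_decay2 N1 w1 t1 Hr HN) as [K1 D1]. pose proof (decay2_nonneg _ _ D1) as HK1.
  set (d := Rmin 1 (Rmin (s / 2) ((2 * PI - s) / 2))).
  assert (Hd : 0 < d) by (unfold d; repeat apply Rmin_pos; lra).
  assert (Hd1 : d <= 1) by apply Rmin_l.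
  assert (Hd2 : d <= s / 2) by (unfold d; eapply Rle_trans; [apply Rmin_r|apply Rmin_l]).
  assert (Hd3 : d <= (2 * PI - s) / 2) by (unfold d; eapply Rle_trans; [apply Rmin_r|apply Rmin_r]).
  destruct (cos_strip (s - d) (s + d)) as [c [Hc Hcc]]; try lra.
  destruct (ex_intro (fun B => B = 2 / (1 - c)) _ eq_refl) as [B EB].
  assert (Hcos : forall h y, Cmod h < d -> cos (Im (v0 - (y, t1) + h)%C) <= c).
  { intros h y Hh. apply Hcc. rewrite Im_plus, Im_minus. simpl.
    pose proof (im_le_Cmod h) as Q. apply Rabs_le_between in Q. unfold s. lra. }
  assert (HB : forall h y, Cmod h < d -> Cmod (expm1_inv (v0 - (y, t1) + h)%C) <= B).
  { intros h y Hh. rewrite EB. apply expm1_inv_bound; auto. }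
  assert (HB0 : 0 <= B) by (eapply Rle_trans; [apply Cmod_ge_0|apply (HB 0%C 0); rewrite Cmod_0; auto]).
  assert (Hne : forall h y, Cmod h < d -> (Cexp (v0 - (y, t1) + h) - 1)%C <> 0%C).
  { intros h y Hh. apply expm1_neq_0. eapply Rle_lt_trans; [apply Hcos; auto|auto]. }
  assert (Hc0 : forall h, Cmod h < d -> forall y, cts (fun y => expm1_inv (v0 + h - (y, t1))%C) y).
  { intros h Hh. apply (cts_line (fun v => expm1_inv (v0 + h - v)%C)). intros y. apply CD_expm1_inv_sub.
    specialize (Hcos h y Hh). rewrite Im_plus, Im_minus in Hcos. simpl in Hcos. rewrite Im_plus. simpl.
    replace (Im v0 + Im h - t1) with (Im v0 - t1 + Im h) by ring.
    unfold Rminus in *. lra. }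
  assert (H0 : Cmod 0%C < d) by (rewrite Cmod_0; auto).
  eexists. eapply (RI_deriv anyC (fun v y => gamma_factor N1 w1 (y, t1) * expm1_inv (v - (y, t1)))%C
    (fun y => gamma_factor N1 w1 (y, t1) * expm1_inv' (v0 - (y, t1)))%C v0 _ _ (K1 * (6 * (1 + B) * (1 + B) * B)) d Hd).
  - apply decay2_dom. apply decay2_bounded with (B := B); [exact D1| |].
    + intros y. generalize (Hc0 0%C H0 y). apply cts_ext. intros. rewrite Cplus_0_r. auto.
    + intros y. specialize (HB 0%C y H0). rewrite Cplus_0_r in HB. auto.
  - apply decay2_dom. apply decay2_bounded with (B := (1 + B) * B); [exact D1| |].
    + intros y. unfold expm1_inv'. apply cts_opp.
      assert (Q : cts (fun y => expm1_inv (v0 - (y, t1))%C) y).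
      { generalize (Hc0 0%C H0 y). apply cts_ext. intros. rewrite Cplus_0_r. auto. }
      apply cts_mult; auto. apply cts_plus; auto. apply cts_const.
    + intros y. unfold expm1_inv'. rewrite Cmod_opp, Cmod_mult.
      specialize (HB 0%C y H0). rewrite Cplus_0_r in HB.
      apply Rmult_le_compat; auto; try apply Cmod_ge_0.
      eapply Rle_trans; [apply Cmod_triangle|]. rewrite Cmod_1. lra.
  - intros h _ Hh. eexists. apply decay2_dom. apply decay2_bounded with (B := B); [exact D1|auto|].
    intros y. specialize (HB h y Hh). replace (v0 + h - (y, t1))%C with (v0 - (y, t1) + h)%C; auto.
    generalize ((y, t1) : C). intros. ring.
  - intros h y _ Hh. specialize (Hne h y Hh) as Q1. specialize (Hne 0%C y H0) as Q2.
    specialize (HB h y Hh) as Q3. specialize (HB 0%C y H0) as Q4. rewrite Cplus_0_r in Q2, Q4.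
    destruct D1 as [_ D1]. specialize (D1 y).
    replace (v0 + h - (y, t1))%C with (v0 - (y, t1) + h)%C by (generalize ((y, t1) : C); intros; ring).
    revert Q1 Q2 Q3 Q4 D1. generalize (gamma_factor N1 w1 (y, t1)). generalize (v0 - (y, t1))%C. intros u f Q1 Q2 Q3 Q4 D1.
    replace (f * expm1_inv (u + h) - f * expm1_inv u - h * (f * expm1_inv' u))%C with
      (f * (expm1_inv (u + h) - expm1_inv u - h * expm1_inv' u))%C by ring.
    rewrite Cmod_mult. pose proof (expm1_inv_taylor u h B Q2 Q1 Q4 Q3 ltac:(lra)) as T.
    apply Rle_trans with (K1 * (wt y * wt y) * (6 * (1 + B) * (1 + B) * B * (Cmod h * Cmod h))).
    + apply Rmult_le_compat; auto; apply Cmod_ge_0.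
    + pose proof (wt2_le y).
      replace (K1 * (wt y * wt y) * (6 * (1 + B) * (1 + B) * B * (Cmod h * Cmod h))) with
        (K1 * (6 * (1 + B) * (1 + B) * B) * (Cmod h * Cmod h) * (wt y * wt y)) by ring.
      apply Rmult_le_compat_l; auto.
      pose proof (Cmod_ge_0 h). apply Rmult_le_pos; [|nra]. apply Rmult_le_pos; auto. apply Rmult_le_pos; auto. nra.
Qed.

Lemma Phi_shift0 : forall N0 N1 a0 w1 t0 t0' t1, t0 <= t0' -> 1 <= Re N0 -> 1 <= Re N1 ->
  0 < rate w1 t1 -> PI / 2 < Im a0 + t0 -> Im a0 + t0' < 3 * (PI / 2) -> 0 < t0 -> t0' < 2 * PI ->
  0 < t0 - t1 -> t0' - t1 < 2 * PI ->
  Phi N0 N1 (Cexp a0) w1 t0 t1 = Phi N0 N1 (Cexp a0) w1 t0' t1.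
Proof.
  intros N0 N1 a0 w1 t0 t0' t1 Ht HN0 HN1 Hr1 H1 H2 H3 H4 H5 H6.
  destruct (rate_strip a0 t0 t0' Ht H1 H2) as [kp [Hkp Hr]].
  destruct (cos_strip t0 t0') as [c [Hc Hcc]]; try lra.
  destruct (cos_strip (t0 - t1) (t0' - t1)) as [c' [Hc' Hcc']]; try lra.
  destruct (gamma_factor_le N0 kp (Rabs t0 + Rabs t0') Hkp HN0) as [K [HK HB]].
  destruct (gamma_factor_decay2 N1 w1 t1 Hr1 HN1) as [K1 D1]. pose proof (decay2_nonneg _ _ D1) as HK1.
  set (g := fun v => ((gamma_factor N0 (Cexp a0) v * expm1_inv (- v)) * RI (fun y => gamma_factor N1 w1 (y, t1) * expm1_inv (v - (y, t1))))%C).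
  assert (Hdom : forall x t, t0 <= t <= t0' ->
    dom (fun y => gamma_factor N1 w1 (y, t1) * expm1_inv ((x, t) - (y, t1)))%C (K1 * (2 / (1 - c')))).
  { intros x t Htt. apply decay2_dom. apply decay2_bounded; auto.
    - apply (cts_line (fun v => expm1_inv ((x, t) - v)%C)). intros y. apply CD_expm1_inv_sub. simpl.
      eapply Rle_lt_trans; [apply Hcc'|auto]. lra.
    - intros y. apply expm1_inv_bound; auto. simpl. apply Hcc'. lra. }
  assert (E : forall t, t0 <= t <= t0' -> Phi N0 N1 (Cexp a0) w1 t t1 = RI (fun x => g (x, t))).
  { intros t Htt. apply RI_ext. intros x. unfold g, phi_integrand.
    rewrite <- (RI_scal _ _ _ (Hdom x t Htt)). reflexivity. }
  rewrite !E by lra.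
  apply (RI_strip_shift g t0 t0' (K * (2 / (1 - c)) * (PI * (K1 * (2 / (1 - c')))))); auto.
  - intros x t Htt. destruct (CD_gamma_factor N0 (Cexp a0) (x, t)) as [l Hl].
    destruct (CD_inner N1 w1 t1 (x, t)) as [m Hm]; auto; [simpl; lra|].
    eexists. unfold g. apply deriv_mult; [apply deriv_mult; [exact Hl|]|exact Hm].
    apply (deriv_comp _ expm1_inv); [|apply deriv_opp, deriv_id]. apply CD_expm1_inv. apply expm1_neq_0.
    rewrite Im_opp, cos_neg. simpl. eapply Rle_lt_trans; [apply Hcc|auto]. lra.
  - intros x t Htt. unfold g. rewrite !Cmod_mult.
    assert (B1 : Cmod (expm1_inv (- (x, t))%C) <= 2 / (1 - c)).
    { apply expm1_inv_bound; auto. rewrite Im_opp, cos_neg. apply Hcc. auto. }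
    pose proof (RI_bound _ _ (Hdom x t Htt)) as B2.
    specialize (HB (Cexp a0) t x (Hr t Htt) (abs_le_max _ _ _ Htt)).
    apply Rle_trans with (K * (wt x * wt x) * (2 / (1 - c)) * (PI * (K1 * (2 / (1 - c'))))).
    + apply Rmult_le_compat; auto; try apply Cmod_ge_0.
      * apply Rmult_le_pos; apply Cmod_ge_0.
      * apply Rmult_le_compat; auto; apply Cmod_ge_0.
    + pose proof (wt2_le x).
      replace (K * (wt x * wt x) * (2 / (1 - c)) * (PI * (K1 * (2 / (1 - c')))))
        with (K * (2 / (1 - c)) * (PI * (K1 * (2 / (1 - c')))) * (wt x * wt x)) by ring.
      apply Rmult_le_compat_l; auto. apply Rmult_le_pos.
      * apply Rmult_le_pos; [lra|]. eapply Rle_trans; [apply Cmod_ge_0|exact B1].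
      * eapply Rle_trans; [apply Cmod_ge_0|exact B2].
Qed.

(** The heights [t0], [t1] suit the logarithms [a_j] of [sigma_j z]: the first two conditions
    make the exponential factors decay, the last two separate the lines from each other and
    from 0 without meeting another pole of the kernels. *)
Definition admissible (a0 a1 : C) (t0 t1 : R) : Prop :=
  (PI / 2 < Im a0 + t0 /\ Im a0 + t0 < 3 * (PI / 2)) /\
  (PI / 2 < Im a1 + t1 /\ Im a1 + t1 < 3 * (PI / 2)) /\
  (0 < t0 /\ t0 < 2 * PI) /\ (0 < t0 - t1 /\ t0 - t1 < 2 * PI).

Lemma admissible_rate0 : forall a0 a1 t0 t1, admissible a0 a1 t0 t1 -> 0 < rate (Cexp a0) t0.
Proof.
  intros a0 a1 t0 t1 [H _]. rewrite rate_Cexp. pose proof (exp_pos (Re a0)).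
  assert (cos (Im a0 + t0) < 0) by (apply cos_lt_0; lra). nra.
Qed.

Lemma admissible_rate1 : forall a0 a1 t0 t1, admissible a0 a1 t0 t1 -> 0 < rate (Cexp a1) t1.
Proof.
  intros a0 a1 t0 t1 [_ [H _]]. rewrite rate_Cexp. pose proof (exp_pos (Re a1)).
  assert (cos (Im a1 + t1) < 0) by (apply cos_lt_0; lra). nra.
Qed.

Lemma Phi_move1 : forall N0 N1 a0 a1 t0 t1 t1', 1 <= Re N1 -> admissible a0 a1 t0 t1 -> admissible a0 a1 t0 t1' ->
  Phi N0 N1 (Cexp a0) (Cexp a1) t0 t1 = Phi N0 N1 (Cexp a0) (Cexp a1) t0 t1'.
Proof.
  intros N0 N1 a0 a1 t0 t1 t1' HN [A [B [D E]]] [A' [B' [D' E']]].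
  destruct (Rle_dec t1 t1').
  - apply Phi_shift1; auto; lra.
  - symmetry. apply Phi_shift1; auto; lra.
Qed.

Lemma Phi_move0 : forall N0 N1 a0 a1 t0 t0' t1, 1 <= Re N0 -> 1 <= Re N1 -> admissible a0 a1 t0 t1 -> admissible a0 a1 t0' t1 ->
  Phi N0 N1 (Cexp a0) (Cexp a1) t0 t1 = Phi N0 N1 (Cexp a0) (Cexp a1) t0' t1.
Proof.
  intros N0 N1 a0 a1 t0 t0' t1 HN0 HN1 H H'.
  pose proof (admissible_rate1 _ _ _ _ H) as R1.
  destruct H as [A [B [D E]]]. destruct H' as [A' [B' [D' E']]].
  destruct (Rle_dec t0 t0').
  - apply Phi_shift0; auto; lra.
  - symmetry. apply Phi_shift0; auto; lra.
Qed.

(** Any two admissible pairs are joined by moving the lines one at a time, in one order or the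
    other.  The two intermediate pairs cannot both fail: not in the same direction, because
    their differences of heights add up to the sum of the given ones, nor in opposite
    directions, because the heights of each line range over an interval of length [PI]. *)
Lemma Phi_indep : forall N0 N1 a0 a1 t0 t1 t0' t1', 1 <= Re N0 -> 1 <= Re N1 ->
  admissible a0 a1 t0 t1 -> admissible a0 a1 t0' t1' ->
  Phi N0 N1 (Cexp a0) (Cexp a1) t0 t1 = Phi N0 N1 (Cexp a0) (Cexp a1) t0' t1'.
Proof.
  intros N0 N1 a0 a1 t0 t1 t0' t1' HN0 HN1 H H'.
  pose proof PI_RGT_0.
  destruct (classic (admissible a0 a1 t0' t1)) as [K|K].
  - rewrite (Phi_move0 N0 N1 a0 a1 t0 t0' t1) by auto. apply Phi_move1; auto.
  - destruct (classic (admissible a0 a1 t0 t1')) as [K'|K'].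
    + rewrite (Phi_move1 N0 N1 a0 a1 t0 t1 t1') by auto. apply Phi_move0; auto.
    + exfalso. destruct H as [A [B [D E]]]. destruct H' as [A' [B' [D' E']]].
      unfold admissible in K, K'.
      assert (X : t0' - t1 <= 0 \/ 2 * PI <= t0' - t1).
      { destruct (Rle_dec (t0' - t1) 0); auto. destruct (Rle_dec (2 * PI) (t0' - t1)); auto.
        exfalso. apply K. repeat split; lra. }
      assert (Y : t0 - t1' <= 0 \/ 2 * PI <= t0 - t1').
      { destruct (Rle_dec (t0 - t1') 0); auto. destruct (Rle_dec (2 * PI) (t0 - t1')); auto.
        exfalso. apply K'. repeat split; lra. }
      lra.
Qed.

(** * Agreement with the integral along rays *)

(** The substitution [t = e^x]. *)
Lemma is_RI_gen_ray : forall G l, (forall x, cts G x) -> is_RI G l ->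
  is_RInt_gen (V := C_R_CompleteNormedModule) (fun t => (RtoC (/ t) * G (ln t))%C)
    (at_right 0) (Rbar_locally p_infty) l.
Proof.
  intros G l HG H P HP. specialize (H P HP).
  destruct H as [Q S [A HA] [B HB] HQ].
  apply Filter_prod with (fun a => 0 < a < exp A) (fun b => Rmax (exp A) (exp B) < b).
  - exists (mkposreal _ (exp_pos A)). intros y Hy Hy0.
    assert (Rabs (y - 0) < exp A) by exact Hy. rewrite Rminus_0_r, Rabs_pos_eq in H by lra. lra.
  - eexists. intros x Hx. exact Hx.
  - intros a b Ha Hb.
    pose proof (Rmax_l (exp A) (exp B)). pose proof (Rmax_r (exp A) (exp B)).
    destruct (HQ (ln a) (ln b)) as [y [Hy1 Hy2]].
    + apply HA. rewrite <- (ln_exp A). apply ln_increasing; lra.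
    + apply HB. rewrite <- (ln_exp B). apply ln_increasing; [apply exp_pos|lra].
    + exists y. split; auto. simpl in *.
      apply (is_RInt_unique (V := C_R_CompleteNormedModule)) in Hy1. rewrite <- Hy1.
      apply (is_RInt_ext (V := C_R_CompleteNormedModule) (fun t => scal (/ t) (G (ln t)))).
      * intros x Hx. apply scal_R_Cmult.
      * apply (is_RInt_comp (V := C_R_CompleteNormedModule) G ln (fun t => / t)).
        -- intros x Hx. apply cts_continuous. auto.
        -- intros x Hx. rewrite Rmin_left, Rmax_right in Hx by lra. split.
           ++ apply is_derive_Reals. apply derivable_pt_lim_ln. lra.
           ++ apply (ex_derive_continuous (V := R_NormedModule)). auto_derive. lra.
Qed.

Lemma ray_integral_RI : forall theta f K, dom (fun x => f (x, theta) * Cexp (x, theta))%C K ->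
  ray_integral theta f = RI (fun x => f (x, theta) * Cexp (x, theta))%C.
Proof.
  intros theta f K D. unfold ray_integral.
  set (k := Cexp (Ci * theta)).
  assert (Hk : k <> 0%C) by apply Cexp_neq_0.
  set (G := fun x : R => (f (x, theta) * Cexp (x, theta))%C) in *.
  pose proof (dom_scal G K (/ k)%C D) as D'.
  pose proof (is_RI_gen_ray _ _ (proj1 D') (is_RI_dom _ _ D')) as H.
  rewrite (RI_scal G K) in H by auto.
  assert (E : RInt_gen (V := C_R_CompleteNormedModule) (fun t => f (ln t, theta)) (at_right 0) (Rbar_locally p_infty) = (/ k * RI G)%C).
  { apply (is_RInt_gen_unique (V := C_R_CompleteNormedModule)).
    refine (is_RInt_gen_ext (V := C_R_CompleteNormedModule) _ _ _ _ H).
    apply Filter_prod with (fun a => 0 < a) (fun b => 0 < b).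
    - exists (mkposreal 1 Rlt_0_1). intros y _ Hy. auto.
    - exists 0. auto.
    - intros a b Ha Hb x [Hx _]. simpl in Hx.
      assert (Hx0 : 0 < x) by (eapply Rlt_trans; [|exact Hx]; apply Rmin_pos; auto).
      unfold G.
      assert (EE : Cexp (ln x, theta) = (RtoC x * k)%C).
      { unfold k. rewrite <- (exp_ln x) at 2 by auto. rewrite <- Cexp_RtoC, <- Cexp_plus. f_equal.
        apply C_ext; simpl; ring. }
      rewrite EE, RtoC_inv by lra. match goal with |- ?a = ?b => change (@eq C a b) end.
      field. split; auto. intros Q. apply RtoC_inj in Q. lra. }
  rewrite E. field. auto.
Qed.

(** Here [v_j = u_j - lz], so that [tau_j = z e^(v_j)]; the factors [Cexp u1] and [Cexp u0]
    are the Jacobians of the two rays. *)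
Lemma integrand_log : forall N0 N1 lz s0 s1 u0 u1,
  (Cexp (u0 - lz) - 1)%C <> 0%C -> (Cexp (u0 - u1) - 1)%C <> 0%C ->
  (hyperterminant2_integrand N0 N1 lz s0 s1 u0 u1 * Cexp u1 * Cexp u0)%C =
  (Cexp ((N0 + N1) * lz) * ((gamma_factor N0 (Cexp (s0 + lz)) (u0 - lz) * expm1_inv (- (u0 - lz)))
    * (gamma_factor N1 (Cexp (s1 + lz)) (u1 - lz) * expm1_inv ((u0 - lz) - (u1 - lz)))))%C.
Proof.
  intros N0 N1 lz s0 s1 u0 u1 H1 H2.
  assert (Hz : (Cexp lz - Cexp u0)%C <> 0%C).
  { intros E. apply H1. rewrite Cexp_minus. replace (Cexp u0) with (Cexp lz).
    - field. apply Cexp_neq_0.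
    - replace (Cexp u0) with (Cexp lz - (Cexp lz - Cexp u0))%C by ring. rewrite E. ring. }
  assert (H01 : (Cexp u0 - Cexp u1)%C <> 0%C).
  { intros E. apply H2. rewrite Cexp_minus. replace (Cexp u0) with (Cexp u1).
    - field. apply Cexp_neq_0.
    - replace (Cexp u1) with (Cexp u0 - (Cexp u0 - Cexp u1))%C by ring. rewrite E. ring. }
  unfold hyperterminant2_integrand, gamma_factor, expm1_inv.
  replace (- (u0 - lz))%C with (lz - u0)%C by ring.
  replace (u0 - lz - (u1 - lz))%C with (u0 - u1)%C by ring.
  assert (E0 : (Cexp (s0 + lz) * Cexp (u0 - lz) = Cexp s0 * Cexp u0)%C)
    by (rewrite <- !Cexp_plus; f_equal; ring).
  assert (E1 : (Cexp (s1 + lz) * Cexp (u1 - lz) = Cexp s1 * Cexp u1)%C)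
    by (rewrite <- !Cexp_plus; f_equal; ring).
  rewrite E0, E1.
  replace (N0 * (u0 - lz))%C with (N0 * u0 - N0 * lz)%C by ring.
  replace (N1 * (u1 - lz))%C with (N1 * u1 - N1 * lz)%C by ring.
  replace ((N0 + N1) * lz)%C with (N0 * lz + N1 * lz)%C by ring.
  rewrite !Cexp_minus, !Cexp_plus, !Cexp_minus.
  pose proof (Cexp_neq_0 u0). pose proof (Cexp_neq_0 u1). pose proof (Cexp_neq_0 lz).
  pose proof (Cexp_neq_0 (N0 * lz)). pose proof (Cexp_neq_0 (N1 * lz)).
  field. repeat split; auto.
Qed.

(** On the ray of argument [PI - Im s_j] the product [sigma_j tau_j] is negative; in the
    variable [v_j] this ray is a horizontal line, and its height is admissible. *)
Lemma base_agree : forall N0 N1 lz s0 s1, 1 <= Re N0 -> 1 <= Re N1 -> base_domain (lz, s0, s1) ->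
  admissible (s0 + lz) (s1 + lz) (PI - Im s0 - Im lz) (PI - Im s1 - Im lz) /\
  hyperterminant2_integral N0 N1 lz s0 s1 =
   (Cexp ((N0 + N1) * lz) * Phi N0 N1 (Cexp (s0 + lz)) (Cexp (s1 + lz)) (PI - Im s0 - Im lz) (PI - Im s1 - Im lz))%C.
Proof.
  intros N0 N1 lz s0 s1 HN0 HN1 [H1 H2].
  pose proof PI_RGT_0. apply Rabs_def2 in H1. rewrite Im_plus in H1. rewrite Im_minus in H2.
  set (t0 := PI - Im s0 - Im lz). set (t1 := PI - Im s1 - Im lz).
  assert (Hok : admissible (s0 + lz) (s1 + lz) t0 t1).
  { unfold admissible, t0, t1. rewrite !Im_plus. repeat split; lra. }
  split; auto.
  set (w0 := Cexp (s0 + lz)). set (w1 := Cexp (s1 + lz)). set (A := Cexp ((N0 + N1) * lz)).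
  pose proof (admissible_rate0 _ _ _ _ Hok) as R0. pose proof (admissible_rate1 _ _ _ _ Hok) as R1.
  fold w0 in R0. fold w1 in R1.
  destruct Hok as [_ [_ [T0 T1]]].
  destruct (phi_dom2 N0 N1 w0 w1 t0 t1) as [K D]; auto.
  set (P := phi_integrand N0 N1 w0 w1 t0 t1) in *.
  set (x0 := Re lz).
  assert (Epair : forall x s, ((x, (PI - Im s)%R) - lz)%C = ((x + - x0)%R, (PI - Im s - Im lz)%R)).
  { intros. unfold x0. apply C_ext; simpl; unfold Re, Im; ring. }
  assert (Epair0 : forall x, ((x, (PI - Im s0)%R) - lz)%C = ((x + - x0)%R, t0)) by (intros; apply Epair).
  assert (Epair1 : forall x, ((x, (PI - Im s1)%R) - lz)%C = ((x + - x0)%R, t1)) by (intros; apply Epair).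
  assert (Hpt : forall x y, (hyperterminant2_integrand N0 N1 lz s0 s1 (x, (PI - Im s0)%R) (y, (PI - Im s1)%R)
      * Cexp (y, (PI - Im s1)%R) * Cexp (x, (PI - Im s0)%R))%C = (A * P (x + - x0)%R (y + - x0)%R)%C).
  { intros x y. rewrite integrand_log.
    - fold A w0 w1. rewrite Epair0, Epair1. reflexivity.
    - rewrite Epair0. apply expm1_neq_0. simpl. apply cos_lt_1. auto.
    - apply expm1_neq_0. simpl. apply cos_lt_1. unfold t0, t1 in *. lra. }
  assert (Hcut : forall (a b c : C), c <> 0%C -> (a * c = b)%C -> a = (b * / c)%C).
  { intros a b c Hc E. rewrite <- E. field. auto. }
  assert (Din : forall x, exists K', dom (fun y => (A * / Cexp (x, (PI - Im s0)%R)) * P (x + - x0)%R (y + - x0)%R)%C K').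
  { intros x. eexists. apply (dom_scal (fun y => P (x + - x0)%R (y + - x0)%R)).
    apply (dom_shift (P (x + - x0))). apply dom2_inner. exact D. }
  assert (Ein : forall x, ray_integral (PI - Im s1) (fun u1 => hyperterminant2_integrand N0 N1 lz s0 s1 (x, (PI - Im s0)%R) u1)
     = (A * / Cexp (x, (PI - Im s0)%R) * RI (P (x + - x0)%R))%C).
  { intros x.
    assert (Ef : forall y, (A * / Cexp (x, (PI - Im s0)%R) * P (x + - x0)%R (y + - x0)%R)%C =
      (hyperterminant2_integrand N0 N1 lz s0 s1 (x, (PI - Im s0)%R) (y, (PI - Im s1)%R) * Cexp (y, (PI - Im s1)%R))%C).
    { intros y. symmetry. rewrite (Hcut _ _ _ (Cexp_neq_0 (x, (PI - Im s0)%R)) (Hpt x y)). ring. }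
    destruct (Din x) as [K' D'].
    erewrite ray_integral_RI by (eapply dom_ext; [exact Ef|exact D']).
    rewrite <- (RI_ext _ _ Ef).
    rewrite <- (RI_scal (P (x + - x0)) (K * wt (x + - x0))) by (apply dom2_inner; auto).
    apply (RI_shift (fun y => A * / Cexp (x, (PI - Im s0)%R) * P (x + - x0)%R y)%C _ (- x0)
      (dom_scal _ _ _ (dom2_inner _ _ (x + - x0) D))). }
  unfold hyperterminant2_integral.
  assert (Eo : forall x, (A * RI (P (x + - x0)%R))%C = (ray_integral (PI - Im s1) (fun u1 => hyperterminant2_integrand N0 N1 lz s0 s1 (x, (PI - Im s0)%R) u1) * Cexp (x, (PI - Im s0)%R))%C).
  { intros x. rewrite Ein. field. apply Cexp_neq_0. }
  pose proof (dom_scal _ _ A (dom2_outer _ _ D)) as Do.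
  pose proof (dom_shift _ _ (- x0) Do) as Do'.
  erewrite (ray_integral_RI (PI - Im s0)) by (eapply dom_ext; [exact Eo|exact Do']).
  rewrite <- (RI_ext _ _ Eo).
  rewrite (RI_shift (fun x => A * RI (P x))%C _ (- x0) Do).
  apply (RI_scal _ _ A (dom2_outer _ _ D)).
Qed.

(** * Analytic continuation in three variables *)

Notation CV := C_NormedModule.

Lemma C3_Cmod_of_ball : forall (p q : C3) e, ball (M := C3) p e q ->
  Cmod (fst (fst q) - fst (fst p))%C < 2 * e /\ Cmod (snd (fst q) - snd (fst p))%C < 2 * e /\
  Cmod (snd q - snd p)%C < 2 * e.
Proof.
  intros p q e [[H1 H2] H3]. repeat split; apply Cmod_of_ball; auto.
Qed.

Lemma filterdiff_quadratic : forall (f : C -> C -> C) (u v l0 l1 : C) K d, 0 < d -> 0 <= K ->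
  (forall h0 h1, Cmod h0 < d -> Cmod h1 < d ->
    Cmod (f (u + h0) (v + h1) - f u v - l0 * h0 - l1 * h1)%C <= K * (Cmod h0 + Cmod h1) ^ 2) ->
  filterdiff (K := C_AbsRing) (U := prod_NormedModule C_AbsRing CV CV) (V := CV) (fun t => f (fst t) (snd t)) (locally (u, v))
    (fun t => l0 * fst t + l1 * snd t)%C.
Proof.
  intros f u v l0 l1 K d Hd HK H. split.
  - split.
    + intros x y. change (@eq C (l0 * (fst x + fst y) + l1 * (snd x + snd y))
        (l0 * fst x + l1 * snd x + (l0 * fst y + l1 * snd y)))%C. ring.
    + intros k x. change (@eq C (l0 * (k * fst x) + l1 * (k * snd x)) (k * (l0 * fst x + l1 * snd x)))%C. ring.
    + exists (Cmod l0 + Cmod l1 + 1). pose proof (Cmod_ge_0 l0). pose proof (Cmod_ge_0 l1). split; [lra|].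
      intros x. change (Cmod (l0 * fst x + l1 * snd x)%C <= (Cmod l0 + Cmod l1 + 1) * norm x).
      assert (N1 : Cmod (fst x) <= norm x) by apply (norm_le_prod_norm_1 (U := CV) (V := CV) x).
      assert (N2 : Cmod (snd x) <= norm x) by apply (norm_le_prod_norm_2 (U := CV) (V := CV) x).
      eapply Rle_trans; [apply Cmod_triangle|]. rewrite !Cmod_mult.
      pose proof (Cmod_ge_0 (fst x)). nra.
  - intros x Hx.
    pose proof (@is_filter_lim_locally_unique C_AbsRing (prod_NormedModule C_AbsRing CV CV) (u, v) x Hx) as E.
    subst x. clear Hx. intros eps. pose proof (cond_pos eps) as He.
    set (r := Rmin (d / 2) (eps / (8 * (K + 1)))).
    assert (Hr : 0 < r) by (unfold r; apply Rmin_pos; [lra|]; apply Rdiv_lt_0_compat; lra).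
    assert (Hr1 : r <= d / 2) by apply Rmin_l. assert (Hr2 : r <= eps / (8 * (K + 1))) by apply Rmin_r.
    assert (Main : forall a b : C, Cmod (a - u) < 2 * r -> Cmod (b - v) < 2 * r ->
      Cmod (f a b - f u v - (l0 * (a - u) + l1 * (b - v)))%C <= eps * Rmax (Cmod (a - u)) (Cmod (b - v))).
    { intros a b B1 B2. set (h0 := (a - u)%C) in *. set (h1 := (b - v)%C) in *.
      specialize (H h0 h1 ltac:(lra) ltac:(lra)).
      replace (u + h0)%C with a in H by (unfold h0; ring).
      replace (v + h1)%C with b in H by (unfold h1; ring).
      replace (f a b - f u v - (l0 * h0 + l1 * h1))%C with (f a b - f u v - l0 * h0 - l1 * h1)%C by ring.
      eapply Rle_trans; [exact H|].
      pose proof (Rmax_l (Cmod h0) (Cmod h1)). pose proof (Rmax_r (Cmod h0) (Cmod h1)).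
      assert (Hm : Rmax (Cmod h0) (Cmod h1) <= 2 * r) by (apply Rmax_lub; lra).
      revert H0 H1 Hm. generalize (Rmax (Cmod h0) (Cmod h1)). intros m H0 H1 Hm.
      pose proof (Cmod_ge_0 h0). pose proof (Cmod_ge_0 h1).
      apply Rle_trans with (K * (2 * m) ^ 2); [apply Rmult_le_compat_l; auto; apply pow_incr; lra|].
      assert (K * (4 * m) <= eps).
      { apply Rle_trans with ((K + 1) * (4 * (2 * (eps / (8 * (K + 1)))))).
        - apply Rmult_le_compat; lra.
        - apply Req_le. field. lra. }
      replace (K * (2 * m) ^ 2) with (K * (4 * m) * m) by ring. apply Rmult_le_compat_r; lra. }
    exists (mkposreal r Hr). intros y [B1 B2].
    specialize (Main (fst y) (snd y) (Cmod_of_ball _ _ _ B1) (Cmod_of_ball _ _ _ B2)).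
    eapply Rle_trans; [exact Main|]. apply Rmult_le_compat_l; [lra|].
    apply (norm_prod (U := CV) (V := CV) (fst y - u)%C (snd y - v)%C).
Qed.

Lemma filterdiff_CD : forall (f : C -> C) (c l : C), CD f c l ->
  filterdiff (K := C_AbsRing) (U := CV) (V := CV) f (locally c) (fun t => l * t)%C.
Proof.
  intros f c l H. split.
  - split.
    + intros x y. change (@eq C (l * (x + y)) (l * x + l * y))%C. ring.
    + intros k x. change (@eq C (l * (k * x)) (k * (l * x)))%C. ring.
    + exists (Cmod l + 1). pose proof (Cmod_ge_0 l). split; [lra|].
      intros x. change (Cmod (l * x)%C <= (Cmod l + 1) * Cmod x). rewrite Cmod_mult.
      pose proof (Cmod_ge_0 x). nra.
  - intros x Hx. pose proof (@is_filter_lim_locally_unique C_AbsRing CV c x Hx) as E. subst x. clear Hx.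
    intros eps. destruct (H eps (cond_pos eps)) as [d [Hd K]].
    assert (Main : forall y : C, Cmod (y - c) < 2 * (d / 2) -> Cmod (f y - f c - l * (y - c))%C <= eps * Cmod (y - c)).
    { intros y B. replace (2 * (d / 2)) with d in B by field.
      specialize (K (y - c)%C I B). replace (c + (y - c))%C with y in K by ring. exact K. }
    assert (Hd2 : 0 < d / 2) by lra. exists (mkposreal _ Hd2). intros y B.
    exact (Main y (Cmod_of_ball _ _ _ B)).
Qed.

Definition c3line (p d : C3) (t : C) : C3 := plus p (scal t d).

(** Complex lines reduce uniqueness of the continuation to functions of one variable. *)
Lemma CD_c3line : forall (f : C3 -> C) (p d : C3) (t : C),
  ex_filterdiff (K := C_AbsRing) (U := C3) (V := CV) f (locally (c3line p d t)) ->
  exists l, CD (fun z => f (c3line p d z)) t l.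
Proof.
  intros f p d t [l [Hl H]]. exists (l d).
  intros eps He.
  specialize (H (c3line p d t) (fun P HP => HP)).
  pose proof (norm_ge_0 d) as Hn.
  assert (P : 0 < eps / (norm d + 1)) by (apply Rdiv_lt_0_compat; lra).
  specialize (H (mkposreal _ P)).
  pose proof (locally_norm_le_locally (K := C_AbsRing) (V := C3) (c3line p d t) _ H) as H'. clear H. rename H' into H.
  destruct H as [[r Hr] H].
  assert (P2 : 0 < r / (norm d + 1)) by (apply Rdiv_lt_0_compat; lra).
  exists (r / (norm d + 1)). split; auto. intros h _ Hh.
  assert (E : minus (c3line p d (t + h)%C) (c3line p d t) = scal h d).
  { destruct p as [[p1 p2] p3], d as [[d1 d2] d3]. unfold c3line.
    assert (X : forall a b : C, (a + (t + h) * b + - (a + t * b) = h * b)%C) by (intros; ring).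
    change (@eq (C * C * C) ((p1 + (t + h) * d1 + - (p1 + t * d1), p2 + (t + h) * d2 + - (p2 + t * d2)),
      p3 + (t + h) * d3 + - (p3 + t * d3))%C ((h * d1, h * d2), h * d3)%C).
    rewrite !X. reflexivity. }
  assert (NB : norm (scal h d) <= Cmod h * norm d) by apply (norm_scal (K := C_AbsRing) h d).
  specialize (H (c3line p d (t + h)%C)).
  assert (HB : ball_norm (c3line p d t) (mkposreal r Hr) (c3line p d (t + h)%C)).
  { unfold ball_norm. rewrite E. simpl. eapply Rle_lt_trans; [exact NB|].
    apply Rle_lt_trans with (Cmod h * (norm d + 1)); [apply Rmult_le_compat_l; [apply Cmod_ge_0|lra]|].
    apply Rmult_lt_compat_r with (r := norm d + 1) in Hh; [|lra].
    replace (r / (norm d + 1) * (norm d + 1)) with r in Hh by (field; lra). auto. }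
  specialize (H HB). rewrite E in H.
  rewrite (linear_scal _ Hl) in H.
  change (Cmod (f (c3line p d (t + h)%C) - f (c3line p d t) - h * l d)%C <= eps / (norm d + 1) * norm (scal h d)) in H.
  rewrite (Cmult_comm (l d)). eapply Rle_trans; [exact H|].
  apply Rle_trans with (eps / (norm d + 1) * (Cmod h * (norm d + 1))).
  - apply Rmult_le_compat_l; [lra|]. eapply Rle_trans; [exact NB|]. apply Rmult_le_compat_l; [apply Cmod_ge_0|lra].
  - apply Req_le. field. lra.
Qed.

(** * The domain of the continuation *)

Section Continuation.
Variables N0 N1 : C.
Hypotheses (HN0 : 1 <= Re N0) (HN1 : 1 <= Re N1).

(** The conditions on the heights are linear in them and in the imaginary parts of the
    logarithms, which makes this set convex. *)
Definition cont_domain (p : C3) : Prop :=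
  exists t0 t1, admissible (snd (fst p) + fst (fst p))%C (snd p + fst (fst p))%C t0 t1.

(** A choice of admissible heights; by [Phi_indep] nothing depends on it. *)
Definition heights (p : C3) : R * R :=
  epsilon (inhabits (0, 0)) (fun t => admissible (snd (fst p) + fst (fst p))%C (snd p + fst (fst p))%C (fst t) (snd t)).

Definition cont_value (t0 t1 : R) (p : C3) : C :=
  (Cexp ((N0 + N1) * fst (fst p)) *
    Phi N0 N1 (Cexp (snd (fst p) + fst (fst p))) (Cexp (snd p + fst (fst p))) t0 t1)%C.

Definition continuation (p : C3) : C := cont_value (fst (heights p)) (snd (heights p)) p.

Lemma continuation_eq : forall p t0 t1, admissible (snd (fst p) + fst (fst p))%C (snd p + fst (fst p))%C t0 t1 ->
  continuation p = cont_value t0 t1 p.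
Proof.
  intros p t0 t1 H. unfold continuation, cont_value. apply f_equal. apply Phi_indep; auto.
  unfold heights. apply (epsilon_spec (inhabits (0, 0))
    (fun t => admissible (snd (fst p) + fst (fst p))%C (snd p + fst (fst p))%C (fst t) (snd t))).
  exists (t0, t1). auto.
Qed.

Lemma admissible_near : forall (a b : C) t0 t1, admissible a b t0 t1 -> exists r, 0 < r /\ forall a' b' : C,
  Cmod (a' - a) < r -> Cmod (b' - b) < r -> admissible a' b' t0 t1.
Proof.
  intros a b t0 t1 [[A1 A2] [[B1 B2] [D E]]].
  set (r := Rmin (Rmin (Im a + t0 - PI / 2) (3 * (PI / 2) - (Im a + t0)))
    (Rmin (Im b + t1 - PI / 2) (3 * (PI / 2) - (Im b + t1)))).
  assert (R1 : r <= Im a + t0 - PI / 2) by (eapply Rle_trans; [apply Rmin_l|apply Rmin_l]).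
  assert (R2 : r <= 3 * (PI / 2) - (Im a + t0)) by (eapply Rle_trans; [apply Rmin_l|apply Rmin_r]).
  assert (R3 : r <= Im b + t1 - PI / 2) by (eapply Rle_trans; [apply Rmin_r|apply Rmin_l]).
  assert (R4 : r <= 3 * (PI / 2) - (Im b + t1)) by (eapply Rle_trans; [apply Rmin_r|apply Rmin_r]).
  exists r. split; [unfold r; repeat apply Rmin_pos; lra|]. intros a' b' Ha Hb.
  pose proof (im_le_Cmod (a' - a)) as I1. pose proof (im_le_Cmod (b' - b)) as I2.
  apply Rabs_le_between in I1. apply Rabs_le_between in I2. rewrite Im_minus in I1, I2.
  unfold admissible. repeat split; lra.
Qed.

Lemma admissible_open : forall (p : C3) t0 t1, admissible (snd (fst p) + fst (fst p))%C (snd p + fst (fst p))%C t0 t1 ->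
  locally p (fun q : C3 => admissible (snd (fst q) + fst (fst q))%C (snd q + fst (fst q))%C t0 t1).
Proof.
  intros p t0 t1 H. destruct (admissible_near _ _ _ _ H) as [r [Hr K]].
  assert (S : forall x x' y y' : C, Cmod (x' - x) < 2 * (r / 4) -> Cmod (y' - y) < 2 * (r / 4) ->
     Cmod (x' + y' - (x + y))%C < r).
  { intros x x' y y' Hx Hy. replace (x' + y' - (x + y))%C with ((x' - x) + (y' - y))%C by ring.
    eapply Rle_lt_trans; [apply Cmod_triangle|]. lra. }
  assert (Hr4 : 0 < r / 4) by lra.
  exists (mkposreal _ Hr4). intros q Hq. apply C3_Cmod_of_ball in Hq. destruct Hq as [Q1 [Q2 Q3]].
  apply K; apply S; assumption.
Qed.

Lemma cont_domain_open : open cont_domain.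
Proof.
  intros p [t0 [t1 H]]. eapply filter_imp; [|apply (admissible_open p t0 t1 H)].
  intros q Hq. exists t0, t1. exact Hq.
Qed.

Lemma cont_domain_convex : convex3 cont_domain.
Proof.
  intros [[p1 p2] p3] [[q1 q2] q3] t [t0 [t1 H]] [t0' [t1' H']] Ht.
  exists ((1 - t) * t0 + t * t0'), ((1 - t) * t1 + t * t1').
  unfold admissible in *. simpl in H, H'.
  match goal with |- context [plus ?a ?b] =>
    change (plus a b) with ((((RtoC (1 - t) * p1 + RtoC t * q1), (RtoC (1 - t) * p2 + RtoC t * q2)), (RtoC (1 - t) * p3 + RtoC t * q3))%C : C3) end.
  cbn [fst snd]. rewrite !Im_plus, !Im_mult, !Re_RtoC, !Im_RtoC in *.
  unfold Im in *.
  destruct H as [[A1 A2] [[B1 B2] [[D1 D2] [E1 E2]]]]. destruct H' as [[A1' A2'] [[B1' B2'] [[D1' D2'] [E1' E2']]]].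
  assert (X : forall a a' b, a < b -> a' < b -> (1 - t) * a + t * a' < b).
  { intros a a' b Ha Ha'. destruct (Req_dec t 0) as [->|]; [lra|].
    assert (t * a' < t * b) by (apply Rmult_lt_compat_l; lra).
    assert ((1 - t) * a <= (1 - t) * b) by (apply Rmult_le_compat_l; lra). lra. }
  assert (Y : forall a a' b, b < a -> b < a' -> b < (1 - t) * a + t * a').
  { intros a a' b Ha Ha'. specialize (X (- a) (- a') (- b) ltac:(lra) ltac:(lra)). lra. }
  repeat split.
  - pose proof (Y _ _ _ A1 A1'). lra.
  - pose proof (X _ _ _ A2 A2'). lra.
  - pose proof (Y _ _ _ B1 B1'). lra.
  - pose proof (X _ _ _ B2 B2'). lra.
  - pose proof (Y _ _ _ D1 D1'). lra.
  - pose proof (X _ _ _ D2 D2'). lra.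
  - pose proof (Y _ _ _ E1 E1'). lra.
  - pose proof (X _ _ _ E2 E2'). lra.
Qed.

Lemma cont_value_diff : forall p t0 t1, admissible (snd (fst p) + fst (fst p))%C (snd p + fst (fst p))%C t0 t1 ->
  ex_filterdiff (K := C_AbsRing) (U := C3) (V := CV) (cont_value t0 t1) (locally p).
Proof.
  intros p t0 t1 H.
  assert (L1 : is_linear (K := C_AbsRing) (U := C3) (V := CV) (fun q => fst (fst q))).
  { apply (is_linear_comp (K := C_AbsRing) (U := C3) (V := prod_NormedModule C_AbsRing CV CV) (W := CV) fst fst); apply is_linear_fst. }
  assert (L2 : is_linear (K := C_AbsRing) (U := C3) (V := CV) (fun q => snd (fst q))).
  { apply (is_linear_comp (K := C_AbsRing) (U := C3) (V := prod_NormedModule C_AbsRing CV CV) (W := CV) fst snd); [apply is_linear_fst|apply is_linear_snd]. }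
  assert (L3 : is_linear (K := C_AbsRing) (U := C3) (V := CV) snd) by apply is_linear_snd.
  pose proof (filterdiff_linear (F := locally p) _ L1) as D1.
  pose proof (filterdiff_linear (F := locally p) _ L2) as D2.
  pose proof (filterdiff_linear (F := locally p) _ L3) as D3.
  pose proof (filterdiff_plus_fct (K := C_AbsRing) (U := C3) (V := CV) (F := locally p) _ _ _ _ D2 D1) as A0.
  pose proof (filterdiff_plus_fct (K := C_AbsRing) (U := C3) (V := CV) (F := locally p) _ _ _ _ D3 D1) as A1.
  pose proof (filterdiff_comp' (K := C_AbsRing) (U := C3) (V := CV) (W := CV) _ Cexp p _ _ A0 (filterdiff_CD _ _ _ (CD_Cexp _))) as E0.
  pose proof (filterdiff_comp' (K := C_AbsRing) (U := C3) (V := CV) (W := CV) _ Cexp p _ _ A1 (filterdiff_CD _ _ _ (CD_Cexp _))) as E1.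
  assert (HC : forall c, CD (fun z => Cexp ((N0 + N1) * z)) c (Cexp ((N0 + N1) * c) * (N0 + N1))%C).
  { intros c. eapply deriv_eq; [|apply deriv_Cexp, deriv_scal, deriv_id]. ring. }
  pose proof (filterdiff_comp' (K := C_AbsRing) (U := C3) (V := CV) (W := CV) _ _ p _ _ D1 (filterdiff_CD _ _ _ (HC _))) as EN.
  destruct (Phi_diff N0 N1 (Cexp (snd (fst p) + fst (fst p))) (Cexp (snd p + fst (fst p))) t0 t1) as [l0 [l1 [K [d [Hd [HK HP]]]]]]; auto.
  { apply (admissible_rate0 _ _ _ _ H). } { apply (admissible_rate1 _ _ _ _ H). } { apply H. } { apply H. }
  pose proof (filterdiff_quadratic (fun a b => Phi N0 N1 a b t0 t1) _ _ _ _ K d Hd HK HP) as DP.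
  pose proof (filterdiff_comp'_2 (K := C_AbsRing) (T := C3) (U := CV) (V := CV) (W := CV) _ _ (fun a b => Phi N0 N1 a b t0 t1) p _ _
    (fun a b : C => (l0 * a + l1 * b)%C) E0 E1 DP) as DPc.
  set (u := Cexp ((N0 + N1) * fst (fst p))).
  set (v := Phi N0 N1 (Cexp (snd (fst p) + fst (fst p))) (Cexp (snd p + fst (fst p))) t0 t1).
  assert (DM : forall a b : C, filterdiff (K := C_AbsRing) (U := prod_NormedModule C_AbsRing CV CV) (V := CV) (fun t => (fst t * snd t)%C) (locally (a, b))
    (fun t => b * fst t + a * snd t)%C).
  { intros a b. apply (filterdiff_quadratic (fun x y => x * y)%C a b b a 1 1); try lra.
    intros h0 h1 _ _. replace ((a + h0) * (b + h1) - a * b - b * h0 - a * h1)%C with (h0 * h1)%C by ring.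
    rewrite Cmod_mult. pose proof (Cmod_ge_0 h0). pose proof (Cmod_ge_0 h1). nra. }
  eexists.
  exact (filterdiff_comp'_2 (K := C_AbsRing) (T := C3) (U := CV) (V := CV) (W := CV) _ _ (fun x y : C => (x * y)%C) p _ _
    (fun a b : C => (v * a + u * b)%C) EN DPc (DM u v)).
Qed.

Lemma continuation_holomorphic : holomorphic_on cont_domain continuation.
Proof.
  intros p [t0 [t1 H]]. destruct (cont_value_diff p t0 t1 H) as [l Hl]. exists l.
  apply (filterdiff_ext_locally (K := C_AbsRing) (U := C3) (V := CV) (cont_value t0 t1) continuation); auto.
  eapply filter_imp; [|apply (admissible_open p t0 t1 H)]. intros q Hq. simpl in Hq. symmetry. apply continuation_eq. auto.
Qed.

Lemma is_hyperterminant2_continuation : forall p, cont_domain p -> is_hyperterminant2 N0 N1 p (continuation p).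
Proof.
  intros p Hp. exists cont_domain, continuation.
  repeat split; auto.
  - apply cont_domain_open.
  - apply cont_domain_convex.
  - intros [[lz s0] s1] Hq. destruct (base_agree N0 N1 lz s0 s1 HN0 HN1 Hq) as [Ho _].
    eexists. eexists. exact Ho.
  - apply continuation_holomorphic.
  - intros lz s0 s1 Hq. destruct (base_agree N0 N1 lz s0 s1 HN0 HN1 Hq) as [Ho E].
    rewrite E. apply (continuation_eq ((lz, s0, s1) : C3)). exact Ho.
Qed.
End Continuation.

(** * Uniqueness of the continuation *)

Lemma open_c3line : forall (W : C3 -> Prop) (p d : C3) (t : C), open W -> W (c3line p d t) ->
  exists r, 0 < r /\ forall z, Cmod (z - t) < r -> W (c3line p d z).
Proof.
  intros W p d t HW Ht. specialize (HW _ Ht).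
  apply (locally_norm_le_locally (K := C_AbsRing) (V := C3)) in HW. destruct HW as [[r Hr] H].
  pose proof (norm_ge_0 d).
  exists (r / (norm d + 1)). split; [apply Rdiv_lt_0_compat; lra|]. intros z Hz. apply H.
  unfold ball_norm. simpl.
  assert (E : minus (c3line p d z) (c3line p d t) = scal (z - t)%C d).
  { destruct p as [[p1 p2] p3], d as [[d1 d2] d3].
    assert (X : forall a b : C, (a + z * b + - (a + t * b) = (z - t) * b)%C) by (intros; ring).
    change (@eq (C * C * C) ((p1 + z * d1 + - (p1 + t * d1), p2 + z * d2 + - (p2 + t * d2)),
      p3 + z * d3 + - (p3 + t * d3))%C (((z - t) * d1, (z - t) * d2), (z - t) * d3)%C).
    rewrite !X. reflexivity. }
  rewrite E. eapply Rle_lt_trans; [apply (norm_scal (K := C_AbsRing) (z - t)%C d)|].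
  change (Cmod (z - t)%C * norm d < r).
  apply Rle_lt_trans with (Cmod (z - t)%C * (norm d + 1)); [apply Rmult_le_compat_l; [apply Cmod_ge_0|lra]|].
  apply Rmult_lt_compat_r with (r := norm d + 1) in Hz; [|lra].
  replace (r / (norm d + 1) * (norm d + 1)) with r in Hz by (field; lra). auto.
Qed.

Lemma convex_c3line : forall (W : C3 -> Prop) (p d : C3) (r : R), convex3 W ->
  (forall z, Cmod (z - 0)%C < r -> W (c3line p d z)) -> (forall z, Cmod (z - 1)%C < r -> W (c3line p d z)) ->
  forall (t : R) (z : C), 0 <= t <= 1 -> Cmod (z - t)%C < r -> W (c3line p d z).
Proof.
  intros W p d r HW H0 H1 t z Ht Hz.
  set (k := (z - t)%C) in *.
  assert (A : W (c3line p d k)) by (apply H0; replace (k - 0)%C with k by ring; auto).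
  assert (B : W (c3line p d (1 + k)%C)) by (apply H1; replace (1 + k - 1)%C with k by ring; auto).
  pose proof (HW _ _ t A B Ht) as Q.
  replace (c3line p d z) with (plus (scal (RtoC (1 - t)) (c3line p d k)) (scal (RtoC t) (c3line p d (1 + k)%C))); auto.
  destruct p as [[p1 p2] p3], d as [[d1 d2] d3].
  assert (X : forall a b : C, (RtoC (1 - t) * (a + k * b) + RtoC t * (a + (1 + k) * b) = a + z * b)%C).
  { intros. unfold k. rewrite RtoC_minus. ring. }
  change (@eq (C * C * C) ((RtoC (1 - t) * (p1 + k * d1) + RtoC t * (p1 + (1 + k) * d1),
    RtoC (1 - t) * (p2 + k * d2) + RtoC t * (p2 + (1 + k) * d2)), RtoC (1 - t) * (p3 + k * d3) + RtoC t * (p3 + (1 + k) * d3))%C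
    ((p1 + z * d1, p2 + z * d2), p3 + z * d3)%C).
  rewrite !X. reflexivity.
Qed.

(** Two continuations agree near a point of the base domain.  Since both domains are convex,
    they contain a neighbourhood of the segment from there to [p] in the complex line through
    these points, and the identity theorem applies on it. *)
Lemma is_hyperterminant2_unique : forall N0 N1 p v1 v2,
  is_hyperterminant2 N0 N1 p v1 -> is_hyperterminant2 N0 N1 p v2 -> v1 = v2.
Proof.
  intros N0 N1 p v1 v2 [W1 [F1 [O1 [X1 [B1 [P1 [H1 [E1 ->]]]]]]]] [W2 [F2 [O2 [X2 [B2 [P2 [H2 [E2 ->]]]]]]]].
  (* the point [z = sigma_0 = 1], [sigma_1 = e^(i PI)] of the base domain *)
  set (q := ((RtoC 0, RtoC 0), (Ci * PI)%C) : C3).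
  set (d := minus p q).
  assert (EP : c3line q d 1%C = p).
  { destruct p as [[p1 p2] p3]. unfold d, q.
    change (@eq (C * C * C) ((0 + 1 * (p1 + - 0), 0 + 1 * (p2 + - 0)), Ci * PI + 1 * (p3 + - (Ci * PI)))%C ((p1, p2), p3)).
    assert (X : forall a b : C, (a + 1 * (b + - a) = b)%C) by (intros; ring). rewrite !X. reflexivity. }
  assert (EQ : c3line q d 0%C = q).
  { destruct p as [[p1 p2] p3]. unfold d, q.
    change (@eq (C * C * C) ((0 + 0 * (p1 + - 0), 0 + 0 * (p2 + - 0)), Ci * PI + 0 * (p3 + - (Ci * PI)))%C ((RtoC 0, RtoC 0), (Ci * PI)%C)).
    assert (X : forall a b : C, (a + 0 * b = a)%C) by (intros; ring). rewrite !X. reflexivity. }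
  assert (Hbase : exists r, 0 < r /\ forall z, Cmod z < r -> base_domain (c3line q d z)).
  { destruct d as [[d1 d2] d3].
    set (M := Cmod (d1 + d2)%C + Cmod (d3 - d2)%C + 1).
    pose proof (Cmod_ge_0 (d1 + d2)%C). pose proof (Cmod_ge_0 (d3 - d2)%C).
    exists (/ M). split; [apply Rinv_0_lt_compat; unfold M; lra|]. intros z Hz.
    change (base_domain ((0 + z * d1, 0 + z * d2), Ci * PI + z * d3)%C).
    assert (B : forall x, Cmod x <= M -> Rabs (Im (z * x)%C) < 1).
    { intros x Hx. eapply Rle_lt_trans; [apply im_le_Cmod|]. rewrite Cmod_mult.
      apply Rle_lt_trans with (Cmod z * M); [apply Rmult_le_compat_l; auto; apply Cmod_ge_0|].
      apply Rmult_lt_compat_r with (r := M) in Hz; [|unfold M; lra]. rewrite Rinv_l in Hz by (unfold M; lra). auto. }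
    pose proof PI2_1. unfold base_domain. split.
    - replace (0 + z * d2 + (0 + z * d1))%C with (z * (d1 + d2))%C by ring.
      eapply Rlt_trans; [apply B; unfold M; lra|lra].
    - replace (Ci * PI + z * d3 - (0 + z * d2))%C with (Ci * PI + z * (d3 - d2))%C by ring.
      rewrite Im_plus. replace (Im (Ci * PI)%C) with PI by (simpl; ring).
      assert (Q : Rabs (Im (z * (d3 - d2))%C) < 1) by (apply B; unfold M; lra). apply Rabs_def2 in Q. lra. }
  destruct Hbase as [r0 [Hr0 Hb]].
  assert (P1' : W1 (c3line q d 1%C)) by (rewrite EP; auto).
  assert (P2' : W2 (c3line q d 1%C)) by (rewrite EP; auto).
  destruct (open_c3line W1 q d 1%C O1 P1') as [r1 [Hr1 K1]].
  destruct (open_c3line W2 q d 1%C O2 P2') as [r2 [Hr2 K2]].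
  set (r := Rmin r0 (Rmin r1 r2)).
  assert (Hr : 0 < r) by (unfold r; repeat apply Rmin_pos; auto).
  assert (Ra : r <= r0) by apply Rmin_l.
  assert (Rb : r <= r1) by (unfold r; eapply Rle_trans; [apply Rmin_r|apply Rmin_l]).
  assert (Rc : r <= r2) by (unfold r; eapply Rle_trans; [apply Rmin_r|apply Rmin_r]).
  pose proof (identity_segment (fun z => F1 (c3line q d z) - F2 (c3line q d z))%C r Hr) as ID.
  rewrite <- EP.
  assert (G : (F1 (c3line q d 1%C) - F2 (c3line q d 1%C))%C = 0%C).
  { apply ID.
    - intros t z Ht Hz.
      destruct (CD_c3line F1 q d z) as [l1 L1].
      { apply H1. apply (convex_c3line W1 q d r X1) with (t := t); auto; intros u Hu.
        - apply B1, Hb. replace u with (u - 0)%C by ring. lra.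
        - apply K1. lra. }
      destruct (CD_c3line F2 q d z) as [l2 L2].
      { apply H2. apply (convex_c3line W2 q d r X2) with (t := t); auto; intros u Hu.
        - apply B2, Hb. replace u with (u - 0)%C by ring. lra.
        - apply K2. lra. }
      eexists. apply deriv_minus; eauto.
    - intros z Hz. specialize (Hb z ltac:(lra)). destruct (c3line q d z) as [[lz s0] s1].
      rewrite E1, E2 by exact Hb. ring. }
  replace (F1 (c3line q d 1%C)) with ((F1 (c3line q d 1%C) - F2 (c3line q d 1%C)) + F2 (c3line q d 1%C))%C by ring.
  rewrite G. ring.
Qed.

(** This replaces the definition by continuation with a double integral along any
    admissible pair of lines. *)
Theorem hyperterminant2_value : forall N0 N1 lz s0 s1 t0 t1, 1 <= Re N0 -> 1 <= Re N1 ->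
  admissible (s0 + lz) (s1 + lz) t0 t1 ->
  hyperterminant2 N0 N1 lz s0 s1 =
   (Cexp ((N0 + N1) * lz) * Phi N0 N1 (Cexp (s0 + lz)) (Cexp (s1 + lz)) t0 t1)%C.
Proof.
  intros N0 N1 lz s0 s1 t0 t1 HN0 HN1 H.
  assert (HW : cont_domain ((lz, s0, s1) : C3)) by (exists t0, t1; exact H).
  pose proof (is_hyperterminant2_continuation N0 N1 HN0 HN1 _ HW) as HF.
  rewrite (continuation_eq N0 N1 HN0 HN1 ((lz, s0, s1) : C3) t0 t1 H) in HF.
  apply (iota_unique (V := C_CompleteNormedModule)); auto.
  intros y Hy. eapply is_hyperterminant2_unique; eauto.
Qed.

(** * Rapidly decreasing functions *)

Definition rapid (f : R -> C) : Prop :=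
  (forall x, cts f x) /\ forall m, exists K, 0 <= K /\ forall x, Cmod (f x) <= K * wt x ^ m.

Lemma rapid_decay2 : forall f, rapid f -> exists K, decay2 f K.
Proof.
  intros f [H1 H2]. destruct (H2 2%nat) as [K [_ HK]]. exists K. split; auto.
  intros x. replace (wt x * wt x) with (wt x ^ 2) by ring. auto.
Qed.

Lemma rapid_dom : forall f, rapid f -> exists K, dom f K.
Proof. intros f H. destruct (rapid_decay2 f H) as [K HK]. exists K. apply decay2_dom; auto. Qed.

Lemma rapid_ext : forall f g, (forall x, f x = g x) -> rapid f -> rapid g.
Proof.
  intros f g E H. assert (EE : f = g) by (apply FunctionalExtensionality.functional_extensionality; auto).
  rewrite <- EE. auto.
Qed.

Lemma rapid_plus : forall f g, rapid f -> rapid g -> rapid (fun x => f x + g x)%C.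
Proof.
  intros f g [F1 F2] [G1 G2]. split; [intros; apply cts_plus; auto|].
  intros m. destruct (F2 m) as [K [HK A]]. destruct (G2 m) as [L [HL B]]. exists (K + L). split; [lra|].
  intros x. eapply Rle_trans; [apply Cmod_triangle|]. specialize (A x). specialize (B x). lra.
Qed.

Lemma rapid_bounded : forall f g B, rapid f -> (forall x, cts g x) -> (forall x, Cmod (g x) <= B) ->
  rapid (fun x => g x * f x)%C.
Proof.
  intros f g B [F1 F2] G1 G2. split; [intros; apply cts_mult; auto|].
  assert (HB : 0 <= B) by (eapply Rle_trans; [apply Cmod_ge_0|apply (G2 0)]).
  intros m. destruct (F2 m) as [K [HK A]]. exists (B * K). split; [nra|].
  intros x. rewrite Cmod_mult, Rmult_assoc. apply Rmult_le_compat; auto; apply Cmod_ge_0.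
Qed.

Lemma rapid_scal : forall f k, rapid f -> rapid (fun x => k * f x)%C.
Proof. intros. apply (rapid_bounded f (fun _ => k) (Cmod k)); auto; [intros; apply cts_const|intros; lra]. Qed.

Lemma rapid_minus : forall f g, rapid f -> rapid g -> rapid (fun x => f x - g x)%C.
Proof.
  intros f g Hf Hg. apply (rapid_ext (fun x => f x + (- (1)) * g x)%C); [intros; ring|].
  apply rapid_plus; auto. apply rapid_scal; auto.
Qed.

Lemma cts_pair : forall t x, cts (fun x => (x, t) : C) x.
Proof. intros t. apply (cts_line (fun v => v)). intros. eexists. apply deriv_id. Qed.

Lemma Cmod_pair_wt : forall x t, Cmod (x, t) * wt x <= 1 + Rabs t.
Proof.
  intros x t. unfold wt. assert (P : 0 < 1 + x * x) by (pose proof (Rle_0_sqr x); unfold Rsqr in *; lra).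
  apply Rmult_le_reg_r with (1 + x * x); auto. rewrite Rmult_assoc, Rinv_l by lra. rewrite Rmult_1_r.
  eapply Rle_trans; [apply Cmod_le_reim|]. simpl.
  pose proof (Rabs_pos t). pose proof (Rabs_pos x).
  assert (E : x * x = Rabs x * Rabs x) by (rewrite <- Rabs_mult, Rabs_pos_eq; auto; pose proof (Rle_0_sqr x); auto).
  rewrite E. assert (0 <= Rabs t * (Rabs x * Rabs x)) by (apply Rmult_le_pos; nra).
  assert (Rabs x <= 1 + Rabs x * Rabs x) by (pose proof (Rle_0_sqr (Rabs x - 1)); unfold Rsqr in *; nra).
  nra.
Qed.

Lemma rapid_mulY : forall f t, rapid f -> rapid (fun x => (x, t) * f x)%C.
Proof.
  intros f t [F1 F2]. split; [intros; apply cts_mult; auto; apply cts_pair|].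
  intros m. destruct (F2 (S m)) as [K [HK A]]. exists ((1 + Rabs t) * K). pose proof (Rabs_pos t). split; [nra|].
  intros x. rewrite Cmod_mult. specialize (A x). pose proof (Cmod_pair_wt x t).
  assert (0 <= wt x ^ m) by (apply pow_le; left; apply wt_pos).
  apply Rle_trans with (Cmod (x, t) * (K * wt x ^ S m)); [apply Rmult_le_compat_l; auto; apply Cmod_ge_0|].
  simpl. replace (Cmod (x, t) * (K * (wt x * wt x ^ m))) with (Cmod (x, t) * wt x * (K * wt x ^ m)) by ring.
  rewrite (Rmult_assoc (1 + Rabs t)). apply Rmult_le_compat_r; auto. apply Rmult_le_pos; auto.
Qed.

Lemma inv_line_le1 : forall v : C, Im v = 1 -> Cmod (/ v)%C <= 1.
Proof.
  intros v Hv. assert (1 <= Cmod v).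
  { eapply Rle_trans; [|apply im_le_Cmod]. rewrite Hv, Rabs_R1. lra. }
  rewrite Cmod_inv by (apply Cneq_0_Im; lra). rewrite <- Rinv_1. apply Rinv_le_contravar; lra.
Qed.

Lemma rapid_divY : forall f, rapid f -> rapid (fun x => / (x, 1%R) * f x)%C.
Proof.
  intros f H. apply (rapid_bounded f (fun x => / (x, 1%R))%C 1); auto.
  - apply (cts_line (fun v => / v)%C). intros x. eexists. apply CD_inv. apply Cneq_0_Im. simpl. lra.
  - intros x. apply inv_line_le1. reflexivity.
Qed.

(** * Gaussians *)

Definition gauss (nu Y : C) : C := Cexp (- (nu * RtoC (/ 2) * (Y * Y)))%C.

Lemma CD_gauss : forall nu Y, CD (gauss nu) Y (- (nu * Y) * gauss nu Y)%C.
Proof.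
  intros. unfold gauss. eapply deriv_eq; [|apply deriv_Cexp, deriv_opp, deriv_scal, deriv_mult; apply deriv_id].
  assert (E : (RtoC (/ 2) * (1 * Y + Y * 1) = Y)%C).
  { replace (RtoC (/ 2) * (1 * Y + Y * 1))%C with ((RtoC (/ 2) + RtoC (/ 2)) * Y)%C by ring.
    rewrite <- RtoC_plus. replace (/ 2 + / 2) with 1 by lra. ring. }
  rewrite <- Cmult_assoc, E. ring.
Qed.

(** The constant is uniform in [nu]; this is what makes the error term uniform. *)
Lemma gauss_decay : forall lam Lam T, 0 < lam -> 0 <= T -> forall m, exists K, 0 < K /\ forall nu t x,
  lam <= Re nu -> Cmod nu <= Lam -> Rabs t <= T -> Cmod (gauss nu (x, t)) <= K * wt x ^ m.
Proof.
  intros lam Lam T Hl HT m. destruct (exp_decay 1 m Rlt_0_1) as [K [HK H]].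
  set (L := Rabs Lam + 1).
  assert (HL : 1 <= L) by (unfold L; pose proof (Rabs_pos Lam); lra).
  set (D := L * (T * T) + (L * T + 1) * (L * T + 1) / lam).
  exists (exp D * K). split; [apply Rmult_lt_0_compat; auto; apply exp_pos|].
  intros nu t x H1 H2 H3. specialize (H x).
  rewrite Rmult_assoc. apply Rle_trans with (exp D * exp (- (1 * Rabs x))); [|apply Rmult_le_compat_l; auto; left; apply exp_pos].
  unfold gauss. rewrite Cmod_Cexp, <- exp_plus. apply exp_le_compat.
  assert (B1 : Rabs (Re nu) <= L).
  { eapply Rle_trans; [apply re_le_Cmod|]. eapply Rle_trans; [exact H2|]. unfold L. pose proof (Rle_abs Lam). lra. }
  assert (B2 : Rabs (Im nu) <= L).
  { eapply Rle_trans; [apply im_le_Cmod|]. eapply Rle_trans; [exact H2|]. unfold L. pose proof (Rle_abs Lam). lra. }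
  assert (E : Re (- (nu * RtoC (/ 2) * ((x, t) * (x, t))))%C = - (Re nu * (x * x - t * t) / 2) + Im nu * (x * t)).
  { rewrite Re_opp, !Re_mult, !Im_mult. simpl. field. }
  rewrite E.
  assert (T1 : t * t <= T * T).
  { replace (t * t) with (Rabs t * Rabs t) by (rewrite <- Rabs_mult; apply Rabs_pos_eq; apply Rle_0_sqr).
    pose proof (Rabs_pos t). nra. }
  assert (Q1 : Im nu * (x * t) <= L * T * Rabs x).
  { eapply Rle_trans; [apply Rle_abs|]. rewrite !Rabs_mult. pose proof (Rabs_pos x). pose proof (Rabs_pos t). pose proof (Rabs_pos (Im nu)).
    replace (L * T * Rabs x) with (L * (Rabs x * T)) by ring.
    apply Rmult_le_compat; auto; [apply Rmult_le_pos; auto|]. apply Rmult_le_compat_l; auto. }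
  assert (Q2 : Re nu * (t * t) / 2 <= L * (T * T)).
  { apply Rabs_le_between in B1. assert (0 <= t * t) by apply Rle_0_sqr.
    assert (Re nu * (t * t) <= L * (t * t)) by (apply Rmult_le_compat_r; lra). nra. }
  assert (EX : x * x = Rabs x * Rabs x) by (rewrite <- Rabs_mult; symmetry; apply Rabs_pos_eq; apply Rle_0_sqr).
  set (a := Rabs x) in *. assert (Ha : 0 <= a) by apply Rabs_pos.
  assert (Q3 : lam * (a * a) / 2 <= Re nu * (x * x) / 2) by (rewrite EX; assert (0 <= a * a) by nra; nra).
  assert (Q4 : (L * T + 1) * a <= lam * (a * a) / 2 + (L * T + 1) * (L * T + 1) / lam).
  { generalize (L * T + 1). intros M. apply Rmult_le_reg_r with lam; auto.
    replace ((lam * (a * a) / 2 + M * M / lam) * lam) with (lam * lam * (a * a) / 2 + M * M) by (field; lra).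
    pose proof (Rle_0_sqr (lam * a - M)). pose proof (Rle_0_sqr M). unfold Rsqr in *. nra. }
  unfold D. replace (Re nu * (x * x - t * t) / 2) with (Re nu * (x * x) / 2 - Re nu * (t * t) / 2) by field. lra.
Qed.

Lemma gauss_rapid : forall nu t, 0 < Re nu -> rapid (fun x => gauss nu (x, t)).
Proof.
  intros nu t Hn. split.
  - apply cts_line. intros x. eexists. apply CD_gauss.
  - intros m. destruct (gauss_decay (Re nu) (Cmod nu) (Rabs t) Hn (Rabs_pos t) m) as [K [HK H]]. exists K. split; [lra|].
    intros x. apply H; auto; lra.
Qed.

(** * Iterated integrals against powers of 1/(Y0 - s Y1) *)

(** The denominator [Y_0 - s Y_1] for [Y_0 = x + i] and [Y_1 = y]; for [s = 0] the variables
    separate, and [s = 1] is the case of interest. *)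
Definition gap (s : R) (x y : R) : C := ((x, 1%R) - RtoC s * (y, 0%R))%C.

Definition gap_inv (s : R) (n : nat) (x y : R) : C := ((/ gap s x y) ^ n)%C.

Definition gap_int (s : R) (f0 f1 : R -> C) (n : nat) : C :=
  RI2 (fun x y => f0 x * (f1 y * gap_inv s n x y))%C.

Lemma Im_gap : forall s x y, Im (gap s x y) = 1.
Proof. intros. unfold gap. simpl. ring. Qed.

Lemma gap_neq_0 : forall s x y, gap s x y <> 0%C.
Proof. intros. apply Cneq_0_Im. rewrite Im_gap. lra. Qed.

Lemma gap_inv_le1 : forall s n x y, Cmod (gap_inv s n x y) <= 1.
Proof.
  intros. unfold gap_inv. rewrite Cmod_pow. rewrite <- (pow1 n). apply pow_incr. split; [apply Cmod_ge_0|].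
  apply inv_line_le1, Im_gap.
Qed.

Lemma gap_inv_S : forall s n x y, gap_inv s (S n) x y = (/ gap s x y * gap_inv s n x y)%C.
Proof. reflexivity. Qed.

Lemma inv_diff_line : forall a b : C, a <> 0%C -> b <> 0%C -> (/ a - / b = (b - a) * (/ a * / b))%C.
Proof. intros. field. auto. Qed.

Lemma gap_dx : forall s x x' y, (gap s x' y - gap s x y)%C = RtoC (x' - x).
Proof. intros. unfold gap. apply C_ext; simpl; ring. Qed.

Lemma gap_inv_lip : forall s n x x' y, Cmod (gap_inv s n x' y - gap_inv s n x y)%C <= INR n * Rabs (x' - x).
Proof.
  intros s n x x' y. induction n.
  - unfold gap_inv. simpl. replace (1 - 1)%C with (RtoC 0) by ring. rewrite Cmod_0. lra.
  - rewrite !gap_inv_S, S_INR.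
    replace (/ gap s x' y * gap_inv s n x' y - / gap s x y * gap_inv s n x y)%C with
      ((/ gap s x' y - / gap s x y) * gap_inv s n x' y + / gap s x y * (gap_inv s n x' y - gap_inv s n x y))%C by ring.
    rewrite inv_diff_line by apply gap_neq_0.
    eapply Rle_trans; [apply Cmod_triangle|]. rewrite !Cmod_mult.
    pose proof (inv_line_le1 _ (Im_gap s x' y)) as A. pose proof (inv_line_le1 _ (Im_gap s x y)) as B.
    pose proof (gap_inv_le1 s n x' y) as P.
    rewrite <- Cmod_opp. replace (- (gap s x y - gap s x' y))%C with (gap s x' y - gap s x y)%C by ring.
    rewrite gap_dx, Cmod_R.
    pose proof (Cmod_ge_0 (/ gap s x' y)). pose proof (Cmod_ge_0 (/ gap s x y)). pose proof (Cmod_ge_0 (gap_inv s n x' y)).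
    pose proof (Rabs_pos (x' - x)). pose proof (Cmod_ge_0 (gap_inv s n x' y - gap_inv s n x y)%C).
    assert (Cmod (/ gap s x' y) * Cmod (/ gap s x y) <= 1) by nra.
    assert (0 <= Cmod (/ gap s x' y) * Cmod (/ gap s x y)) by nra.
    assert (Rabs (x' - x) * (Cmod (/ gap s x' y) * Cmod (/ gap s x y)) * Cmod (gap_inv s n x' y) <= Rabs (x' - x)).
    { apply Rle_trans with (Rabs (x' - x) * 1 * 1); [|lra]. apply Rmult_le_compat; auto; [apply Rmult_le_pos; auto|].
      apply Rmult_le_compat_l; auto. }
    assert (Cmod (/ gap s x y) * Cmod (gap_inv s n x' y - gap_inv s n x y)%C <= 1 * (INR n * Rabs (x' - x)))
      by (apply Rmult_le_compat; auto).
    lra.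
Qed.

Lemma deriv_pow : forall A f c l n, deriv A f c l -> deriv A (fun z => f z ^ (S n))%C c (INR (S n) * f c ^ n * l)%C.
Proof.
  intros A f c l n H. induction n.
  - apply (deriv_ext _ f); [intros; simpl; ring|]. eapply deriv_eq; [|exact H]. simpl. ring.
  - apply (deriv_ext _ (fun z => f z * f z ^ (S n))%C); [intros; reflexivity|].
    eapply deriv_eq; [|apply deriv_mult; [exact H|exact IHn]].
    rewrite (S_INR (S n)), RtoC_plus. simpl Cpow. ring.
Qed.

Lemma CD_gap_inv_gen : forall (a b : C) n c, (a + b * c)%C <> 0%C ->
  CD (fun z => (/ (a + b * z)) ^ n)%C c (- (INR n * b * (/ (a + b * c)) ^ (S n)))%C.
Proof.
  intros a b n c H. destruct n.
  - apply (deriv_ext _ (fun _ => 1)%C); [reflexivity|]. eapply deriv_eq; [|apply deriv_const]. simpl. ring.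
  - eapply deriv_eq; [|apply deriv_pow; eapply (deriv_comp _ (fun z => / z)%C (fun z => a + b * z)%C);
      [apply CD_inv; auto|apply CD_affine]].
    simpl Cpow. field. auto.
Qed.

Lemma gap_inv_cts : forall s n x y, cts (gap_inv s n x) y.
Proof.
  intros s n x y.
  assert (H : (((x, 1%R) + (- RtoC s) * RtoC y)%C <> 0%C)).
  { apply Cneq_0_Im. simpl. lra. }
  pose proof (RD_cts _ y _ (deriv_of_CD isreal _ _ _ (CD_gap_inv_gen (x, 1%R) (- RtoC s) n (RtoC y) H))) as K.
  revert K. apply cts_ext. intros t. unfold gap_inv, gap. f_equal. f_equal. apply C_ext; simpl; ring.
Qed.

Lemma gap_inv_ker : forall s n, ker (gap_inv s n) 1 (INR n + 2 * 1).
Proof.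
  intros s n. apply ker_bounded.
  - apply pos_INR.
  - intros. apply gap_inv_cts.
  - intros. apply gap_inv_le1.
  - intros. apply gap_inv_lip.
Qed.

Lemma gap_int_dom2 : forall s f0 f1 n, rapid f0 -> rapid f1 ->
  exists K, dom2 (fun x y => f0 x * (f1 y * gap_inv s n x y))%C K.
Proof.
  intros s f0 f1 n H0 H1. destruct (rapid_decay2 _ H0) as [K0 D0]. destruct (rapid_decay2 _ H1) as [K1 D1].
  eexists. eapply dom2_prod; eauto. apply gap_inv_ker.
Qed.

Lemma gap_int_plus0 : forall s f0 g0 f1 n, rapid f0 -> rapid g0 -> rapid f1 ->
  gap_int s (fun x => f0 x + g0 x)%C f1 n = (gap_int s f0 f1 n + gap_int s g0 f1 n)%C.
Proof.
  intros s f0 g0 f1 n H0 H0' H1. destruct (gap_int_dom2 s f0 f1 n H0 H1) as [K D]. destruct (gap_int_dom2 s g0 f1 n H0' H1) as [K' D'].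
  unfold gap_int. rewrite <- (RI2_plus _ _ _ _ D D'). apply RI2_ext. intros. ring.
Qed.

Lemma gap_int_scal0 : forall s k f0 f1 n, rapid f0 -> rapid f1 ->
  gap_int s (fun x => k * f0 x)%C f1 n = (k * gap_int s f0 f1 n)%C.
Proof.
  intros s k f0 f1 n H0 H1. destruct (gap_int_dom2 s f0 f1 n H0 H1) as [K D].
  unfold gap_int. rewrite <- (RI2_scal _ _ k D). apply RI2_ext. intros. ring.
Qed.

Lemma gap_int_plus1 : forall s f0 f1 g1 n, rapid f0 -> rapid f1 -> rapid g1 ->
  gap_int s f0 (fun x => f1 x + g1 x)%C n = (gap_int s f0 f1 n + gap_int s f0 g1 n)%C.
Proof.
  intros s f0 f1 g1 n H0 H1 H1'. destruct (gap_int_dom2 s f0 f1 n H0 H1) as [K D]. destruct (gap_int_dom2 s f0 g1 n H0 H1') as [K' D'].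
  unfold gap_int. rewrite <- (RI2_plus _ _ _ _ D D'). apply RI2_ext. intros. ring.
Qed.

Lemma gap_int_scal1 : forall s k f0 f1 n, rapid f0 -> rapid f1 ->
  gap_int s f0 (fun x => k * f1 x)%C n = (k * gap_int s f0 f1 n)%C.
Proof.
  intros s k f0 f1 n H0 H1. destruct (gap_int_dom2 s f0 f1 n H0 H1) as [K D].
  unfold gap_int. rewrite <- (RI2_scal _ _ k D). apply RI2_ext. intros. ring.
Qed.

Lemma gap_int_ext : forall s f0 g0 f1 g1 n, (forall x, f0 x = g0 x) -> (forall x, f1 x = g1 x) ->
  gap_int s f0 f1 n = gap_int s g0 g1 n.
Proof. intros. apply RI2_ext. intros. rewrite H, H0. reflexivity. Qed.

(** One factor [Y_0 - s Y_1] in the numerator lowers the power by one. *)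
Lemma gap_int_lower : forall s f0 f1 n, rapid f0 -> rapid f1 ->
  (gap_int s (fun x => (x, 1%R) * f0 x) f1 (S n) - s * gap_int s f0 (fun y => (y, 0%R) * f1 y) (S n) = gap_int s f0 f1 n)%C.
Proof.
  intros s f0 f1 n H0 H1.
  destruct (gap_int_dom2 s _ f1 (S n) (rapid_mulY f0 1 H0) H1) as [K D].
  destruct (gap_int_dom2 s f0 _ (S n) H0 (rapid_mulY f1 0 H1)) as [K' D'].
  unfold gap_int. rewrite <- (RI2_scal _ _ s D'). rewrite <- (RI2_minus _ _ _ _ D (dom2_scal _ _ s D')).
  apply RI2_ext. intros x y. rewrite gap_inv_S.
  replace ((x, 1) * f0 x * (f1 y * (/ gap s x y * gap_inv s n x y)) - s * (f0 x * ((y, 0) * f1 y * (/ gap s x y * gap_inv s n x y))))%C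
    with (f0 x * (f1 y * gap_inv s n x y) * (gap s x y * / gap s x y))%C by (unfold gap; ring).
  rewrite Cinv_r by apply gap_neq_0. ring.
Qed.

Lemma gap_int_zero : forall s f0 f1, rapid f0 -> rapid f1 -> gap_int s f0 f1 0 = (RI f0 * RI f1)%C.
Proof.
  intros s f0 f1 H0 H1. destruct (rapid_dom _ H0) as [K0 D0]. destruct (rapid_dom _ H1) as [K1 D1].
  unfold gap_int, RI2. rewrite <- (RI_scal_r f0 K0) by auto. apply RI_ext. intros x.
  rewrite <- (RI_scal f1 K1) by auto. apply RI_ext. intros y. unfold gap_inv. simpl. ring.
Qed.

Lemma gap_int_parts1 : forall s f0 (F1 : C -> C) f1' n, rapid f0 -> rapid (fun y => F1 (RtoC y)) -> rapid f1' ->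
  (forall y : R, RD F1 y (f1' y)) ->
  gap_int s f0 f1' n = (- (s * INR n) * gap_int s f0 (fun y => F1 (RtoC y)) (S n))%C.
Proof.
  intros s f0 F1 f1' n H0 H1 H1' HD.
  destruct (gap_int_dom2 s f0 _ n H0 H1') as [K D]. destruct (gap_int_dom2 s f0 _ (S n) H0 H1) as [K' D'].
  rewrite <- (gap_int_scal1 s (- (s * INR n))%C f0 _ (S n)) by auto.
  assert (Z : (gap_int s f0 f1' n - gap_int s f0 (fun y => - (s * INR n) * F1 (RtoC y)) (S n) = 0)%C).
  { destruct (gap_int_dom2 s f0 _ (S n) H0 (rapid_scal _ (- (s * INR n))%C H1)) as [K'' D''].
    unfold gap_int. rewrite <- (RI2_minus _ _ _ _ D D'').
    unfold RI2. rewrite (RI_ext _ (fun _ => RtoC 0)).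
    { assert (DZ : dom (fun _ => RtoC 0) 0) by (split; [intros; apply cts_const|intros; rewrite Cmod_0; lra]).
      apply Cmod_eq_0. apply Rle_antisym; [|apply Cmod_ge_0]. eapply Rle_trans; [apply (RI_bound _ 0 DZ)|lra]. }
    intros x.
    destruct (rapid_dom _ H1) as [L DL].
    set (g := fun z => (f0 x * (F1 z * (/ ((x, 1%R) + (- RtoC s) * z)) ^ n))%C).
    assert (Ep : forall y k, gap_inv s k x y = ((/ ((x, 1%R) + (- RtoC s) * RtoC y)) ^ k)%C).
    { intros. unfold gap_inv, gap. f_equal. f_equal. apply C_ext; simpl; ring. }
    set (gd := fun z : C => (f0 x * (f1' (Re z) * gap_inv s n x (Re z)) - f0 x * (- (s * INR n) * F1 (RtoC (Re z)) * gap_inv s (S n) x (Re z)))%C).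
    apply (RI_deriv_zero g gd (K * wt x + K'' * wt x) (Cmod (f0 x) * L)).
    - intros y. unfold g, gd. rewrite Re_RtoC. eapply deriv_eq; [|apply deriv_scal, deriv_mult; [apply HD|]].
      2:{ apply deriv_of_CD. apply CD_gap_inv_gen. apply Cneq_0_Im. simpl. lra. }
      rewrite <- !Ep. ring.
    - apply (dom_minus _ _ _ _ (dom2_inner _ _ x D) (dom2_inner _ _ x D'')).
    - intros y. unfold g. rewrite !Cmod_mult, Rmult_assoc. apply Rmult_le_compat_l; [apply Cmod_ge_0|].
      rewrite <- Ep. pose proof (gap_inv_le1 s n x y). destruct DL as [_ DL]. specialize (DL y).
      pose proof (Cmod_ge_0 (F1 y)). pose proof (Cmod_ge_0 (gap_inv s n x y)). nra. }
  replace (gap_int s f0 f1' n) with ((gap_int s f0 f1' n - gap_int s f0 (fun y => - (s * INR n) * F1 (RtoC y)) (S n)) + gap_int s f0 (fun y => - (s * INR n) * F1 (RtoC y)) (S n))%C by ring.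
  rewrite Z. ring.
Qed.

(** The inner integral as a function of the outer variable, which has to be differentiated when
    integrating by parts in the latter. *)
Definition inner_int (s : R) (f1 : R -> C) (n : nat) (x : R) : C := RI (fun y => f1 y * gap_inv s n x y)%C.

Lemma gap_inv_taylor : forall s n x h y, Rabs h <= 1 ->
  Cmod (gap_inv s n (x + h) y - gap_inv s n x y - h * (- (INR n * gap_inv s (S n) x y)))%C <= 2 * INR n * INR n * (Rabs h * Rabs h).
Proof.
  intros s n x h y Hh. induction n.
  - unfold gap_inv. simpl. replace (1 - 1 - h * - (0 * (/ gap s x y * 1)))%C with (RtoC 0) by ring. rewrite Cmod_0. lra.
  - rewrite (gap_inv_S s (S n) x y), !gap_inv_S.
    set (a := (/ gap s (x + h) y)%C). set (b := (/ gap s x y)%C).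
    set (p := gap_inv s n (x + h) y) in *. set (q := gap_inv s n x y) in *.
    assert (Eab : (a - b = - (h * (a * b)))%C).
    { unfold a, b. rewrite inv_diff_line by apply gap_neq_0.
      replace (gap s x y - gap s (x + h) y)%C with (- (gap s (x + h) y - gap s x y))%C by ring.
      rewrite gap_dx. replace (x + h - x) with h by ring. ring. }
    assert (Hq : gap_inv s (S n) x y = (b * q)%C) by reflexivity. rewrite Hq in IHn.
    assert (Ha : Cmod a <= 1) by apply inv_line_le1, Im_gap. assert (Hb : Cmod b <= 1) by apply inv_line_le1, Im_gap.
    assert (Hp : Cmod p <= 1) by apply gap_inv_le1. assert (Hq1 : Cmod q <= 1) by apply gap_inv_le1.
    assert (Hpq : Cmod (p - q) <= INR n * Rabs h).
    { pose proof (gap_inv_lip s n x (x + h) y). replace (x + h - x) with h in H by ring. auto. }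
    rewrite S_INR, RtoC_plus.
    replace (a * p - b * q - h * - ((INR n + 1) * (b * (b * q))))%C with
      (b * (p - q - h * - (INR n * (b * q))) + (a - b) * (p - q) + ((a - b) + h * (b * b)) * q)%C by ring.
    assert (E2 : ((a - b) + h * (b * b) = - (h * (b * (a - b))))%C) by (rewrite Eab at 1; ring).
    rewrite E2, Eab.
    pose proof (Cmod_ge_0 a). pose proof (Cmod_ge_0 b). pose proof (Cmod_ge_0 p). pose proof (Cmod_ge_0 q).
    pose proof (Rabs_pos h). pose proof (pos_INR n). pose proof (Cmod_ge_0 (p - q)).
    assert (Hab : Cmod a * Cmod b <= 1) by nra. assert (0 <= Cmod a * Cmod b) by nra.
    eapply Rle_trans; [apply Cmod_triangle|]. eapply Rle_trans; [apply Rplus_le_compat_r, Cmod_triangle|].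
    rewrite !Cmod_mult, !Cmod_opp, !Cmod_mult, !Cmod_opp, !Cmod_mult, !Cmod_R.
    match type of IHn with ?z <= _ => set (Z := z) in * end.
    assert (HZ : 0 <= Z) by (unfold Z; apply Cmod_ge_0).
    assert (P1 : Cmod b * Z <= 2 * INR n * INR n * (Rabs h * Rabs h)) by nra.
    assert (P2 : Rabs h * (Cmod a * Cmod b) * Cmod (p - q) <= Rabs h * 1 * (INR n * Rabs h)).
    { apply Rmult_le_compat; auto; [apply Rmult_le_pos; auto|apply Rmult_le_compat_l; auto]. }
    assert (P3 : Rabs h * (Cmod b * (Rabs h * (Cmod a * Cmod b))) * Cmod q <= Rabs h * (1 * (Rabs h * 1)) * 1).
    { apply Rmult_le_compat; auto.
      - apply Rmult_le_pos; auto. apply Rmult_le_pos; auto. apply Rmult_le_pos; auto.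
      - apply Rmult_le_compat_l; auto. apply Rmult_le_compat; auto; [apply Rmult_le_pos; auto|apply Rmult_le_compat_l; auto]. }
    nra.
Qed.

Lemma inner_int_dom : forall s f1 n x K, dom f1 K -> dom (fun y => f1 y * gap_inv s n x y)%C K.
Proof.
  intros s f1 n x K [H1 H2]. split; [intros; apply cts_mult; auto; apply gap_inv_cts|].
  intros y. rewrite Cmod_mult. specialize (H2 y). pose proof (gap_inv_le1 s n x y). pose proof (Cmod_ge_0 (f1 y)).
  pose proof (Cmod_ge_0 (gap_inv s n x y)). nra.
Qed.

Lemma inner_int_bound : forall s f1 n x K, dom f1 K -> Cmod (inner_int s f1 n x) <= PI * K.
Proof. intros. apply RI_bound. apply inner_int_dom; auto. Qed.

Lemma inner_int_RD : forall s f1 n (x : R), rapid f1 ->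
  RD (fun z => inner_int s f1 n (Re z)) x (- (INR n * inner_int s f1 (S n) x))%C.
Proof.
  intros s f1 n x H1. destruct (rapid_dom _ H1) as [K D]. pose proof (dom_K_nonneg _ _ D) as HK.
  assert (E : (- (INR n * inner_int s f1 (S n) x) = RI (fun y => - INR n * (f1 y * gap_inv s (S n) x y)))%C).
  { rewrite (RI_scal _ K) by (apply inner_int_dom; auto). unfold inner_int. ring. }
  rewrite E.
  apply (RI_deriv isreal (fun z y => f1 y * gap_inv s n (Re z) y)%C _ x K (Cmod (- INR n)%C * K) (K * (2 * INR n * INR n)) 1 Rlt_0_1).
  - apply inner_int_dom; auto.
  - apply dom_scal. apply inner_int_dom; auto.
  - intros h _ _. exists K. apply inner_int_dom; auto.
  - intros h y Hr Hh. unfold isreal in Hr.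
    assert (Eh : h = RtoC (Re h)) by (apply C_ext; simpl; auto).
    rewrite Eh in Hh |- *. rewrite Cmod_R in *. rewrite Re_plus, !Re_RtoC.
    pose proof (gap_inv_taylor s n x (Re h) y ltac:(lra)) as T.
    destruct D as [_ D]. specialize (D y).
    replace (f1 y * gap_inv s n (x + Re h) y - f1 y * gap_inv s n x y - Re h * (- INR n * (f1 y * gap_inv s (S n) x y)))%C
     with (f1 y * (gap_inv s n (x + Re h) y - gap_inv s n x y - Re h * - (INR n * gap_inv s (S n) x y)))%C by ring.
    rewrite Cmod_mult.
    replace (K * (2 * INR n * INR n) * (Rabs (Re h) * Rabs (Re h)) * wt y) with
      (K * wt y * (2 * INR n * INR n * (Rabs (Re h) * Rabs (Re h)))) by ring.
    apply Rmult_le_compat; auto; apply Cmod_ge_0.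
Qed.

Lemma gap_int_inner_int : forall s f0 f1 n, rapid f1 -> gap_int s f0 f1 n = RI (fun x => f0 x * inner_int s f1 n x)%C.
Proof.
  intros s f0 f1 n H1. destruct (rapid_dom _ H1) as [K D]. apply RI_ext. intros x.
  apply (RI_scal _ K). apply inner_int_dom; auto.
Qed.

Lemma gap_int_parts0 : forall s (F0 : C -> C) f0' f1 n, rapid (fun y => F0 (RtoC y)) -> rapid f0' -> rapid f1 ->
  (forall y : R, RD F0 y (f0' y)) ->
  gap_int s f0' f1 n = (INR n * gap_int s (fun y => F0 (RtoC y)) f1 (S n))%C.
Proof.
  intros s F0 f0' f1 n H0 H0' H1 HD.
  rewrite <- gap_int_scal0 by auto. rewrite !gap_int_inner_int by auto.
  destruct (rapid_dom _ H0) as [K0 D0]. destruct (rapid_dom _ H0') as [K0' D0']. destruct (rapid_dom _ H1) as [K D].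
  pose proof (dom_K_nonneg _ _ D0). pose proof (dom_K_nonneg _ _ D0'). pose proof (dom_K_nonneg _ _ D).
  assert (Hb : forall f L k, dom f L -> dom (fun x => f x * inner_int s f1 k x)%C (L * (PI * K))).
  { intros f L k Df. pose proof (dom_K_nonneg _ _ Df). destruct Df as [Df1 Df2]. split.
    - intros x. apply cts_mult; auto. eapply (RD_cts (fun z => inner_int s f1 k (Re z))). apply inner_int_RD; auto.
    - intros x. rewrite Cmod_mult. replace (L * (PI * K) * wt x) with (L * wt x * (PI * K)) by ring.
      apply Rmult_le_compat; auto; try apply Cmod_ge_0. apply inner_int_bound; auto. }
  pose proof (Hb _ _ n D0') as DA. pose proof (Hb _ _ (S n) (dom_scal _ _ (RtoC (INR n)) D0)) as DB.
  assert (Z : (RI (fun x => f0' x * inner_int s f1 n x) - RI (fun x => INR n * F0 (RtoC x) * inner_int s f1 (S n) x) = 0)%C).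
  { rewrite <- (RI_minus _ _ _ _ DA DB).
    set (gd := fun z : C => (f0' (Re z) * inner_int s f1 n (Re z) - INR n * F0 (RtoC (Re z)) * inner_int s f1 (S n) (Re z))%C).
    apply (RI_deriv_zero (fun z => F0 z * inner_int s f1 n (Re z))%C gd
      (K0' * (PI * K) + Cmod (INR n) * K0 * (PI * K)) (K0 * (PI * K))).
    - intros x. eapply deriv_eq; [|apply deriv_mult; [apply HD|apply inner_int_RD; auto]].
      unfold gd. rewrite !Re_RtoC. ring.
    - apply (dom_minus _ _ _ _ DA DB).
    - intros x. apply (Hb _ _ n D0). }
  match goal with |- ?a = ?b => replace a with ((a - b) + b)%C by ring end. rewrite Z. ring.
Qed.

(** * The principal logarithm *)

Lemma Cmod_ratio_bound : forall w : C, w <> 0%C -> -1 <= Re w / Cmod w <= 1.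
Proof.
  intros w H. apply Cmod_gt_0 in H. pose proof (re_le_Cmod w) as R. apply Rabs_le_between in R.
  split; apply Rmult_le_reg_r with (Cmod w); auto; replace (Re w / Cmod w * Cmod w) with (Re w) by (field; lra); lra.
Qed.

Lemma Carg_bound : forall w : C, - PI <= Carg w <= PI.
Proof.
  intros w. unfold Carg. pose proof (acos_bound (Re w / Cmod w)). pose proof PI_RGT_0.
  destruct Rlt_dec; lra.
Qed.

Lemma Carg_gt : forall w : C, w <> 0%C -> - PI < Carg w.
Proof.
  intros w H. unfold Carg. pose proof (acos_bound (Re w / Cmod w)) as B. pose proof PI_RGT_0.
  destruct Rlt_dec as [Hi|Hi]; [|lra].
  destruct (Req_dec (acos (Re w / Cmod w)) PI) as [E|E]; [|lra]. exfalso.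
  pose proof (Cmod_ratio_bound w H) as R. pose proof (cos_acos _ R) as Cc. rewrite E, cos_PI in Cc.
  apply Cmod_gt_0 in H.
  assert (E1 : Re w = - Cmod w) by (replace (Re w) with (Re w / Cmod w * Cmod w) by (field; lra); rewrite <- Cc; ring).
  pose proof (Cmod_sqr w). rewrite E1 in H1. nra.
Qed.

Lemma Cexp_Clog : forall w : C, w <> 0%C -> Cexp (Clog w) = w.
Proof.
  intros w H. pose proof (Cmod_ratio_bound w H) as R. pose proof (proj1 (Cmod_gt_0 w) H) as Hm.
  assert (Hs : sin (acos (Re w / Cmod w)) = Rabs (Im w) / Cmod w).
  { rewrite sin_acos by auto.
    replace (1 - Rsqr (Re w / Cmod w)) with (Rsqr (Rabs (Im w) / Cmod w)).
    - apply sqrt_Rsqr. apply Rmult_le_pos; [apply Rabs_pos|]. left. apply Rinv_0_lt_compat; auto.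
    - unfold Rsqr. pose proof (Cmod_sqr w).
      replace (Rabs (Im w) / Cmod w * (Rabs (Im w) / Cmod w)) with ((Rabs (Im w) * Rabs (Im w)) / (Cmod w * Cmod w)) by (field; lra).
      replace (Rabs (Im w) * Rabs (Im w)) with (Im w * Im w) by (rewrite <- Rabs_mult; symmetry; apply Rabs_pos_eq; apply Rle_0_sqr).
      apply Rmult_eq_reg_r with (Cmod w * Cmod w); [|nra]. field_simplify; [|lra|lra]. nra. }
  unfold Clog. apply C_ext.
  - rewrite Re_Cexp. simpl. rewrite exp_ln by auto. unfold Carg.
    destruct Rlt_dec; rewrite ?cos_neg, cos_acos by auto; field; lra.
  - rewrite Im_Cexp. simpl. rewrite exp_ln by auto. unfold Carg.
    destruct Rlt_dec as [Hi|Hi].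
    + rewrite sin_neg, Hs, Rabs_left by auto. field. lra.
    + rewrite Hs, Rabs_pos_eq by lra. field. lra.
Qed.

Lemma Im_Clog_bound : forall w : C, w <> 0%C -> - PI < Im (Clog w) <= PI.
Proof. intros w H. simpl. split; [apply Carg_gt; auto|apply Carg_bound]. Qed.

Lemma cos_sin_eq : forall a b, cos a = cos b -> sin a = sin b -> - (2 * PI) < a - b < 2 * PI -> a = b.
Proof.
  intros a b Hc Hs H.
  assert (E : cos (a - b) = 1).
  { rewrite cos_minus, Hc, Hs. pose proof (sin2_cos2 b). unfold Rsqr in *. lra. }
  destruct (Rtotal_order (a - b) 0) as [L|[L|L]].
  - pose proof (cos_lt_1 (b - a) ltac:(lra)) as K. replace (b - a) with (- (a - b)) in K by ring. rewrite cos_neg in K. lra.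
  - lra.
  - pose proof (cos_lt_1 (a - b) ltac:(lra)). lra.
Qed.

Lemma Cexp_inj : forall a b : C, Cexp a = Cexp b -> - (2 * PI) < Im a - Im b < 2 * PI -> a = b.
Proof.
  intros a b E H.
  assert (ER : Re a = Re b).
  { apply exp_inv. rewrite <- !Cmod_Cexp, E. reflexivity. }
  pose proof (f_equal Re E) as E1. pose proof (f_equal Im E) as E2.
  rewrite !Re_Cexp, ER in E1. rewrite !Im_Cexp, ER in E2. pose proof (exp_pos (Re b)).
  apply C_ext; auto. apply cos_sin_eq; auto.
  - apply Rmult_eq_reg_l in E1; lra.
  - apply Rmult_eq_reg_l in E2; lra.
Qed.

Lemma Clog_unique : forall a w : C, Cexp a = w -> - PI < Im a <= PI -> Clog w = a.
Proof.
  intros a w E H. assert (Hw : w <> 0%C) by (rewrite <- E; apply Cexp_neq_0).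
  pose proof (Im_Clog_bound w Hw). apply Cexp_inj; [|lra]. rewrite Cexp_Clog; auto.
Qed.

Lemma Clog_1 : Clog 1 = 0%C.
Proof. apply Clog_unique; [apply Cexp_0|]. simpl. pose proof PI_RGT_0. lra. Qed.

Lemma Clog_mult : forall a b : C, a <> 0%C -> b <> 0%C -> - PI < Im (Clog a) + Im (Clog b) <= PI ->
  Clog (a * b) = (Clog a + Clog b)%C.
Proof.
  intros a b Ha Hb H. apply Clog_unique; [|exact H]. rewrite Cexp_plus, !Cexp_Clog; auto.
Qed.

Lemma Clog_div : forall a b : C, a <> 0%C -> b <> 0%C -> - PI < Im (Clog a) - Im (Clog b) <= PI ->
  Clog (a / b) = (Clog a - Clog b)%C.
Proof.
  intros a b Ha Hb H. apply Clog_unique; [|exact H]. rewrite Cexp_minus, !Cexp_Clog; auto.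
Qed.

Lemma Clog_RtoC : forall x, 0 < x -> Clog (RtoC x) = RtoC (ln x).
Proof.
  intros x Hx. apply Clog_unique; [rewrite Cexp_RtoC, exp_ln; auto|]. simpl. pose proof PI_RGT_0. lra.
Qed.

Lemma Im_Clog_right : forall w : C, 0 < Re w -> - (PI / 2) < Im (Clog w) < PI / 2.
Proof.
  intros w H. assert (Hw : w <> 0%C) by (apply Cneq_0_Re; lra).
  pose proof (Im_Clog_bound w Hw) as B. pose proof (f_equal Re (Cexp_Clog w Hw)) as E.
  rewrite Re_Cexp in E. pose proof (exp_pos (Re (Clog w))). pose proof PI_RGT_0.
  assert (0 < cos (Im (Clog w))) by nra.
  split.
  - apply Rnot_le_lt. intros K. pose proof (cos_le_0 (- Im (Clog w)) ltac:(lra) ltac:(lra)) as Q. rewrite cos_neg in Q. lra.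
  - apply Rnot_le_lt. intros K. pose proof (cos_le_0 (Im (Clog w)) ltac:(lra) ltac:(lra)) as Q. lra.
Qed.

Lemma Im_Clog_slit : forall w : C, Im w <> 0 \/ 0 < Re w -> - PI < Im (Clog w) < PI.
Proof.
  intros w H. assert (Hw : w <> 0%C) by (destruct H; [apply Cneq_0_Im|apply Cneq_0_Re]; lra).
  pose proof (Im_Clog_bound w Hw) as B. split; [lra|].
  destruct (Req_dec (Im (Clog w)) PI) as [E|E]; [|lra]. exfalso.
  pose proof (f_equal Re (Cexp_Clog w Hw)) as E1. pose proof (f_equal Im (Cexp_Clog w Hw)) as E2.
  rewrite Re_Cexp, E, cos_PI in E1. rewrite Im_Cexp, E, sin_PI in E2. pose proof (exp_pos (Re (Clog w))). lra.
Qed.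

Lemma Carg_small : forall w : C, 0 < Re w -> Rabs (Carg w) <= Rabs (Im w) / Re w.
Proof.
  intros w H. assert (Hw : w <> 0%C) by (apply Cneq_0_Re; lra).
  pose proof (Im_Clog_right w H) as B. change (Im (Clog w)) with (Carg w) in B.
  pose proof (f_equal Re (Cexp_Clog w Hw)) as E1. pose proof (f_equal Im (Cexp_Clog w Hw)) as E2.
  rewrite Re_Cexp in E1. rewrite Im_Cexp in E2. change (Im (Clog w)) with (Carg w) in *.
  pose proof (exp_pos (Re (Clog w))). set (r := exp (Re (Clog w))) in *. set (t := Carg w) in *.
  assert (Hc : 0 < cos t) by (apply cos_gt_0; lra).
  assert (Et : tan t = Im w / Re w) by (unfold tan; rewrite <- E1, <- E2; field; lra).
  assert (X : forall s, 0 < s < PI / 2 -> s <= tan s).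
  { intros s Hs. assert (Hcs : 0 < cos s) by (apply cos_gt_0; lra).
    destruct (MVT_cor2 (fun x => sin x - x * cos x) (fun x => x * sin x) 0 s) as [c [Q1 Q2]]; [lra| |].
    - intros c Hc'. apply is_derive_Reals. auto_derive; auto. ring.
    - assert (0 < sin c) by (apply sin_gt_0; lra). rewrite sin_0 in Q1.
      assert (Q3 : s * cos s <= sin s) by (assert (0 <= c * sin c * (s - 0)) by (apply pos_prod3; lra); lra).
      apply Rmult_le_reg_r with (cos s); auto. unfold tan. replace (sin s / cos s * cos s) with (sin s) by (field; lra). auto. }
  assert (Y : Rabs t <= Rabs (tan t)).
  { destruct (Rtotal_order t 0) as [L|[L|L]].
    - rewrite (Rabs_left t) by lra. specialize (X (- t) ltac:(lra)). rewrite tan_neg in X.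
      rewrite Rabs_left1; lra.
    - rewrite L, tan_0, Rabs_R0. lra.
    - rewrite (Rabs_right t) by lra. specialize (X t ltac:(lra)). rewrite Rabs_right; lra. }
  eapply Rle_trans; [exact Y|]. rewrite Et. unfold Rdiv. rewrite Rabs_mult, (Rabs_inv (Re w)), (Rabs_pos_eq (Re w)) by lra. lra.
Qed.

Lemma CD_Clog_1 : CD Clog 1%C 1%C.
Proof.
  assert (Sm : forall h, Cmod h <= 1 / 2 -> Cmod (Clog (1 + h)) <= 4 * Cmod h).
  { intros h Hh. pose proof (re_le_Cmod h) as Hr. apply Rabs_le_between in Hr. pose proof (im_le_Cmod h) as Hi.
    pose proof (Cmod_ge_0 h).
    assert (Hre : 1 / 2 <= Re (1 + h)%C) by (rewrite Re_plus, Re_RtoC; lra).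
    eapply Rle_trans; [apply Cmod_le_reim|].
    assert (A1 : Rabs (Im (Clog (1 + h))) <= 2 * Cmod h).
    { eapply Rle_trans; [apply Carg_small; lra|]. rewrite Im_plus, Im_RtoC, Rplus_0_l.
      apply Rmult_le_reg_r with (Re (1 + h)%C); [lra|].
      replace (Rabs (Im h) / Re (1 + h)%C * Re (1 + h)%C) with (Rabs (Im h)) by (field; lra). nra. }
    assert (A2 : Rabs (Re (Clog (1 + h))) <= 2 * Cmod h).
    { simpl. pose proof (Cmod_triangle 1 h) as U1. rewrite Cmod_1 in U1.
      pose proof (Cmod_triangle_rev 1 h) as U2. rewrite Cmod_1 in U2.
      set (m := Cmod (1 + h)) in *. assert (Hm : 1 / 2 <= m) by lra.
      assert (U : ln m <= m - 1) by (pose proof (exp_ineq1_le (ln m)); rewrite exp_ln in *; lra).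
      assert (L : - ln m <= / m - 1).
      { pose proof (exp_ineq1_le (- ln m)) as Q. rewrite exp_Ropp, exp_ln in Q by lra. lra. }
      apply Rabs_le. split; [|lra].
      assert (/ m - 1 <= 2 * Cmod h).
      { apply Rmult_le_reg_r with m; [lra|]. rewrite Rmult_minus_distr_r, Rinv_l by lra. nra. }
      lra. }
    lra. }
  intros eps He. exists (Rmin (1 / 4) (eps / 48)). split; [apply Rmin_pos; lra|].
  intros h _ Hh. apply Rmin_Rgt in Hh as [H1 H2].
  specialize (Sm h ltac:(lra)). pose proof (Cmod_ge_0 h).
  rewrite Clog_1. set (k := Clog (1 + h)) in *.
  assert (Hn : (1 + h)%C <> 0%C).
  { apply Cmod_gt_0. pose proof (Cmod_triangle_rev 1 h) as T. rewrite Cmod_1 in T. lra. }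
  assert (E : h = (Cexp k - 1)%C) by (unfold k; rewrite Cexp_Clog; auto; ring).
  replace (k - 0 - 1 * h)%C with (- exp_rem2 k)%C by (unfold exp_rem2; rewrite E at 1; ring).
  rewrite Cmod_opp. destruct (taylor_le1 k ltac:(lra)) as [_ [T _]].
  eapply Rle_trans; [exact T|]. pose proof (Cmod_ge_0 k).
  apply Rle_trans with (3 * (4 * Cmod h) ^ 2); [apply Rmult_le_compat_l; [lra|]; apply pow_incr; lra|].
  replace (3 * (4 * Cmod h) ^ 2) with (48 * Cmod h * Cmod h) by ring.
  apply Rmult_le_compat_r; auto. lra.
Qed.

(** The increment is moved to the point 1 by dividing by [w]; away from the cut the
    logarithms add up. *)
Lemma CD_Clog : forall w : C, Im w <> 0 \/ 0 < Re w -> CD Clog w (/ w)%C.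
Proof.
  intros w H. assert (Hw : w <> 0%C) by (destruct H; [apply Cneq_0_Im|apply Cneq_0_Re]; lra).
  pose proof (Im_Clog_slit w H) as B. pose proof (proj1 (Cmod_gt_0 w) Hw) as Hm.
  set (q := Rmin (PI - Im (Clog w)) (PI + Im (Clog w))).
  assert (Hq : 0 < q) by (unfold q; apply Rmin_pos; lra).
  assert (Hq1 : q <= PI - Im (Clog w)) by apply Rmin_l. assert (Hq2 : q <= PI + Im (Clog w)) by apply Rmin_r.
  set (r := Cmod w * Rmin (1 / 2) (q / 4)).
  assert (Hr : 0 < r) by (unfold r; apply Rmult_lt_0_compat; auto; apply Rmin_pos; lra).
  apply (deriv_ext_loc _ (fun z => Clog w + Clog (/ w * z))%C _ _ _ r Hr).
  - intros h Hh. set (u := (/ w * (w + h))%C).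
    assert (Eu : u = (1 + / w * h)%C) by (unfold u; field; auto).
    assert (Hu : Cmod (/ w * h) < Rmin (1 / 2) (q / 4)).
    { rewrite Cmod_mult, Cmod_inv by auto. apply Rmult_lt_reg_l with (Cmod w); auto.
      replace (Cmod w * (/ Cmod w * Cmod h)) with (Cmod h) by (field; lra). exact Hh. }
    apply Rmin_Rgt in Hu as [Hu1 Hu2].
    pose proof (re_le_Cmod (/ w * h)) as Br. apply Rabs_le_between in Br. pose proof (im_le_Cmod (/ w * h)) as Bi.
    assert (Rp : 1 / 2 < Re u) by (rewrite Eu, Re_plus, Re_RtoC; lra).
    pose proof (Carg_small u ltac:(lra)) as CS.
    assert (CS2 : Rabs (Carg u) < q).
    { eapply Rle_lt_trans; [exact CS|]. apply Rmult_lt_reg_r with (Re u); [lra|].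
      replace (Rabs (Im u) / Re u * Re u) with (Rabs (Im u)) by (field; lra).
      replace (Im u) with (Im (/ w * h)) by (rewrite Eu, Im_plus, Im_RtoC; lra). nra. }
    apply Rabs_def2 in CS2.
    rewrite <- Clog_mult; auto.
    + f_equal. unfold u. field. auto.
    + apply Cneq_0_Re. lra.
    + change (Im (Clog u)) with (Carg u). lra.
  - eapply deriv_eq; [|apply deriv_plus; [apply deriv_const|
      apply (deriv_comp _ Clog (fun z => / w * z)%C w (/ w * 1)%C 1%C); [|apply deriv_scal, deriv_id]]].
    + ring.
    + rewrite Cinv_l by auto. apply CD_Clog_1.
Qed.

(** * Square roots and the arctangent *)

Lemma half_C : forall w : C, (w / 2 = RtoC (/ 2) * w)%C.
Proof. intros. unfold Cdiv. rewrite RtoC_inv by lra. ring. Qed.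

Lemma half_double : forall w : C, (w / 2 + w / 2 = w)%C.
Proof.
  intros. rewrite half_C, <- Cmult_plus_distr_r, <- RtoC_plus. replace (/ 2 + / 2) with 1 by lra. ring.
Qed.

Lemma Csqrt_sqr : forall w : C, w <> 0%C -> (Csqrt w * Csqrt w)%C = w.
Proof.
  intros w H. unfold Csqrt. rewrite <- Cexp_plus, half_double. apply Cexp_Clog; auto.
Qed.

Lemma Csqrt_neq_0 : forall w : C, Csqrt w <> 0%C.
Proof. intros. apply Cexp_neq_0. Qed.

Lemma Csqrt_div : forall a b : C, a <> 0%C -> b <> 0%C -> - PI < Im (Clog a) - Im (Clog b) <= PI ->
  Csqrt (a / b) = (Csqrt a / Csqrt b)%C.
Proof.
  intros a b Ha Hb H. unfold Csqrt. rewrite Clog_div by auto. rewrite <- Cexp_minus. f_equal.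
  rewrite !half_C. ring.
Qed.

Lemma Csqrt_div_right : forall a b : C, 0 < Re a -> 0 < Re b -> Csqrt (a / b) = (Csqrt a / Csqrt b)%C.
Proof.
  intros a b Ha Hb. pose proof (Im_Clog_right a Ha). pose proof (Im_Clog_right b Hb).
  apply Csqrt_div; [apply Cneq_0_Re; lra|apply Cneq_0_Re; lra|lra].
Qed.

Lemma Csqrt_RtoC : forall x, 0 < x -> Csqrt (RtoC x) = RtoC (sqrt x).
Proof.
  intros x Hx. unfold Csqrt. rewrite Clog_RtoC by auto. rewrite half_C, <- RtoC_mult, Cexp_RtoC. f_equal.
  rewrite <- (exp_ln (sqrt x)) by (apply sqrt_lt_R0; auto). f_equal.
  rewrite <- Rpower_sqrt by auto. unfold Rpower. rewrite ln_exp. reflexivity.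
Qed.

Lemma CD_Csqrt : forall w : C, Im w <> 0 \/ 0 < Re w -> CD Csqrt w (Csqrt w * (RtoC (/ 2) * / w))%C.
Proof.
  intros w H. unfold Csqrt. apply (deriv_Cexp anyC (fun z => Clog z / 2)%C).
  apply (deriv_ext _ (fun z => RtoC (/ 2) * Clog z)%C); [intros; rewrite half_C; auto|].
  apply deriv_scal. apply CD_Clog; auto.
Qed.

Lemma Carctan_0 : Carctan 0 = 0%C.
Proof.
  unfold Carctan. replace (1 + Ci * 0)%C with (RtoC 1) by ring. replace (1 - Ci * 0)%C with (RtoC 1) by ring.
  rewrite Clog_1. unfold Cdiv. ring.
Qed.

Lemma Ci_sqr : (Ci * Ci = - (1))%C.
Proof. apply C_ext; simpl; ring. Qed.

Lemma Ci_neq_0 : Ci <> 0%C.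
Proof. apply Cneq_0_Im. simpl. lra. Qed.

(** The hypothesis keeps [1 + i w] and [1 - i w] off the cut of the logarithm. *)
Lemma CD_Carctan : forall w : C, Re w <> 0 \/ w = 0%C -> CD Carctan w (/ (1 + w * w))%C.
Proof.
  intros w H.
  assert (S1 : Im (1 + Ci * w) <> 0 \/ 0 < Re (1 + Ci * w)).
  { destruct H as [H|H]; [left; simpl; unfold Re in H; lra|right; rewrite H; simpl; lra]. }
  assert (S2 : Im (1 - Ci * w) <> 0 \/ 0 < Re (1 - Ci * w)).
  { destruct H as [H|H]; [left; simpl; unfold Re in H; lra|right; rewrite H; simpl; lra]. }
  assert (N1 : (1 + Ci * w)%C <> 0%C) by (destruct S1; [apply Cneq_0_Im|apply Cneq_0_Re]; lra).
  assert (N2 : (1 - Ci * w)%C <> 0%C) by (destruct S2; [apply Cneq_0_Im|apply Cneq_0_Re]; lra).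
  unfold Carctan, Cdiv.
  eapply deriv_eq; [|apply deriv_mult; [apply deriv_minus; [apply (deriv_comp _ Clog (fun z => 1 + Ci * z)%C); [apply CD_Clog; auto|apply CD_affine]|
     apply (deriv_comp _ Clog (fun z => 1 - Ci * z)%C); [apply CD_Clog; auto|]]|apply deriv_const]].
  2:{ apply deriv_minus; [apply deriv_const|apply deriv_scal, deriv_id]. }
  assert (E : (1 + w * w = (1 + Ci * w) * (1 - Ci * w))%C).
  { transitivity (1 - (Ci * Ci) * (w * w))%C; [rewrite Ci_sqr; ring|ring]. }
  rewrite E. field. repeat split; auto. apply Ci_neq_0.
Qed.

(** * The mass of a complex Gaussian *)

Lemma inv_off_line_le1 : forall x t, 1 <= Rabs x \/ 1 <= Rabs t -> ((x, t) : C) <> 0%C /\ Cmod (/ (x, t))%C <= 1.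
Proof.
  intros x t H.
  assert (B : 1 <= Cmod (x, t)).
  { destruct H as [H|H]; (eapply Rle_trans; [exact H|]); [apply (re_le_Cmod (x, t))|apply (im_le_Cmod (x, t))]. }
  assert (N : ((x, t) : C) <> 0%C) by (apply Cmod_gt_0; lra).
  split; auto. rewrite Cmod_inv by auto. rewrite <- Rinv_1. apply Rinv_le_contravar; lra.
Qed.

(** The lines of heights -1 and 1 enclose the pole, and the reflection through it exchanges
    them, so that each carries half of the residue. *)
Lemma gauss_pole : forall nu, 0 < Re nu -> RI (fun x => / (x, 1%R) * gauss nu (x, 1%R))%C = (- (PI * Ci))%C.
Proof.
  intros nu Hn.
  set (g := fun z => (gauss nu z * / (z - (0%R, 0%R)))%C).
  assert (E0 : forall z, (z - (0%R, 0%R))%C = z) by (intros [? ?]; apply C_ext; simpl; ring).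
  destruct (gauss_decay (Re nu) (Cmod nu) 1 Hn Rle_0_1 1) as [K [HK HB]].
  assert (Hg : forall x t, 1 <= Rabs x \/ 1 <= Rabs t -> exists l, CD g (x, t) l).
  { intros x t H. destruct (inv_off_line_le1 x t H) as [N _]. eexists.
    apply deriv_mult; [apply CD_gauss|]. apply (deriv_ext _ (fun z => / z)%C); [intros; rewrite E0; auto|].
    apply CD_inv. auto. }
  assert (HgB : forall x t, 1 <= Rabs x \/ 1 <= Rabs t -> Rabs t <= 1 -> Cmod (g (x, t)) <= K * wt x).
  { intros x t H Ht. destruct (inv_off_line_le1 x t H) as [_ N]. unfold g. rewrite E0, Cmod_mult.
    specialize (HB nu t x (Rle_refl _) (Rle_refl _) Ht). rewrite pow_1 in HB.
    pose proof (Cmod_ge_0 (gauss nu (x, t))). pose proof (Cmod_ge_0 (/ (x, t))%C). nra. }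
  assert (R1 : Rabs 1 = 1) by (apply Rabs_pos_eq; lra).
  assert (Rm1 : Rabs (- (1)) = 1) by (rewrite Rabs_Ropp; auto).
  assert (D : forall t, Rabs t = 1 -> dom (fun x => g (x, t)) K).
  { intros t Ht. split; [|intros; apply HgB; lra].
    apply cts_line. intros. apply Hg. lra. }
  assert (Hbox : (RI (fun x => g (x, (- (1))%R)) - RI (fun x => g (x, 1%R)) = 2 * PI * Ci)%C).
  { apply (RI_box_limit g (- (1)) 1 K); auto; try lra.
    - intros x t Hx Ht. apply HgB; auto. apply Rabs_le. auto.
    - intros n Hn1. unfold g. rewrite (cauchy_formula (gauss nu)) by (try lra; intros x y _ _; eexists; apply CD_gauss).
      unfold gauss. replace (- (nu * RtoC (/ 2) * ((0%R, 0%R) * (0%R, 0%R))))%C with (RtoC 0) by (apply C_ext; simpl; ring).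
      rewrite Cexp_0. ring. }
  assert (Erefl : RI (fun x => g (x, (- (1))%R)) = (- RI (fun x => g (x, 1%R)))%C).
  { rewrite <- (RI_opp _ K) by auto.
    rewrite <- (RI_reflect (fun x => g (x, (- (1))%R)) K) by auto. apply RI_ext. intros x.
    unfold g. rewrite !E0.
    assert (Em : ((- x, (- (1))%R) : C) = (- (x, 1%R))%C) by (apply C_ext; simpl; ring). rewrite Em.
    unfold gauss. replace (- (x, 1%R) * - (x, 1%R))%C with ((x, 1%R) * (x, 1%R))%C by ring.
    destruct (inv_off_line_le1 x 1 (or_intror (Req_le _ _ (eq_sym R1)))) as [N _].
    field. auto. }
  rewrite (RI_ext _ (fun x => g (x, 1%R))) by (intros; unfold g; rewrite E0; ring).
  rewrite Erefl in Hbox.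
  set (c := RI (fun x => g (x, 1%R))) in *.
  assert (E2 : (c + c = - (2 * PI * Ci))%C) by (rewrite <- Hbox; ring).
  assert (E3 : (RtoC (/ 2) * (c + c) = c)%C).
  { replace (RtoC (/ 2) * (c + c))%C with ((RtoC (/ 2) + RtoC (/ 2)) * c)%C by ring.
    rewrite <- RtoC_plus. replace (/ 2 + / 2) with 1 by lra. ring. }
  rewrite <- E3, E2. transitivity (- (RtoC (/ 2 * 2) * (PI * Ci)))%C; [rewrite RtoC_mult; ring|].
  replace (/ 2 * 2) with 1 by lra. ring.
Qed.

Definition gauss_mass (nu : C) : C := RI (fun x => gauss nu (x, 0%R)).

Lemma gauss_dom : forall nu t, 0 < Re nu -> exists K, dom (fun x => gauss nu (x, t)) K.
Proof. intros. apply rapid_dom, gauss_rapid; auto. Qed.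

Lemma gauss_line : forall nu t, 0 < Re nu -> RI (fun x => gauss nu (x, t)) = gauss_mass nu.
Proof.
  intros nu t Hn.
  destruct (gauss_decay (Re nu) (Cmod nu) (Rabs t) Hn (Rabs_pos t) 1) as [K [HK H]].
  assert (X : forall a b, a <= b -> Rabs a <= Rabs t -> Rabs b <= Rabs t ->
    RI (fun x => gauss nu (x, a)) = RI (fun x => gauss nu (x, b))).
  { intros a b Hab Ha Hb. apply (RI_strip_shift (gauss nu) a b K Hab).
    - intros x s _. eexists. apply CD_gauss.
    - intros x s Hs. rewrite <- (pow_1 (wt x)). apply H; try lra.
      apply Rabs_le_between in Ha. apply Rabs_le_between in Hb. apply Rabs_le. lra. }
  unfold gauss_mass. pose proof (Rabs_pos t).
  assert (Z : Rabs 0 <= Rabs t) by (rewrite Rabs_R0; auto).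
  destruct (Rle_dec 0 t).
  - symmetry. apply X; lra.
  - apply X; lra.
Qed.

(** Let [c b] be the pole integral with the additional factor [e^(i b Y)].  Completing the
    square, its derivative is [i e^(- b^2 / 2) gauss_mass 1], and [c] tends to 0 at infinity; hence
    [c 0 = - i (gauss_mass 1)^2 / 2], while [c 0 = - PI i] by [gauss_pole]. *)
Lemma gauss_mass_1_sqr : (gauss_mass 1 * gauss_mass 1 = RtoC (2 * PI))%C.
Proof.
  assert (Hn : 0 < Re 1) by (simpl; lra).
  set (f := fun (z : C) (x : R) => (/ (x, 1%R) * (Cexp (Ci * z * (x, 1%R)) * gauss 1 (x, 1%R)))%C).
  set (f' := fun (b : R) (x : R) => (Ci * (Cexp (Ci * b * (x, 1%R)) * gauss 1 (x, 1%R)))%C).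
  pose proof (gauss_rapid 1 1 Hn) as HR.
  assert (Emod : forall (b x : R), Cmod (Cexp (Ci * b * (x, 1%R))) = exp (- b)).
  { intros. rewrite Cmod_Cexp. f_equal. simpl. ring. }
  assert (Ectsx : forall (b : R) x, cts (fun x => Cexp (Ci * b * (x, 1%R))%C) x).
  { intros b. apply (cts_line (fun v => Cexp (Ci * b * v)%C)). intros. eexists. apply deriv_Cexp, deriv_scal, deriv_id. }
  assert (Hr : forall b : R, rapid (fun x => Cexp (Ci * b * (x, 1%R)) * gauss 1 (x, 1%R))%C).
  { intros b. apply (rapid_bounded _ (fun x => Cexp (Ci * b * (x, 1%R))%C) (exp (- b))); auto.
    intros. rewrite Emod. lra. }
  destruct (rapid_dom _ HR) as [K0 DK].
  pose proof (dom_K_nonneg _ _ DK) as HK0.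
  assert (Hf : forall b : R, dom (f b) (exp (- b) * K0)).
  { intros b. split; [apply (rapid_divY _ (Hr b))|]. intros x. unfold f. rewrite !Cmod_mult, Emod.
    destruct DK as [_ DK]. specialize (DK x).
    pose proof (inv_line_le1 (x, 1%R) eq_refl). pose proof (Cmod_ge_0 (/ (x, 1%R))%C). pose proof (exp_pos (- b)).
    pose proof (Cmod_ge_0 (gauss 1 (x, 1%R))).
    assert (exp (- b) * Cmod (gauss 1 (x, 1%R)) <= exp (- b) * (K0 * wt x)) by (apply Rmult_le_compat_l; lra).
    assert (0 <= exp (- b) * Cmod (gauss 1 (x, 1%R))) by (apply Rmult_le_pos; lra). nra. }
  destruct (rapid_dom _ (rapid_mulY _ 1 HR)) as [K1 DK1].
  pose proof (dom_K_nonneg _ _ DK1) as HK1.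
  assert (HD : forall b : R, RD (fun z => RI (f z)) b (RI (f' b))).
  { intros b. destruct (rapid_dom _ (rapid_scal _ Ci (Hr b))) as [Kf' Df'].
    apply (RI_deriv isreal f (f' b) b _ Kf' (exp (- b) * exp 1 * K1) 1 Rlt_0_1 (Hf b) Df').
    - intros h Hh _. exists (exp (- (b + Re h)) * K0).
      replace (b + h)%C with (RtoC (b + Re h)); [apply Hf|]. unfold isreal in Hh. ceq; rewrite ?Hh; ring.
    - intros h x Hh Hh1. unfold f, f'.
      assert (Eh : h = RtoC (Re h)) by (apply C_ext; simpl; auto). set (r := Re h) in *. rewrite Eh in *. clear Eh.
      rewrite Cmod_R in *.
      destruct (inv_off_line_le1 x 1) as [N NB]; [right; rewrite Rabs_pos_eq; lra|].
      assert (Nm : Cmod (/ (x, 1%R))%C * Cmod (x, 1%R) = 1) by (rewrite <- Cmod_mult, Cinv_l, Cmod_1; auto).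
      pose proof (Cexp_sub_taylor (Ci * (b + r) * (x, 1%R)) (Ci * b * (x, 1%R))) as T.
      replace (Ci * (b + r) * (x, 1%R) - Ci * b * (x, 1%R))%C with (Ci * r * (x, 1%R))%C in T by ring.
      replace (/ (x, 1) * (Cexp (Ci * (b + r) * (x, 1)) * gauss 1 (x, 1)) - / (x, 1) * (Cexp (Ci * b * (x, 1)) * gauss 1 (x, 1)) -
         r * (Ci * (Cexp (Ci * b * (x, 1)) * gauss 1 (x, 1))))%C with
       (/ (x, 1) * gauss 1 (x, 1) * (Cexp (Ci * (b + r) * (x, 1)) - Cexp (Ci * b * (x, 1)) * (1 + Ci * r * (x, 1))))%C by (field; auto).
      rewrite !Cmod_mult.
      rewrite <- RtoC_plus in *. rewrite !Emod in T. rewrite !Cmod_mult, Cmod_Ci, Cmod_R, Rmult_1_l in T.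
      assert (M : Rmax (exp (- (b + r))) (exp (- b)) <= exp (- b) * exp 1).
      { rewrite <- exp_plus. apply Rabs_def2 in Hh1. apply Rmax_lub; apply exp_le_compat; lra. }
      destruct DK1 as [_ DK1]. specialize (DK1 x). rewrite Cmod_mult in DK1.
      pose proof (Cmod_ge_0 (gauss 1 (x, 1%R))) as P1. pose proof (Cmod_ge_0 (/ (x, 1%R))%C) as P2. pose proof (Cmod_ge_0 (x, 1%R)) as P3.
      set (Y := Cmod (x, 1%R)) in *. set (gg := Cmod (gauss 1 (x, 1%R))) in *. set (iy := Cmod (/ (x, 1%R))%C) in *.
      apply Rle_trans with (iy * gg * (exp (- b) * exp 1 * (Rabs r * Y) ^ 2)).
      + apply Rmult_le_compat_l; [apply Rmult_le_pos; auto|]. eapply Rle_trans; [exact T|].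
        apply Rmult_le_compat_r; auto. apply pow2_ge_0.
      + replace (iy * gg * (exp (- b) * exp 1 * (Rabs r * Y) ^ 2)) with (exp (- b) * exp 1 * (Rabs r * Rabs r) * (iy * Y * (Y * gg))) by ring.
        replace (iy * Y) with 1 by auto. rewrite Rmult_1_l.
        replace (exp (- b) * exp 1 * K1 * (Rabs r * Rabs r) * wt x) with (exp (- b) * exp 1 * (Rabs r * Rabs r) * (K1 * wt x)) by ring.
        apply Rmult_le_compat_l; auto. pose proof (exp_pos (- b)). pose proof (exp_pos 1). pose proof (Rabs_pos r).
        apply Rmult_le_pos; apply Rmult_le_pos; lra. }
  assert (Ef' : forall b : R, RI (f' b) = (Ci * gauss_mass 1 * gauss 1 (b, 0%R))%C).
  { intros b.
    assert (Ep : forall x, f' b x = (Ci * gauss 1 (b, 0%R) * gauss 1 (x, (1 - b)%R))%C).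
    { intros x. transitivity (Ci * (gauss 1 (b, 0%R) * gauss 1 (x, (1 - b)%R)))%C; [|ring].
      unfold f', gauss. apply (f_equal (Cmult Ci)). rewrite <- !Cexp_plus. apply f_equal.
      apply C_ext; simpl; field. }
    rewrite (RI_ext _ _ Ep). destruct (gauss_dom 1 (1 - b) Hn) as [K D]. rewrite (RI_scal _ K) by auto.
    rewrite gauss_line by auto. ring. }
  set (G := gauss_mass 1) in *.
  destruct (gauss_dom 1 0 Hn) as [Kg Dg].
  assert (Hfin : forall B : R, 0 <= B -> (RI (f B) - RI (f 0) = Ci * G * CRI (fun b => gauss 1 (b, 0%R)) 0 B)%C).
  { intros B HB. rewrite <- CRI_scal by (eapply ex_CRI_dom; eauto).
    pose proof (CRI_FTC (fun z => RI (f z)) (fun z => Ci * G * gauss 1 (Re z, 0%R))%C 0 B HB) as FT. simpl in FT.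
    symmetry. apply FT.
    - intros x _. rewrite <- Ef'. apply HD.
    - intros x _. apply (cts_mult (fun _ => (Ci * G)%C)); [apply cts_const|apply Dg]. }
  assert (Hhalf : forall B : R, 0 <= B -> (RtoC 2 * CRI (fun b => gauss 1 (b, 0%R)) 0 B = CRI (fun b => gauss 1 (b, 0%R)) (- B) B)%C).
  { intros B HB.
    assert (Ex : forall u v, ex_CRI (fun b => gauss 1 (b, 0%R)) u v) by (intros; eapply ex_CRI_dom; eauto).
    rewrite <- (CRI_chasles _ (- B) 0 B) by auto.
    assert (Er : CRI (fun b => gauss 1 (b, 0%R)) (- B) 0 = CRI (fun b => gauss 1 (b, 0%R)) 0 B).
    { pose proof (CRI_reflect _ 0 B Ex) as Q. rewrite Ropp_0 in Q. rewrite <- Q. apply CRI_ext; auto.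
      intros x _. unfold gauss. f_equal. apply C_ext; simpl; ring. }
    rewrite Er. change (RtoC 2) with (RtoC (1 + 1)). rewrite RtoC_plus. ring. }
  assert (Hc0 : RI (f 0) = (- (PI * Ci))%C).
  { rewrite <- (gauss_pole 1 Hn). apply RI_ext. intros x. unfold f.
    replace (Ci * 0 * (x, 1))%C with (RtoC 0) by ring. rewrite Cexp_0. ring. }
  assert (Main : (Ci * (RtoC (2 * PI) - G * G) = 0)%C).
  { apply C_eq_eps. intros eps He. pose proof PI_RGT_0.
    pose proof (Cmod_ge_0 G) as HG.
    assert (P1 : 0 < eps / (2 * (Cmod G + 1))) by (apply Rdiv_lt_0_compat; lra).
    destruct (RI_trunc_dom _ _ Dg _ P1) as [A [HA H1]].
    set (B := A + 1 + 4 * (PI * K0) / eps).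
    assert (HB0 : 0 <= 4 * (PI * K0) / eps) by (apply Rmult_le_pos; [apply Rmult_le_pos; [lra|apply Rmult_le_pos; lra]|left; apply Rinv_0_lt_compat; auto]).
    assert (HB : 0 <= B) by (unfold B; lra).
    specialize (Hfin B HB). specialize (Hhalf B HB). specialize (H1 B B ltac:(unfold B; lra) ltac:(unfold B; lra)).
    rewrite <- Hhalf in H1. rewrite Hc0 in Hfin. set (J := CRI (fun b => gauss 1 (b, 0%R)) 0 B) in *.
    change (Cmod (2 * J - G) < eps / (2 * (Cmod G + 1))) in H1.
    assert (E : (Ci * (RtoC (2 * PI) - G * G) = Ci * G * (2 * J - G) - 2 * RI (f B) + 2 * (RI (f B) - - (PI * Ci) - Ci * G * J))%C).
    { rewrite RtoC_mult. ring. }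
    replace (RI (f B) - - (PI * Ci) - Ci * G * J)%C with (RtoC 0) in E by (rewrite Hfin; ring).
    replace (Ci * (RtoC (2 * PI) - G * G) - 0)%C with (Ci * G * (2 * J - G) - 2 * RI (f B))%C by (rewrite E; ring).
    eapply Rle_trans; [apply Cmod_triangle_minus|]. rewrite !Cmod_mult, Cmod_Ci, Cmod_R, (Rabs_pos_eq 2), Rmult_1_l by lra.
    pose proof (RI_bound _ _ (Hf B)) as HBd.
    assert (Q1 : Cmod G * Cmod (2 * J - G) <= eps / 2).
    { apply Rle_trans with ((Cmod G + 1) * (eps / (2 * (Cmod G + 1)))).
      - apply Rmult_le_compat; try lra. apply Cmod_ge_0.
      - apply Req_le. field. lra. }
    assert (Q2 : PI * (exp (- B) * K0) <= eps / 4).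
    { assert (HBp : 0 < B) by (unfold B; lra).
      assert (exp (- B) <= / B).
      { rewrite exp_Ropp. apply Rinv_le_contravar; auto. pose proof (exp_ineq1_le B). lra. }
      apply Rle_trans with (/ B * (PI * K0)).
      - replace (PI * (exp (- B) * K0)) with (exp (- B) * (PI * K0)) by ring. apply Rmult_le_compat_r; auto. apply Rmult_le_pos; lra.
      - apply Rmult_le_reg_l with B; auto. rewrite <- Rmult_assoc, Rinv_r, Rmult_1_l by lra.
        assert (HBB : 4 * (PI * K0) / eps <= B) by (unfold B; lra).
        apply Rmult_le_compat_r with (r := eps) in HBB; [|lra].
        replace (4 * (PI * K0) / eps * eps) with (4 * (PI * K0)) in HBB by (field; lra). lra. }
    lra. }
  assert (E : (RtoC (2 * PI) - G * G = - Ci * (Ci * (RtoC (2 * PI) - G * G)))%C).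
  { transitivity (- (Ci * Ci) * (RtoC (2 * PI) - G * G))%C; [rewrite Ci_sqr; ring|ring]. }
  rewrite Main in E. replace (G * G)%C with (RtoC (2 * PI) - (RtoC (2 * PI) - G * G))%C by ring. rewrite E. ring.
Qed.

Lemma gauss_mass_1 : gauss_mass 1 = RtoC (sqrt (2 * PI)).
Proof.
  assert (Hn : 0 < Re 1) by (simpl; lra). pose proof PI_RGT_0.
  destruct (gauss_dom 1 0 Hn) as [K D].
  assert (Er : forall x, gauss 1 (x, 0%R) = RtoC (exp (- (x * x / 2)))).
  { intros x. rewrite <- Cexp_RtoC. unfold gauss. f_equal. apply C_ext; simpl; field. }
  assert (Hre : 0 <= Re (gauss_mass 1)).
  { apply Rnot_lt_le. intros Hlt.
    destruct (RI_trunc_dom _ _ D (- Re (gauss_mass 1))) as [A [HA H1]]; [lra|].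
    specialize (H1 (A + 1) (A + 1) ltac:(lra) ltac:(lra)).
    assert (Hex : ex_RInt (fun x => exp (- (x * x / 2))) (- (A + 1)) (A + 1)).
    { apply (ex_RInt_continuous (V := R_CompleteNormedModule)). intros. apply (ex_derive_continuous (V := R_NormedModule)). auto_derive. auto. }
    assert (E : CRI (fun x => gauss 1 (x, 0%R)) (- (A + 1)) (A + 1) = RtoC (RInt (fun x => exp (- (x * x / 2))) (- (A + 1)) (A + 1))).
    { rewrite (CRI_ext _ (fun x => RtoC (exp (- (x * x / 2))))) by (try lra; auto).
      apply (is_RInt_unique (V := C_R_CompleteNormedModule)). apply is_CRI_RtoC.
      apply (RInt_correct (V := R_CompleteNormedModule)). auto. }
    rewrite E in H1. pose proof (re_le_Cmod (RtoC (RInt (fun x => exp (- (x * x / 2))) (- (A + 1)) (A + 1)) - RI (fun x => gauss 1 (x, 0%R)))) as R1.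
    rewrite Re_minus, Re_RtoC in R1. apply Rabs_le_between in R1.
    assert (0 <= RInt (fun x => exp (- (x * x / 2))) (- (A + 1)) (A + 1)).
    { apply RInt_ge_0; auto; [lra|]. intros; left; apply exp_pos. }
    unfold gauss_mass in *. lra. }
  pose proof gauss_mass_1_sqr as S. set (G := gauss_mass 1) in *.
  assert (Hsq : sqrt (2 * PI) * sqrt (2 * PI) = 2 * PI) by (apply sqrt_sqrt; lra).
  assert (Hsp : 0 < sqrt (2 * PI)) by (apply sqrt_lt_R0; lra).
  set (q := sqrt (2 * PI)) in *.
  assert (P : ((G - RtoC q) * (G + RtoC q) = 0)%C).
  { transitivity (G * G - RtoC (q * q))%C; [rewrite RtoC_mult; ring|]. rewrite S, Hsq. ring. }
  assert (N : (G + RtoC q)%C <> 0%C) by (apply Cneq_0_Re; rewrite Re_plus, Re_RtoC; lra).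
  replace G with (((G - RtoC q) * (G + RtoC q)) / (G + RtoC q) + RtoC q)%C by (field; auto). rewrite P.
  unfold Cdiv. ring.
Qed.

(** Integration by parts. *)
Lemma gauss_second_moment : forall nu, 0 < Re nu ->
  RI (fun x => nu * ((x, 0%R) * ((x, 0%R) * gauss nu (x, 0%R))))%C = gauss_mass nu.
Proof.
  intros nu Hn. pose proof (gauss_rapid nu 0 Hn) as H0. pose proof (rapid_mulY _ 0 H0) as H1.
  pose proof (rapid_scal _ nu (rapid_mulY _ 0 H1)) as H2.
  destruct (rapid_dom _ H0) as [K0 D0]. destruct (rapid_dom _ H1) as [K1 D1]. destruct (rapid_dom _ H2) as [K2 D2].
  assert (Ep : forall x : R, ((x, 0%R) : C) = RtoC x) by reflexivity.
  assert (Z : (gauss_mass nu - RI (fun x => nu * ((x, 0%R) * ((x, 0%R) * gauss nu (x, 0%R)))) = 0)%C).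
  { unfold gauss_mass. rewrite <- (RI_minus _ _ _ _ D0 D2).
    apply (RI_deriv_zero (fun z => z * gauss nu z)%C (fun z => gauss nu z - nu * (z * (z * gauss nu z)))%C (K0 + K2) K1).
    - intros x. eapply deriv_eq; [|apply deriv_mult; [apply deriv_id|apply deriv_of_CD, CD_gauss]]. cbv beta. ring.
    - apply (dom_minus _ _ _ _ D0 D2).
    - intros x. apply D1. }
  match goal with |- ?a = _ => replace a with (gauss_mass nu - (gauss_mass nu - a))%C by ring end. rewrite Z. ring.
Qed.

Lemma CD_gauss_mass : forall nu, 0 < Re nu -> CD gauss_mass nu (- (RtoC (/ 2) * / nu * gauss_mass nu))%C.
Proof.
  intros nu Hn. set (r := Re nu) in *.
  pose proof (gauss_rapid nu 0 Hn) as H0. pose proof (rapid_mulY _ 0 (rapid_mulY _ 0 H0)) as H2.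
  set (f' := fun x : R => (- RtoC (/ 2) * ((x, 0%R) * ((x, 0%R) * gauss nu (x, 0%R))))%C).
  assert (Hnu : nu <> 0%C) by (apply Cneq_0_Re; unfold r in *; lra).
  assert (E : RI f' = (- (RtoC (/ 2) * / nu * gauss_mass nu))%C).
  { rewrite <- (gauss_second_moment nu) by auto. destruct (rapid_dom _ H2) as [K D].
    unfold f'. rewrite (RI_scal _ K) by auto. rewrite (RI_scal _ K nu) by auto. field. auto. }
  rewrite <- E. destruct (rapid_dom _ H0) as [K0 D0]. destruct (rapid_dom _ (rapid_scal _ (- RtoC (/ 2))%C H2)) as [K1 D1].
  destruct (gauss_decay (r / 2) (Cmod nu + r) 0) with (m := 3%nat) as [K [HK HB]]; [lra|lra|].
  apply (RI_deriv anyC (fun mu x => gauss mu (x, 0%R)) f' nu K0 K1 K (r / 2) ltac:(lra) D0 D1).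
  - intros h _ Hh. apply gauss_dom. rewrite Re_plus. pose proof (re_le_Cmod h) as Q. apply Rabs_le_between in Q. unfold r in *; lra.
  - intros h x _ Hh.
    assert (B1 : Cmod (gauss (nu + h) (x, 0%R)) <= K * wt x ^ 3).
    { apply HB; [|eapply Rle_trans; [apply Cmod_triangle|lra]|rewrite Rabs_R0; lra].
      rewrite Re_plus. pose proof (re_le_Cmod h) as Q. apply Rabs_le_between in Q. unfold r in *; lra. }
    assert (B2 : Cmod (gauss nu (x, 0%R)) <= K * wt x ^ 3).
    { apply HB; [unfold r in *; lra|lra|rewrite Rabs_R0; lra]. }
    pose proof (Cexp_sub_taylor (- ((nu + h) * RtoC (/ 2) * ((x, 0%R) * (x, 0%R)))) (- (nu * RtoC (/ 2) * ((x, 0%R) * (x, 0%R))))) as T.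
    change (Cexp (- ((nu + h) * RtoC (/ 2) * ((x, 0%R) * (x, 0%R))))) with (gauss (nu + h) (x, 0%R)) in T.
    change (Cexp (- (nu * RtoC (/ 2) * ((x, 0%R) * (x, 0%R))))) with (gauss nu (x, 0%R)) in T.
    set (dd := (- ((nu + h) * RtoC (/ 2) * ((x, 0%R) * (x, 0%R))) - - (nu * RtoC (/ 2) * ((x, 0%R) * (x, 0%R))))%C) in *.
    assert (Ed : dd = (- (h * RtoC (/ 2)) * ((x, 0%R) * (x, 0%R)))%C) by (unfold dd; ring).
    unfold f'. replace (gauss (nu + h) (x, 0) - gauss nu (x, 0) - h * (- RtoC (/ 2) * ((x, 0) * ((x, 0) * gauss nu (x, 0)))))%C
     with (gauss (nu + h) (x, 0) - gauss nu (x, 0) * (1 + dd))%C by (rewrite Ed; ring).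
    eapply Rle_trans; [exact T|].
    pose proof (Cmod_pair_wt x 0) as P. rewrite Rabs_R0, Rplus_0_r in P. pose proof (Cmod_ge_0 (x, 0%R)) as P0. pose proof (wt_pos x) as Wx.
    pose proof (wt_le_1 x) as W1.
    assert (Hdd : Cmod dd <= Cmod h * (Cmod (x, 0%R) * Cmod (x, 0%R))).
    { rewrite Ed, !Cmod_mult, Cmod_opp, Cmod_mult, Cmod_R, (Rabs_pos_eq (/ 2)) by lra.
      apply Rmult_le_compat_r; [nra|]. pose proof (Cmod_ge_0 h). lra. }
    set (Y := Cmod (x, 0%R)) in *.
    assert (HY : Y * Y <= / wt x).
    { unfold Y. rewrite Cmod_sqr. simpl. unfold wt. rewrite Rinv_inv. lra. }
    apply Rle_trans with (K * wt x ^ 3 * (Cmod h * / wt x) ^ 2).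
    + apply Rmult_le_compat; [eapply Rle_trans; [apply Cmod_ge_0|apply Rmax_l]|apply pow2_ge_0|apply Rmax_lub; auto|].
      apply pow_incr. split; [apply Cmod_ge_0|]. eapply Rle_trans; [exact Hdd|]. apply Rmult_le_compat_l; auto. apply Cmod_ge_0.
    + apply Req_le. field. lra.
Qed.

(** The left-hand side has derivative zero in [nu], and its value at 1 is known. *)
Lemma gauss_mass_eq : forall nu, 0 < Re nu -> (gauss_mass nu * Csqrt nu = RtoC (sqrt (2 * PI)))%C.
Proof.
  intros nu Hn.
  assert (Hseg : forall t : R, 0 <= t <= 1 -> 0 < Re (1 + t * (nu - 1))%C).
  { intros t Ht. simpl. replace (1 + (t * (Re nu + - (1)) - 0 * (Im nu + - 0))) with ((1 - t) + t * Re nu) by ring.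
    destruct (Req_dec t 0) as [->|]; [lra|]. assert (0 < t * Re nu) by (apply Rmult_lt_0_compat; lra). unfold Re in *. lra. }
  assert (C0 : Cmod ((gauss_mass (1 + (nu - 1)) * Csqrt (1 + (nu - 1))) - gauss_mass 1 * Csqrt 1)%C <= 0 * Cmod (nu - 1)).
  { apply (mean_value_le (fun z => gauss_mass z * Csqrt z)%C (fun _ => 0%C)).
    - intros t Ht. pose proof (Hseg t Ht) as P. assert ((1 + t * (nu - 1))%C <> 0%C) by (apply Cneq_0_Re; lra).
      eapply deriv_eq; [|apply deriv_mult; [apply CD_gauss_mass; auto|apply CD_Csqrt; auto]]. field. auto.
    - intros t Ht. eexists. apply deriv_const.
    - intros. rewrite Cmod_0. lra. }
  rewrite Rmult_0_l in C0.
  assert (E : ((gauss_mass (1 + (nu - 1)) * Csqrt (1 + (nu - 1))) - gauss_mass 1 * Csqrt 1 = 0)%C).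
  { apply Cmod_eq_0. apply Rle_antisym; auto. apply Cmod_ge_0. }
  replace (1 + (nu - 1))%C with nu in E by ring.
  rewrite gauss_mass_1, (Csqrt_RtoC 1), sqrt_1 in E by lra.
  replace (gauss_mass nu * Csqrt nu)%C with ((gauss_mass nu * Csqrt nu - RtoC (sqrt (2 * PI)) * 1) + RtoC (sqrt (2 * PI)))%C by ring.
  rewrite E. ring.
Qed.

(** * Dependence on the parameter s *)

Lemma RI2_deriv : forall A (f : C -> R -> R -> C) (f' : R -> R -> C) (c : C) K0 K1 K d, 0 < d ->
  dom2 (f c) K0 -> dom2 f' K1 ->
  (forall h, A h -> Cmod h < d -> exists K2, dom2 (f (c + h)%C) K2) ->
  (forall h x y, A h -> Cmod h < d ->
     Cmod (f (c + h)%C x y - f c x y - h * f' x y)%C <= K * (Cmod h * Cmod h) * (wt x * wt y)) ->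
  deriv A (fun z => RI2 (f z)) c (RI2 f').
Proof.
  intros A f f' c K0 K1 K d Hd D0 D1 D2 HB.
  apply (RI_deriv A (fun z x => RI (f z x)) (fun x => RI (f' x)) c _ _ (PI * K) d Hd (dom2_outer _ _ D0) (dom2_outer _ _ D1)).
  - intros h Ah Hh. destruct (D2 h Ah Hh) as [K2 DD]. eexists. apply dom2_outer. exact DD.
  - intros h x Ah Hh. destruct (D2 h Ah Hh) as [K2 DD].
    pose proof (dom2_inner _ _ x DD) as I1. pose proof (dom2_inner _ _ x D0) as I2. pose proof (dom2_inner _ _ x D1) as I3.
    rewrite <- (RI_scal _ _ h I3). rewrite <- (RI_minus _ _ _ _ I1 I2).
    rewrite <- (RI_minus _ _ _ _ (dom_minus _ _ _ _ I1 I2) (dom_scal _ _ h I3)).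
    replace (PI * K * (Cmod h * Cmod h) * wt x) with (PI * (K * (Cmod h * Cmod h) * wt x)) by ring.
    apply RI_bound. split.
    + apply (dom_minus _ _ _ _ (dom_minus _ _ _ _ I1 I2) (dom_scal _ _ h I3)).
    + intros y. rewrite Rmult_assoc. apply HB; auto.
Qed.

Lemma gap_ds : forall s h x y, (gap (s + h) x y = gap s x y - h * (y, 0%R))%C.
Proof. intros. unfold gap. rewrite RtoC_plus. ring. Qed.

Lemma gap_int_deriv_s : forall (s : R) f0 f1, rapid f0 -> rapid f1 ->
  RD (fun z => gap_int (Re z) f0 f1 1) s (gap_int s f0 (fun y => (y, 0%R) * f1 y)%C 2).
Proof.
  intros s f0 f1 H0 H1.
  pose proof (rapid_mulY f1 0 H1) as H1'. pose proof (rapid_mulY _ 0 H1') as H1''.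
  destruct (rapid_dom _ H0) as [L0 B0]. destruct (rapid_dom _ H1'') as [L1 B1].
  pose proof (dom_K_nonneg _ _ B0) as HL0. pose proof (dom_K_nonneg _ _ B1) as HL1.
  destruct (gap_int_dom2 s f0 f1 1 H0 H1) as [K0 D0]. destruct (gap_int_dom2 s f0 _ 2 H0 H1') as [K1 D1].
  apply (RI2_deriv isreal (fun z x y => f0 x * (f1 y * gap_inv (Re z) 1 x y))%C _ s K0 K1 (L0 * L1) 1 Rlt_0_1 D0 D1).
  - intros h _ _. rewrite Re_plus. apply gap_int_dom2; auto.
  - intros h x y Hh _. assert (Eh : h = RtoC (Re h)) by (apply C_ext; simpl; auto). set (r := Re h) in *.
    rewrite Eh. rewrite Re_plus, !Re_RtoC, Cmod_R.
    unfold gap_inv. pose proof (gap_neq_0 s x y) as N1. pose proof (gap_neq_0 (s + r) x y) as N2.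
    assert (M1 : Cmod (/ gap s x y) <= 1) by apply inv_line_le1, Im_gap.
    assert (M2 : Cmod (/ gap (s + r) x y) <= 1) by apply inv_line_le1, Im_gap.
    pose proof (gap_ds s r x y) as E.
    replace (f0 x * (f1 y * (/ gap (s + r) x y) ^ 1) - f0 x * (f1 y * (/ gap s x y) ^ 1) - r * (f0 x * ((y, 0) * f1 y * (/ gap s x y) ^ 2)))%C
      with (r * r * (f0 x * ((y, 0) * ((y, 0) * f1 y))) * (/ gap s x y * / gap s x y * / gap (s + r) x y))%C.
    + destruct B0 as [_ B0]. destruct B1 as [_ B1]. specialize (B0 x). specialize (B1 y).
      set (q := ((y, 0) * ((y, 0) * f1 y))%C) in *. rewrite !Cmod_mult, Cmod_R.
      pose proof (Cmod_ge_0 (/ gap s x y)). pose proof (Cmod_ge_0 (/ gap (s + r) x y)). pose proof (Rabs_pos r).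
      pose proof (Cmod_ge_0 (f0 x)). pose proof (Cmod_ge_0 q).
      apply Rle_trans with (Rabs r * Rabs r * ((L0 * wt x) * (L1 * wt y)) * (1 * 1 * 1)).
      * apply Rmult_le_compat; [| |apply Rmult_le_compat_l; [nra|apply Rmult_le_compat; auto]|].
        -- apply Rmult_le_pos; [nra|]. apply Rmult_le_pos; auto.
        -- apply Rmult_le_pos; auto. apply Rmult_le_pos; auto.
        -- apply Rmult_le_compat; auto; [apply Rmult_le_pos; auto|]. apply Rmult_le_compat; auto.
      * right. ring.
    + assert (Er : (r * (y, 0) = gap s x y - gap (s + r) x y)%C) by (rewrite E; ring).
      transitivity ((f0 x * f1 y) * ((r * (y, 0)) * (r * (y, 0)) * (/ gap s x y * / gap s x y * / gap (s + r) x y)))%C; [ring|].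
      transitivity ((f0 x * f1 y) * (/ gap (s + r) x y - / gap s x y - (r * (y, 0)) * (/ gap s x y * / gap s x y)))%C; [|simpl Cpow; ring].
      rewrite Er. apply (f_equal (Cmult _)). field. auto.
Qed.

(** * The two Gaussian double integrals of the expansion *)

Section GaussianValues.
Variables nu0 nu1 : C.
Hypotheses (Hn0 : 0 < Re nu0) (Hn1 : 0 < Re nu1).

Definition gauss0 (x : R) : C := gauss nu0 (x, 1%R).
Definition gauss1 (y : R) : C := gauss nu1 (y, 0%R).
Definition gauss0_pole (x : R) : C := (/ (x, 1%R) * gauss0 x)%C.
Definition Ygauss0 (x : R) : C := ((x, 1%R) * gauss0 x)%C.
Definition Ygauss1 (y : R) : C := ((y, 0%R) * gauss1 y)%C.

Lemma rapid_gauss0 : rapid gauss0.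
Proof. apply gauss_rapid; auto. Qed.
Lemma rapid_gauss1 : rapid gauss1.
Proof. apply gauss_rapid; auto. Qed.
Lemma rapid_gauss0_pole : rapid gauss0_pole.
Proof. apply rapid_divY, rapid_gauss0. Qed.
Lemma rapid_Ygauss0 : rapid Ygauss0.
Proof. apply rapid_mulY, rapid_gauss0. Qed.
Lemma rapid_Ygauss1 : rapid Ygauss1.
Proof. apply rapid_mulY, rapid_gauss1. Qed.
Lemma rapid_YYgauss1 : rapid (fun y => (y, 0%R) * Ygauss1 y)%C.
Proof. apply (rapid_mulY Ygauss1 0 rapid_Ygauss1). Qed.
Lemma rapid_YYgauss0 : rapid (fun x => (x, 1%R) * Ygauss0 x)%C.
Proof. apply (rapid_mulY Ygauss0 1 rapid_Ygauss0). Qed.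

Lemma pair1 : forall x : R, ((x, 1%R) : C) = (RtoC x + Ci)%C.
Proof. intros. apply C_ext; simpl; ring. Qed.

Lemma nz0 : nu0 <> 0%C.
Proof. apply Cneq_0_Re. lra. Qed.
Lemma nz1 : nu1 <> 0%C.
Proof. apply Cneq_0_Re. lra. Qed.

Definition mass0 := gauss_mass nu0.
Definition mass1 := gauss_mass nu1.
Definition half_residue : C := (- (PI * Ci))%C.

Lemma RI_gauss0 : RI gauss0 = mass0.
Proof. apply gauss_line; auto. Qed.
Lemma RI_gauss0_pole : RI gauss0_pole = half_residue.
Proof. apply gauss_pole; auto. Qed.

Lemma RD_gauss0 : forall x : R, RD (fun z => gauss nu0 (z + Ci)) x (- nu0 * Ygauss0 x)%C.
Proof.
  intros x. unfold Ygauss0, gauss0. rewrite pair1.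
  eapply deriv_eq; [|apply (deriv_comp _ (gauss nu0) (fun z => z + Ci)%C); [apply CD_gauss|apply deriv_plus; [apply deriv_id|apply deriv_const]]].
  ring.
Qed.

Lemma RD_gauss1 : forall y : R, RD (gauss nu1) y (- nu1 * Ygauss1 y)%C.
Proof.
  intros y. unfold Ygauss1, gauss1. eapply deriv_eq; [|apply deriv_of_CD, CD_gauss].
  change ((y, 0%R) : C) with (RtoC y). ring.
Qed.

Lemma gap_int_Ygauss0 : forall s n, gap_int s Ygauss0 gauss1 n = (- (/ nu0) * (INR n * gap_int s gauss0 gauss1 (S n)))%C.
Proof.
  intros s n.
  pose proof (gap_int_parts0 s (fun z => gauss nu0 (z + Ci)) (fun x => - nu0 * Ygauss0 x)%C gauss1 n) as P.
  assert (Ex : forall x : R, gauss nu0 (RtoC x + Ci) = gauss0 x) by (intros; unfold gauss0; rewrite pair1; auto).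
  rewrite gap_int_scal0 in P by (apply rapid_Ygauss0 || apply rapid_gauss1).
  rewrite (gap_int_ext s (fun y => gauss nu0 (RtoC y + Ci)) gauss0 gauss1 gauss1 (S n)) in P by auto.
  rewrite <- P.
  - field. apply nz0.
  - apply (rapid_ext gauss0); auto. apply rapid_gauss0.
  - apply rapid_scal, rapid_Ygauss0.
  - apply rapid_gauss1.
  - apply RD_gauss0.
Qed.

Lemma gap_int_Ygauss1 : forall (s : R) f0 n, rapid f0 -> gap_int s f0 Ygauss1 n = (/ nu1 * (s * INR n * gap_int s f0 gauss1 (S n)))%C.
Proof.
  intros s f0 n H0.
  pose proof (gap_int_parts1 s f0 (gauss nu1) (fun y => - nu1 * Ygauss1 y)%C n H0) as P.
  rewrite gap_int_scal1 in P by (auto; apply rapid_Ygauss1).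
  replace (gap_int s f0 Ygauss1 n) with (- / nu1 * (- nu1 * gap_int s f0 Ygauss1 n))%C by (field; apply nz1).
  rewrite P.
  - change (fun y : R => gauss nu1 (RtoC y)) with gauss1. ring.
  - apply rapid_gauss1.
  - apply rapid_scal, rapid_Ygauss1.
  - apply RD_gauss1.
Qed.

Lemma den_right : forall s : R, 0 < Re (nu1 + s * s * nu0)%C.
Proof.
  intros s. rewrite Re_plus, <- RtoC_mult, Re_mult, Re_RtoC, Im_RtoC.
  assert (0 <= s * s) by apply Rle_0_sqr. nra.
Qed.

Lemma den_nz : forall s : R, (nu1 + s * s * nu0)%C <> 0%C.
Proof. intros s. apply Cneq_0_Re. pose proof (den_right s). lra. Qed.

(** Integration by parts in each variable turns [Y_0 E_0] and [Y_1 E_1] over the first power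
    into multiples of this integral, and their combination is the product of the masses. *)
Lemma gap_int_2 : forall s : R, (gap_int s gauss0 gauss1 2 = - (mass0 * mass1 * nu0 * nu1 / (nu1 + s * s * nu0)))%C.
Proof.
  intros s. pose proof (gap_int_lower s gauss0 gauss1 0 rapid_gauss0 rapid_gauss1) as L.
  change (fun x : R => ((x, 1%R) * gauss0 x)%C) with Ygauss0 in L. change (fun x : R => ((x, 0%R) * gauss1 x)%C) with Ygauss1 in L.
  rewrite gap_int_zero, RI_gauss0 in L by (apply rapid_gauss0 || apply rapid_gauss1). change (RI gauss1) with mass1 in L.
  rewrite gap_int_Ygauss0, (gap_int_Ygauss1 s gauss0) in L by apply rapid_gauss0.
  pose proof (den_nz s). pose proof nz0. pose proof nz1. simpl INR in L.
  rewrite <- L. field. auto.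
Qed.

Lemma RD_zero_const : forall F : C -> C, (forall x : R, 0 <= x <= 1 -> RD F x 0%C) -> F 1%C = F 0%C.
Proof.
  intros F H.
  pose proof (CRI_FTC F (fun _ => 0%C) 0 1 Rle_0_1 H (fun x _ => cts_const _ x)) as P.
  assert (Z : CRI (fun _ => RtoC 0) 0 1 = RtoC 0).
  { apply Cmod_eq_0. apply Rle_antisym; [|apply Cmod_ge_0].
    eapply Rle_trans; [apply (CRI_bound (fun _ => RtoC 0) 0 1 0); [lra|apply ex_CRI_cts'; intros; apply cts_const|]|lra].
    intros. rewrite Cmod_0. lra. }
  replace (F 1%C) with ((F (RtoC 1) - F (RtoC 0)) + F 0%C)%C by ring. rewrite <- P.
  transitivity (CRI (fun _ => RtoC 0) 0 1 + F 0)%C; [reflexivity|]. rewrite Z. ring.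
Qed.

Definition rho := (Csqrt nu0 / Csqrt nu1)%C.

Lemma rho_sqrt : Csqrt (nu0 / nu1) = rho.
Proof. apply Csqrt_div_right; auto. Qed.

Lemma Re_rho : 0 < Re rho.
Proof.
  unfold rho, Csqrt. rewrite <- Cexp_minus, Re_Cexp. apply Rmult_lt_0_compat; [apply exp_pos|].
  pose proof (Im_Clog_right _ Hn0). pose proof (Im_Clog_right _ Hn1).
  rewrite Im_minus, !half_C, !Im_mult, !Re_RtoC, !Im_RtoC. apply cos_gt_0; lra.
Qed.

Lemma G_eq : forall nu, 0 < Re nu -> gauss_mass nu = (RtoC (sqrt (2 * PI)) / Csqrt nu)%C.
Proof.
  intros nu H. rewrite <- (gauss_mass_eq nu H). field. apply Csqrt_neq_0.
Qed.

Lemma sqrt2PI_sqr : (RtoC (sqrt (2 * PI)) * RtoC (sqrt (2 * PI)) = RtoC 2 * RtoC PI)%C.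
Proof. rewrite <- !RtoC_mult, sqrt_sqrt; auto. pose proof PI_RGT_0. lra. Qed.

(** Up to sign, [s * gap_int s gauss0_pole gauss1 1] and [2 PI arctan (rho s)] have the same derivative in [s],
    by [gap_int_lower] and [gap_int_2], and both vanish at [s = 0]. *)
Lemma lead_value : gap_int 1 gauss0_pole gauss1 1 = (- (2 * PI * Carctan (Csqrt (nu0 / nu1))))%C.
Proof.
  set (F := fun z : C => (z * gap_int (Re z) gauss0_pole gauss1 1 + 2 * PI * Carctan (rho * z))%C).
  pose proof Re_rho as Hr. pose proof nz0 as Z0. pose proof nz1 as Z1.
  assert (Q0 : (Csqrt nu0 * Csqrt nu0)%C = nu0) by (apply Csqrt_sqr; auto).
  assert (Q1 : (Csqrt nu1 * Csqrt nu1)%C = nu1) by (apply Csqrt_sqr; auto).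
  pose proof (Csqrt_neq_0 nu0) as N0. pose proof (Csqrt_neq_0 nu1) as N1.
  assert (E : F 1%C = F 0%C).
  { apply RD_zero_const. intros s _.
    pose proof (gap_int_deriv_s s gauss0_pole gauss1 rapid_gauss0_pole rapid_gauss1) as DI. change (fun y : R => ((y, 0%R) * gauss1 y)%C) with Ygauss1 in DI.
    assert (DA : CD Carctan (rho * s) (/ (1 + (rho * s) * (rho * s)))%C).
    { apply CD_Carctan. destruct (Req_dec s 0) as [->|Hs]; [right; ring|left].
      rewrite Re_mult, Re_RtoC, Im_RtoC. intros K. assert (Re rho * s <> 0) by (apply Rmult_integral_contrapositive; lra). lra. }
    eapply deriv_eq; [|apply deriv_plus; [apply deriv_mult; [apply deriv_id|exact DI]|
      apply deriv_scal, (deriv_comp _ Carctan (fun z => rho * z)%C); [exact DA|apply deriv_scal, deriv_id]]].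
    cbv beta. rewrite ?Re_RtoC.
    pose proof (gap_int_lower s gauss0_pole gauss1 1 rapid_gauss0_pole rapid_gauss1) as L.
    change (fun x : R => ((x, 0%R) * gauss1 x)%C) with Ygauss1 in L.
    rewrite (gap_int_ext s _ gauss0 gauss1 gauss1 2) in L; [|intros x; unfold gauss0_pole; field; apply Cneq_0_Im; simpl; lra|auto].
    replace (gap_int s gauss0_pole gauss1 1) with (gap_int s gauss0 gauss1 2 - s * gap_int s gauss0_pole Ygauss1 2)%C by exact L.
    pose proof (gap_int_2 s) as V. unfold mass0, mass1 in V. rewrite !G_eq in V by auto.
    pose proof (den_nz s) as DZ.
    assert (Hk : (RtoC (sqrt (2 * PI)) * RtoC (sqrt (2 * PI)) = RtoC 2 * RtoC PI)%C) by apply sqrt2PI_sqr.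
    clear F DI DA L Hr. unfold rho. revert V DZ Hk Q0 Q1 N0 N1.
    generalize (gap_int s gauss0 gauss1 2) (gap_int s gauss0_pole Ygauss1 2) (RtoC (sqrt (2 * PI))) (Csqrt nu0) (Csqrt nu1).
    intros I2 J k q0 q1 V DZ Hk Q0 Q1 N0 N1. rewrite V, <- Q0, <- Q1. rewrite <- Q0, <- Q1 in DZ.
    transitivity ((RtoC 2 * RtoC PI - k * k) * (q0 * q1 / (q1 * q1 + s * s * (q0 * q0))))%C.
    - field. repeat split; auto.
      replace (q1 * q1 + q0 * s * (q0 * s))%C with (q1 * q1 + s * s * (q0 * q0))%C by ring. auto.
    - rewrite Hk. ring. }
  unfold F in E. rewrite !Re_RtoC, rho_sqrt in *. rewrite Cmult_1_r, Cmult_0_r, Carctan_0 in E.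
  match goal with |- ?a = _ => replace a with ((1 * a + 2 * PI * Carctan rho) - 2 * PI * Carctan rho)%C by ring end.
  rewrite E. ring.
Qed.

(** The product [gap_int s gauss0 gauss1 1 * Csqrt (nu1 + s^2 nu0)] does not depend on [s]; at [s = 0] the
    variables separate. *)
Lemma pole_value : (gap_int 1 gauss0 gauss1 1 * Csqrt (nu0 + nu1) = half_residue * RtoC (sqrt (2 * PI)))%C.
Proof.
  set (F := fun z : C => (gap_int (Re z) gauss0 gauss1 1 * Csqrt (nu1 + z * z * nu0))%C).
  pose proof nz0 as Z0. pose proof nz1 as Z1.
  assert (E : F 1%C = F 0%C).
  { apply RD_zero_const. intros s _.
    pose proof (gap_int_deriv_s s gauss0 gauss1 rapid_gauss0 rapid_gauss1) as DI. change (fun y : R => ((y, 0%R) * gauss1 y)%C) with Ygauss1 in DI.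
    pose proof (den_right s) as DR. pose proof (den_nz s) as DZ.
    eapply deriv_eq; [|apply deriv_mult; [exact DI|apply (deriv_comp _ Csqrt (fun z => nu1 + z * z * nu0)%C);
      [apply CD_Csqrt; auto|apply deriv_plus; [apply deriv_const|apply deriv_mult; [apply deriv_mult; apply deriv_id|apply deriv_const]]]]].
    cbv beta. rewrite ?Re_RtoC.
    pose proof (gap_int_lower s gauss0 gauss1 1 rapid_gauss0 rapid_gauss1) as L.
    change (fun x : R => ((x, 0%R) * gauss1 x)%C) with Ygauss1 in L. change (fun x : R => ((x, 1%R) * gauss0 x)%C) with Ygauss0 in L.
    rewrite <- L. rewrite gap_int_Ygauss0, gap_int_Ygauss1 by apply rapid_gauss0. simpl INR.
    assert (Eh : RtoC (/ 2) = (/ (1 + 1))%C) by (rewrite RtoC_inv by lra; f_equal; apply C_ext; simpl; ring).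
    rewrite Eh. rewrite RtoC_plus. field. repeat split; auto. }
  unfold F in E. rewrite !Re_RtoC in E.
  replace (nu1 + 1 * 1 * nu0)%C with (nu0 + nu1)%C in E by ring. rewrite E.
  replace (nu1 + 0 * 0 * nu0)%C with nu1 by ring.
  assert (E00 : gap_int 0 gauss0 gauss1 1 = (half_residue * mass1)%C).
  { change mass1 with (RI gauss1). rewrite <- RI_gauss0_pole. rewrite <- (gap_int_zero 0 gauss0_pole gauss1) by (apply rapid_gauss0_pole || apply rapid_gauss1).
    apply RI2_ext. intros x y. unfold gap_inv, gap, gauss0_pole.
    replace ((x, 1%R) - RtoC 0 * (y, 0%R))%C with ((x, 1%R) : C) by (apply C_ext; simpl; ring).
    simpl. ring. }
  rewrite E00. unfold mass1. rewrite G_eq by auto. field. apply Csqrt_neq_0.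
Qed.

(** The terms of first order in [h]: the cubic terms of the exponents, and the constant
    term -1/2 in the expansion of each kernel at its pole. *)
Definition corr_integrand (x y : R) : C :=
  (gauss0 x * gauss1 y * ((nu0 * ((x, 1%R) * (x, 1%R) * (x, 1%R)) + nu1 * ((y, 0%R) * (y, 0%R) * (y, 0%R))) * RtoC (/ 6)
     * (/ (x, 1%R) * / gap 1 x y) + RtoC (/ 2) * / (x, 1%R) - RtoC (/ 2) * / gap 1 x y))%C.

(** The cubic terms are reduced by parts, as [nu_j Y_j E_j] is minus the derivative of [E_j];
    the integrals over the second power that this produces cancel by [gap_int_lower]. *)
Lemma corr_value : RI2 corr_integrand = (RtoC (/ 3) * (half_residue * mass1 - gap_int 1 gauss0 gauss1 1))%C /\
  exists K, dom2 corr_integrand K.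
Proof.
  pose proof nz0 as Z0. pose proof nz1 as Z1.
  set (YY0 := fun x => (nu0 * ((x, 1%R) * Ygauss0 x))%C).
  set (YY1 := fun y => (nu1 * ((y, 0%R) * Ygauss1 y))%C).
  assert (r0 : rapid YY0) by apply rapid_scal, rapid_YYgauss0.
  assert (r1 : rapid YY1) by apply rapid_scal, rapid_YYgauss1.
  assert (r1' : rapid (fun y => (y, 0%R) * YY1 y)%C) by (apply rapid_mulY; auto).
  destruct (gap_int_dom2 1 YY0 gauss1 1 r0 rapid_gauss1) as [Ka Da].
  destruct (gap_int_dom2 1 gauss0_pole _ 1 rapid_gauss0_pole r1') as [Kb Db].
  destruct (gap_int_dom2 1 gauss0_pole gauss1 0 rapid_gauss0_pole rapid_gauss1) as [Kc Dc].
  destruct (gap_int_dom2 1 gauss0 gauss1 1 rapid_gauss0 rapid_gauss1) as [Kd Dd].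
  assert (Ei : forall x y, (RtoC (/ 6) * (YY0 x * (gauss1 y * gap_inv 1 1 x y) + gauss0_pole x * ((y, 0%R) * YY1 y * gap_inv 1 1 x y))
     + (RtoC (/ 2) * (gauss0_pole x * (gauss1 y * gap_inv 1 0 x y)) - RtoC (/ 2) * (gauss0 x * (gauss1 y * gap_inv 1 1 x y))))%C = corr_integrand x y).
  { intros x y. unfold corr_integrand, YY0, YY1, Ygauss0, Ygauss1, gauss0_pole, gap_inv.
    assert (N : ((x, 1%R) : C) <> 0%C) by (apply Cneq_0_Im; simpl; lra). pose proof (gap_neq_0 1 x y).
    simpl Cpow. field. auto. }
  pose proof (dom2_plus _ _ _ _ (dom2_scal _ _ (RtoC (/ 6)) (dom2_plus _ _ _ _ Da Db))
     (dom2_minus _ _ _ _ (dom2_scal _ _ (RtoC (/ 2)) Dc) (dom2_scal _ _ (RtoC (/ 2)) Dd))) as DD.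
  split; [|eexists; eapply dom2_ext; [exact Ei|exact DD]].
  assert (EI : RI2 corr_integrand = (RtoC (/ 6) * (gap_int 1 YY0 gauss1 1 + gap_int 1 gauss0_pole (fun y => (y, 0%R) * YY1 y)%C 1)
     + (RtoC (/ 2) * gap_int 1 gauss0_pole gauss1 0 - RtoC (/ 2) * gap_int 1 gauss0 gauss1 1))%C).
  { etransitivity; [exact (eq_sym (RI2_ext _ _ Ei))|].
    etransitivity; [exact (RI2_plus _ _ _ _ (dom2_scal _ _ (RtoC (/ 6)) (dom2_plus _ _ _ _ Da Db))
      (dom2_minus _ _ _ _ (dom2_scal _ _ (RtoC (/ 2)) Dc) (dom2_scal _ _ (RtoC (/ 2)) Dd)))|].
    apply f_equal2.
    - etransitivity; [exact (RI2_scal _ _ _ (dom2_plus _ _ _ _ Da Db))|]. apply f_equal. exact (RI2_plus _ _ _ _ Da Db).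
    - etransitivity; [exact (RI2_minus _ _ _ _ (dom2_scal _ _ (RtoC (/ 2)) Dc) (dom2_scal _ _ (RtoC (/ 2)) Dd))|].
      apply f_equal2; [exact (RI2_scal _ _ _ Dc)|exact (RI2_scal _ _ _ Dd)]. }
  rewrite EI.
  rewrite gap_int_zero, RI_gauss0_pole by (apply rapid_gauss0_pole || apply rapid_gauss1). change (RI gauss1) with mass1.
  pose proof (gap_int_lower 1 gauss0_pole YY1 0 rapid_gauss0_pole r1) as LA.
  rewrite gap_int_zero, RI_gauss0_pole in LA by (apply rapid_gauss0_pole || auto).
  assert (EM : RI YY1 = mass1) by apply gauss_second_moment, Hn1. rewrite EM in LA.
  rewrite (gap_int_ext 1 _ gauss0 YY1 YY1 1) in LA; [|intros x; unfold gauss0_pole; field; apply Cneq_0_Im; simpl; lra|auto].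
  assert (LB : gap_int 1 gauss0 (fun y => gauss1 y - YY1 y)%C 1 = (- (1 * 1) * gap_int 1 gauss0 Ygauss1 2)%C).
  { apply (gap_int_parts1 1 gauss0 (fun z => z * gauss nu1 z)%C (fun y => gauss1 y - YY1 y)%C 1).
    - apply rapid_gauss0. - apply rapid_Ygauss1. - apply rapid_minus; [apply rapid_gauss1|auto].
    - intros y. eapply deriv_eq; [|apply deriv_mult; [apply deriv_id|apply RD_gauss1]].
      unfold YY1, gauss1. change ((y, 0%R) : C) with (RtoC y). ring. }
  assert (LB' : (gap_int 1 gauss0 (fun y => gauss1 y - YY1 y) 1 = gap_int 1 gauss0 gauss1 1 - gap_int 1 gauss0 YY1 1)%C).
  { rewrite (gap_int_ext 1 gauss0 gauss0 _ (fun y => gauss1 y + (- (1)) * YY1 y)%C 1); [|auto|intros; ring].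
    rewrite gap_int_plus1, gap_int_scal1 by (apply rapid_gauss0 || apply rapid_gauss1 || auto || apply rapid_scal; auto). ring. }
  assert (LC : gap_int 1 (fun x => gauss0 x - YY0 x)%C gauss1 1 = (1 * gap_int 1 Ygauss0 gauss1 2)%C).
  { assert (Ex : forall x : R, Ygauss0 x = ((RtoC x + Ci) * gauss nu0 (RtoC x + Ci))%C) by (intros; unfold Ygauss0, gauss0; rewrite !pair1; auto).
    rewrite (gap_int_ext 1 Ygauss0 (fun x : R => (RtoC x + Ci) * gauss nu0 (RtoC x + Ci))%C gauss1 gauss1 2) by auto.
    apply (gap_int_parts0 1 (fun z => (z + Ci) * gauss nu0 (z + Ci))%C (fun x => gauss0 x - YY0 x)%C gauss1 1).
    - apply (rapid_ext Ygauss0); auto. apply rapid_Ygauss0.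
    - apply rapid_minus; [apply rapid_gauss0|auto].
    - apply rapid_gauss1.
    - intros x. eapply deriv_eq; [|apply deriv_mult; [apply deriv_plus; [apply deriv_id|apply deriv_const]|apply RD_gauss0]].
      unfold YY0, gauss0. rewrite !pair1. ring. }
  assert (LC' : (gap_int 1 (fun x => gauss0 x - YY0 x) gauss1 1 = gap_int 1 gauss0 gauss1 1 - gap_int 1 YY0 gauss1 1)%C).
  { rewrite (gap_int_ext 1 _ (fun x => gauss0 x + (- (1)) * YY0 x)%C gauss1 gauss1 1); [|intros; ring|auto].
    rewrite gap_int_plus0, gap_int_scal0 by (apply rapid_gauss0 || apply rapid_gauss1 || auto || apply rapid_scal; auto). ring. }
  pose proof (gap_int_lower 1 gauss0 gauss1 1 rapid_gauss0 rapid_gauss1) as LD.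
  change (fun x : R => ((x, 0%R) * gauss1 x)%C) with Ygauss1 in LD. change (fun x : R => ((x, 1%R) * gauss0 x)%C) with Ygauss0 in LD.
  set (D1 := gap_int 1 gauss0 gauss1 1) in *. set (X := gap_int 1 Ygauss0 gauss1 2) in *. set (Y := gap_int 1 gauss0 Ygauss1 2) in *.
  set (P := gap_int 1 YY0 gauss1 1) in *. set (Q := gap_int 1 gauss0 YY1 1) in *. set (S := gap_int 1 gauss0_pole (fun y => (y, 0%R) * YY1 y)%C 1) in *.
  rewrite LB' in LB. rewrite LC' in LC.
  assert (EP : P = (D1 - X)%C).
  { replace P with (D1 - (D1 - P))%C by ring. rewrite LC. ring. }
  assert (EQ : Q = (D1 + Y)%C).
  { replace Q with (D1 - (D1 - Q))%C by ring. rewrite LB. ring. }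
  assert (ES : S = (Q - half_residue * mass1)%C) by (rewrite <- LA; ring).
  assert (EX : X = (D1 + Y)%C) by (rewrite <- LD; ring).
  rewrite EP, ES, EQ, EX.
  replace (/ 2) with (/ 6 + / 6 + / 6) by lra. replace (/ 3) with (/ 6 + / 6) by lra. rewrite !RtoC_plus. ring.
Qed.
End GaussianValues.

(** * The phase on lines close to the real axis *)

Definition exp_excess (x : R) : R := exp x - 1 - x.

Lemma exp_quad_le : forall x, 0 <= x -> 1 + x + x * x / 4 <= exp x.
Proof.
  intros x Hx. replace x with (x / 2 + x / 2) at 4 by field. rewrite exp_plus.
  pose proof (exp_ineq1_le (x / 2)). nra.
Qed.

Lemma exp_upper : forall x, x < 1 -> exp x <= / (1 - x).
Proof.
  intros x Hx. rewrite <- (Rinv_inv (exp x)). rewrite <- exp_Ropp.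
  apply Rinv_le_contravar; [lra|]. pose proof (exp_ineq1_le (- x)). lra.
Qed.

Lemma exp_excess_nonneg : forall x, 0 <= exp_excess x.
Proof. intros. unfold exp_excess. pose proof (exp_ineq1_le x). lra. Qed.

(** The derivative of the difference is [2 (e^x - 1) (4 - e^x)], of the sign of [x]. *)
Lemma expm1_sq_le : forall x, exp x <= 4 -> (exp x - 1) * (exp x - 1) <= 8 * exp_excess x.
Proof.
  intros x Hx.
  set (F := fun x => 8 * exp_excess x - (exp x - 1) * (exp x - 1)).
  set (F' := fun x => 2 * (exp x - 1) * (4 - exp x)).
  assert (D : forall c, derivable_pt_lim F c (F' c)).
  { intros c. apply is_derive_Reals. unfold F, F', exp_excess. auto_derive; auto. ring. }
  assert (F0 : F 0 = 0) by (unfold F, exp_excess; rewrite exp_0; ring).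
  enough (0 <= F x) by (unfold F in *; lra).
  destruct (Rtotal_order x 0) as [L|[L|L]].
  - destruct (MVT_cor2 F F' x 0 L) as [c [Q1 Q2]]; [intros; apply D|].
    assert (exp c < 1) by (rewrite <- exp_0; apply exp_increasing; lra). pose proof (exp_pos c).
    assert (Z : F' c <= 0) by (unfold F'; nra). rewrite F0 in Q1. nra.
  - rewrite L, F0. lra.
  - destruct (MVT_cor2 F F' 0 x L) as [c [Q1 Q2]]; [intros; apply D|].
    assert (1 < exp c) by (rewrite <- exp_0; apply exp_increasing; lra).
    assert (exp c < exp x) by (apply exp_increasing; lra).
    assert (Z : 0 <= F' c) by (unfold F'; nra). rewrite F0 in Q1. nra.
Qed.

Lemma expm1_le_exp_excess : forall x, 2 < exp x -> exp x - 1 <= 9 * exp_excess x.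
Proof.
  intros x Hx.
  assert (H : 1 / 2 < x).
  { apply Rnot_le_lt. intros K. pose proof (exp_upper x ltac:(lra)).
    assert (/ (1 - x) <= 2) by (rewrite <- (Rinv_inv 2); apply Rinv_le_contravar; lra). lra. }
  pose proof (exp_quad_le x ltac:(lra)). unfold exp_excess. nra.
Qed.

Lemma expm1_abs_lower : forall x, Rabs x <= 1 -> Rabs x / 2 <= Rabs (exp x - 1).
Proof.
  intros x Hx. apply Rabs_le_between in Hx. destruct (Rle_dec 0 x).
  - pose proof (exp_ineq1_le x). rewrite !Rabs_pos_eq by lra. lra.
  - pose proof (exp_upper x ltac:(lra)) as U.
    assert (/ (1 - x) <= 1 + x / 2).
    { apply Rmult_le_reg_r with (1 - x); [lra|]. rewrite Rinv_l by lra. nra. }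
    rewrite !Rabs_left by lra. lra.
Qed.

(** Below by [(h x)^2 / 32 ] near 0 and by a linear function further out, which after
    rescaling leaves a linear bound independent of [h]. *)
Lemma exp_excess_lower : forall x h, 0 < h <= 1 -> Rabs x / 64 - 1 <= exp_excess (h * x) / (h * h).
Proof.
  intros x h Hh. set (z := h * x). set (a := Rabs x).
  assert (Ha : 0 <= a) by apply Rabs_pos.
  assert (Hz : Rabs z = h * a) by (unfold z, a; rewrite Rabs_mult, (Rabs_pos_eq h) by lra; auto).
  assert (Hhh : 0 < h * h) by nra.
  apply Rmult_le_reg_r with (h * h); auto. replace (exp_excess z / (h * h) * (h * h)) with (exp_excess z) by (field; lra).
  destruct (Rle_dec (Rabs z) 1) as [L|L].
  - pose proof (expm1_abs_lower z L) as B.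
    assert (E4 : exp z <= 4).
    { apply Rabs_le_between in L. eapply Rle_trans; [apply exp_le_compat with (y := 1); lra|]. pose proof exp_le_3. lra. }
    pose proof (expm1_sq_le z E4) as Q.
    assert ((exp z - 1) * (exp z - 1) = Rabs (exp z - 1) * Rabs (exp z - 1)) by (rewrite <- Rabs_mult; symmetry; apply Rabs_pos_eq; apply Rle_0_sqr).
    rewrite Hz in B. assert (0 <= h * a) by nra.
    assert (h * a / 2 * (h * a / 2) <= Rabs (exp z - 1) * Rabs (exp z - 1)) by (apply Rmult_le_compat; lra).
    assert (a / 64 - 1 <= a * a / 32) by (pose proof (Rle_0_sqr (a - 1)); unfold Rsqr in *; nra).
    assert ((a / 64 - 1) * (h * h) <= a * a / 32 * (h * h)) by (apply Rmult_le_compat_r; lra). nra.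
  - apply Rnot_le_lt in L. rewrite Hz in L.
    assert (G : h * a / 64 <= exp_excess z).
    { destruct (Rle_dec 0 z) as [P|P].
      - rewrite Rabs_pos_eq in Hz by auto. pose proof (exp_quad_le z P). unfold exp_excess. nra.
      - rewrite Rabs_left in Hz by lra. unfold exp_excess. pose proof (exp_pos z).
        destruct (Rle_dec (h * a) 2).
        + assert (U : exp z <= 1 / 2).
          { eapply Rle_trans; [apply exp_le_compat with (y := -1); lra|]. pose proof (exp_upper (-1) ltac:(lra)) as U.
            replace (1 - -1) with 2 in U by ring. lra. }
          assert (E4 : exp z <= 4) by lra. pose proof (expm1_sq_le z E4) as Q. unfold exp_excess in Q. nra.
        + lra. }
    assert (a / 64 * (h * h) <= h * a / 64) by nra. nra.
Qed.

(** * The scaled exponential factor *)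

(** The exponential factor at [v = h Y] divided by its value at the saddle point, where
    [nu = h^2 N]. *)
Definition scaled_gauss (nu : C) (h : R) (Y : C) : C := Cexp (- (nu * RtoC (/ (h * h)) * exp_rem2 (h * Y)))%C.

Lemma exp_rem2_split : forall x t : R, exp_rem2 (x, t) = (RtoC (exp_excess x) + RtoC (exp x - 1) * exp_rem1 (0%R, t) + exp_rem2 (0%R, t))%C.
Proof.
  intros. unfold exp_rem2, exp_rem1, exp_excess. apply C_ext; unfold Cexp; simpl; rewrite exp_0; ring.
Qed.

(** On the real axis the phase is at least [lam * exp_excess x].  Raising the line to height [t] adds
    a cross term of size [|e^x - 1| t], absorbed by half of it: for [e^x <= 2] through
    [(e^x - 1)^2 <= 8 exp_excess x], beyond through [e^x - 1 <= 9 exp_excess x]. *)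
Lemma phase_lower : forall lam Lam nu x t, 0 < lam -> lam <= Re nu -> Cmod nu <= Lam ->
  0 <= t -> t <= 1 -> 54 * Lam * t <= lam ->
  lam / 2 * exp_excess x - (36 * Lam * Lam / lam + 3 * Lam) * (t * t) <= Re (nu * exp_rem2 (x, t))%C.
Proof.
  intros lam Lam nu x t Hl H1 H2 Ht0 Ht1 Ht.
  pose proof (Cmod_ge_0 nu) as HL0.
  assert (Hm : Cmod (0%R, t) = t).
  { replace ((0%R, t) : C) with (Ci * RtoC t)%C by (apply C_ext; simpl; ring).
    rewrite Cmod_mult, Cmod_Ci, Cmod_R, Rabs_pos_eq by auto. ring. }
  destruct (taylor_le1 (0%R, t)) as [B1 [B2 _]]; [lra|]. rewrite Hm in B1, B2.
  rewrite exp_rem2_split.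
  replace (nu * (RtoC (exp_excess x) + RtoC (exp x - 1) * exp_rem1 (0%R, t) + exp_rem2 (0%R, t)))%C with
    (RtoC (exp_excess x) * nu + (RtoC (exp x - 1) * (nu * exp_rem1 (0%R, t)) + nu * exp_rem2 (0%R, t)))%C by ring.
  rewrite !Re_plus. rewrite (Re_mult (RtoC (exp_excess x))), Re_RtoC, Im_RtoC.
  pose proof (exp_excess_nonneg x) as Hg.
  set (q := Rabs (exp x - 1)). assert (Hq : 0 <= q) by apply Rabs_pos.
  assert (R1 : - (3 * Lam * t * q) <= Re (RtoC (exp x - 1) * (nu * exp_rem1 (0%R, t)))).
  { pose proof (re_le_Cmod (RtoC (exp x - 1) * (nu * exp_rem1 (0%R, t)))) as R. apply Rabs_le_between in R.
    rewrite !Cmod_mult, Cmod_R in R. fold q in R. pose proof (Cmod_ge_0 (exp_rem1 (0%R, t))).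
    assert (q * (Cmod nu * Cmod (exp_rem1 (0%R, t))) <= q * (Lam * (3 * t))) by (apply Rmult_le_compat_l; auto; apply Rmult_le_compat; auto).
    lra. }
  assert (R2 : - (3 * Lam * (t * t)) <= Re (nu * exp_rem2 (0%R, t))).
  { pose proof (re_le_Cmod (nu * exp_rem2 (0%R, t))) as R. apply Rabs_le_between in R.
    rewrite !Cmod_mult in R. pose proof (Cmod_ge_0 (exp_rem2 (0%R, t))).
    assert (Cmod nu * Cmod (exp_rem2 (0%R, t)) <= Lam * (3 * t ^ 2)) by (apply Rmult_le_compat; auto). lra. }
  assert (R3 : 3 * Lam * t * q <= lam / 2 * exp_excess x + 36 * Lam * Lam / lam * (t * t)).
  { assert (HLam : 0 <= Lam) by lra.
    assert (0 <= 36 * Lam * Lam / lam * (t * t)).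
    { apply Rmult_le_pos; [|nra]. apply Rmult_le_pos; [nra|left; apply Rinv_0_lt_compat; auto]. }
    destruct (Rle_dec (exp x) 2) as [L|L].
    - pose proof (expm1_sq_le x ltac:(lra)) as Q.
      assert (Eq : (exp x - 1) * (exp x - 1) = q * q) by (unfold q; rewrite <- Rabs_mult; symmetry; apply Rabs_pos_eq; apply Rle_0_sqr).
      rewrite Eq in Q.
      assert (3 * Lam * t * q <= lam / 16 * (q * q) + 36 * Lam * Lam / lam * (t * t)).
      { apply Rmult_le_reg_r with lam; auto.
        replace ((lam / 16 * (q * q) + 36 * Lam * Lam / lam * (t * t)) * lam) with (lam * lam / 16 * (q * q) + 36 * Lam * Lam * (t * t)) by (field; lra).
        pose proof (Rle_0_sqr (lam * q / 4 - 6 * Lam * t)). unfold Rsqr in *. nra. }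
      nra.
    - apply Rnot_le_lt in L. pose proof (expm1_le_exp_excess x L) as Q.
      assert (Eq : q = exp x - 1) by (unfold q; apply Rabs_pos_eq; lra). rewrite <- Eq in Q.
      assert (0 <= 3 * Lam * t) by nra.
      assert (3 * Lam * t * q <= 3 * Lam * t * (9 * exp_excess x)) by (apply Rmult_le_compat_l; auto).
      assert (3 * Lam * t * (9 * exp_excess x) <= lam / 2 * exp_excess x) by nra. lra. }
  assert (lam * exp_excess x <= exp_excess x * Re nu) by nra. nra.
Qed.

Lemma scaled_gauss_decay : forall lam Lam, 0 < lam -> forall m, exists K h0, 0 < K /\ 0 < h0 /\ forall nu h t x,
  lam <= Re nu -> Cmod nu <= Lam -> 0 < h <= h0 -> 0 <= t <= 1 -> Cmod (scaled_gauss nu h (x, t)) <= K * wt x ^ m.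
Proof.
  intros lam Lam Hl m. destruct (exp_decay (lam / 128) m) as [K [HK H]]; [lra|].
  set (L := Rmax Lam 0). set (D := lam / 2 + (36 * L * L / lam + 3 * L)).
  assert (HL : 0 <= L) by apply Rmax_r.
  exists (exp D * K), (Rmin 1 (lam / (54 * (L + 1)))).
  split; [apply Rmult_lt_0_compat; auto; apply exp_pos|].
  split; [apply Rmin_pos; [lra|apply Rdiv_lt_0_compat; lra]|].
  intros nu h t x H1 H2 [Hh0 Hh] Ht.
  assert (Hh1 : h <= 1) by (eapply Rle_trans; [exact Hh|apply Rmin_l]).
  assert (Hh2 : h <= lam / (54 * (L + 1))) by (eapply Rle_trans; [exact Hh|apply Rmin_r]).
  rewrite Rmult_assoc. apply Rle_trans with (exp D * exp (- (lam / 128 * Rabs x))); [|apply Rmult_le_compat_l; auto; left; apply exp_pos].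
  unfold scaled_gauss. rewrite Cmod_Cexp, <- exp_plus. apply exp_le_compat.
  assert (Ev : (h * (x, t))%C = ((h * x)%R, (h * t)%R)) by (apply C_ext; simpl; ring). rewrite Ev.
  assert (Hhh : 0 < h * h) by nra.
  pose proof (phase_lower lam L nu (h * x) (h * t) Hl H1) as P.
  assert (Q : 54 * L * h <= lam).
  { apply Rle_trans with (54 * (L + 1) * h); [nra|]. apply Rmult_le_compat_l with (r := 54 * (L + 1)) in Hh2; [|lra].
    replace (54 * (L + 1) * (lam / (54 * (L + 1)))) with lam in Hh2 by (field; lra). lra. }
  specialize (P ltac:(eapply Rle_trans; [exact H2|apply Rmax_l]) ltac:(nra) ltac:(nra)).
  assert (Q2 : 54 * L * (h * t) <= lam).
  { apply Rle_trans with (54 * L * h); auto. apply Rmult_le_compat_l; [lra|]. nra. }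
  specialize (P Q2).
  rewrite Re_opp.
  replace (Re (nu * RtoC (/ (h * h)) * exp_rem2 ((h * x)%R, (h * t)%R))%C) with (Re (nu * exp_rem2 ((h * x)%R, (h * t)%R))%C / (h * h)).
  2:{ replace (nu * RtoC (/ (h * h)) * exp_rem2 ((h * x)%R, (h * t)%R))%C with (RtoC (/ (h * h)) * (nu * exp_rem2 ((h * x)%R, (h * t)%R)))%C by ring.
      rewrite (Re_mult (RtoC _)), Re_RtoC, Im_RtoC. unfold Rdiv. ring. }
  pose proof (exp_excess_lower x h ltac:(lra)) as G.
  assert (HC : 0 <= 36 * L * L / lam + 3 * L).
  { assert (0 <= 36 * L * L / lam) by (apply Rmult_le_pos; [nra|left; apply Rinv_0_lt_compat; auto]). lra. }
  revert P. set (R0 := Re (nu * exp_rem2 ((h * x)%R, (h * t)%R))%C). unfold D. revert HC. generalize (36 * L * L / lam + 3 * L). intros C0 HC P.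
  assert (P2 : (lam / 2 * exp_excess (h * x) - C0 * (h * t * (h * t))) / (h * h) <= R0 / (h * h)).
  { apply Rmult_le_compat_r; auto. left. apply Rinv_0_lt_compat; auto. }
  replace ((lam / 2 * exp_excess (h * x) - C0 * (h * t * (h * t))) / (h * h)) with (lam / 2 * (exp_excess (h * x) / (h * h)) - C0 * (t * t)) in P2 by (field; lra).
  assert (C0 * (t * t) <= C0) by (assert (t * t <= 1) by nra; nra).
  assert (lam / 2 * (Rabs x / 64 - 1) <= lam / 2 * (exp_excess (h * x) / (h * h))) by (apply Rmult_le_compat_l; lra).
  lra.
Qed.

Lemma Cmod_line_sq : forall x t, 0 <= t <= 1 -> Cmod (x, t) * Cmod (x, t) <= / wt x.
Proof.
  intros x t Ht. rewrite Cmod_sqr. simpl. unfold wt. rewrite Rinv_inv. nra.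
Qed.

Lemma Cmod_line_le : forall x t, 0 <= t <= 1 -> Cmod (x, t) <= / wt x.
Proof.
  intros x t Ht. pose proof (Cmod_line_sq x t Ht). pose proof (Cmod_ge_0 (x, t)).
  assert (1 <= / wt x) by (unfold wt; rewrite Rinv_inv; nra).
  destruct (Rle_dec (Cmod (x, t)) 1); [lra|nra].
Qed.

(** Where [h |Y| <= 1] the exponent is expanded by Taylor's formula; elsewhere
    [h^2 |Y|^2 > 1], and each of the three terms is as small as the error. *)
Lemma scaled_gauss_expand : forall lam Lam, 0 < lam -> forall m, exists K h0, 0 < K /\ 0 < h0 /\ forall nu h t x,
  lam <= Re nu -> Cmod nu <= Lam -> 0 < h <= h0 -> 0 <= t <= 1 ->
  Cmod (gauss nu (x, t)) <= K * wt x ^ m /\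
  Cmod (- (nu * ((x, t) * (x, t) * (x, t)) * RtoC (/ 6)) * gauss nu (x, t))%C <= K * wt x ^ m /\
  Cmod (scaled_gauss nu h (x, t) - gauss nu (x, t) - h * (- (nu * ((x, t) * (x, t) * (x, t)) * RtoC (/ 6)) * gauss nu (x, t)))%C
   <= K * wt x ^ m * (h * h).
Proof.
  intros lam Lam Hl m.
  destruct (scaled_gauss_decay lam Lam Hl (m + 3)) as [K1 [h1 [HK1 [Hh1 B1]]]].
  destruct (gauss_decay lam Lam 1 Hl Rle_0_1 (m + 3)) as [K2 [HK2 B2]].
  set (L := Rmax Lam 0). assert (HL : 0 <= L) by apply Rmax_r.
  set (K0 := K1 + K2). assert (HK0 : 0 < K0) by (unfold K0; lra).
  exists (K0 * (9 * L * L + 3 * L + L + 2)), (Rmin h1 1).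
  split; [apply Rmult_lt_0_compat; nra|]. split; [apply Rmin_pos; lra|].
  intros nu h t x H1 H2 [Hh0 Hh] Ht.
  assert (Hha : h <= h1) by (eapply Rle_trans; [exact Hh|apply Rmin_l]).
  assert (Hhb : h <= 1) by (eapply Rle_trans; [exact Hh|apply Rmin_r]).
  specialize (B1 nu h t x H1 H2 (conj Hh0 Hha) Ht).
  specialize (B2 nu t x H1 H2 ltac:(apply Rabs_le; lra)).
  assert (HnL : Cmod nu <= L) by (eapply Rle_trans; [exact H2|apply Rmax_l]).
  pose proof (wt_pos x) as Wx. pose proof (wt_le_1 x) as Wx1.
  pose proof (Cmod_line_sq x t Ht) as YY. pose proof (Cmod_line_le x t Ht) as Y1.
  pose proof (Cmod_ge_0 (x, t)) as Y0.
  assert (Hwm : 0 < wt x ^ m) by (apply pow_lt; auto).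
  assert (Hw3 : wt x ^ (m + 3) = wt x ^ m * (wt x * wt x * wt x)) by (rewrite pow_add; ring).
  rewrite Hw3 in B1, B2.
  set (y := Cmod (x, t)) in *. set (w := wt x) in *.
  assert (Iw : 1 <= / w) by (rewrite <- Rinv_1; apply Rinv_le_contravar; lra).
  assert (Hww : w * / w = 1) by (apply Rinv_r; lra).
  (* [w y^2 <= 1], so [w^3] absorbs the powers of [y] up to the sixth *)
  assert (P0 : w * w * w <= 1) by nra.
  assert (P3 : w * w * w * (y * y * y) <= 1).
  { apply Rle_trans with (w * w * w * (/ w * / w)).
    - apply Rmult_le_compat_l; [nra|]. apply Rmult_le_compat; auto; nra.
    - replace (w * w * w * (/ w * / w)) with (w * (w * / w) * (w * / w)) by ring. rewrite Hww. lra. }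
  assert (P6 : w * w * w * (y * y * y * (y * y * y)) <= 1).
  { apply Rle_trans with (w * w * w * (/ w * / w * / w)).
    - apply Rmult_le_compat_l; [nra|]. replace (y * y * y * (y * y * y)) with ((y * y) * (y * y) * (y * y)) by ring.
      apply Rmult_le_compat; auto; [nra|nra|]. apply Rmult_le_compat; auto; nra.
    - replace (w * w * w * (/ w * / w * / w)) with ((w * / w) * (w * / w) * (w * / w)) by ring. rewrite Hww. lra. }
  assert (P4 : w * w * w * (y * y * y * y) <= 1).
  { apply Rle_trans with (w * w * w * (/ w * / w)).
    - apply Rmult_le_compat_l; [nra|]. replace (y * y * y * y) with ((y * y) * (y * y)) by ring. apply Rmult_le_compat; auto; nra.
    - replace (w * w * w * (/ w * / w)) with (w * (w * / w) * (w * / w)) by ring. rewrite Hww. lra. }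
  assert (P2 : w * w * w * (y * y) <= 1).
  { apply Rle_trans with (w * w * w * (/ w)).
    - apply Rmult_le_compat_l; [nra|]. auto.
    - replace (w * w * w * (/ w)) with (w * w * (w * / w)) by ring. rewrite Hww. nra. }
  assert (P5 : w * w * w * (y * y * (y * y * y)) <= 1).
  { apply Rle_trans with (w * w * w * (/ w * (/ w * / w))).
    - apply Rmult_le_compat_l; [nra|]. apply Rmult_le_compat; auto; [nra|nra|]. apply Rmult_le_compat; auto; nra.
    - replace (w * w * w * (/ w * (/ w * / w))) with ((w * / w) * (w * / w) * (w * / w)) by ring. rewrite Hww. lra. }
  set (M := w ^ m) in *.
  assert (BE : Cmod (scaled_gauss nu h (x, t)) <= K0 * M * (w * w * w)).
  { eapply Rle_trans; [exact B1|]. unfold K0. assert (0 <= M * (w * w * w)) by (apply Rmult_le_pos; [lra|nra]). nra. }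
  assert (BG : Cmod (gauss nu (x, t)) <= K0 * M * (w * w * w)).
  { eapply Rle_trans; [exact B2|]. unfold K0. assert (0 <= M * (w * w * w)) by (apply Rmult_le_pos; [lra|nra]). nra. }
  assert (HKM : 0 < K0 * M) by (apply Rmult_lt_0_compat; auto).
  set (Y3 := ((x, t) * (x, t) * (x, t))%C).
  assert (HY3 : Cmod Y3 = y * y * y) by (unfold Y3; rewrite !Cmod_mult; auto).
  assert (Hy3 : 0 <= y * y * y) by (apply pos_prod3; auto).
  set (c1 := (- (nu * Y3 * RtoC (/ 6)))%C).
  assert (Hc1 : Cmod c1 <= L * (y * y * y)).
  { unfold c1. rewrite Cmod_opp, !Cmod_mult, HY3, Cmod_R, (Rabs_pos_eq (/ 6)) by lra.
    assert (Cmod nu * (y * y * y) <= L * (y * y * y)) by (apply Rmult_le_compat_r; auto).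
    pose proof (Cmod_ge_0 nu). assert (0 <= Cmod nu * (y * y * y)) by (apply Rmult_le_pos; auto). lra. }
  pose proof (Cmod_ge_0 (gauss nu (x, t))) as G0'. pose proof (Cmod_ge_0 c1) as C0'.
  set (S := 9 * L * L + 3 * L + L + 2). assert (HS : 2 <= S) by (unfold S; nra).
  assert (BG1 : Cmod (c1 * gauss nu (x, t)) <= K0 * M * L).
  { rewrite Cmod_mult. apply Rle_trans with (L * (y * y * y) * (K0 * M * (w * w * w))).
    - apply Rmult_le_compat; auto.
    - replace (L * (y * y * y) * (K0 * M * (w * w * w))) with (K0 * M * (L * (w * w * w * (y * y * y)))) by ring.
      apply Rmult_le_compat_l; [lra|]. rewrite <- (Rmult_1_r L) at 2. apply Rmult_le_compat_l; auto. }
  replace (K0 * S * M) with (K0 * M * S) by ring.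
  split; [|split].
  - eapply Rle_trans; [exact BG|]. apply Rmult_le_compat_l; lra.
  - eapply Rle_trans; [exact BG1|]. apply Rmult_le_compat_l; [lra|]. unfold S. nra.
  - set (v := (h * (x, t))%C). assert (Hv : Cmod v = h * y) by (unfold v; rewrite Cmod_mult, Cmod_R, Rabs_pos_eq by lra; auto).
    assert (Hhh : 0 < h * h) by nra. set (ih := RtoC (/ (h * h))).
    assert (Eih : (ih * (RtoC h * RtoC h) = 1)%C) by (unfold ih; rewrite <- !RtoC_mult; f_equal; apply Rinv_l; lra).
    destruct (Rle_dec (h * y) 1) as [Lv|Lv].
    + (* small argument: Taylor expansion of the exponent *)
      destruct (taylor_le1 v) as [_ [_ [T3b T4b]]]; [rewrite Hv; auto|]. rewrite Hv in T3b, T4b.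
      pose proof (Cexp_sub_taylor (- (nu * ih * exp_rem2 v)) (- (nu * RtoC (/ 2) * ((x, t) * (x, t))))) as T.
      change (Cexp (- (nu * ih * exp_rem2 v))) with (scaled_gauss nu h (x, t)) in T.
      change (Cexp (- (nu * RtoC (/ 2) * ((x, t) * (x, t))))) with (gauss nu (x, t)) in T.
      set (dd := (- (nu * ih * exp_rem2 v) - - (nu * RtoC (/ 2) * ((x, t) * (x, t))))%C) in *.
      assert (Edd : dd = (- (nu * ih * exp_rem3 v))%C).
      { unfold dd. replace (exp_rem2 v) with (exp_rem3 v + v * v * RtoC (/ 2))%C by (unfold exp_rem2, exp_rem3; ring). unfold v.
        transitivity (- (nu * ih * exp_rem3 (h * (x, t))) + (1 - ih * (RtoC h * RtoC h)) * (nu * RtoC (/ 2) * ((x, t) * (x, t))))%C; [ring|].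
        rewrite Eih. ring. }
      assert (Edd2 : (dd - h * c1 = - (nu * ih * exp_rem4 v))%C).
      { rewrite Edd. replace (exp_rem3 v) with (exp_rem4 v + v * v * v * RtoC (/ 6))%C by (unfold exp_rem4, exp_rem3; ring). unfold v, c1, Y3.
        transitivity (- (nu * ih * exp_rem4 (h * (x, t))) + h * (1 - ih * (RtoC h * RtoC h)) * (nu * ((x, t) * (x, t) * (x, t)) * RtoC (/ 6)))%C; [ring|].
        rewrite Eih. ring. }
      assert (Mih : Cmod ih = / (h * h)) by (unfold ih; rewrite Cmod_R, Rabs_pos_eq; auto; left; apply Rinv_0_lt_compat; auto).
      assert (Iih : 0 < / (h * h)) by (apply Rinv_0_lt_compat; auto).
      assert (Bdd : Cmod dd <= 3 * L * (h * (y * y * y))).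
      { rewrite Edd, Cmod_opp, !Cmod_mult, Mih.
        apply Rle_trans with (L * / (h * h) * (3 * (h * y) ^ 3)).
        - apply Rmult_le_compat; auto; [apply Rmult_le_pos; [apply Cmod_ge_0|lra]|apply Cmod_ge_0|]. apply Rmult_le_compat_r; lra.
        - right. field. lra. }
      assert (Bdd2 : Cmod (dd - h * c1) <= 3 * L * (h * h * (y * y * y * y))).
      { rewrite Edd2, Cmod_opp, !Cmod_mult, Mih.
        apply Rle_trans with (L * / (h * h) * (3 * (h * y) ^ 4)).
        - apply Rmult_le_compat; auto; [apply Rmult_le_pos; [apply Cmod_ge_0|lra]|apply Cmod_ge_0|]. apply Rmult_le_compat_r; lra.
        - right. field. lra. }
      replace (scaled_gauss nu h (x, t) - gauss nu (x, t) - h * (c1 * gauss nu (x, t)))%C with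
        ((scaled_gauss nu h (x, t) - gauss nu (x, t) * (1 + dd)) + gauss nu (x, t) * (dd - h * c1))%C by ring.
      eapply Rle_trans; [apply Cmod_triangle|]. rewrite Cmod_mult.
      assert (X1 : Cmod (scaled_gauss nu h (x, t) - gauss nu (x, t) * (1 + dd)) <= K0 * M * (9 * L * L) * (h * h)).
      { eapply Rle_trans; [exact T|]. apply Rle_trans with (K0 * M * (w * w * w) * (3 * L * (h * (y * y * y))) ^ 2).
        - apply Rmult_le_compat; [eapply Rle_trans; [exact G0'|apply Rmax_r]|apply pow2_ge_0|apply Rmax_lub; auto|].
          apply pow_incr. split; auto. apply Cmod_ge_0.
        - replace (K0 * M * (w * w * w) * (3 * L * (h * (y * y * y))) ^ 2) with
            (K0 * M * (9 * L * L) * (h * h) * (w * w * w * (y * y * y * (y * y * y)))) by ring.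
          rewrite <- (Rmult_1_r (K0 * M * (9 * L * L) * (h * h))) at 2. apply Rmult_le_compat_l; auto.
          apply Rmult_le_pos; [|lra]. apply Rmult_le_pos; [lra|nra]. }
      assert (X2 : Cmod (gauss nu (x, t)) * Cmod (dd - h * c1) <= K0 * M * (3 * L) * (h * h)).
      { apply Rle_trans with (K0 * M * (w * w * w) * (3 * L * (h * h * (y * y * y * y)))).
        - apply Rmult_le_compat; auto. apply Cmod_ge_0.
        - replace (K0 * M * (w * w * w) * (3 * L * (h * h * (y * y * y * y)))) with
            (K0 * M * (3 * L) * (h * h) * (w * w * w * (y * y * y * y))) by ring.
          rewrite <- (Rmult_1_r (K0 * M * (3 * L) * (h * h))) at 2. apply Rmult_le_compat_l; auto.
          apply Rmult_le_pos; [|lra]. apply Rmult_le_pos; [lra|nra]. }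
      assert (X3 : 0 <= K0 * M * (h * h) * (L + 2)) by (apply Rmult_le_pos; [apply Rmult_le_pos; lra|lra]).
      unfold S. nra.
    + (* large argument: every term is small, and [1 < (h |Y|)^2] *)
      apply Rnot_le_lt in Lv.
      assert (Hbig : 1 <= h * h * (y * y)) by nra.
      assert (X0 : Cmod (scaled_gauss nu h (x, t) - gauss nu (x, t) - h * (c1 * gauss nu (x, t))) <= K0 * M * (w * w * w) * (2 + L * (y * y * y))).
      { eapply Rle_trans; [apply Cmod_triangle_minus|]. eapply Rle_trans; [apply Rplus_le_compat_r, Cmod_triangle_minus|].
        rewrite !Cmod_mult, Cmod_R, (Rabs_pos_eq h) by lra.
        assert (h * (Cmod c1 * Cmod (gauss nu (x, t))) <= 1 * (L * (y * y * y) * (K0 * M * (w * w * w)))).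
        { apply Rmult_le_compat; auto; [lra|apply Rmult_le_pos; auto|]. apply Rmult_le_compat; auto. }
        lra. }
      eapply Rle_trans; [exact X0|].
      assert (X4 : 0 <= K0 * M * (w * w * w) * (2 + L * (y * y * y))).
      { apply Rmult_le_pos; [apply Rmult_le_pos; [lra|nra]|]. assert (0 <= L * (y * y * y)) by (apply Rmult_le_pos; auto). lra. }
      apply Rle_trans with (K0 * M * (w * w * w) * (2 + L * (y * y * y)) * (h * h * (y * y))); [nra|].
      replace (K0 * M * (w * w * w) * (2 + L * (y * y * y)) * (h * h * (y * y))) with
        (K0 * M * (h * h) * (2 * (w * w * w * (y * y)) + L * (w * w * w * (y * y * (y * y * y))))) by ring.
      replace (K0 * M * S * (h * h)) with (K0 * M * (h * h) * S) by ring.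
      apply Rmult_le_compat_l; [apply Rmult_le_pos; lra|].
      assert (L * (w * w * w * (y * y * (y * y * y))) <= L * 1) by (apply Rmult_le_compat_l; auto). unfold S. nra.
Qed.

(** * The kernel near its pole *)

(** In this strip the only pole is [v = 0].  For small [v] the exponential is expanded;
    elsewhere each term is bounded, hence at most a multiple of [|v|]. *)
Lemma expm1_inv_expand : forall v : C, v <> 0%C -> Rabs (Im v) <= / 12 ->
  Cmod (expm1_inv v - / v + RtoC (/ 2))%C <= 100 * Cmod v.
Proof.
  intros v Hv Hi. pose proof (proj1 (Cmod_gt_0 v) Hv) as Hm. set (m := Cmod v) in *.
  destruct (Rle_dec m (/ 6)) as [L|L].
  - destruct (taylor_le1 v) as [_ [B2 [B3 _]]]; [fold m; lra|]. fold m in B2, B3.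
    assert (HD : m / 2 <= Cmod (Cexp v - 1)%C).
    { replace (Cexp v - 1)%C with (v + exp_rem2 v)%C by (unfold exp_rem2; ring).
      pose proof (Cmod_triangle_rev v (exp_rem2 v)) as T. fold m in T. nra. }
    assert (HD0 : (Cexp v - 1)%C <> 0%C) by (apply Cmod_gt_0; lra).
    assert (E : (expm1_inv v - / v + RtoC (/ 2) = (- exp_rem3 v + v * v * v * RtoC (/ 2 * / 2) + v * exp_rem3 v * RtoC (/ 2)) * (/ v * / (Cexp v - 1)))%C).
    { assert (E2 : (v - (Cexp v - 1) + v * (Cexp v - 1) * RtoC (/ 2) = - exp_rem3 v + v * v * v * RtoC (/ 2 * / 2) + v * exp_rem3 v * RtoC (/ 2))%C).
      { unfold exp_rem3. rewrite RtoC_mult. ring. }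
      rewrite <- E2. unfold expm1_inv. field. auto. }
    rewrite E, !Cmod_mult, Cmod_inv, Cmod_inv by auto. fold m.
    assert (N : Cmod (- exp_rem3 v + v * v * v * RtoC (/ 2 * / 2) + v * exp_rem3 v * RtoC (/ 2)) <= 4 * (m * m * m)).
    { eapply Rle_trans; [apply Cmod_triangle|]. eapply Rle_trans; [apply Rplus_le_compat_r, Cmod_triangle|].
      rewrite Cmod_opp, !Cmod_mult, !Cmod_R, !Rabs_pos_eq by lra. fold m. pose proof (Cmod_ge_0 (exp_rem3 v)).
      assert (m * Cmod (exp_rem3 v) * / 2 <= Cmod (exp_rem3 v) / 12) by nra. nra. }
    apply Rle_trans with (4 * (m * m * m) * (/ m * / (m / 2))).
    + apply Rmult_le_compat; auto; [apply Cmod_ge_0| |].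
      * apply Rmult_le_pos; left; apply Rinv_0_lt_compat; lra.
      * apply Rmult_le_compat_l; [left; apply Rinv_0_lt_compat; lra|]. apply Rinv_le_contravar; lra.
    + replace (4 * (m * m * m) * (/ m * / (m / 2))) with (8 * m) by (field; lra). lra.
  - apply Rnot_le_lt in L. set (x := Re v).
    assert (Hx : / 8 <= Rabs x).
    { pose proof (Cmod_sqr v) as Q. fold m x in Q.
      assert (Im v * Im v <= / 12 * / 12).
      { replace (Im v * Im v) with (Rabs (Im v) * Rabs (Im v)) by (rewrite <- Rabs_mult; apply Rabs_pos_eq; apply Rle_0_sqr).
        pose proof (Rabs_pos (Im v)). apply Rmult_le_compat; lra. }
      assert (x * x = Rabs x * Rabs x) by (rewrite <- Rabs_mult; symmetry; apply Rabs_pos_eq; apply Rle_0_sqr).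
      pose proof (Rabs_pos x). assert (/ 6 * / 6 <= m * m) by nra. nra. }
    assert (HD : / 9 <= Cmod (Cexp v - 1)%C).
    { apply Rle_trans with (Rabs (exp x - 1)).
      - destruct (Rle_dec 0 x).
        + rewrite Rabs_pos_eq in Hx by auto. pose proof (exp_ineq1_le x). rewrite Rabs_pos_eq; lra.
        + rewrite Rabs_left in Hx by lra.
          assert (U : exp x <= 8 / 9).
          { eapply Rle_trans; [apply exp_le_compat with (y := - / 8); lra|]. eapply Rle_trans; [apply exp_upper; lra|]. right; field. }
          rewrite Rabs_left; lra.
      - pose proof (Cmod_triangle_rev (Cexp v) (- (1))%C) as U1. pose proof (Cmod_triangle_rev 1 (- Cexp v)%C) as U2.
        rewrite !Cmod_opp, Cmod_1, Cmod_Cexp in *. fold x in U1, U2.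
        replace (1 + - Cexp v)%C with (- (Cexp v - 1))%C in U2 by ring. rewrite Cmod_opp in U2.
        apply Rabs_le. change (Cexp v + - (1))%C with (Cexp v - 1)%C in U1. lra. }
    assert (HD0 : (Cexp v - 1)%C <> 0%C) by (apply Cmod_gt_0; lra).
    eapply Rle_trans; [apply Cmod_triangle|]. eapply Rle_trans; [apply Rplus_le_compat_r, Cmod_triangle_minus|].
    rewrite Cmod_R, Rabs_pos_eq by lra. unfold expm1_inv. rewrite !Cmod_inv by auto. fold m.
    assert (/ Cmod (Cexp v - 1)%C <= 9) by (rewrite <- (Rinv_inv 9); apply Rinv_le_contravar; lra).
    assert (/ m <= 6) by (rewrite <- (Rinv_inv 6); apply Rinv_le_contravar; lra).
    lra.
Qed.

Lemma expm1_inv_scaled : forall (h : R) (u : C), 0 < h <= / 12 -> u <> 0%C -> Rabs (Im u) <= 1 ->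
  Cmod (h * expm1_inv (h * u) - / u - h * - RtoC (/ 2))%C <= 100 * Cmod u * (h * h).
Proof.
  intros h u Hh Hu Hi.
  assert (Hh0 : RtoC h <> 0%C) by (intros Q; apply RtoC_inj in Q; lra).
  pose proof (expm1_inv_expand (h * u)%C) as B.
  replace (h * expm1_inv (h * u) - / u - h * - RtoC (/ 2))%C with (h * (expm1_inv (h * u) - / (h * u) + RtoC (/ 2)))%C by (field; auto).
  rewrite Cmod_mult, Cmod_R, Rabs_pos_eq by lra.
  rewrite Cmod_mult, Cmod_R, (Rabs_pos_eq h) in B by lra.
  replace (100 * Cmod u * (h * h)) with (h * (100 * (h * Cmod u))) by ring.
  apply Rmult_le_compat_l; [lra|]. apply B.
  - apply Cmult_neq_0; auto.
  - rewrite Im_mult, Re_RtoC, Im_RtoC. replace (h * Im u + 0 * Re u) with (h * Im u) by ring.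
    rewrite Rabs_mult, (Rabs_pos_eq h) by lra. pose proof (Rabs_pos (Im u)). nra.
Qed.

(** * Products of first order expansions *)

Definition expands (A A0 A1 : C) (a h : R) : Prop :=
  Cmod A0 <= a /\ Cmod A1 <= a /\ Cmod (A - A0 - h * A1)%C <= a * (h * h).

Lemma expands_mult : forall A A0 A1 a K K0 K1 k h, 0 <= h <= 1 -> expands A A0 A1 a h -> expands K K0 K1 k h ->
  expands (A * K) (A0 * K0) (A1 * K0 + A0 * K1) (6 * (a * k)) h.
Proof.
  intros A A0 A1 a K K0 K1 k h Hh [HA0 [HA1 HA]] [HK0 [HK1 HK]].
  pose proof (Cmod_ge_0 A0) as a0. pose proof (Cmod_ge_0 A1) as a1. pose proof (Cmod_ge_0 K0) as k0. pose proof (Cmod_ge_0 K1) as k1.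
  assert (Ha : 0 <= a) by lra. assert (Hk : 0 <= k) by lra. assert (Hak : 0 <= a * k) by (apply Rmult_le_pos; auto).
  assert (X00 : Cmod A0 * Cmod K0 <= a * k) by (apply Rmult_le_compat; auto).
  assert (X10 : Cmod A1 * Cmod K0 <= a * k) by (apply Rmult_le_compat; auto).
  assert (X01 : Cmod A0 * Cmod K1 <= a * k) by (apply Rmult_le_compat; auto).
  assert (X11 : Cmod A1 * Cmod K1 <= a * k) by (apply Rmult_le_compat; auto).
  split; [rewrite Cmod_mult; lra|]. split.
  - eapply Rle_trans; [apply Cmod_triangle|]. rewrite !Cmod_mult. lra.
  - set (RA := (A - A0 - h * A1)%C) in *. set (RK := (K - K0 - h * K1)%C) in *.
    replace (A * K - A0 * K0 - h * (A1 * K0 + A0 * K1))%C with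
      (h * h * (A1 * K1) + ((A0 + h * A1) * RK + RA * (K0 + h * K1 + RK)))%C by (unfold RA, RK; ring).
    pose proof (Cmod_ge_0 RA). pose proof (Cmod_ge_0 RK).
    assert (Hhh : 0 <= h * h <= 1) by nra.
    assert (Y1 : Cmod (A0 + h * A1) <= 2 * a).
    { eapply Rle_trans; [apply Cmod_triangle|]. rewrite Cmod_mult, Cmod_R, Rabs_pos_eq by lra. nra. }
    assert (Y2 : Cmod (K0 + h * K1 + RK) <= 3 * k).
    { eapply Rle_trans; [apply Cmod_triangle|]. eapply Rle_trans; [apply Rplus_le_compat_r, Cmod_triangle|].
      rewrite Cmod_mult, Cmod_R, Rabs_pos_eq by lra. assert (k * (h * h) <= k * 1) by (apply Rmult_le_compat_l; lra). nra. }
    eapply Rle_trans; [apply Cmod_triangle|]. eapply Rle_trans; [apply Rplus_le_compat_l, Cmod_triangle|].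
    rewrite !Cmod_mult, !Cmod_R, !Rabs_pos_eq by lra.
    assert (Z1 : h * h * (Cmod A1 * Cmod K1) <= h * h * (a * k)) by (apply Rmult_le_compat_l; lra).
    assert (Z2 : Cmod (A0 + h * A1) * Cmod RK <= 2 * a * (k * (h * h))) by (apply Rmult_le_compat; auto; apply Cmod_ge_0).
    assert (Z3 : Cmod RA * Cmod (K0 + h * K1 + RK) <= a * (h * h) * (3 * k)) by (apply Rmult_le_compat; auto; apply Cmod_ge_0).
    lra.
Qed.

(** The lines have heights [h] and 0, so that after rescaling the distance from [Y_0] to the
    poles 0 and [Y_1] stays at least one. *)
Definition scaled_integrand (nu0 nu1 : C) (h x y : R) : C :=
  ((scaled_gauss nu0 h (x, 1%R) * scaled_gauss nu1 h (y, 0%R)) *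
   ((h * expm1_inv (h * - (x, 1%R))) * (h * expm1_inv (h * gap 1 x y))))%C.

(** The errors in the expansions of the kernels grow like inverse weights; the third power of
    the weight gained from each exponential factor outweighs them. *)
Lemma scaled_expand : forall lam Lam, 0 < lam -> exists K h0, 0 < K /\ 0 < h0 /\ forall nu0 nu1 h x y,
  lam <= Re nu0 -> lam <= Re nu1 -> Cmod nu0 <= Lam -> Cmod nu1 <= Lam -> 0 < h <= h0 ->
  Cmod (scaled_integrand nu0 nu1 h x y - - (gauss0_pole nu0 x * (gauss1 nu1 y * gap_inv 1 1 x y)) - h * corr_integrand nu0 nu1 x y)%C
   <= K * (h * h) * (wt x * wt y).
Proof.
  intros lam Lam Hl.
  destruct (scaled_gauss_expand lam Lam Hl 3) as [K [h1 [HK [Hh1 B]]]].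
  exists (6 * (6 * (K * K) * (6 * (100 * 200)))), (Rmin h1 (/ 12)).
  split; [nra|]. split; [apply Rmin_pos; lra|].
  intros nu0 nu1 h x y H0 H1 L0 L1 [Hh0 Hh].
  assert (Hha : h <= h1) by (eapply Rle_trans; [exact Hh|apply Rmin_l]).
  assert (Hhb : h <= / 12) by (eapply Rle_trans; [exact Hh|apply Rmin_r]).
  destruct (B nu0 h 1 x H0 L0 (conj Hh0 Hha) ltac:(lra)) as [P1 [P2 P3]].
  destruct (B nu1 h 0 y H1 L1 (conj Hh0 Hha) ltac:(lra)) as [Q1 [Q2 Q3]].
  pose proof (wt_pos x) as Wx. pose proof (wt_pos y) as Wy. pose proof (wt_le_1 x) as Wx1. pose proof (wt_le_1 y) as Wy1.
  assert (Ix : 1 <= / wt x) by (rewrite <- Rinv_1; apply Rinv_le_contravar; lra).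
  assert (Iy : 1 <= / wt y) by (rewrite <- Rinv_1; apply Rinv_le_contravar; lra).
  assert (Nx : (- (x, 1%R))%C <> 0%C) by (apply Cneq_0_Im; simpl; lra).
  assert (Ra : Rabs 1 <= 1) by (rewrite Rabs_R1; lra).
  assert (Mx : Cmod (- (x, 1%R))%C <= / wt x) by (rewrite Cmod_opp; apply Cmod_line_le; lra).
  assert (Mu : Cmod (gap 1 x y) <= 2 * (/ wt x * / wt y)).
  { unfold gap. eapply Rle_trans; [apply Cmod_triangle_minus|]. rewrite Cmod_mult, Cmod_R, Rabs_R1, Rmult_1_l.
    pose proof (Cmod_line_le x 1 ltac:(lra)). pose proof (Cmod_line_le y 0 ltac:(lra)). nra. }
  assert (X1 : expands (h * expm1_inv (h * - (x, 1%R))) (/ - (x, 1%R)) (- RtoC (/ 2)) (100 * / wt x) h).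
  { split; [|split].
    - replace (/ - (x, 1%R))%C with (- / (x, 1%R))%C by (field; apply Cneq_0_Im; simpl; lra).
      rewrite Cmod_opp. pose proof (inv_line_le1 (x, 1%R) eq_refl). lra.
    - rewrite Cmod_opp, Cmod_R, Rabs_pos_eq; lra.
    - eapply Rle_trans; [apply expm1_inv_scaled; auto; simpl; rewrite Rabs_Ropp; auto|].
      apply Rmult_le_compat_r; [nra|]. lra. }
  assert (X2 : expands (h * expm1_inv (h * gap 1 x y)) (/ gap 1 x y) (- RtoC (/ 2)) (200 * (/ wt x * / wt y)) h).
  { assert (1 <= / wt x * / wt y) by nra. split; [|split].
    - pose proof (inv_line_le1 _ (Im_gap 1 x y)). lra.
    - rewrite Cmod_opp, Cmod_R, Rabs_pos_eq; lra.
    - eapply Rle_trans; [apply expm1_inv_scaled; auto; [apply gap_neq_0|rewrite Im_gap; auto]|].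
      apply Rmult_le_compat_r; [nra|]. lra. }
  assert (Hh01 : 0 <= h <= 1) by lra.
  pose proof (expands_mult (scaled_gauss nu0 h (x, 1%R)) _ _ _ (scaled_gauss nu1 h (y, 0%R)) _ _ _ h Hh01 (conj P1 (conj P2 P3)) (conj Q1 (conj Q2 Q3))) as XE.
  pose proof (expands_mult _ _ _ _ _ _ _ _ h Hh01 X1 X2) as XK.
  destruct (expands_mult _ _ _ _ _ _ _ _ h Hh01 XE XK) as [_ [_ R]].
  unfold scaled_integrand.
  assert (Nx' : ((x, 1%R) : C) <> 0%C) by (apply Cneq_0_Im; simpl; lra).
  pose proof (gap_neq_0 1 x y) as Nu.
  eapply Rle_trans; [|eapply Rle_trans; [exact R|]].
  - right. f_equal. unfold corr_integrand, gauss0_pole, gauss0, gauss1, gap_inv. simpl Cpow.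
    set (g0 := gauss nu0 (x, 1%R)). set (g1 := gauss nu1 (y, 0%R)). set (U := gap 1 x y) in *.
    set (Y0 := ((x, 1%R) : C)) in *. set (Y1 := ((y, 0%R) : C)).
    set (b0 := expm1_inv (h * - Y0)). set (b1 := expm1_inv (h * U)).
    set (e0 := scaled_gauss nu0 h Y0). set (e1 := scaled_gauss nu1 h Y1).
    field. auto.
  - replace (6 * (6 * (K * wt x ^ 3 * (K * wt y ^ 3)) * (6 * (100 * / wt x * (200 * (/ wt x * / wt y))))) * (h * h)) with
      (6 * (6 * (K * K) * (6 * (100 * 200))) * (h * h) * (wt x * (wt y * wt y))) by (field; lra).
    apply Rmult_le_compat_l.
    + apply Rmult_le_pos; [|nra]. nra.
    + apply Rmult_le_compat_l; [lra|]. nra.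
Qed.

(** * The asymptotic expansion *)

Lemma wt_scale : forall h x, 0 < h <= 1 -> wt (h * x) <= wt x * / (h * h).
Proof.
  intros h x Hh. unfold wt. rewrite <- Rinv_mult. apply Rinv_le_contravar.
  - apply Rmult_lt_0_compat; nra.
  - nra.
Qed.

Lemma cts_scale : forall f h x, 0 < h <= 1 -> cts f (h * x)%R -> cts (fun y => f (h * y)%R) x.
Proof.
  intros f h x Hh H eps He. destruct (H eps He) as [d [Hd B]]. exists d. split; auto.
  intros y Hy. apply B. rewrite <- Rmult_minus_distr_l, Rabs_mult, (Rabs_pos_eq h) by lra.
  pose proof (Rabs_pos (y - x)). nra.
Qed.

Lemma dom2_scale : forall F K h, 0 < h <= 1 -> dom2 F K ->
  dom2 (fun x y => F (h * x)%R (h * y)%R) (K * (/ (h * h) * / (h * h))).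
Proof.
  intros F K h Hh [H1 H2 H3]. assert (Hhh : 0 < h * h) by nra.
  assert (Ih : 0 < / (h * h)) by (apply Rinv_0_lt_compat; auto).
  split.
  - intros x y. apply (cts_scale (F (h * x)%R)); auto.
  - intros x eps He. destruct (H2 (h * x) (eps * (h * h))) as [d [Hd B]]; [apply Rmult_lt_0_compat; auto|].
    exists d. split; auto. intros x' y Hx. eapply Rle_trans; [apply B|].
    + rewrite <- Rmult_minus_distr_l, Rabs_mult, (Rabs_pos_eq h) by lra.
      pose proof (Rabs_pos (x' - x)). nra.
    + replace (eps * wt y) with (eps * (h * h) * (wt y * / (h * h))) by (field; lra).
      apply Rmult_le_compat_l; [nra|]. apply wt_scale; auto.
  - intros x y. eapply Rle_trans; [apply H3|].
    assert (HK : 0 <= K).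
    { specialize (H3 0 0). pose proof (Cmod_ge_0 (F 0 0)). pose proof (wt_pos 0).
      assert (0 < wt 0 * wt 0) by nra. nra. }
    replace (K * (/ (h * h) * / (h * h)) * (wt x * wt y)) with (K * ((wt x * / (h * h)) * (wt y * / (h * h)))) by ring.
    apply Rmult_le_compat_l; auto. apply Rmult_le_compat; try (left; apply wt_pos); apply wt_scale; auto.
Qed.

Lemma RI2_scale : forall F K h, 0 < h <= 1 -> dom2 F K ->
  RI2 (fun x y => RtoC h * (RtoC h * F (h * x)%R (h * y)%R))%C = RI2 F.
Proof.
  intros F K h Hh D. unfold RI2.
  rewrite <- (RI_scale _ _ h (proj1 Hh) (dom2_outer _ _ D)).
  apply RI_ext. intros x.
  rewrite <- (RI_scale _ _ h (proj1 Hh) (dom2_inner _ _ (h * x)%R D)).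
  apply (RI_scal _ (Cmod h * (K * (/ (h * h) * / (h * h))) * wt x)).
  apply (dom2_inner (fun x y => RtoC h * F (h * x)%R (h * y)%R)%C _ x).
  apply (dom2_scal (fun x y => F (h * x)%R (h * y)%R)). apply dom2_scale; auto.
Qed.

Lemma gamma_factor_scaled : forall N (h : R) Y, h <> 0 ->
  (Cexp N * gamma_factor N (- N) (h * Y))%C = scaled_gauss (N * (h * h)) h Y.
Proof.
  intros N h Y Hh. unfold gamma_factor, scaled_gauss. rewrite <- Cexp_plus. f_equal.
  assert (E : (RtoC h * RtoC h * RtoC (/ (h * h)) = 1)%C) by (rewrite <- !RtoC_mult; f_equal; field; auto).
  replace (N * (h * h) * RtoC (/ (h * h)))%C with (N * (RtoC h * RtoC h * RtoC (/ (h * h))))%C by ring.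
  rewrite E. unfold exp_rem2. ring.
Qed.

Lemma line_scale : forall h x t : R, ((h * x)%R, (h * t)%R) = (RtoC h * (x, t))%C.
Proof. intros. apply C_ext; simpl; ring. Qed.

Lemma phi_scaled : forall N0 N1 (h x y : R), h <> 0 ->
  (Cexp (N0 + N1) * (RtoC h * (RtoC h * phi_integrand N0 N1 (- N0) (- N1) h 0 (h * x)%R (h * y)%R)))%C
   = scaled_integrand (N0 * (h * h)) (N1 * (h * h)) h x y.
Proof.
  intros N0 N1 h x y Hh. unfold phi_integrand, scaled_integrand.
  rewrite <- !gamma_factor_scaled by auto. rewrite Cexp_plus.
  replace ((h * x)%R, h) with (RtoC h * (x, 1%R))%C by (rewrite <- line_scale; f_equal; ring).
  replace ((h * y)%R, 0%R) with (RtoC h * (y, 0%R))%C by (rewrite <- line_scale; f_equal; ring).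
  replace (h * - (x, 1%R))%C with (- (h * (x, 1%R)))%C by ring.
  replace (h * gap 1 x y)%C with (h * (x, 1%R) - h * (y, 0%R))%C by (unfold gap; ring).
  ring.
Qed.

Lemma Phi_scaled : forall N0 N1 h, 0 < h <= 1 -> 1 <= Re N0 -> 1 <= Re N1 ->
  0 < rate (- N0) h -> 0 < rate (- N1) 0 ->
  (exists K, dom2 (scaled_integrand (N0 * (h * h)) (N1 * (h * h)) h) K) /\
  (Cexp (N0 + N1) * Phi N0 N1 (- N0) (- N1) h 0)%C = RI2 (scaled_integrand (N0 * (h * h)) (N1 * (h * h)) h).
Proof.
  intros N0 N1 h Hh H0 H1 R0 R1. pose proof PI2_1 as HPI.
  destruct (phi_dom2 N0 N1 (- N0) (- N1) h 0 H0 H1 R0 R1) as [K D]; [lra|lra|].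
  pose proof (dom2_scal _ _ (Cexp (N0 + N1)) (dom2_scal _ _ h (dom2_scal _ _ h (dom2_scale _ _ h Hh D)))) as DD.
  assert (Hh0 : h <> 0) by lra.
  split; [eexists; eapply dom2_ext; [|exact DD]; intros; apply (phi_scaled N0 N1 h x y Hh0)|].
  unfold Phi. rewrite <- (RI2_scale _ _ h Hh D).
  etransitivity; [symmetry; exact (RI2_scal _ _ (Cexp (N0 + N1)) (dom2_scal _ _ h (dom2_scal _ _ h (dom2_scale _ _ h Hh D))))|].
  apply RI2_ext. intros. apply (phi_scaled N0 N1 h x y Hh0).
Qed.

(** The integral of the remainder in [scaled_expand] costs a factor [PI^2]; the explicit terms
    are evaluated by [lead_value], [corr_value] and [pole_value]. *)
Lemma Phi_expansion : forall lam Lam, 0 < lam -> exists K h0, 0 < h0 /\ forall N0 N1 h nu0 nu1,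
  0 < h <= h0 -> h <= 1 -> 1 <= Re N0 -> 1 <= Re N1 -> 0 < rate (- N0) h -> 0 < rate (- N1) 0 ->
  nu0 = (N0 * (h * h))%C -> nu1 = (N1 * (h * h))%C ->
  lam <= Re nu0 -> lam <= Re nu1 -> Cmod nu0 <= Lam -> Cmod nu1 <= Lam ->
  Cmod (Cexp (N0 + N1) * Phi N0 N1 (- N0) (- N1) h 0
     - (2 * PI * Carctan (Csqrt (nu0 / nu1))
        + h * (RtoC (/ 3) * (half_residue * (RtoC (sqrt (2 * PI)) * (/ Csqrt nu1 - / Csqrt (nu0 + nu1)))))))%C <= K * (h * h).
Proof.
  intros lam Lam Hl. destruct (scaled_expand lam Lam Hl) as [K [h0 [HK [Hh0 B]]]].
  exists (PI * (PI * K)), h0. split; auto.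
  intros N0 N1 h nu0 nu1 Hh Hh1 H0 H1 R0 R1 E0' E1' L0 L1 M0 M1.
  destruct (Phi_scaled N0 N1 h (conj (proj1 Hh) Hh1) H0 H1 R0 R1) as [[K' D] EQ].
  rewrite EQ. rewrite <- E0', <- E1' in *.
  assert (P0 : 0 < Re nu0) by lra. assert (P1 : 0 < Re nu1) by lra.
  destruct (corr_value nu0 nu1 P0 P1) as [VC [KC DC]].
  destruct (gap_int_dom2 1 (gauss0_pole nu0) (gauss1 nu1) 1 (rapid_gauss0_pole nu0 P0) (rapid_gauss1 nu1 P1)) as [KA DA].
  pose proof (lead_value nu0 nu1 P0 P1) as LV.
  pose proof (pole_value nu0 nu1 P0 P1) as PV.
  assert (PV' : gap_int 1 (gauss0 nu0) (gauss1 nu1) 1 = (half_residue * RtoC (sqrt (2 * PI)) / Csqrt (nu0 + nu1))%C).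
  { rewrite <- PV. field. apply Csqrt_neq_0. }
  rewrite PV' in VC. unfold mass1 in VC. rewrite G_eq in VC by auto.
  replace (2 * PI * Carctan (Csqrt (nu0 / nu1)))%C with (- gap_int 1 (gauss0_pole nu0) (gauss1 nu1) 1)%C by (rewrite LV; ring).
  assert (EC : (RtoC (/ 3) * (half_residue * (RtoC (sqrt (2 * PI)) * (/ Csqrt nu1 - / Csqrt (nu0 + nu1)))) = RI2 (corr_integrand nu0 nu1))%C).
  { rewrite VC. field. split; apply Csqrt_neq_0. }
  rewrite EC.
  assert (EI : RI2 (fun x y => scaled_integrand nu0 nu1 h x y - - (gauss0_pole nu0 x * (gauss1 nu1 y * gap_inv 1 1 x y)) - h * corr_integrand nu0 nu1 x y)%C
     = (RI2 (scaled_integrand nu0 nu1 h) - (- gap_int 1 (gauss0_pole nu0) (gauss1 nu1) 1 + h * RI2 (corr_integrand nu0 nu1)))%C).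
  { etransitivity; [exact (RI2_minus _ _ _ _ (dom2_minus _ _ _ _ D (dom2_opp _ _ DA)) (dom2_scal _ _ h DC))|].
    transitivity (RI2 (scaled_integrand nu0 nu1 h) - - gap_int 1 (gauss0_pole nu0) (gauss1 nu1) 1 - h * RI2 (corr_integrand nu0 nu1))%C; [|ring].
    apply f_equal2; [|exact (RI2_scal _ _ h DC)].
    etransitivity; [exact (RI2_minus _ _ _ _ D (dom2_opp _ _ DA))|]. apply f_equal.
    etransitivity; [|etransitivity; [exact (RI2_scal _ _ (- (1))%C DA)|]]; [apply RI2_ext; intros; ring|unfold gap_int; ring]. }
  rewrite <- EI.
  apply Rle_trans with (PI * (PI * (K * (h * h)))); [|right; ring].
  apply RI2_bound. eapply dom2_rebound.
  - exact (dom2_minus _ _ _ _ (dom2_minus _ _ _ _ D (dom2_opp _ _ DA)) (dom2_scal _ _ h DC)).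
  - intros x y. apply B; auto.
Qed.

Lemma Re_sector : forall (N : C) delta, N <> 0%C -> 0 < delta <= PI / 2 -> Rabs (Carg N) <= PI / 2 - delta ->
  Cmod N * sin delta <= Re N.
Proof.
  intros N d HN Hd HA. pose proof (proj1 (Cmod_gt_0 N) HN) as Hm.
  assert (E : Re N = Cmod N * cos (Carg N)).
  { rewrite <- (Cexp_Clog N HN) at 1. rewrite Re_Cexp. simpl Re. simpl Im. rewrite exp_ln; auto. }
  rewrite E. apply Rmult_le_compat_l; [lra|]. rewrite <- cos_shift.
  pose proof (Rabs_pos (Carg N)). pose proof PI_RGT_0.
  replace (cos (Carg N)) with (cos (Rabs (Carg N))).
  - apply cos_decr_1; lra.
  - unfold Rabs. destruct (Rcase_abs (Carg N)); auto. apply cos_neg.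
Qed.

(** As [w_j = - N_j], the ratio of the [N_j] is that of the [sigma_j]. *)
Lemma Cmod_quotient : forall (N0 N1 lz s0 s1 : C) M, N0 <> 0%C -> N1 <> 0%C ->
  (lz - Ci * PI = Clog N0 - s0)%C -> (lz - Ci * PI = Clog N1 - s1)%C ->
  Cmod (Cexp s0) <= M -> Cmod (/ Cexp s1) <= M -> Cmod N0 <= M * M * Cmod N1.
Proof.
  intros N0 N1 lz s0 s1 M H0 H1 E0' E1' B0 B1.
  assert (E : N0 = (N1 * (Cexp s0 * / Cexp s1))%C).
  { rewrite <- (Cexp_Clog N0 H0), <- (Cexp_Clog N1 H1).
    replace (Clog N0) with (lz - Ci * PI + s0)%C by (rewrite E0'; ring).
    replace (Clog N1) with (lz - Ci * PI + s1)%C by (rewrite E1'; ring).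
    rewrite !(Cexp_plus (lz - Ci * PI)). field. apply Cexp_neq_0. }
  rewrite E, !Cmod_mult, (Rmult_comm (M * M)). apply Rmult_le_compat_l; [apply Cmod_ge_0|].
  apply Rmult_le_compat; auto; apply Cmod_ge_0.
Qed.

Theorem corollary9p1 :
  forall (delta M : R), 0 < delta ->
  exists K X : R,
  forall (N0 N1 lz s0 s1 : C),
  let z := Cexp lz in
  let sigma0 := Cexp s0 in
  let sigma1 := Cexp s1 in
  Cmod sigma0 <= M -> Cmod (/ sigma0) <= M ->
  Cmod sigma1 <= M -> Cmod (/ sigma1) <= M ->
  N0 <> 0%C -> N1 <> 0%C ->
  Rabs (Carg N0) <= PI / 2 - delta ->
  Rabs (Carg N1) <= PI / 2 - delta ->
  Rabs (Im (log_add s0 s1 + lz - Ci * (PI / 2))%C) <= PI - delta ->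
  (lz - Ci * PI = Clog N0 - s0)%C ->
  (lz - Ci * PI = Clog N1 - s1)%C ->
  X <= Re N1 ->
  Cmod (Cexp (- ((sigma0 + sigma1) * z)) / Cexp ((N0 + N1) * lz)
          * hyperterminant2 N0 N1 lz s0 s1
        - (2 * PI * Carctan (Csqrt (N0 / N1))
           - PI * Ci / 3 * Csqrt (2 * PI / N1) * (1 - 1 / Csqrt (1 + N0 / N1))))%C
  <= K / Cmod N1.
Proof.
  intros delta M Hdelta.
  destruct (Rle_dec delta (PI / 2)) as [Hd|Hd].
  (* otherwise no argument satisfies the bounds *)
  2:{ exists 0, 0. intros. pose proof (Rabs_pos (Carg N0)). lra. }
  assert (Hsin : 0 < sin delta) by (apply sin_gt_0; pose proof PI_RGT_0; lra).
  set (L := Rmax M 1 * Rmax M 1).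
  assert (HL : 1 <= L) by (unfold L; pose proof (Rmax_r M 1); nra).
  set (lam := sin delta / L).
  assert (Hlam : 0 < lam) by (apply Rdiv_lt_0_compat; lra).
  destruct (Phi_expansion lam L Hlam) as [K [h0 [Hh0 B]]].
  set (h1 := Rmin h0 (Rmin (delta / 2) 1)).
  assert (Hh1 : 0 < h1) by (unfold h1; repeat apply Rmin_pos; lra).
  (* the first summand ensures [h <= h1], the second [1 <= Re N0] and [1 <= Re N1] *)
  exists K, (/ (h1 * h1) + / lam).
  intros N0 N1 lz s0 s1 z sigma0 sigma1 S0 S0' S1 S1' Z0 Z1 A0 A1 _ E0' E1' HX.
  assert (Ih1 : 0 < / (h1 * h1)) by (apply Rinv_0_lt_compat; nra).
  assert (Ilam : 0 < / lam) by (apply Rinv_0_lt_compat; auto).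
  pose proof (proj1 (Cmod_gt_0 N1) Z1) as HN1.
  assert (HRN : Re N1 <= Cmod N1).
  { pose proof (re_le_Cmod N1) as Q. apply Rabs_le_between in Q. lra. }
  (* the scale at which both saddle points have width of order one *)
  set (h := sqrt (/ Cmod N1)).
  assert (Ehh : h * h = / Cmod N1) by (apply sqrt_sqrt; left; apply Rinv_0_lt_compat; auto).
  assert (Hh : 0 < h) by (apply sqrt_lt_R0, Rinv_0_lt_compat; auto).
  assert (Hhh1 : h <= h1).
  { apply Rsqr_incr_0_var; [|lra]. unfold Rsqr. rewrite Ehh. rewrite <- (Rinv_inv (h1 * h1)).
    apply Rinv_le_contravar; lra. }
  assert (Hha : h <= h0) by (eapply Rle_trans; [exact Hhh1|apply Rmin_l]).
  assert (Hhb : h <= delta / 2) by (eapply Rle_trans; [exact Hhh1|eapply Rle_trans; [apply Rmin_r|apply Rmin_l]]).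
  assert (Hhc : h <= 1) by (eapply Rle_trans; [exact Hhh1|eapply Rle_trans; [apply Rmin_r|apply Rmin_r]]).
  pose proof (Rmax_l M 1) as HM.
  assert (Q01 : Cmod N0 <= L * Cmod N1) by (apply (Cmod_quotient N0 N1 lz s0 s1); auto; fold sigma0 sigma1; lra).
  assert (Q10 : Cmod N1 <= L * Cmod N0) by (apply (Cmod_quotient N1 N0 lz s1 s0); auto; fold sigma0 sigma1; lra).
  assert (R0 : lam * Cmod N1 <= Re N0).
  { apply Rle_trans with (Cmod N0 * sin delta); [|apply Re_sector; auto; lra].
    unfold lam. apply Rmult_le_reg_l with L; [lra|].
    replace (L * (sin delta / L * Cmod N1)) with (sin delta * Cmod N1) by (field; lra). nra. }
  assert (R1 : lam * Cmod N1 <= Re N1).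
  { apply Rle_trans with (Cmod N1 * sin delta); [|apply Re_sector; auto; lra].
    unfold lam. apply Rmult_le_reg_l with L; [lra|].
    replace (L * (sin delta / L * Cmod N1)) with (sin delta * Cmod N1) by (field; lra).
    assert (0 < Cmod N1 * sin delta) by nra. nra. }
  assert (Hbig : 1 <= lam * Cmod N1).
  { rewrite <- (Rinv_r lam) by lra. apply Rmult_le_compat_l; lra. }
  set (nu0 := (N0 * (h * h))%C). set (nu1 := (N1 * (h * h))%C).
  assert (Ehc : (RtoC h * RtoC h = RtoC (/ Cmod N1))%C) by (rewrite <- RtoC_mult, Ehh; auto).
  assert (Ipos : 0 < / Cmod N1) by (apply Rinv_0_lt_compat; auto).
  assert (Enu : forall N, Re (N * (h * h))%C = Re N * / Cmod N1 /\ Cmod (N * (h * h))%C = Cmod N * / Cmod N1).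
  { intros N. rewrite Ehc. split.
    - rewrite Re_mult, Re_RtoC, Im_RtoC. ring.
    - rewrite Cmod_mult, Cmod_R, Rabs_pos_eq by lra. auto. }
  destruct (Enu N0) as [Rn0 Mn0]. destruct (Enu N1) as [Rn1 Mn1]. fold nu0 in Rn0, Mn0. fold nu1 in Rn1, Mn1.
  assert (L0 : lam <= Re nu0).
  { rewrite Rn0. replace lam with (lam * Cmod N1 * / Cmod N1) by (field; lra). apply Rmult_le_compat_r; lra. }
  assert (L1 : lam <= Re nu1).
  { rewrite Rn1. replace lam with (lam * Cmod N1 * / Cmod N1) by (field; lra). apply Rmult_le_compat_r; lra. }
  assert (M0 : Cmod nu0 <= L).
  { rewrite Mn0. replace L with (L * Cmod N1 * / Cmod N1) by (field; lra). apply Rmult_le_compat_r; lra. }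
  assert (M1 : Cmod nu1 <= L) by (rewrite Mn1, Rinv_r by lra; lra).
  assert (F0 : (s0 + lz = Ci * PI + Clog N0)%C).
  { replace (Clog N0) with (lz - Ci * PI + s0)%C by (rewrite E0'; ring). ring. }
  assert (F1 : (s1 + lz = Ci * PI + Clog N1)%C).
  { replace (Clog N1) with (lz - Ci * PI + s1)%C by (rewrite E1'; ring). ring. }
  assert (OK : admissible (s0 + lz) (s1 + lz) h 0).
  { rewrite F0, F1. unfold admissible. rewrite !Im_plus.
    replace (Im (Ci * PI)) with PI by (simpl; ring). simpl Im.
    apply Rabs_le_between in A0. apply Rabs_le_between in A1. pose proof PI2_1. lra. }
  assert (W0 : Cexp (s0 + lz) = (- N0)%C) by (rewrite F0, Cexp_plus, Cexp_iPI, Cexp_Clog by auto; ring).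
  assert (W1 : Cexp (s1 + lz) = (- N1)%C) by (rewrite F1, Cexp_plus, Cexp_iPI, Cexp_Clog by auto; ring).
  assert (P0 : 1 <= Re N0) by lra. assert (P1 : 1 <= Re N1) by lra.
  pose proof (admissible_rate0 _ _ _ _ OK) as RA0. pose proof (admissible_rate1 _ _ _ _ OK) as RA1. rewrite W0 in RA0. rewrite W1 in RA1.
  rewrite (hyperterminant2_value N0 N1 lz s0 s1 h 0 P0 P1 OK), W0, W1.
  specialize (B N0 N1 h nu0 nu1 (conj Hh Hha) Hhc P0 P1 RA0 RA1 eq_refl eq_refl L0 L1 M0 M1).
  replace (K / Cmod N1) with (K * (h * h)) by (rewrite Ehh; auto).
  eapply Rle_trans; [right|exact B]. f_equal. apply f_equal2.
  - replace (- ((sigma0 + sigma1) * z))%C with (N0 + N1)%C.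
    + field. apply Cexp_neq_0.
    + unfold sigma0, sigma1, z. rewrite Cmult_plus_distr_r, <- !Cexp_plus, W0, W1. ring.
  - (* both sides have the same square roots once the scale is taken out *)
    assert (Hc : RtoC h <> 0%C) by (intros Q; apply RtoC_inj in Q; lra).
    replace (N0 / N1)%C with (nu0 / nu1)%C by (unfold nu0, nu1; field; auto).
    assert (N1' : nu1 <> 0%C) by (apply Cneq_0_Re; lra).
    replace (1 + nu0 / nu1)%C with ((nu0 + nu1) / nu1)%C by (field; auto).
    rewrite (Csqrt_div_right (nu0 + nu1) nu1) by (rewrite ?Re_plus; lra).
    pose proof PI_RGT_0 as HPI.
    replace (2 * PI / N1)%C with (RtoC (2 * PI * (h * h)) / nu1)%C.
    2:{ unfold nu1. rewrite !RtoC_mult. field. auto. }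
    assert (Hh2 : 0 < h * h) by (apply Rmult_lt_0_compat; auto).
    assert (H2 : 0 < 2 * PI * (h * h)) by (apply Rmult_lt_0_compat; lra).
    rewrite (Csqrt_div_right (RtoC (2 * PI * (h * h))) nu1) by (rewrite ?Re_RtoC; lra).
    rewrite Csqrt_RtoC by auto. rewrite sqrt_mult, sqrt_square by lra.
    rewrite (RtoC_mult (sqrt (2 * PI))), (RtoC_inv 3) by lra. unfold half_residue.
    pose proof (Csqrt_neq_0 nu1). pose proof (Csqrt_neq_0 (nu0 + nu1)).
    assert (RtoC 3 <> 0%C) by (intros Q; apply RtoC_inj in Q; lra).
    field. auto.
Qed.
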